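(* Let $k$ be a perfect field of characteristic $p>0$ and let $\pi:Y\to X$ be an unramified Galois cover of smooth, proper, geometrically irreducible curves over $k$, with a fixed isomorphism $G=\mathrm{Gal}(Y/X)\cong\mathbb{Z}/p\mathbb{Z}$. Let $\nu_X=\dim_{\mathbb{F}_p}J_X[p](k)$ and $\nu_Y=\dim_{\mathbb{F}_p}J_Y[p](k)$. Consider the exact sequences $$\text{(a)}\quad 0\to\mathcal{G}_{X,et}\to J_Y[p]_{et}[\delta]\to\mathbb{Z}/p\mathbb{Z}\to0,\qquad\text{(b)}\quad 0\to\mathbb{Z}/p\mathbb{Z}\to J_Y[p]_{et}/\delta\to\mathcal{G}_{X,et}\to0$$ described in the context. (1) We have $\nu_X\le\nu_Y\le p\nu_X$. (2) If the exact sequence $0\to\mathcal{G}_{X,et}\to J_X[p]_{et}\to\mathbb{Z}/p\mathbb{Z}\to0$ (equivalently (a)) splits, then we have the stronger upper bound $\nu_Y-1\le p(\nu_X-1)$. (3) If $k$ is finite or algebraically closed, then $\nu_X\ge1$. (4) If $k$ is finite, (a) is split, and (b) is non-split, then $\nu_X\ge2$.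
   Context: $J_X,J_Y$ are the Jacobians of $X,Y$; $J_X[p]_{et},J_Y[p]_{et}$ are the étale parts of their $p$-torsion subgroup schemes. $\gamma\in G$ corresponds to $1\in\mathbb{Z}/p\mathbb{Z}$ and $\delta=\gamma-1\in\mathbb{F}_p[G]\cong\mathbb{F}_p[\delta]/(\delta^p)$, which acts on $J_Y[p]$. $\mathcal{G}[\delta]$ and $\mathcal{G}/\delta$ denote kernel and cokernel of $\delta$. $\mathcal{G}\mapsto M(\mathcal{G})$ is the contravariant Dieudonné functor on finite commutative $k$-group schemes killed by $p$; $M(J_X[p])\cong H^1_{dR}(X)$. The cover with its isomorphism $G\cong\mathbb{Z}/p\mathbb{Z}$ is a $\mathbb{Z}/p\mathbb{Z}$-torsor over $X$, giving a class in $H^1_{et}(X,\mathbb{Z}/p\mathbb{Z})$ whose image in $H^1(X,\mathcal{O}_X)$ is nonzero, Frobenius-fixed, and has a unique lift $\eta_X\in H^1_{dR}(X)$ with $F\eta_X=\eta_X$. The injection $M(\mathbb{Z}/p\mathbb{Z})=k\to H^1_{dR}(X)$, $\alpha\mapsto\alpha\eta_X$, corresponds to a canonical surjection $J_X[p]_{et}\to\mathbb{Z}/p\mathbb{Z}$, and $\mathcal{G}_{X,et}$ is its kernel. Pull back $\pi^*$ gives an isomorphism $J_X[p]_{et}\cong J_Y[p]_{et}[\delta]$; sequence (a) is $0\to\mathcal{G}_{X,et}\to J_X[p]_{et}\to\mathbb{Z}/p\mathbb{Z}\to0$ transported through it. The image of $\delta^{p-1}:J_Y[p]_{et}/\delta\to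 J_Y[p]_{et}[\delta]$ is the subgroup $\mathcal{G}_{X,et}$ and its kernel is isomorphic to $\mathbb{Z}/p\mathbb{Z}$; this gives sequence (b). *)

(* Defs.v *)
From HB Require Import structures.
From mathcomp Require Import all_boot all_order all_algebra.
From mathcomp Require Import ring_quotient generic_quotient.
From mathcomp Require Import boolp classical_sets functions cardinality fsbigop.

Set Implicit Arguments.
Unset Strict Implicit.
Unset Printing Implicit Defensive.

Import Order.TTheory GRing.Theory Num.Theory.
Local Open Scope ring_scope.
Local Open Scope classical_set_scope.
Local Open Scope quotient_scope.

(* Smooth proper geometrically irreducible curves over a perfect field k are
   given by their function fields, and finite etale k-group schemes by their
   kbar-points with the action of Gal(kbar/k).  Throughout, i : k -> kb is an
   algebraic closure. *)

(* ff = k(X) is finitely generated of transcendence degree one over k.  The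
   last two fields say that  k(X) (x)_k kbar -> gff  is surjective and
   injective: its source is then a domain, so X is geometrically irreducible,
   and gff = kbar(X) is the function field of X_kbar. *)
Record curve (k : fieldType) (kb : closedFieldType) (i : {rmorphism k -> kb}) :=
  Curve {
    ff : fieldType;
    kcst : {rmorphism k -> ff};
    gff : fieldType;
    gcst : {rmorphism kb -> gff};
    bc : {rmorphism ff -> gff};
    bc_cst : forall a : k, bc (kcst a) = gcst (i a);
    ff_trdeg1 : exists x : ff, ~ algebraicOver kcst x /\
      exists n (b : 'I_n -> ff), forall z : ff,
        exists (d : {poly k}) (c : 'I_n -> {poly k}), d != 0 /\
          (map_poly kcst d).[x] * z = \sum_j (map_poly kcst (c j)).[x] * b j;
    bc_span : forall z : gff, exists n (u : 'I_n -> ff) (c : 'I_n -> kb),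
      z = \sum_j bc (u j) * gcst (c j);
    bc_free : forall n (u : 'I_n -> ff) (c : 'I_n -> kb),
      (forall a : 'I_n -> k, \sum_j i (a j) * c j = 0 -> forall j, a j = 0) ->
      \sum_j bc (u j) * gcst (c j) = 0 -> forall j, u j = 0 }.

Section Curve.
Variables (k : fieldType) (kb : closedFieldType) (i : {rmorphism k -> kb}).
Implicit Types X Y : curve i.

(* The closed points of X_kbar are the normalized discrete valuations of
   kbar(X) that are trivial on kbar.  By convention ord 0 = 0 (and not
   infinity), so that 0 <= ord P f means that f is regular at P, also for
   f = 0. *)
Record place X := Place {
  ord :> gff X -> int;
  ord_zero : ord 0 = 0;
  ord_mul : forall f g, f != 0 -> g != 0 -> ord (f * g) = ord f + ord g;
  ord_add : forall f g, f != 0 -> g != 0 -> f + g != 0 ->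
    Num.min (ord f) (ord g) <= ord (f + g);
  ord_cst : forall c, ord (gcst X c) = 0;
  ord_unif : exists t, ord t = 1 }.

Lemma place_eq X (P Q : place X) : P =1 Q -> P = Q.
Proof.
case: P Q => [o o0 oM oD oc ou] [o' o0' oM' oD' oc' ou'] /= /funext oo'.
by case: _ / oo' in o0' oM' oD' oc' ou' *; congr Place; exact: Prop_irrelevance.
Qed.

HB.instance Definition _ X := gen_eqMixin (place X).
HB.instance Definition _ X := gen_choiceMixin (place X).

Lemma ord_inv X (P : place X) f : ord P f^-1 = - ord P f.
Proof.
have [->|f0] := eqVneq f 0; first by rewrite invr0 ord_zero oppr0.
apply/eqP; rewrite -addr_eq0 -ord_mul ?invr_eq0// mulVf//.
by rewrite -(rmorph1 (gcst X)) ord_cst.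
Qed.

Definition div_pred X (D : place X -> int) : bool :=
  `[< finite_set [set P | D P != 0] /\ \sum_(P \in [set: place X]) D P = 0 >].

Lemma div_pred_sum X (D : place X -> int) (A : set (place X)) :
  [set P | D P != 0] `<=` A ->
  \sum_(P \in [set: place X]) D P = \sum_(P \in A) D P.
Proof.
move=> DA; rewrite (@fsbig_widen _ _ _ _ A setT)// => P [_] /= nA.
by apply/eqP; apply/negPn/negP => /DA.
Qed.

Lemma div_pred_closed X : zmod_closed (@div_pred X).
Proof.
split=> [|D E].
  apply/asboolP; split; last by rewrite fsbig1.
  by rewrite (_ : [set _ | _] = set0) //; apply/seteqP; split => P //=; rewrite eqxx.
move=> /asboolP[Df D0] /asboolP[Ef E0]; apply/asboolP.
set A := [set P | D P != 0] `|` [set P | E P != 0].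
have Af : finite_set A by rewrite finite_setU.
have DEA : [set P | (D - E) P != 0] `<=` A.
  move=> P /=; apply: contra_neqP => /not_orP[/negP/negPn/eqP DP /negP/negPn/eqP EP].
  by rewrite !fctE DP EP subr0.
split; first exact: sub_finite_set DEA Af.
rewrite (div_pred_sum DEA).
have -> : \sum_(P \in A) (D - E) P = \sum_(P \in A) (D P - E P) by [].
rewrite fsbig_split//=.
have -> : \sum_(P \in A) - E P = - \sum_(P \in A) E P.
  by rewrite !fsbig_finite// sumrN.
rewrite -(div_pred_sum (D := D)); last exact: subsetUl.
by rewrite -(div_pred_sum (D := E)) ?D0 ?E0 ?subr0//; exact: subsetUr.
Qed.

HB.instance Definition _ X := GRing.isZmodClosed.Build _ (@div_pred X) (@div_pred_closed X).

(* Divisors of degree zero on X_kbar. *)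
Record div0 X := Div0 { div0_val :> place X -> int; _ : div_pred div0_val }.
HB.instance Definition _ X := [isSub for @div0_val X].
HB.instance Definition _ X := [Choice of div0 X by <:].
HB.instance Definition _ X := [SubChoice_isSubZmodule of div0 X by <:].

Definition principal X (D : div0 X) : bool :=
  `[< exists f : gff X, f != 0 /\ forall P, D P = ord P f >].

Lemma principal_closed X : zmod_closed (@principal X).
Proof.
split=> [|D E].
  apply/asboolP; exists 1; split=> [|P]; first exact: oner_neq0.
  by rewrite -(rmorph1 (gcst X)) ord_cst.
move=> /asboolP[f [f0 Df]] /asboolP[g [g0 Eg]]; apply/asboolP.
exists (f / g); split=> [|P]; first by rewrite mulf_neq0 ?invr_eq0.
by rewrite ord_mul ?invr_eq0// ord_inv -Df -Eg.
Qed.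

HB.instance Definition _ X :=
  GRing.isZmodClosed.Build _ (@principal X) (@principal_closed X).

(* J_X(kbar) = Pic^0(X_kbar). *)
Definition jac X :=
  Quotient.quot (GRing.ZmodClosed.clone _ (@principal X) _).
HB.instance Definition _ X := GRing.Zmodule.on (jac X).

(* Automorphisms of kbar(X) that preserve kbar, not necessarily pointwise. *)
Record semiaut X := Semiaut {
  sfun :> {rmorphism gff X -> gff X};
  sinv : gff X -> gff X;
  sfunK : cancel sfun sinv;
  sinvK : cancel sinv sfun;
  sfun_cst : forall z, (exists c, z = gcst X c) <-> (exists c, sfun z = gcst X c) }.

Section Twist.
Variables (X : curve i) (s : semiaut X).

Let twist_ordM (P : place X) f g : f != 0 -> g != 0 ->
  ord P (s (f * g)) = ord P (s f) + ord P (s g).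
Proof. by move=> f0 g0; rewrite rmorphM ord_mul ?fmorph_eq0. Qed.

Let twist_ordD (P : place X) f g : f != 0 -> g != 0 -> f + g != 0 ->
  Num.min (ord P (s f)) (ord P (s g)) <= ord P (s (f + g)).
Proof. by move=> *; rewrite rmorphD ord_add -?rmorphD ?fmorph_eq0. Qed.

Let twist_ord_cst (P : place X) c : ord P (s (gcst X c)) = 0.
Proof.
by have /(sfun_cst s)[d ->] : exists d, gcst X c = gcst X d by [exists c];
  rewrite ord_cst.
Qed.

Let twist_ord_unif (P : place X) : exists t, ord P (s t) = 1.
Proof. by have [t Pt] := ord_unif P; exists (sinv s t); rewrite sinvK. Qed.

Let twist_ord0 (P : place X) : ord P (s 0) = 0.
Proof. by rewrite rmorph0 ord_zero. Qed.

(* The place f |-> ord P (s f). *)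
Definition twist (P : place X) : place X :=
  Place (twist_ord0 P) (@twist_ordM P) (@twist_ordD P) (twist_ord_cst P)
        (twist_ord_unif P).

Let sinv_rmorphM : {morph sinv s : f g / f * g}.
Proof. by move=> f g; apply: (can_inj (sfunK s)); rewrite rmorphM !sinvK. Qed.

Let sinv_rmorphD : {morph sinv s : f g / f + g}.
Proof. by move=> f g; apply: (can_inj (sfunK s)); rewrite rmorphD !sinvK. Qed.

Let sinv0 : sinv s 0 = 0.
Proof. by apply: (can_inj (sfunK s)); rewrite rmorph0 sinvK. Qed.

Let sinv_eq0 f : (sinv s f == 0) = (f == 0).
Proof. by rewrite -(inj_eq (can_inj (sfunK s))) rmorph0 sinvK. Qed.

Lemma twist_bij : bijective twist.
Proof.
have inj : injective twist.
  move=> P Q PQ; apply: place_eq => f; rewrite -(sinvK s f).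
  exact: (congr1 (fun R : place X => ord R (sinv s f)) PQ).
have sur (P : place X) : exists Q, P = twist Q.
  have o0 : ord P (sinv s 0) = 0 by rewrite sinv0 ord_zero.
  have oM f g : f != 0 -> g != 0 ->
      ord P (sinv s (f * g)) = ord P (sinv s f) + ord P (sinv s g).
    by move=> f0 g0; rewrite sinv_rmorphM ord_mul ?sinv_eq0.
  have oD f g : f != 0 -> g != 0 -> f + g != 0 ->
      Num.min (ord P (sinv s f)) (ord P (sinv s g)) <= ord P (sinv s (f + g)).
    by move=> *; rewrite sinv_rmorphD ord_add -?sinv_rmorphD ?sinv_eq0.
  have oc c : ord P (sinv s (gcst X c)) = 0.
    have /(proj2 (sfun_cst s _))[d ->] :
        exists d, s (sinv s (gcst X c)) = gcst X d by exists c; rewrite sinvK.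
    by rewrite ord_cst.
  have ou : exists t, ord P (sinv s t) = 1.
    by have [t Pt] := ord_unif P; exists (s t); rewrite sfunK.
  by exists (Place o0 oM oD oc ou); apply: place_eq => f /=; rewrite sfunK.
have /choice[h hK] := sur.
by exists h => P; [apply: inj|]; rewrite -hK.
Qed.

Let div_act_subproof (D : div0 X) : div_pred (D \o twist).
Proof.
have [Df D0] := asboolP _ (valP D); apply/asboolP; split.
  apply: (finite_preimage (f := twist) _ Df).
  by move=> P Q _ _; apply: (bij_inj twist_bij).
by rewrite -[RHS]D0 [RHS](reindex_fsbigT twist _ twist_bij).
Qed.

(* The image of D under s; it satisfies s (div f) = div (s f). *)
Definition div_act (D : div0 X) : div0 X := Div0 (div_act_subproof D).

Definition act (x : jac X) : jac X := \pi_(jac X) (div_act (repr x)).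

End Twist.
End Curve.

Section Torsion.
Variables (p : nat) (k : fieldType) (kb : closedFieldType) (i : {rmorphism k -> kb}).
Implicit Types X Y : curve i.

(* Gal(kbar/k), acting on kbar(X) = k(X) (x)_k kbar through the second
   factor; restriction to kbar identifies it with Aut(kbar(X) / k(X)). *)
Definition galois X (s : semiaut X) : Prop := forall u, s (bc X u) = bc X u.

(* The Galois module J_X[p]_et(kbar) = J_X[p](kbar), and J_X[p](k). *)
Definition jtors X : set (jac X) := [set x | x *+ p = 0].
Definition jtors_k X : set (jac X) :=
  [set x | jtors x /\ forall s : semiaut X, galois s -> act s x = x].

(* A is an F_p-vector space with a basis of n elements. *)
Definition has_dim (V : zmodType) (A : set V) (n : nat) : Prop :=
  exists b : 'I_n -> V, (forall j, A (b j)) /\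
    forall x, A x -> exists! c : {ffun 'I_n -> 'F_p}, x = \sum_j b j *+ c j.

Definition nu X : nat := xget 0%N [set n | has_dim (@jtors_k X) n].

(* Unramified Galois covers Y -> X with group Z/p.  By Artin's theorem, the
   conditions on deck say that k(Y)/k(X) is Galois with group <deck>, cyclic
   of order p; deck is the element gamma corresponding to 1, and gdeck is its
   kbar-linear extension to kbar(Y).  The last field says that each ramification
   index over X_kbar is 1. *)
Record zp_cover X Y := ZpCover {
  cov : {rmorphism ff X -> ff Y};
  cov_cst : forall a, cov (kcst X a) = kcst Y a;
  gcov : {rmorphism gff X -> gff Y};
  gcov_cst : forall c, gcov (gcst X c) = gcst Y c;
  gcov_bc : forall u, gcov (bc X u) = bc Y (cov u);
  deck : {rmorphism ff Y -> ff Y};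
  deck_order : forall u, iter p deck u = u;
  deck_nontrivial : exists u, deck u != u;
  deck_fixed : forall u, deck u = u <-> exists v, u = cov v;
  gdeck : semiaut Y;
  gdeck_cst : forall c, gdeck (gcst Y c) = gcst Y c;
  gdeck_bc : forall u, gdeck (bc Y u) = bc Y (deck u);
  unramified : forall Q : place Y, exists t, ord Q (gcov t) = 1 }.

Section DeRham.
Variable X : curve i.

Record der := Der {
  der_fun :> gff X -> gff X;
  derD : {morph der_fun : f g / f + g};
  derM : forall f g, der_fun (f * g) = der_fun f * g + f * der_fun g;
  der_cst : forall c, der_fun (gcst X c) = 0 }.

(* Meromorphic differentials on X_kbar, as forms f dg on derivations. *)
Definition dform : Type := der -> gff X.
Definition diff (g : gff X) : dform := fun D => D g.
Definition is_dform (w : dform) : Prop := exists f g, forall D, w D = f * D g.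

(* D = d/dt for a uniformizer t at P. *)
Definition local_der (P : place X) (t : gff X) (D : der) : Prop :=
  ord P t = 1 /\ D t = 1.

Definition regular_dform (P : place X) (w : dform) : Prop :=
  forall t D, local_der P t D -> 0 <= ord P (w D).

(* c is the coefficient of dt / t in the expansion of w at P. *)
Definition residue (P : place X) (w : dform) (c : kb) : Prop :=
  exists t D, local_der P t D /\ exists m (a : 'I_m.+1 -> kb),
    0 <= ord P (w D - \sum_j gcst X (a j) * t ^- j.+1) /\ c = a ord0.

(* H^1_dR(X_kbar), by repartitions: a class is given by r in the adeles and a
   differential w with w + d(r_P) regular at each P.  For an affine cover (U_j),
   a Cech hypercocycle (f_jl, w_j) is recovered from f_PQ = r_P - r_Q and
   w_P = w + d(r_P).  The image of (r, w) in H^1(X, O_X) is the class of r. *)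
Definition dr_cocycle (r : place X -> gff X) (w : dform) : Prop :=
  [/\ finite_set [set P | ~~ (0 <= ord P (r P))], is_dform w &
      forall P, regular_dform P (fun D => w D + diff (r P) D)].

Definition dr_cohomologous (r : place X -> gff X) (w : dform)
    (r' : place X -> gff X) (w' : dform) : Prop :=
  exists h, (forall P, 0 <= ord P (r P - r' P - h)) /\
    forall D, w D - w' D = - diff h D.

(* F acts on functions by f |-> f^p and kills differentials. *)
Definition dr_Ffixed (r : place X -> gff X) (w : dform) : Prop :=
  dr_cohomologous (fun P => r P ^+ p) (fun=> 0) r w.

(* The divisor class x is killed by p, with p D = div f for a divisor D in x,
   and w = df / f; this w depends only on x and is everywhere regular. *)
Definition is_dlog (x : jac X) (w : dform) : Prop :=
  exists (D : div0 X) (f : gff X), [/\ x = \pi_(jac X) D, f != 0,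
    forall P, D P *+ p = ord P f & forall E, w E = E f / f].

(* The cup product of the class of r in H^1(X, O_X) and of w in H^0(X, Omega^1). *)
Definition cup (r : place X -> gff X) (w : dform) (c : kb) : Prop :=
  exists rho : place X -> kb,
    (forall P, residue P (fun D => r P * w D) (rho P)) /\
    c = \sum_(P \in [set: place X]) rho P.

End DeRham.

Section Cover.
Variables (X Y : curve i) (pi : zp_cover X Y).

Section Below.
Variable Q : place Y.

Let below0 : ord Q (gcov pi 0) = 0.
Proof. by rewrite rmorph0 ord_zero. Qed.

Let belowM f g : f != 0 -> g != 0 ->
  ord Q (gcov pi (f * g)) = ord Q (gcov pi f) + ord Q (gcov pi g).
Proof. by move=> f0 g0; rewrite rmorphM ord_mul ?fmorph_eq0. Qed.

Let belowD f g : f != 0 -> g != 0 -> f + g != 0 ->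
  Num.min (ord Q (gcov pi f)) (ord Q (gcov pi g)) <= ord Q (gcov pi (f + g)).
Proof. by move=> *; rewrite rmorphD ord_add -?rmorphD ?fmorph_eq0. Qed.

Let below_cst c : ord Q (gcov pi (gcst X c)) = 0.
Proof. by rewrite gcov_cst ord_cst. Qed.

(* The image of Q in X_kbar. *)
Definition below : place X :=
  Place below0 belowM belowD below_cst (unramified pi Q).

End Below.

(* pi^* : J_X(kbar) -> J_Y(kbar); as pi is unramified, the multiplicity of
   pi^* D at Q is that of D at the image of Q. *)
Definition pullback (x : jac X) : jac Y :=
  xget 0 [set y | exists (D : div0 X) (E : div0 Y),
    [/\ x = \pi_(jac X) D, y = \pi_(jac Y) E &
        forall Q, E Q = D (below Q)]].

Definition delta (y : jac Y) : jac Y := act (gdeck pi) y - y.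

(* r represents the image in H^1(X_kbar, O) of the class of the torsor Y: the
   torsor of functions z with gamma z = z + 1 has the rational section y and the
   section y + r_P near P. *)
Definition torsor_class (r : place X -> gff X) : Prop :=
  exists y : gff Y, gdeck pi y = y + 1 /\
    forall Q : place Y, 0 <= ord Q (y + gcov pi (r (below Q))).

Definition eta (r : place X -> gff X) (w : dform X) : Prop :=
  [/\ dr_cocycle r w, torsor_class r & dr_Ffixed r w].

(* The surjection J_X[p]_et -> Z/p defined by eta_X.  Under
   M(J_X[p]) = H^1_dR(X), evaluation of Dieudonne modules at a point x of
   J_X[p](kbar), seen as a homomorphism Z/p -> J_X[p], is the cup product
   H^1_dR(X_kbar) -> kbar with dlog x in H^0(Omega^1), the latter being
   contained in H^1_dR.  It factors through H^1(O), and its value on eta_X is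
   in F_p. *)
Definition surj (x : jac X) : 'F_p :=
  xget 0 [set c : 'F_p | exists r w u,
    [/\ eta r w, is_dlog x u & cup r u (c : nat)%:R]].

(* G_{X,et}, as a subgroup of J_X[p]_et and, through pi^*, of J_Y[p]_et[delta]. *)
Definition Get : set (jac X) := [set x | jtors x /\ surj x = 0].
Definition GetY : set (jac Y) := pullback @` Get.

Definition jtors_delta : set (jac Y) := [set y | jtors y /\ delta y = 0].
Definition delta_jtors : set (jac Y) := delta @` @jtors Y.

(* 0 -> G_{X,et} -> J_X[p]_et -> Z/p -> 0 splits: the surjection has a Galois
   equivariant section. *)
Definition split_X : Prop :=
  exists s : 'F_p -> jac X,
    [/\ forall a, jtors (s a) /\ surj (s a) = a,
        forall a b, s (a + b) = s a + s b &
        forall g : semiaut X, galois g -> forall a, act g (s a) = s a].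

(* Sequence (a) splits; its surjection sends pi^* x to surj x. *)
Definition split_a : Prop :=
  exists s : 'F_p -> jac Y,
    [/\ forall a, jtors_delta (s a) /\
          exists x, [/\ jtors x, pullback x = s a & surj x = a],
        forall a b, s (a + b) = s a + s b &
        forall g : semiaut Y, galois g -> forall a, act g (s a) = s a].

(* Sequence (b), with surjection delta^(p-1), splits; the values in
   J_Y[p]_et / delta of the section are given by representatives s x in
   J_Y[p]_et, so that the identities hold modulo delta J_Y[p]_et. *)
Definition split_b : Prop :=
  exists s : jac Y -> jac Y,
    [/\ forall x, GetY x -> jtors (s x) /\ iter p.-1 delta (s x) = x,
        forall x y, GetY x -> GetY y -> delta_jtors (s (x + y) - (s x + s y)) &
        forall g : semiaut Y, galois g ->
          forall x, GetY x -> delta_jtors (s (act g x) - act g (s x))].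

End Cover.
End Torsion.

(* Main.v *)
(* A divisor class on Y fixed by gamma contains an invariant divisor (Hilbert 90), and
   invariant divisors are pulled back from X, since gamma acts freely on the places of
   Y; so pi^* identifies J_X[p] with the kernel of delta on J_Y[p], where delta^p = 0.
   Filtering the rational points of J_Y[p] by the kernels of the delta^j gives (1).

   For a class x of order p, write p D = div f.  By Tsen's theorem f is the norm of some
   g on Y, and div g = p D' + (B o gamma - B); the cup product of eta and dlog x is then
   -deg B modulo p.  Hence surj is onto, is zero on the x with pi^* x in delta J_Y[p],
   and its kernel is sent by pi^* to the image of the norm N = delta^(p-1).  So the line
   spanned by a rational x0 with surj x0 = 1 meets the image of delta in 0, and (2)
   results from filtering modulo this line.

   If k is finite, Galois acts through powers of Frobenius F, and F - 1 is not onto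
   J_X[p], because surj is invariant; being not injective either, it has a fixed point,
   which is (3).  If moreover (a) splits and nu_X = 1, then F - 1 is bijective on
   G_{X,et}; with x = (F - 1) z and z = N m, x |-> (F - 1) m splits (b), as the kernel
   of N is spanned by the image of delta and the rational class x0.

   The facts on curves that this requires (degree of principal divisors, residue theorem,
   divisibility of Pic^0 by p, finiteness of J[p]) are obtained from the expansion
   K = sum_(j < p) K^p t^j of the function field K of X_kbar: it defines the Cartier
   operator on differentials A dt / t, whose fixed points are the logarithmic ones. *)
From HB Require Import structures.
Require Import Defs.
From mathcomp Require Import all_boot all_order all_algebra.
From mathcomp Require Import generic_quotient ring_quotient separable cyclic cyclotomic finfield.
From mathcomp Require Import boolp classical_sets functions cardinality fsbigop.
From mathcomp Require Import zify ring lra.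
Set Implicit Arguments.
Unset Strict Implicit.
Unset Printing Implicit Defensive.

Import Order.TTheory GRing.Theory Num.Theory.
Local Open Scope ring_scope.
Local Open Scope classical_set_scope.

(** * Linear algebra *)

(** With curves given by function fields, everything global comes from counting dimensions over kb
    with unspecified constants; the genus never appears. A sum S of residues satisfies S (phi u) ^ p
    = S u for the Cartier operator phi, and it vanishes on the fixed points of phi, where it is the
    degree of a principal divisor modulo p. Each u generates a finite-dimensional space stable under
    phi, and this forces S = 0 everywhere, in place of a reduction to the projective line. The same
    finiteness makes 1 - phi onto. This gives divisibility by p, and also the norm theorem: the
    cyclic algebra attached to Y and to a function f acts on K itself, through p-th powers,
    multiplication by f and an operator theta + c, where c solves an equation c - phi c = a. The
    main obstacle is [surj], defined by cohomology classes and residues. The data [sdat] turn it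
    into the degree of a divisor on Y, independent of all choices; what remains is linear algebra
    over F_p with the operators delta and F - 1. *)

Section LinearAlgebra.
Variables (F : fieldType) (V : lmodType F).
Implicit Types S : set V.

Definition subspace S :=
  S 0 /\ forall (a : F) u v, S u -> S v -> S (a *: u + v).

Lemma subspaceD S u v : subspace S -> S u -> S v -> S (u + v).
Proof. by move=> [_ h] Su Sv; rewrite -[u]scale1r; apply: h. Qed.

Lemma subspaceZ S a u : subspace S -> S u -> S (a *: u).
Proof. by move=> [S0 h] Su; rewrite -[_ *: _]addr0; apply: h. Qed.

Lemma subspaceN S u : subspace S -> S u -> S (- u).
Proof. by move=> hS Su; rewrite -scaleN1r; apply: subspaceZ. Qed.

Lemma subspaceB S u v : subspace S -> S u -> S v -> S (u - v).
Proof. by move=> hS Su Sv; apply: subspaceD => //; apply: subspaceN. Qed.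

Lemma subspace_sum S (I : Type) (r : seq I) (P : pred I) (f : I -> V) :
  subspace S -> (forall j, P j -> S (f j)) -> S (\sum_(j <- r | P j) f j).
Proof.
by move=> hS h; elim/big_ind: _ => [|u v|j /h //]; [case: hS|apply: subspaceD].
Qed.

Lemma subspace_lin S (T : finType) (c : T -> F) (v : T -> V) :
  subspace S -> (forall j, S (v j)) -> S (\sum_j c j *: v j).
Proof. by move=> hS h; apply: subspace_sum => // j _; apply: subspaceZ. Qed.

Lemma subspace0 : subspace [set 0].
Proof. by split=> [|a u v /= -> ->] //=; rewrite scaler0 addr0. Qed.

(* The n vectors w_j, not required to lie in S, span S modulo S0. *)
Definition spans S0 S n := exists w : 'I_n -> V,
  forall v, S v -> exists c : 'I_n -> F, S0 (v - \sum_j c j *: w j).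

Definition indep S0 (T : finType) (v : T -> V) :=
  forall c : T -> F, S0 (\sum_j c j *: v j) -> forall j, c j = 0.

Lemma spans_fin S0 S (T : finType) (w : T -> V) :
  (forall v, S v -> exists c : T -> F, S0 (v - \sum_j c j *: w j)) ->
  spans S0 S #|T|.
Proof.
move=> h; exists (w \o enum_val) => v /h[c hc]; exists (c \o enum_val).
rewrite (_ : \sum_j _ = \sum_j c j *: w j) //.
rewrite [RHS](reindex (@enum_val T predT)) //=.
exact/onW_bij/enum_val_bij.
Qed.

Lemma spans_dep S0 S n (T : finType) (v : T -> V) :
  subspace S0 -> spans S0 S n -> (forall j, S (v j)) -> (n < #|T|)%N ->
  exists c : T -> F, (exists j, c j != 0) /\ S0 (\sum_j c j *: v j).
Proof.
move=> hS [w hw] Sv ltn; have /choice[a ha] := fun j => hw _ (Sv j).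
pose A : 'M[F]_(#|T|, n) := \matrix_(l, j) a (enum_val l) j.
have [x [xA x0]] : exists x : 'rV[F]_#|T|, x *m A = 0 /\ x != 0.
  have kA : kermx A != 0.
    rewrite kermx_eq0 /row_free neq_ltn.
    by rewrite (leq_ltn_trans (rank_leq_col A) ltn).
  by have /rowV0Pn[l xl l0] := kA; exists l; split=> //; apply/sub_kermxP.
exists (fun j => x 0 (enum_rank j)); split.
  apply/existsP; rewrite -negb_forall; apply: contra x0 => /forallP h.
  by apply/eqP/rowP => l; rewrite mxE; apply/eqP; rewrite -[l]enum_valK h.
have -> : \sum_j x 0 (enum_rank j) *: v j =
  \sum_j x 0 (enum_rank j) *: (v j - \sum_l a j l *: w l).
  under [RHS]eq_bigr do rewrite scalerBr; rewrite sumrB -[LHS]subr0; congr (_ - _).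
  under eq_bigr do rewrite scaler_sumr; rewrite exchange_big /= big1 // => l _.
  under eq_bigr do rewrite scalerA; rewrite -scaler_suml.
  have := congr1 (fun m : 'rV_n => m 0 l) xA; rewrite !mxE => xAl.
  rewrite (_ : \sum_j _ = 0) ?scale0r // -[RHS]xAl.
  rewrite (reindex (@enum_val T predT)) /=; last exact/onW_bij/enum_val_bij.
  by apply: eq_bigr => j _; rewrite enum_valK mxE.
exact: subspace_lin.
Qed.

Lemma spans_indep S0 S n (T : finType) (v : T -> V) :
  subspace S0 -> spans S0 S n -> (forall j, S (v j)) -> indep S0 v ->
  (#|T| <= n)%N.
Proof.
move=> hS hn Sv iv; rewrite leqNgt; apply/negP => lt.
by have [c [[j /eqP cj] /iv/(_ j)]] := spans_dep hS hn Sv lt.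
Qed.

Lemma spans_trans S0 S1 S2 a b :
  spans S0 S1 a -> spans S1 S2 b -> spans S0 S2 (a + b).
Proof.
move=> [w hw] [w' hw'].
exists (fun j => match fintype.split j with inl j => w j | inr j => w' j end).
move=> v /hw'[c' /hw[c hc]].
exists (fun j => match fintype.split j with inl j => c j | inr j => c' j end).
rewrite big_split_ord /=.
under eq_bigr => j _ do rewrite (unsplitK (inl j)).
under [X in _ - (_ + X)]eq_bigr => j _ do rewrite (unsplitK (inr j)).
by rewrite [X in _ - X]addrC opprD addrA.
Qed.

Lemma spans_sub S0 S S' n : S `<=` S' -> spans S0 S' n -> spans S0 S n.
Proof. by move=> h [w hw]; exists w => v /h/hw. Qed.

Lemma spans_refl S : S 0 -> spans S S 0.
Proof.
by move=> S0; exists (fun=> 0) => v Sv; exists (fun=> 0); rewrite big_ord0 subr0.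
Qed.

Lemma spans_leq S0 S n m : S0 0 -> (n <= m)%N -> spans S0 S n -> spans S0 S m.
Proof.
move=> S00 /subnKC<- [w hw].
exists (fun j => match fintype.split j with inl j => w j | inr _ => 0 end).
move=> v /hw[c hc].
exists (fun j => match fintype.split j with inl j => c j | inr _ => 0 end).
rewrite big_split_ord /= [X in _ - (_ + X)]big1 ?addr0.
  by under eq_bigr => j _ do rewrite (unsplitK (inl j)).
by move=> j _; rewrite (unsplitK (inr j)) scaler0.
Qed.

Lemma indep_extend S0 n (w : 'I_n -> V) v : subspace S0 -> indep S0 w ->
  ~ (exists c : 'I_n -> F, S0 (v - \sum_j c j *: w j)) ->
  indep S0 (fun j : 'I_n.+1 => if unlift ord_max j is Some l then w l else v).
Proof.
move=> hS iw nv c; rewrite big_ord_recr /= unlift_none.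
under eq_bigr => j _.
  have -> : widen_ord (leqnSn n) j = lift ord_max j.
    by apply: val_inj; rewrite /= /bump leqNgt ltn_ord.
  rewrite liftK; over.
move=> h.
have c0 : c ord_max = 0.
  apply/eqP/negPn/negP => c0; apply: nv.
  exists (fun j => - (c ord_max)^-1 * c (lift ord_max j)).
  have -> : v - \sum_j (- (c ord_max)^-1 * c (lift ord_max j)) *: w j =
    (c ord_max)^-1 *: (\sum_j c (lift ord_max j) *: w j + c ord_max *: v).
    rewrite scalerDr scalerA mulVf // scale1r addrC; congr (_ + _).
    rewrite scaler_sumr -sumrN; apply: eq_bigr => j _.
    by rewrite mulNr scaleNr opprK scalerA.
  exact: subspaceZ.
move: h; rewrite c0 scale0r addr0 => /iw h j.
by case: (unliftP ord_max j) => [l ->|-> //]; apply: h.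
Qed.

Lemma spans_basis S0 S n : subspace S0 -> spans S0 S n ->
  exists m (w : 'I_m -> V), [/\ (m <= n)%N, forall j, S (w j), indep S0 w &
    forall v, S v -> exists c : 'I_m -> F, S0 (v - \sum_j c j *: w j)].
Proof.
move=> hS hn.
pose Q m := `[< exists w : 'I_m -> V, (forall j, S (w j)) /\ indep S0 w >].
have Q0 : exists m, Q m.
  by exists 0%N; apply/asboolP; exists (fun=> 0); split=> [[]|c _ []].
have Qn m : Q m -> (m <= n)%N.
  move=> /asboolP[w [Sw iw]].
  by rewrite -[m]card_ord; apply: spans_indep hn Sw iw.
case: (ex_maxnP Q0 Qn) => m /asboolP[w [Sw iw]] mmax.
exists m, w; split=> //; first by apply: Qn; apply/asboolP; exists w.
move=> v Sv.
apply: contrapT => nv; have := mmax m.+1; rewrite ltnn => /(_ _)/notF; apply.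
apply/asboolP; eexists; split; last exact: (indep_extend hS iw nv).
by move=> j /=; case: (unlift ord_max j).
Qed.

(** A bound on independent families is often all that is known; this produces the spanning family,
    for instance for the adeles modulo K or for the p-torsion of the Jacobian. *)
Lemma indep_spans S0 S n : subspace S0 ->
  (forall v : 'I_n.+1 -> V, (forall j, S (v j)) -> ~ indep S0 v) ->
  spans S0 S n.
Proof.
move=> hS; elim: n => [|n IHn] h.
  exists (fun=> 0) => v Sv; exists (fun=> 0); rewrite big_ord0 subr0.
  apply: contrapT => nv; apply: (h (fun=> v)) => // c.
  rewrite big_ord1 => Sc j; rewrite ord1; apply/eqP/negPn/negP => c0; apply: nv.
  by rewrite -[v]scale1r -(mulVf c0) -scalerA; apply: subspaceZ.
have [[w [Sw iw]]|nw] :=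
    pselect (exists w : 'I_n.+1 -> V, (forall j, S (w j)) /\ indep S0 w).
  exists w => v Sv; apply: contrapT => nv; have := indep_extend hS iw nv.
  by apply: h => j; case: (unlift ord_max j).
apply: (@spans_leq _ _ n) => //; first by case: hS.
by apply: IHn => v Sv iv; apply: nw; exists v.
Qed.

Lemma indep_cat S0 S1 (T T' : finType) (v : T -> V) (w : T' -> V) :
  subspace S1 -> S0 `<=` S1 -> (forall j, S1 (v j)) ->
  indep S0 v -> indep S1 w ->
  indep S0 (fun j : T + T' => match j with inl j => v j | inr j => w j end).
Proof.
move=> hS S01 Sv iv iw c; rewrite big_sumType /= => h.
have c'0 : forall j, c (inr j) = 0.
  apply: iw; rewrite -[X in S1 X](addKr (\sum_j c (inl j) *: v j)).
  apply: subspaceD => //; last exact: S01.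
  by apply: subspaceN => //; apply: subspace_lin.
move: h; rewrite [X in _ + X]big1 ?addr0 => [h [] j //|j _].
  exact: (iv (c \o inl)).
by rewrite c'0 scale0r.
Qed.

End LinearAlgebra.

Section LinearMaps.
Variables (F : fieldType) (V V' : lmodType F).

Definition linear_on (S : set V) (f : V -> V') :=
  forall (a : F) u v, S u -> S v -> f (a *: u + v) = a *: f u + f v.

Lemma linear_on_sum S f (T : finType) (c : T -> F) (v : T -> V) :
  subspace S -> linear_on S f -> (forall j, S (v j)) ->
  f (\sum_j c j *: v j) = \sum_j c j *: f (v j).
Proof.
move=> hS lf Sv; have f0 : f 0 = 0.
  have [S0 _] := hS; have := lf (-1) 0 0 S0 S0.
  by rewrite scaler0 addr0 scaleN1r addNr.
suff : S (\sum_j c j *: v j) /\ f (\sum_j c j *: v j) = \sum_j c j *: f (v j).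
  by case.
elim: (index_enum T) => [|j r [Sr fr]].
  by rewrite !big_nil; split=> //; case: hS.
rewrite !big_cons; split; last by rewrite lf // fr.
by have [_] := hS; apply.
Qed.

Lemma spans_map (S0 S : set V) (S0' S' : set V') f n :
  subspace S0 -> subspace S -> subspace S0' -> linear_on S f ->
  (forall v, S v -> S' (f v)) -> (forall v, S v -> S0' (f v) -> S0 v) ->
  spans S0' S' n -> spans S0 S n.
Proof.
move=> hS0 hS hS0' lf fS fS0 hn; apply: indep_spans => // v Sv iv.
suff: (#|'I_n.+1| <= n)%N by rewrite card_ord ltnn.
apply: (spans_indep hS0' hn (v := f \o v)) => [j|c]; first exact: fS.
rewrite /= -(linear_on_sum _ hS lf) // => /fS0 h; apply: iv; apply: h.
exact: subspace_lin.
Qed.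

End LinearMaps.

Lemma spans_functional (F : fieldType) (V : lmodType F) (S0 S : set V) (f : V -> F) :
  subspace S0 -> subspace S ->
  (forall (a : F) u v, S u -> S v -> f (a *: u + v) = a * f u + f v) ->
  (forall v, S v -> f v = 0 -> S0 v) -> spans S0 S 1.
Proof.
move=> hS0 hS lf fS0.
apply: (@spans_map F V F^o S0 S [set 0] setT f) => //; first exact: subspace0.
exists (fun=> 1) => a _; exists (fun=> a).
by rewrite big_ord1 /= -[_ *: _]/(a * 1) mulr1 subrr.
Qed.

(* Functionals that kill S0 are determined by their values on vectors that span
   modulo S0. *)
Lemma functionals_dep (F : fieldType) (V : lmodType F) (S0 S : set V) n
    (T : finType) (f : T -> V -> F) :
  subspace S0 -> subspace S -> spans S0 S n ->
  (forall j (a : F) u v, S u -> S v -> f j (a *: u + v) = a * f j u + f j v) ->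
  (forall j v, S0 v -> S v -> f j v = 0) -> (n < #|T|)%N ->
  exists c : T -> F, (exists j, c j != 0) /\ forall v, S v -> \sum_j c j * f j v = 0.
Proof.
move=> hS0 hS /(spans_basis hS0)[m [w [mn Sw _ hw]]] lf f0 ltn.
pose V' : lmodType F := 'I_m -> F^o.
have [||j||c [cj hc]] := @spans_dep F V' [set 0] setT m T (fun j l => f j (w l)).
- exact: subspace0.
- exists (fun l m => (m == l)%:R) => v _; exists v; apply/funext => l.
  rewrite !fctE fct_sumE (bigD1 l) //= big1 ?addr0.
    by rewrite !fctE eqxx -[_ *: _]/(v l * 1) mulr1 subrr.
  by move=> l' /negPf; rewrite !fctE eq_sym => ->; rewrite -[_ *: _]/(v l' * 0) mulr0.
- by [].
- exact: leq_ltn_trans mn ltn.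
exists c; split=> // v Sv; have [a ha] := hw v Sv.
have fE j : f j v = \sum_l a l * f j (w l).
  have Sl := subspace_lin a hS Sw.
  rewrite -[v](subrK (\sum_l a l *: w l)) -[v - _]scale1r lf //; last exact: subspaceB.
  rewrite f0 //; last exact: subspaceB.
  have lfj : @linear_on F V F^o S (f j) by move=> b u u' Su Su'; rewrite lf.
  by rewrite mulr0 add0r (@linear_on_sum F V F^o S (f j) _ a w).
under eq_bigr do rewrite fE mulr_sumr; rewrite exchange_big big1 // => l _ /=.
have := congr1 (fun g : V' => g l) hc; rewrite fct_sumE /= => hl.
transitivity (a l * (\sum_j c j * f j (w l))); last by rewrite [X in _ * X]hl mulr0.
by rewrite mulr_sumr; apply: eq_bigr => j _; rewrite mulrCA.
Qed.

(** * Function fields of curves *)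

(* E as a vector space over F through f. *)
Definition rmod (F E : fieldType) (f : {rmorphism F -> E}) : Type := E.

Section RestrictScalars.
Variables (F E : fieldType) (f : {rmorphism F -> E}).

HB.instance Definition _ := GRing.Zmodule.on (rmod f).

Let scale (a : F) (v : rmod f) : rmod f := f a * (v : E).

Let scaleA a b v : scale a (scale b v) = scale (a * b) v.
Proof. by rewrite /scale rmorphM mulrA. Qed.

Let scale1 : left_id 1 scale.
Proof. by move=> v; rewrite /scale rmorph1 mul1r. Qed.

Let scaleDr : right_distributive scale +%R.
Proof. by move=> a u v; rewrite /scale mulrDr. Qed.

Let scaleDl v : {morph scale^~ v : a b / a + b}.
Proof. by move=> a b; rewrite /scale rmorphD mulrDl. Qed.

HB.instance Definition _ :=
  GRing.Zmodule_isLmodule.Build F (rmod f) scaleA scale1 scaleDr scaleDl.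

Lemma rmod_scaleE (a : F) (v : rmod f) : a *: v = f a * (v : E).
Proof. by []. Qed.

End RestrictScalars.

Section Base.
Variables (k : fieldType) (kb : closedFieldType) (i : {rmorphism k -> kb}).

(** The constants in an expansion given by [bc_span] are arbitrary, whereas [bc_free] needs them
    independent over k. *)
Lemma kbasis m (d : 'I_m -> kb) : exists n (e : 'I_n -> kb) (a : 'I_m -> 'I_n -> k),
  (forall c : 'I_n -> k, \sum_j i (c j) * e j = 0 -> forall j, c j = 0) /\
  forall j, d j = \sum_l i (a j l) * e l.
Proof.
pose S : set (rmod i) := [set v | exists c : 'I_m -> k, v = \sum_j c j *: (d j : rmod i)].
have hS : spans [set 0] S m.
  by exists d => v [c ->]; exists c; rewrite /= subrr.
have [n [e [_ Se ie sp]]] := spans_basis (subspace0 _) hS.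
have Sd j : S (d j).
  exists (fun l => (l == j)%:R); rewrite (bigD1 j) //= eqxx scale1r big1 ?addr0 //.
  by move=> l /negPf->; rewrite scale0r.
have /choice[a ha] := fun j => sp _ (Sd j).
by exists n, e, a; split=> [c /ie //|j]; apply/eqP; rewrite -subr_eq0; apply/eqP/ha.
Qed.

Variable X : curve i.
Local Notation K := (gff X).

Definition pv (q : {poly kb}) (z : K) : K := (map_poly (gcst X) q).[z].

Lemma pv0 z : pv 0 z = 0. Proof. by rewrite /pv rmorph0 horner0. Qed.
Lemma pv1 z : pv 1 z = 1. Proof. by rewrite /pv rmorph1 hornerC. Qed.
Lemma pvC c z : pv c%:P z = gcst X c. Proof. by rewrite /pv map_polyC hornerC. Qed.
Lemma pvX z : pv 'X z = z. Proof. by rewrite /pv map_polyX hornerX. Qed.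
Lemma pvD q r z : pv (q + r) z = pv q z + pv r z.
Proof. by rewrite /pv rmorphD hornerD. Qed.
Lemma pvN q z : pv (- q) z = - pv q z. Proof. by rewrite /pv rmorphN hornerN. Qed.
Lemma pvM q r z : pv (q * r) z = pv q z * pv r z.
Proof. by rewrite /pv rmorphM hornerM. Qed.
Lemma pvZ c r z : pv (c *: r) z = gcst X c * pv r z.
Proof. by rewrite -mul_polyC pvM pvC. Qed.
Lemma pvXn q n z : pv (q ^+ n) z = pv q z ^+ n.
Proof. by rewrite /pv rmorphXn horner_exp. Qed.
Lemma pv_sum (I : Type) (r : seq I) (P : pred I) (q : I -> {poly kb}) z :
  pv (\sum_(j <- r | P j) q j) z = \sum_(j <- r | P j) pv (q j) z.
Proof. by rewrite /pv rmorph_sum horner_sum. Qed.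
Lemma pv_prod (I : Type) (r : seq I) (P : pred I) (q : I -> {poly kb}) z :
  pv (\prod_(j <- r | P j) q j) z = \prod_(j <- r | P j) pv (q j) z.
Proof. by rewrite /pv rmorph_prod horner_prod. Qed.
Lemma pv_coef (q : {poly kb}) n z : (size q <= n)%N -> pv q z = \sum_(j < n) gcst X q`_j * z ^+ j.
Proof.
move=> h; rewrite /pv (horner_coef_wide _ (n := n)) ?size_map_poly //.
by under eq_bigr do rewrite coef_map.
Qed.
Lemma pv_poly n (c : nat -> kb) z :
  pv (\poly_(j < n) c j) z = \sum_(j < n) gcst X (c j) * z ^+ j.
Proof.
rewrite (pv_coef (n := n)) ?size_poly //.
by apply: eq_bigr => j _; rewrite coef_poly ltn_ord.
Qed.

Lemma pv_bc (d : {poly k}) x :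
  pv (map_poly i d) (bc X x) = bc X (map_poly (kcst X) d).[x].
Proof.
rewrite /pv -horner_map -!map_poly_comp; congr _.[_]; apply: eq_map_poly => a /=.
by rewrite bc_cst.
Qed.

(** The relations of [ff_trdeg1] concern k(X); they pass to kbar(X) because the elements that admit
    such a relation are stable under sums and under multiplication by constants. *)
Lemma gff_finite : exists x n (b : 'I_n -> K), forall z, exists (d : {poly kb})
  (c : 'I_n -> {poly kb}), pv d x != 0 /\ pv d x * z = \sum_j pv (c j) x * b j.
Proof.
have [x0 [nx [n [b hb]]]] := ff_trdeg1 X.
exists (bc X x0), n, (bc X \o b); set x := bc X x0.
pose Q z := exists (d : {poly kb}) (c : 'I_n -> {poly kb}),
  pv d x != 0 /\ pv d x * z = \sum_j pv (c j) x * bc X (b j).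
have QD z z' : Q z -> Q z' -> Q (z + z').
  move=> [d [c [d0 dc]]] [d' [c' [d0' dc']]].
  exists (d * d'), (fun j => d' * c j + d * c' j); split.
    by rewrite pvM mulf_neq0.
  have -> : pv (d * d') x * (z + z') =
    pv d' x * (pv d x * z) + pv d x * (pv d' x * z') by rewrite pvM; ring.
  rewrite dc dc' !mulr_sumr -big_split /=; apply: eq_bigr => j _.
  by rewrite pvD !pvM; ring.
have Qb u : Q (bc X u).
  have [d [c [d0 dc]]] := hb u; exists (map_poly i d), (map_poly i \o c); split.
    rewrite pv_bc fmorph_eq0; apply/negP => /eqP r; apply: nx.
    by exists d => //; apply/eqP.
  by rewrite pv_bc -rmorphM dc rmorph_sum; apply: eq_bigr => j _; rewrite rmorphM -pv_bc.
have QZ c z : Q z -> Q (z * gcst X c).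
  move=> [d [e [d0 de]]]; exists d, (fun j => c *: e j); split=> //.
  rewrite mulrA de mulr_suml; apply: eq_bigr => j _.
  by rewrite pvZ; ring.
move=> z; have [m [u [c ->]]] := bc_span z.
apply: (big_ind Q) => // [|j _]; last exact/QZ/Qb.
exists 1, (fun=> 0); rewrite pv1 oner_neq0 mulr0 big1 // => j _.
by rewrite pv0 mul0r.
Qed.

Section PolySpan.
Variables (x : K) (n : nat) (b : 'I_n -> K).

(** An elementary stand-in for Riemann-Roch spaces, of dimension at most n s, usable before places
    are available. *)
Definition Msp s : set (rmod (gcst X)) := [set v | exists c : 'I_n -> {poly kb},
  (forall j, size (c j) <= s)%N /\ v = \sum_j pv (c j) x * b j].

Lemma Msp0 s : Msp s 0.
Proof.
exists (fun=> 0); split=> [j|]; first by rewrite size_poly0.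
by rewrite big1 // => j _; rewrite pv0 mul0r.
Qed.

Lemma MspD s u v : Msp s u -> Msp s v -> Msp s (u + v).
Proof.
move=> [c [sc ->]] [c' [sc' ->]]; exists (fun j => c j + c' j); split=> [j|].
  by rewrite (leq_trans (size_polyD _ _)) // geq_max sc sc'.
by rewrite -big_split; apply: eq_bigr => j _ /=; rewrite pvD mulrDl.
Qed.

Lemma Msp_sum s (I : Type) (r : seq I) (P : pred I) (f : I -> K) :
  (forall j, P j -> Msp s (f j)) -> Msp s (\sum_(j <- r | P j) f j).
Proof. by move=> h; apply: (@big_ind _ (Msp s)) => //; [exact: Msp0|exact: MspD]. Qed.

Lemma Msp_mul s s' (q : {poly kb}) (v : K) : (size q <= s')%N -> Msp s v ->
  Msp (s + s')%N (pv q x * v).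
Proof.
move=> sq [c [sc ->]]; exists (fun j => q * c j); split=> [j|].
  rewrite (leq_trans (size_polyMleq _ _)) // (leq_trans (leq_pred _)) //.
  by rewrite addnC leq_add.
by rewrite mulr_sumr; apply: eq_bigr => j _; rewrite pvM mulrA.
Qed.

Lemma Msp_leq s s' v : (s <= s')%N -> Msp s v -> Msp s' v.
Proof. by move=> le [c [sc ->]]; exists c; split=> // j; apply: leq_trans le. Qed.

Lemma Msp_spans s : @spans kb (rmod (gcst X)) [set 0] (Msp s) (n * s).
Proof.
have -> : (n * s = #|{: 'I_n * 'I_s}|)%N by rewrite card_prod !card_ord.
apply: (@spans_fin kb (rmod (gcst X)) _ _ _
    (fun jl : 'I_n * 'I_s => x ^+ jl.2 * b jl.1)) => v [c [sc ->]].
exists (fun jl : 'I_n * 'I_s => (c jl.1)`_jl.2) => /=.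
apply/eqP; rewrite subr_eq0; apply/eqP.
rewrite -(pair_bigA _ (fun j l => gcst X (c j)`_(val l) * (x ^+ val l * b j))) /=.
apply: eq_bigr => j _; rewrite (pv_coef _ (sc j)) mulr_suml.
by apply: eq_bigr => l _; rewrite mulrA.
Qed.

Lemma Msp_common : (forall z, exists (d : {poly kb}) (c : 'I_n -> {poly kb}),
    pv d x != 0 /\ pv d x * z = \sum_j pv (c j) x * b j) ->
  forall r : seq K, exists (D : {poly kb}) s,
    pv D x != 0 /\ forall v, v \in r -> Msp s (pv D x * v).
Proof.
move=> hb; elim=> [|v r [D [s [D0 h]]]]; first by exists 1, 0%N; rewrite pv1 oner_neq0.
have [d [c [d0 dc]]] := hb v.
exists (D * d), ((\max_j size (c j)) + size D + (s + size d))%N.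
split=> [|u]; first by rewrite pvM mulf_neq0.
rewrite inE pvM => /orP[/eqP->|/h Mu].
  rewrite -mulrA dc; apply: Msp_leq (leq_addr _ _) _; apply: Msp_mul => //.
  by exists c; split=> // j; apply: (leq_bigmax j).
rewrite -mulrA mulrCA; apply: Msp_leq (leq_addl _ _) _; exact: Msp_mul.
Qed.

End PolySpan.

(** Finiteness of K over kb(t), with N depending on t only. After multiplication by E ^ m D, the
    monomials t ^ l z_j lie in a space of dimension at most n (s + m kp), and there are (n kp + 1)
    (m + 1) of them. *)
Lemma gff_rank (t : K) : exists N, forall z : 'I_N -> K, exists q : 'I_N -> {poly kb},
  (exists j, q j != 0) /\ \sum_j pv (q j) t * z j = 0.
Proof.
have [x [n [b hb]]] := gff_finite.
have common := Msp_common hb; set M := Msp x b in common.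
have [E [s0 [E0 hE]]] := common (codom (fun j => t * b j)).
pose kp := (s0 + size E)%N.
have step s v : M s v -> M (s + kp)%N (pv E x * (t * v)) /\ M (s + kp)%N (pv E x * v).
  move=> Mv; split; last by apply: Msp_mul => //; apply: leq_addl.
  have [c [sc ->]] := Mv; rewrite !mulr_sumr.
  apply: Msp_sum => j _.
  have -> : pv E x * (t * (pv (c j) x * b j)) = pv (c j) x * (pv E x * (t * b j)) by ring.
  apply: (@Msp_leq _ _ _ (s0 + s)%N); first by rewrite /kp; lia.
  by apply: Msp_mul => //; apply: hE; apply/codomP; exists j.
have steps s m j v : (j <= m)%N -> M s v -> M (s + m * kp)%N (pv E x ^+ m * (t ^+ j * v)).
  elim: m j => [|m IHm] [|j] // le Mv.
  - by rewrite !expr0 !mul1r mul0n addn0.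
  - rewrite exprS -mulrA mulSn (addnC kp) addnA; apply: (step _ _ _).2.
    exact: IHm.
  rewrite mulSn (addnC kp) addnA !exprS.
  have -> : pv E x * pv E x ^+ m * (t * t ^+ j * v) =
    pv E x * (t * (pv E x ^+ m * (t ^+ j * v))) by ring.
  by apply: (step _ _ _).1; apply: IHm.
exists (n * kp).+1 => z.
have [D [s [D0 hD]]] := common (codom z).
(* The number of monomials exceeds the dimension by n kp + m + 1 - n s, so m = n s suffices. *)
pose m := (n * s)%N.
have [||c [[[j0 l0] c0]]] := @spans_dep _ (rmod (gcst X)) [set 0] (M (s + m * kp)%N) _
   ('I_(n * kp).+1 * 'I_m.+1)%type
   (fun jl => pv E x ^+ m * (t ^+ jl.2 * (pv D x * z jl.1)))
   (subspace0 _) (Msp_spans _ _ _).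
- by move=> [j l] /=; apply: steps; [rewrite -ltnS|apply/hD/codom_f].
- by rewrite card_prod !card_ord /m; nia.
move=> /= hc; exists (fun j => \poly_(l < m.+1) c (j, inord l)); split.
  exists j0; apply: contra_neq c0 => /(congr1 (fun q : {poly kb} => q`_l0)).
  by rewrite coef0 coef_poly ltn_ord inord_val.
have nz : pv E x ^+ m * pv D x != 0 by rewrite mulf_neq0 ?expf_neq0.
apply: (mulfI nz); rewrite mulr0 -[RHS]hc mulr_sumr.
transitivity (\sum_(j < (n * kp).+1) \sum_(l < m.+1)
    gcst X (c (j, l)) * (pv E x ^+ m * (t ^+ l * (pv D x * z j)))); last first.
  by rewrite pair_bigA; apply: eq_bigr => -[].
apply: eq_bigr => j _; rewrite pv_poly mulr_suml mulr_sumr.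
by apply: eq_bigr => l _; rewrite inord_val; ring.
Qed.

(* A nontrivial relation over kb[t] can be divided by a power of t. *)
Lemma gff_rank0 (t : K) : t != 0 -> exists N, forall z : 'I_N -> K,
  exists q : 'I_N -> {poly kb},
  (exists j, (q j)`_0 != 0) /\ \sum_j pv (q j) t * z j = 0.
Proof.
move=> t0; have [N hN] := gff_rank t; exists N => z.
have [q [[j0 qj0] hq]] := hN z.
have [s sq] : exists s, forall j, (size (q j) <= s)%N.
  by exists (\max_j size (q j)) => j; apply: (leq_bigmax j).
elim: s q qj0 hq sq => [|s IHs] q qj0 hq sq.
  by case/eqP: qj0; apply/eqP; rewrite -size_poly_eq0 -leqn0.
have [[j qj]|nq] := pselect (exists j, (q j)`_0 != 0); first by exists q; split=> //; exists j.
have q0 j : (q j)`_0 = 0.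
  by apply/eqP/negPn/negP => h; apply: nq; exists j.
have qE j : q j = (\poly_(l < s) (q j)`_l.+1) * 'X.
  apply/polyP => -[|l]; rewrite coefMX //= coef_poly; case: ltnP => // le.
  by apply: nth_default; apply: leq_trans (sq j) _.
apply: (IHs (fun j => \poly_(l < s) (q j)`_l.+1)) => [||j].
- by apply: contra_neq qj0 => h; rewrite qE h mul0r.
- apply: (mulfI t0); rewrite mulr0 -[RHS]hq mulr_sumr.
  by apply: eq_bigr => j _; rewrite [in RHS]qE pvM pvX; ring.
exact: size_poly.
Qed.

Hypothesis kb_algebraic : forall z : kb, algebraicOver i z.

Lemma gff_nonconst : exists x : K, forall c, x <> gcst X c.
Proof.
have [x0 [nx _]] := ff_trdeg1 X; exists (bc X x0) => c xc; apply: nx.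
have [q q0 /rootP rq] := kb_algebraic c; exists q => //; apply/rootP.
apply: (fmorph_inj (bc X)); rewrite rmorph0 -pv_bc xc /pv.
by rewrite horner_map rq rmorph0.
Qed.

End Base.

(** * Places *)

Section Places.
Variables (k : fieldType) (kb : closedFieldType) (i : {rmorphism k -> kb}).
Variable X : curve i.
Local Notation K := (gff X).
Implicit Types (P Q : place X) (z u v t : K) (n m : int).

Lemma ordM P u v : u != 0 -> v != 0 -> ord P (u * v) = ord P u + ord P v.
Proof. exact: ord_mul. Qed.

Lemma ord1 P : ord P 1 = 0.
Proof. by rewrite -(rmorph1 (gcst X)) ord_cst. Qed.

Lemma ordX P z (n : nat) : z != 0 -> ord P (z ^+ n) = ord P z *+ n.
Proof.
move=> z0; elim: n => [|n IHn]; first by rewrite expr0 ord1.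
by rewrite exprS ordM ?expf_neq0 // IHn mulrS.
Qed.

Lemma ordN P z : ord P (- z) = ord P z.
Proof.
have [->|z0] := eqVneq z 0; first by rewrite oppr0.
rewrite -mulN1r ordM ?oppr_eq0 ?oner_neq0 //.
by rewrite -(rmorph1 (gcst X)) -rmorphN ord_cst add0r.
Qed.

Lemma ord_prod P (I : Type) (r : seq I) (f : I -> K) :
  (forall j, f j != 0) -> ord P (\prod_(j <- r) f j) = \sum_(j <- r) ord P (f j).
Proof.
move=> f0; elim: r => [|j r IHr]; first by rewrite !big_nil ord1.
rewrite !big_cons ordM ?IHr //; elim: r {IHr} => [|l r IHr].
  by rewrite big_nil oner_neq0.
by rewrite big_cons mulf_neq0.
Qed.

(* Unlike ord, vge treats 0 as having infinite order. *)
Definition vge P n z := (z == 0) || (n <= ord P z).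

Lemma vge0 P n : vge P n 0. Proof. by rewrite /vge eqxx. Qed.

Lemma vgeE P n z : z != 0 -> vge P n z = (n <= ord P z).
Proof. by rewrite /vge => /negPf->. Qed.

Lemma vge_ord P z : vge P (ord P z) z.
Proof. by rewrite /vge lexx orbT. Qed.

Lemma vge_reg P z : vge P 0 z = (0 <= ord P z).
Proof. by rewrite /vge; case: eqVneq => //= ->; rewrite ord_zero. Qed.

Lemma vge_leq P n m z : n <= m -> vge P m z -> vge P n z.
Proof. by rewrite /vge => le /orP[->//|h]; rewrite (le_trans le h) orbT. Qed.

Lemma vgeD P n u v : vge P n u -> vge P n v -> vge P n (u + v).
Proof.
have [->|u0] := eqVneq u 0; first by rewrite add0r.
have [->|v0] := eqVneq v 0; first by rewrite addr0.
have [->|uv0] := eqVneq (u + v) 0; first by rewrite vge0.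
rewrite !vgeE // => nu nv; apply: le_trans (ord_add P u0 v0 uv0).
by rewrite le_min nu nv.
Qed.

Lemma vgeN P n z : vge P n (- z) = vge P n z.
Proof. by rewrite /vge oppr_eq0 ordN. Qed.

Lemma vgeB P n u v : vge P n u -> vge P n v -> vge P n (u - v).
Proof. by move=> nu nv; apply: vgeD => //; rewrite vgeN. Qed.

Lemma vgeM P n m u v : vge P n u -> vge P m v -> vge P (n + m) (u * v).
Proof.
have [->|u0] := eqVneq u 0; first by move=> *; rewrite mul0r vge0.
have [->|v0] := eqVneq v 0; first by move=> *; rewrite mulr0 vge0.
by rewrite !vgeE ?mulf_neq0 // ordM //; apply: lerD.
Qed.

Lemma vgeMl P n u v : vge P 0 u -> vge P n v -> vge P n (u * v).
Proof. by move=> hu hv; rewrite -[n]add0r; apply: vgeM. Qed.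

Lemma vgeMr P n u v : vge P n u -> vge P 0 v -> vge P n (u * v).
Proof. by move=> hu hv; rewrite -[n]addr0; apply: vgeM. Qed.

Lemma vge_cst P c : vge P 0 (gcst X c).
Proof. by rewrite vge_reg ord_cst. Qed.

Lemma vge_1 P : vge P 0 1.
Proof. by rewrite -(rmorph1 (gcst X)) vge_cst. Qed.

Lemma vge_sum P n (I : Type) (r : seq I) (B : pred I) (f : I -> K) :
  (forall j, B j -> vge P n (f j)) -> vge P n (\sum_(j <- r | B j) f j).
Proof. by move=> h; elim/big_ind: _ => // [|u v]; [exact: vge0|exact: vgeD]. Qed.

Lemma vgeX P n z (m : nat) : vge P n z -> vge P (n *+ m) (z ^+ m).
Proof.
move=> h; elim: m => [|m IHm]; first by rewrite expr0 vge_1.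
by rewrite exprS mulrS vgeM.
Qed.

Lemma vgeX0 P z (m : nat) : vge P 0 z -> vge P 0 (z ^+ m).
Proof. by move=> h; rewrite -(mul0rn _ m); apply: vgeX. Qed.

Lemma vgeV P z : vge P (- ord P z) z^-1.
Proof. by rewrite /vge ord_inv lexx orbT. Qed.

Lemma vge1_cst P c : vge P 1 (gcst X c) -> c = 0.
Proof. by rewrite /vge ord_cst fmorph_eq0 orbF => /eqP. Qed.

Lemma vge1_1 P : ~ vge P 1 1.
Proof. by rewrite -(rmorph1 (gcst X)) => /vge1_cst/eqP; rewrite oner_eq0. Qed.

Lemma ordD_eq P u v : u != 0 -> vge P (ord P u + 1) v ->
  u + v != 0 /\ ord P (u + v) = ord P u.
Proof.
move=> u0 hv; have uv0 : u + v != 0.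
  apply: contraL hv; rewrite addrC addr_eq0 => /eqP->.
  by rewrite vgeN vgeE // -ltNge ltzD1.
split=> //; apply/eqP; rewrite eq_le; apply/andP; split; last first.
  by rewrite -vgeE //; apply: vgeD; [exact: vge_ord|apply: vge_leq hv; lia].
rewrite leNgt; apply/negP => lt.
have : vge P (ord P u + 1) (u + v - v).
  by apply: vgeB => //; rewrite vgeE //; lia.
by rewrite addrK vgeE //; lia.
Qed.

Lemma vge_pv P (q : {poly kb}) z : vge P 0 z -> vge P 0 (pv q z).
Proof.
move=> hz; rewrite (pv_coef _ (leqnn (size q))); apply: vge_sum => j _.
by apply: vgeMl; [exact: vge_cst|exact: vgeX0].
Qed.

Lemma pv_split (q : {poly kb}) z : exists r, pv q z = gcst X q`_0 + z * pv r z.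
Proof.
exists (\poly_(j < size q) q`_j.+1).
have {1}-> : q = (q`_0)%:P + 'X * \poly_(j < size q) q`_j.+1.
  apply/polyP => -[|j]; rewrite coefD coefC coefXM /= ?addr0 // add0r.
  rewrite coef_poly; case: ltnP => // le; apply: nth_default.
  exact: leq_trans le (leqnSn _).
by rewrite pvD pvC pvM pvX.
Qed.

Lemma vge_pv0 P (q : {poly kb}) t m : 0 <= m -> vge P m t -> vge P m (pv q t - gcst X q`_0).
Proof.
move=> m0 ht; have [r ->] := pv_split q t; rewrite addrAC subrr add0r.
by apply: vgeMr => //; apply: vge_pv; apply: vge_leq ht.
Qed.

Lemma pv_unit P (q : {poly kb}) t : vge P 1 t -> q`_0 != 0 -> pv q t != 0 /\ ord P (pv q t) = 0.
Proof.
move=> ht q0; have c0 : gcst X q`_0 != 0 by rewrite fmorph_eq0.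
rewrite -[pv q t](subrK (gcst X q`_0)) addrC -[RHS in _ = RHS](ord_cst P q`_0).
by apply: ordD_eq => //; rewrite ord_cst add0r; apply: vge_pv0.
Qed.

(** A unit of the ring of P is a unit of that of Q, so ord Q is a constant multiple of ord P; both
    being normalized, the constant is 1. *)
Lemma place_sub P Q : (forall z, vge P 0 z -> vge Q 0 z) -> P = Q.
Proof.
move=> h.
have hu z : z != 0 -> ord P z = 0 -> ord Q z = 0.
  move=> z0 oz; have := h z; have := h z^-1.
  rewrite !vgeE ?invr_eq0 // !ord_inv oz oppr0 lexx => /(_ isT) a /(_ isT) b; lia.
have [t ot] := ord_unif P; have t0 : t != 0.
  by apply/eqP => t0; move: ot; rewrite t0 ord_zero.
have ozE z : z != 0 -> ord Q z = ord P z * ord Q t.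
  move=> z0; pose w := z * t ^ (- ord P z).
  have tn n : t ^ n != 0 by apply: expfz_neq0.
  have ordz R n : ord R (t ^ n) = n * ord R t.
    case: n => n; first by rewrite -exprnP ordX // -mulr_natl natz.
    by rewrite NegzE -exprnN ord_inv ordX // mulNr -mulr_natl natz.
  have w0 : w != 0 by rewrite mulf_neq0.
  have : ord Q w = 0 by apply: hu => //; rewrite ordM // ordz ot; lia.
  by rewrite ordM // ordz; lia.
have [s os] := ord_unif Q; have s0 : s != 0.
  by apply/eqP => s0; move: os; rewrite s0 ord_zero.
have ge0 : 0 <= ord Q t by rewrite -vgeE // h // vgeE // ot.
have ot1 : ord Q t = 1.
  have := ozE s s0; rewrite os; move: (ord P s) (ord Q t) ge0 => a b b0 e.
  have a0 : 0 < a by case: (ltP 0 a) => // a0; nia.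
  nia.
apply: place_eq => z; have [->|z0] := eqVneq z 0; first by rewrite !ord_zero.
by rewrite ozE // ot1 mulr1.
Qed.

(** The residue field is kb: a relation over kb[t] between the powers of z, reduced at t = 0, is a
    nonzero polynomial over kb whose value at z has positive order, and it splits into linear
    factors. *)
Lemma vge_residue P z : vge P 0 z -> exists c, vge P 1 (z - gcst X c).
Proof.
move=> hz; have [t ot] := ord_unif P.
have t0 : t != 0 by apply/eqP => t0; move: ot; rewrite t0 ord_zero.
have ht : vge P 1 t by rewrite vgeE // ot.
have [N hN] := gff_rank0 t0.
have [q [[j0 qj0] hq]] := hN (fun j => z ^+ j).
pose r := \poly_(j < N) (if insub j is Some l then (q l)`_0 else 0).
have rE : r`_j0 = (q j0)`_0 by rewrite coef_poly ltn_ord valK.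
have r0 : r != 0 by apply: contra_neq qj0; rewrite -rE => ->; rewrite coef0.
have hr : vge P 1 (pv r z).
  rewrite pv_poly; set S := bigop _ _ _.
  suff : vge P 1 (S - \sum_j pv (q j) t * z ^+ j) by rewrite hq subr0.
  rewrite -sumrB; apply: vge_sum => j _.
  rewrite valK -mulrBl -opprB mulNr vgeN; apply: vgeMr; last exact: vgeX0.
  exact: vge_pv0.
have [rs rs_eq] := closed_field_poly_normal r.
move: hr; rewrite rs_eq pvZ pv_prod => hr.
apply: contrapT => nc.
suff [p0 op] : \prod_(c <- rs) pv ('X - c%:P) z != 0 /\
    ord P (\prod_(c <- rs) pv ('X - c%:P) z) = 0.
  move: hr; rewrite vgeE ?mulf_neq0 ?fmorph_eq0 ?lead_coef_eq0 //.
  by rewrite ordM ?fmorph_eq0 ?lead_coef_eq0 // ord_cst op.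
elim: rs {rs_eq hr} => [|c rs [IH0 IH]]; first by rewrite big_nil oner_neq0 ord1.
have hc : ~~ vge P 1 (z - gcst X c) by apply/negP => h; apply: nc; exists c.
have hc0 : z - gcst X c != 0 by apply: contra hc => /eqP->; rewrite vge0.
have oc : ord P (z - gcst X c) = 0.
  move: hc; rewrite vgeE //.
  have : vge P 0 (z - gcst X c) by apply: vgeB => //; apply: vge_cst.
  by rewrite vgeE //; lia.
rewrite big_cons pvD pvX pvN pvC; split; first by rewrite mulf_neq0.
by rewrite ordM // oc IH.
Qed.

Lemma vge_residue_uniq P z c c' :
  vge P 1 (z - gcst X c) -> vge P 1 (z - gcst X c') -> c = c'.
Proof.
move=> h h'; apply/esym/subr0_eq/(@vge1_cst P); rewrite rmorphB.
have -> : gcst X c' - gcst X c = (z - gcst X c) - (z - gcst X c') by ring.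
exact: vgeB.
Qed.

Definition unif P : K := sval (cid (ord_unif P)).

Lemma ord_unifE P : ord P (unif P) = 1.
Proof. exact: svalP (cid (ord_unif P)). Qed.

Lemma ord1_neq0 P t : ord P t = 1 -> t != 0.
Proof. by move=> ot; apply/eqP => t0; move: ot; rewrite t0 ord_zero. Qed.

Lemma unif_neq0 P : unif P != 0.
Proof. exact/(ord1_neq0 (P := P))/ord_unifE. Qed.

Lemma place_sep P Q : P != Q -> exists z, [/\ z != 0, 0 < ord P z & ord Q z < 0].
Proof.
move=> PQ; have sep P' Q' : P' != Q' -> exists z, [/\ z != 0, 0 <= ord P' z & ord Q' z < 0].
  move=> nPQ; apply: contrapT => nz; case/eqP: nPQ; apply: place_sub => z.
  have [->|z0] := eqVneq z 0; first by rewrite !vge0.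
  rewrite !vgeE // => Pz; rewrite leNgt; apply/negP => Qz; apply: nz.
  by exists z.
have [u [u0 Pu Qu]] := sep _ _ PQ.
have [v [v0 Qv Pv]] : exists z, [/\ z != 0, 0 <= ord Q z & ord P z < 0].
  by apply: sep; rewrite eq_sym.
exists (u / v); split; first by rewrite mulf_neq0 ?invr_eq0.
- by rewrite ordM ?invr_eq0 // ord_inv; lia.
by rewrite ordM ?invr_eq0 // ord_inv; lia.
Qed.

Lemma place_sep_seq P (s : seq (place X)) : P \notin s ->
  exists z, [/\ z != 0, 0 < ord P z & forall Q, Q \in s -> ord Q z < 0].
Proof.
elim: s => [|Q s IHs] Ps.
  by exists (unif P); rewrite unif_neq0 ord_unifE; split.
move: Ps; rewrite inE negb_or => /andP[PQ /IHs[z [z0 Pz hz]]].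
have [lt|ge] := ltP (ord Q z) 0.
  by exists z; split=> // R; rewrite inE => /orP[/eqP->//|]; apply: hz.
have [u [u0 Pu Qu]] := place_sep PQ.
(* With r larger than every |ord R z|, the orders of u ^ r and z differ at each R in s, so their sum
   has no cancellation there. *)
have [r [r0 hr]] : exists r : nat, (0 < r)%N /\
    forall R, R \in s -> ord R u *+ r != ord R z.
  exists (\sum_(R <- s) `|ord R z|%N).+1; split=> // R Rs; apply/eqP => h.
  have le : (`|ord R z| <= \sum_(R <- s) `|ord R z|)%N.
    by rewrite (big_rem R) //= leq_addr.
  have := hz R Rs; move: h le; rewrite -mulr_natl natz.
  set n := bigop _ _ _; set a := ord R u; set b := ord R z => h le lt0.
  by case: (ltgtP a 0) => a0; nia.
have ur0 : u ^+ r != 0 by rewrite expf_neq0.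
have key R (a b : K) : a != 0 -> b != 0 -> ord R a < ord R b ->
    a + b != 0 /\ ord R (a + b) = ord R a.
  by move=> a0 b0 lt; apply: ordD_eq => //; rewrite vgeE //; lia.
have [n0 Qn] : u ^+ r + z != 0 /\ ord Q (u ^+ r + z) = ord Q u *+ r.
  by rewrite -ordX //; apply: key => //; rewrite ordX // -mulr_natl; nia.
exists (u ^+ r + z); split=> //.
  have : vge P 1 (u ^+ r + z).
    apply: vgeD; rewrite vgeE //.
    by rewrite ordX // -mulr_natl; nia.
  by rewrite vgeE //; lia.
move=> R; rewrite inE => /orP[/eqP->|Rs].
  by rewrite Qn -mulr_natl; nia.
have := hr R Rs; rewrite -ordX // neq_lt => /orP[lt|lt].
  by have [_ ->] := key R _ _ ur0 z0 lt; apply: lt_trans (hz R Rs).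
by rewrite addrC; have [_ ->] := key R _ _ z0 ur0 lt; apply: hz.
Qed.

(** Take 1 / (1 + z ^ m), where z vanishes at P and has poles on s. *)
Lemma place_idem P (s : seq (place X)) (M : nat) : P \notin s ->
  exists e, vge P M%:Z (e - 1) /\ forall Q, Q \in s -> vge Q M%:Z e.
Proof.
move=> /place_sep_seq[z [z0 Pz hz]]; pose m := M.+1.
have zm0 : z ^+ m != 0 by rewrite expf_neq0.
have [n0 Pn] : 1 + z ^+ m != 0 /\ ord P (1 + z ^+ m) = ord P 1.
  apply: ordD_eq; rewrite ?oner_neq0 // ord1 vgeE // ordX // -mulr_natl; nia.
exists (1 + z ^+ m)^-1; split.
  have -> : (1 + z ^+ m)^-1 - 1 = - (z ^+ m / (1 + z ^+ m)) by field.
  rewrite vgeN vgeE ?mulf_neq0 ?invr_eq0 // ordM ?invr_eq0 // ord_inv Pn ord1 ordX //.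
  by rewrite -mulr_natl; nia.
move=> Q /hz Qz; rewrite vgeE ?invr_eq0 // ord_inv addrC.
have [_ ->] : z ^+ m + 1 != 0 /\ ord Q (z ^+ m + 1) = ord Q (z ^+ m).
  by apply: ordD_eq => //; rewrite vgeE ?oner_neq0 // ord1 ordX // -mulr_natl; nia.
by rewrite ordX // -mulr_natl; nia.
Qed.

Lemma place_approx (s : seq (place X)) (a : place X -> K) (M : nat) : uniq s ->
  exists z, forall P, P \in s -> vge P M%:Z (z - a P).
Proof.
(* L bounds the poles of the prescribed values; multiplying these by idempotents of precision M + L
   leaves precision M. *)
move=> us; have [L hL] : exists L : nat, forall P Q, P \in s -> Q \in s -> vge P (- L%:Z) (a Q).
  exists (\sum_(P <- s) \sum_(Q <- s) `|ord P (a Q)|)%N => P Q Ps Qs.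
  rewrite /vge; case: eqVneq => //= _.
  rewrite (big_rem P) //= (big_rem Q) //=; lia.
have /choice[e he] : forall P, exists e, P \in s -> vge P (M + L)%:Z (e - 1) /\
    forall Q, Q \in s -> Q != P -> vge Q (M + L)%:Z e.
  move=> P; have [Ps|nPs] := boolP (P \in s); last by exists 0.
  have [|e [eP eQ]] := @place_idem P (rem P s) (M + L)%N.
    by rewrite mem_rem_uniq // inE eqxx.
  exists e => _; split=> // Q Qs QP; apply: eQ.
  by rewrite mem_rem_uniq // inE QP.
exists (\sum_(Q <- s) e Q * a Q) => P Ps.
have ML : M%:Z = (M + L)%N%:Z + - L%:Z by lia.
rewrite (big_rem P) //= addrAC -[X in _ - X]mul1r -mulrBl; apply: vgeD.
  by rewrite ML; apply: vgeM; [case: (he P Ps)|apply: hL].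
rewrite big_seq; apply: vge_sum => Q; rewrite mem_rem_uniq // inE => /andP[QP Qs].
rewrite ML; apply: vgeM; last exact: hL.
by have [_] := he Q Qs; apply=> //; rewrite eq_sym.
Qed.

End Places.

(** * Existence of places *)

Section ValuationRing.
Variables (k : fieldType) (kb : closedFieldType) (i : {rmorphism k -> kb}).
Variable X : curve i.
Local Notation K := (gff X).
Implicit Types (z u v w : K).

Definition gsubring (R : set K) :=
  [/\ forall c, R (gcst X c), forall u v, R u -> R v -> R (u - v) &
      forall u v, R u -> R v -> R (u * v)].

Section Subring.
Variable R : set K.
Hypothesis hR : gsubring R.

Lemma gsubring0 : R 0.
Proof. by have [h _ _] := hR; rewrite -(rmorph0 (gcst X)). Qed.

Lemma gsubring1 : R 1.
Proof. by have [h _ _] := hR; rewrite -(rmorph1 (gcst X)). Qed.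

Lemma gsubringB u v : R u -> R v -> R (u - v).
Proof. by have [_ h _] := hR; apply: h. Qed.

Lemma gsubringN u : R u -> R (- u).
Proof. by move=> Ru; rewrite -sub0r; apply: gsubringB => //; apply: gsubring0. Qed.

Lemma gsubringD u v : R u -> R v -> R (u + v).
Proof. by move=> Ru Rv; rewrite -[v]opprK; apply/gsubringB/gsubringN. Qed.

Lemma gsubringM u v : R u -> R v -> R (u * v).
Proof. by have [_ _ h] := hR; apply: h. Qed.

Lemma gsubringX u n : R u -> R (u ^+ n).
Proof.
move=> Ru; elim: n => [|n IHn]; first exact: gsubring1.
by rewrite exprS; apply: gsubringM.
Qed.

Lemma gsubring_sum (I : Type) (r : seq I) (B : pred I) (f : I -> K) :
  (forall j, B j -> R (f j)) -> R (\sum_(j <- r | B j) f j).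
Proof. by move=> h; apply: big_ind => // [|u v]; [exact: gsubring0|exact: gsubringD]. Qed.

Lemma gsubring_pv (q : {poly kb}) t : R t -> R (pv q t).
Proof.
move=> Rt; rewrite (pv_coef _ (leqnn (size q))); apply: gsubring_sum => j _.
by apply: gsubringM; [case: hR|apply: gsubringX].
Qed.

End Subring.

Lemma maximal_subring (A : set K) t : gsubring A -> (forall a, A a -> t * a != 1) ->
  exists R, [/\ gsubring R, A `<=` R, forall a, R a -> t * a != 1 &
    forall R', gsubring R' -> R `<=` R' -> (forall a, R' a -> t * a != 1) -> R' `<=` R].
Proof.
move=> hA tA; pose good R := [/\ gsubring R, A `<=` R & forall a, R a -> t * a != 1].
have [F Fgood Ftot|R [gR maxR]] := @Zorn_bigcup K [set R | R = set0 \/ good R].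
  have [[R0 FR0 R0n]|nF] := pselect (exists2 R, F R & R !=set0); last first.
    left; apply/seteqP; split=> // x [R FR Rx]; apply: nF; exists R => //.
    by exists x.
  have ge R x : F R -> R x -> good R.
    by move=> FR Rx; have [R0E|//] := Fgood R FR; move: Rx; rewrite R0E.
  have two u v : (\bigcup_(R in F) R) u -> (\bigcup_(R in F) R) v ->
      exists R, [/\ F R, R u & R v].
    move=> [R FR Ru] [S FS Sv]; have [RS|SR] := Ftot R S FR FS.
      by exists S; split=> //; apply: RS.
    by exists R; split=> //; apply: SR.
  have [x0 R0x] := R0n; have [[R0c _ _] AR0 _] := ge R0 x0 FR0 R0x.
  right; split=> [|a Aa|a [R FR Ra]]; last by have [_ _] := ge R a FR Ra; apply.
  - split=> [c|u v hu hv|u v hu hv]; first by exists R0.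
      have [R [FR Ru Rv]] := two u v hu hv; exists R => //.
      by have [[_ h _] _ _] := ge R u FR Ru; apply: h.
    have [R [FR Ru Rv]] := two u v hu hv; exists R => //.
    by have [[_ _ h] _ _] := ge R u FR Ru; apply: h.
  by exists R0 => //; apply: AR0.
have hgA : good A by split.
case: gR => [R0|[hR AR tR]].
  have := maxR A; rewrite R0; case; last by right.
  split=> // /(_ 0); case=> //; exact: gsubring0.
exists R; split=> // R' hR' RR' tR'; apply: contrapT => nR; apply: (maxR R').
  by split.
by right; split=> //; apply: subset_trans AR RR'.
Qed.

Section Maximal.
Variables (R : set K) (t : K).
Hypotheses (hR : gsubring R) (Rt : R t) (t0 : t != 0).
Hypothesis tR : forall a, R a -> t * a != 1.
Hypothesis maxR : forall R', gsubring R' -> R `<=` R' ->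
  (forall a, R' a -> t * a != 1) -> R' `<=` R.

Let R0 := gsubring0 hR.
Let R1 := gsubring1 hR.
Let RB := gsubringB hR.
Let RD := gsubringD hR.
Let RN := gsubringN hR.
Let RM := gsubringM hR.
Let RX := gsubringX hR.

(** Inverting w = 1 - t a cannot make t invertible, because every power of w is again 1 - t b with b
    in R; so R[1/w] is R by maximality. *)
Let one_sub_inv a : R a -> R (1 - t * a)^-1.
Proof.
move=> Ra; set w := 1 - t * a.
have w0 : w != 0 by rewrite subr_eq0 eq_sym tR.
have Rw : R w by apply: RB => //; apply: RM.
have wn n : exists2 b, R b & w ^+ n = 1 - t * b.
  elim: n => [|n [b Rb hb]]; first by exists 0 => //; rewrite mulr0 subr0.
  exists (a + w * b); first by apply: RD => //; apply: RM.
  by rewrite exprS hb /w; ring.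
pose R' : set K := [set x | exists n, R (x * w ^+ n)].
have R'E x n m : (n <= m)%N -> R (x * w ^+ n) -> R (x * w ^+ m).
  by move=> /subnKC<- h; rewrite exprD mulrA; apply: RM => //; apply: RX.
apply: (maxR (R' := R')) => [||x [n Rx]|].
- split=> [c|u v [n Ru] [m Rv]|u v [n Ru] [m Rv]].
  + by exists 0%N; rewrite mulr1; case: hR.
  + exists (n + m)%N; rewrite mulrBl; apply: RB.
      by apply: R'E Ru; apply: leq_addr.
    by apply: R'E Rv; apply: leq_addl.
  by exists (n + m)%N; rewrite exprD mulrACA; apply: RM.
- by move=> x Rx; exists 0%N; rewrite mulr1.
- apply/eqP => tx; have [b Rb hb] := wn n.
  have /eqP[] := tR (RD Rx Rb); rewrite mulrDr mulrA tx mul1r hb; ring.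
by exists 1%N; rewrite expr1 mulVf.
Qed.

(** A witness that adjoining z to R makes t invertible, by means of a polynomial in z of degree less
    than n. *)
Let rel z n := exists q : {poly K}, [/\ (size q <= n)%N, forall j, R q`_j & t * q.[z] = 1].

Let relE z : ~ R z -> exists n, rel z n.
Proof.
move=> nRz; apply: contrapT => nrel; apply: nRz.
pose R' : set K := [set x | exists q : {poly K}, (forall j, R q`_j) /\ x = q.[z]].
apply: (maxR (R' := R')) => [||x [q [Rq ->]]|].
- split=> [c|u v [q [Rq ->]] [r [Rr ->]]|u v [q [Rq ->]] [r [Rr ->]]].
  + exists (gcst X c)%:P; rewrite hornerC; split=> // j; rewrite coefC.
    by case: ifP => // _; case: hR.
  + exists (q - r); rewrite hornerD hornerN; split=> // j.
    by rewrite coefB; apply: RB.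
  exists (q * r); rewrite hornerM; split=> // j; rewrite coefM.
  by apply: gsubring_sum => // l _; apply: RM.
- by move=> x Rx; exists x%:P; rewrite hornerC; split=> // j; rewrite coefC; case: ifP.
- by apply/eqP => h; apply: nrel; exists (size q), q.
by exists 'X; rewrite hornerX; split=> // j; rewrite coefX; case: eqP.
Qed.

(** The relation for 1/z, in which 1 - t r_0 is a unit, expresses z ^ n through lower powers of z;
    this lowers the degree of the relation for z. *)
Let rel_lower z n m : z != 0 -> (m <= n.+1)%N -> rel z n.+1 -> rel z^-1 m -> rel z n.
Proof.
move=> z0 mn [q [sq Rq hq]] [r [sr Rr hr]].
case: m mn sr => [|m] mn sr.
  move: sr hr; rewrite size_poly_leq0 => /eqP->; rewrite horner0 mulr0.
  by move=> /esym/eqP; rewrite oner_eq0.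
have Rw := one_sub_inv (Rr 0%N); set w := 1 - t * r`_0 in Rw.
have w0 : w != 0 by rewrite subr_eq0 eq_sym tR.
have rE : w = t * \sum_(j < m) r`_j.+1 * z ^- j.+1.
  rewrite /w -hr (horner_coef_wide _ sr) big_ord_recl expr0 mulr1 mulrDr addrAC subrr add0r.
  by under eq_bigr do rewrite exprVn.
have zn : z ^+ n = t * \sum_(j < m) (w^-1 * r`_j.+1) * z ^+ (n - j.+1).
  rewrite -[LHS]mul1r -(mulVf w0) {2}rE !mulr_sumr mulr_suml; apply: eq_bigr => j _.
  have -> : z ^+ n = z ^+ j.+1 * z ^+ (n - j.+1).
    by rewrite -exprD subnKC //; apply: leq_trans (ltn_ord j) _.
  by field; rewrite expf_neq0 ?andbT.
pose q' : {poly K} := \poly_(j < n) q`_j +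
  \sum_(j < m) (q`_n * t * (w^-1 * r`_j.+1)) *: 'X^(n - j.+1).
exists q'; split.
- rewrite (leq_trans (size_polyD _ _)) // geq_max size_poly /=.
  apply: (leq_trans (size_sum _ _ _)); apply/bigmax_leqP => j _.
  rewrite (leq_trans (size_scale_leq _ _)) // size_polyXn.
  by have := ltn_ord j; lia.
- move=> j; rewrite coefD coef_poly coef_sum; apply: RD; first by case: ifP.
  apply: gsubring_sum => // l _; rewrite coefZ coefXn.
  by apply: RM; [apply: RM; [apply: RM|apply: RM]|case: eqP].
rewrite -hq; congr (t * _); rewrite (horner_coef_wide _ sq) big_ord_recr /=.
rewrite hornerD horner_poly; congr (_ + _).
rewrite zn horner_sum !mulr_sumr; apply: eq_bigr => j _.
by rewrite hornerZ hornerXn; ring.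
Qed.

(** If neither z nor 1/z is in R, both have relations, and [rel_lower] can shorten the longer one
    forever. *)
Lemma maximal_valuation z : z != 0 -> R z \/ R z^-1.
Proof.
move=> z0; have [//|nR] := pselect (R z \/ R z^-1).
have /not_orP[/relE[n rn] /relE[m rm]] := nR.
have rel0 u : ~ rel u 0.
  move=> [q [sq _]]; move: sq; rewrite size_poly_leq0 => /eqP->.
  by rewrite horner0 mulr0 => /esym/eqP; rewrite oner_eq0.
exfalso; have [s ns] : exists s, (n + m <= s)%N by exists (n + m)%N.
elim: s z z0 {nR} n m rn rm ns => [|s IHs] z z0 n m rn rm ns.
  have n0 : n = 0%N by lia.
  by rewrite n0 in rn; apply: rel0 rn.
have [mn|nm] := leqP m n.
  case: n rn mn ns => [/rel0//|n] rn mn ns.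
  by apply: (IHs z z0 n m) => //; exact: rel_lower rn rm.
case: m rm nm ns => [/rel0//|m] rm nm ns.
have rm' : rel z^-1 m.
  apply: (rel_lower (m := n)); [by rewrite invr_eq0|exact: ltnW|exact: rm|].
  by rewrite invrK.
by apply: (IHs z z0 n m) => //; lia.
Qed.

(** The ideal of non-units of R. *)
Let Mx z := R z /\ (z = 0 \/ ~ R z^-1).

Let Mx0 : Mx 0. Proof. by split; [|left]. Qed.

Let MxMl a z : R a -> Mx z -> Mx (a * z).
Proof.
move=> Ra [Rz hz]; split; first exact: RM.
have [->|a0] := eqVneq a 0; first by left; rewrite mul0r.
have [->|z0] := eqVneq z 0; first by left; rewrite mulr0.
case: hz => [/eqP|nz]; first by rewrite (negPf z0).
right=> h; apply: nz; have -> : z^-1 = a * (a * z)^-1 by field; rewrite a0 z0.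
exact: RM.
Qed.

Let MxD u v : Mx u -> Mx v -> Mx (u + v).
Proof.
have [->|u0] := eqVneq u 0; first by rewrite add0r.
have [->|v0] := eqVneq v 0; first by rewrite addr0.
move=> Mu Mv; have vu0 : v / u != 0 by rewrite mulf_neq0 ?invr_eq0.
have [h|h] := maximal_valuation vu0.
  have -> : u + v = (1 + v / u) * u by field.
  by apply: MxMl => //; apply: RD.
have -> : u + v = (1 + (v / u)^-1) * v by field; rewrite u0 v0.
by apply: MxMl => //; apply: RD.
Qed.

Let Mx1 : ~ Mx 1.
Proof. by move=> [_ [/eqP|]]; [rewrite oner_eq0|rewrite invr1]. Qed.

Let nR_Mx z : z != 0 -> ~ R z -> Mx z^-1.
Proof.
move=> z0 nR; split; last by right; rewrite invrK.
by have [|] := maximal_valuation z0.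
Qed.

Let R_nMx z : R z -> ~ Mx z -> z != 0 /\ R z^-1.
Proof.
move=> Rz nM; split; first by apply/eqP => z0; apply: nM; rewrite z0.
by apply: contrapT => h; apply: nM; split=> //; right.
Qed.

Let Mxt : Mx t.
Proof. by split=> //; right=> /tR/eqP[]; rewrite mulfV. Qed.

(** Discreteness of the valuation. The w_j have increasing values, all below that of z. In a
    relation over kb[z], the first w_j whose coefficient does not vanish at z = 0 dominates, as the
    earlier terms carry a factor z; so N such elements cannot exist. *)
Let chain z : z != 0 -> Mx z -> exists N, forall w : nat -> K,
  (forall j, w j != 0) -> (forall j, R (w j)) ->
  (forall l j, (l < j < N)%N -> Mx (w j / w l)) ->
  (forall j, (j < N)%N -> Mx (z / w j)) -> False.
Proof.
move=> z0 Mz; have [N hN] := gff_rank0 z0; exists N => w w0 Rw wl wz.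
have [q [[j1 qj1] hq]] := hN (fun j => w j).
case: (@arg_minnP _ j1 (fun j => (q j)`_0 != 0) (fun j => val j) qj1) => j qj jmin.
have qu : ~ Mx (pv (q j) z).
  move=> h; have [r rE] := pv_split (q j) z.
  have : Mx (gcst X (q j)`_0).
    rewrite -[gcst _ _](addrK (z * pv r z)) -rE -mulrN mulrC; apply: MxD => //.
    by apply: MxMl => //; apply: RN; apply: gsubring_pv => //; case: Mz.
  move=> [_ [/eqP|[]]]; first by rewrite fmorph_eq0 (negPf qj).
  by rewrite -fmorphV; case: hR.
apply: qu; have -> : pv (q j) z = - \sum_(l | l != j) pv (q l) z * (w l / w j).
  apply: (mulIf (w0 j)); apply/eqP; rewrite mulNr -addr_eq0 mulr_suml -[X in _ == X]hq.
  rewrite [X in _ == X](bigD1 j) //=; apply/eqP; congr (_ + _); apply: eq_bigr => l _.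
  by rewrite mulrA divfK.
rewrite -mulN1r; apply: MxMl; first exact: RN.
apply: (big_ind Mx) => // l lj; have [jl|lj'] := ltnP j l.
  by apply: MxMl; [apply: gsubring_pv => //; case: Mz|apply: wl; rewrite jl /=].
have ql : (q l)`_0 = 0.
  apply/eqP/negPn/negP => /jmin; rewrite leqNgt ltn_neqAle lj' andbT negbK => /eqP/val_inj jl.
  by rewrite jl eqxx in lj.
have [r ->] := pv_split (q l) z; rewrite ql rmorph0 add0r.
have -> : z * pv r z * (w l / w j) = (pv r z * w l) * (z / w j) by ring.
by apply: MxMl; [apply: RM => //; apply: gsubring_pv => //; case: Mz|apply: wz].
Qed.

(** Otherwise every nonzero non-unit is a product of two non-units, and starting from t this gives
    chains of any length below the value of t. *)
Let uniformizer : exists pi, [/\ pi != 0, Mx pi & forall z, Mx z -> R (z / pi)].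
Proof.
apply: contrapT => npi.
have /choice[nx hnx] : forall w, exists z, w != 0 -> Mx w -> [/\ z != 0, Mx z & Mx (w / z)].
  move=> w; apply: contrapT => h; apply: npi.
  have w0 : w != 0 by apply/eqP => w0; apply: h; exists 0; rewrite w0 eqxx.
  have Mw : Mx w by apply: contrapT => nM; apply: h; exists 0.
  exists w; split=> // z Mz; apply: contrapT => nR; apply: h; exists z => _ _.
  have z0 : z != 0 by apply/eqP => z0; apply: nR; rewrite z0 mul0r.
  split=> //; rewrite -[w / z]invrK invf_div; apply: nR_Mx => //.
  by rewrite mulf_neq0 ?invr_eq0.
pose w n := iter n nx t.
have wn n : w n != 0 /\ Mx (w n).
  by elim: n => [|n [w0 Mw]] //; have [] := hnx (w n) w0 Mw.
have wS n : Mx (w n / w n.+1) by have [] := hnx (w n) (wn n).1 (wn n).2.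
have wlt a b : (a < b)%N -> Mx (w a / w b).
  elim: b => // b IHb; rewrite ltnS leq_eqVlt => /orP[/eqP->//|/IHb h].
  have -> : w a / w b.+1 = (w a / w b) * (w b / w b.+1).
    by rewrite mulrA divfK ?(wn b).1.
  by apply: MxMl => //; case: h.
have [N hN] := chain t0 Mxt; apply: (hN (fun j => w (N - j)%N)) => [j|j|l j|j].
- by case: (wn (N - j)%N).
- by have [_ []] := wn (N - j)%N.
- by move=> /andP[lj jN]; apply: wlt; lia.
by move=> jN; apply: (wlt 0%N); lia.
Qed.

Lemma maximal_place : exists P : place X,
  (forall z, R z -> vge P 0 z) /\ vge P 1 t.
Proof.
have [pi [pi0 Mpi hpi]] := uniformizer.
have npiV d : (0 < d)%N -> ~ R (pi ^- d).
  move=> d0 h; apply: (@Mx1); have -> : 1 = pi ^- d * pi ^+ d.-1 * pi.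
    by rewrite -mulrA -exprSr prednK // mulVf ?expf_neq0.
  by apply: MxMl => //; apply: RM => //; apply: RX; case: Mpi.
have pz n : pi ^ n != 0 by apply: expfz_neq0.
have Rpi n m z : n <= m -> R (z / pi ^ m) -> R (z / pi ^ n).
  move=> le h; have -> : z / pi ^ n = z / pi ^ m * pi ^+ `|m - n|%N.
    rewrite -[pi ^+ _]/(pi ^ `|m - n|%N%:Z) gez0_abs ?subr_ge0 //.
    have -> : pi ^ m = pi ^ n * pi ^ (m - n) by rewrite -expfzDr // subrKC.
    by move: (pz n) (pz (m - n)) => a0 b0; field; rewrite a0 b0.
  by apply: RM => //; apply: RX; case: Mpi.
pose U z := R z /\ R z^-1.
have ex z : z != 0 -> exists n : int, U (z / pi ^ n).
  move=> z0.
  have exR u : u != 0 -> R u -> exists n : nat, U (u / pi ^+ n).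
    move=> u0 Ru; have [Mu|nMu] := pselect (Mx u); last first.
      by exists 0%N; rewrite divr1; have [] := R_nMx Ru nMu.
    have exn : exists n, `[< ~ R (u / pi ^+ n) >].
      apply: contrapT => nex; have {}nex n : R (u / pi ^+ n).
        by apply: contrapT => h; apply: nex; exists n; apply/asboolP.
      (* Were u divisible by every power of pi, these powers would form chains of any length below
         the value of u. *)
      have [N hN] := chain u0 Mu; apply: (hN (fun n => pi ^+ n)) => [j|j|l j|j _].
      - by rewrite expf_neq0.
      - by apply: RX; case: Mpi.
      - move=> /andP[lj _]; rewrite -expfB //.
        have -> : (j - l = (j - l).-1.+1)%N by lia.
        by rewrite exprSr; apply: MxMl => //; apply: RX; case: Mpi.
      have -> : u / pi ^+ j = u / pi ^+ j.+1 * pi.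
        by rewrite exprSr; field; rewrite pi0 expf_neq0.
      exact: MxMl.
    case: (ex_minnP exn) => -[/asboolP[]|n /asboolP nR nmin]; first by rewrite divr1.
    have Rn : R (u / pi ^+ n).
      by apply: contrapT => h; have := nmin n; rewrite ltnn => /(_ _)/notF; apply; apply/asboolP.
    exists n; split=> //; have [] // := R_nMx Rn.
    by move=> /hpi h; apply: nR; rewrite exprSr invfM mulrA.
  have [Rz|RVz] := maximal_valuation z0.
    by have [n Un] := exR z z0 Rz; exists n.
  have zV0 : z^-1 != 0 by rewrite invr_eq0.
  have [n [U1 U2]] := exR _ zV0 RVz; exists (- n%:Z).
  have -> : z / pi ^ (- n%:Z) = (z^-1 / pi ^+ n)^-1.
    by rewrite -exprnN invfM !invrK.
  by split=> //; rewrite invrK.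
pose o z : int := if z == 0 then 0 else xget 0 [set n | U (z / pi ^ n)].
have oU z : z != 0 -> U (z / pi ^ o z).
  move=> z0; rewrite /o (negPf z0); have [n Un] := ex z z0.
  by case: xgetP => [m -> //|/(_ n)].
have fld (a b c : K) : a != 0 -> b != 0 -> c != 0 -> c^-1 = a / (b * c) / (a / b).
  by move=> a0 b0 c0; field; rewrite a0 b0 c0.
have o_ge z n : z != 0 -> R (z / pi ^ n) -> n <= o z.
  move=> z0 Rz; have [_ Uz] := oU z z0; rewrite leNgt; apply/negP => lt.
  apply: (npiV `|n - o z|%N); first by lia.
  have -> : pi ^- `|n - o z|%N = z / pi ^ n * (z / pi ^ o z)^-1; last exact: RM.
  have -> : pi ^ n = pi ^ o z * pi ^+ `|n - o z|%N.
    rewrite -[pi ^+ _]/(pi ^ `|n - o z|%N%:Z) gez0_abs ?subr_ge0 1?ltW //.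
    by rewrite -expfzDr // subrKC.
  by apply: fld; rewrite ?expf_neq0.
have o_eq z n : z != 0 -> U (z / pi ^ n) -> o z = n.
  move=> z0 [Un Un']; apply/eqP; rewrite eq_le o_ge // andbT.
  rewrite leNgt; apply/negP => lt; have [Uz _] := oU z z0.
  apply: (npiV `|o z - n|%N); first by lia.
  have -> : pi ^- `|o z - n|%N = z / pi ^ o z * (z / pi ^ n)^-1; last exact: RM.
  have -> : pi ^ o z = pi ^ n * pi ^+ `|o z - n|%N.
    rewrite -[pi ^+ _]/(pi ^ `|o z - n|%N%:Z) gez0_abs ?subr_ge0 1?ltW //.
    by rewrite -expfzDr // subrKC.
  by apply: fld; rewrite ?expf_neq0.
have o0 : o 0 = 0 by rewrite /o eqxx.
have oM f g : f != 0 -> g != 0 -> o (f * g) = o f + o g.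
  move=> f0 g0; apply: o_eq; first by rewrite mulf_neq0.
  have [Uf Uf'] := oU f f0; have [Ug Ug'] := oU g g0.
  have -> : f * g / pi ^ (o f + o g) = (f / pi ^ o f) * (g / pi ^ o g).
    by rewrite expfzDr // invfM mulrACA.
  by split; [|rewrite invfM]; apply: RM.
have oD f g : f != 0 -> g != 0 -> f + g != 0 -> Num.min (o f) (o g) <= o (f + g).
  move=> f0 g0 fg0; apply: o_ge => //; rewrite mulrDl.
  by apply: RD; [apply: (Rpi _ (o f))|apply: (Rpi _ (o g))];
    rewrite ?ge_min ?lexx ?orbT //; [case: (oU f)|case: (oU g)].
have oc c : o (gcst X c) = 0.
  have [->|c0] := eqVneq c 0; first by rewrite rmorph0.
  apply: o_eq; rewrite ?fmorph_eq0 // divr1.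
  by split; [|rewrite -fmorphV]; case: hR.
have ou : exists s, o s = 1.
  by exists pi; apply: o_eq => //; rewrite expr1z mulfV //; split; rewrite ?invr1.
exists (Place o0 oM oD oc ou); split=> [z Rz|].
  by rewrite /vge; case: eqVneq => //= z0; apply: o_ge; rewrite // divr1.
by rewrite vgeE //; apply: o_ge => //; rewrite expr1z; apply: hpi.
Qed.

End Maximal.

(** Chevalley's extension theorem. It yields the poles of non-constant functions and the places of Y
    above a place of X. *)
Lemma place_exists (A : set K) t : gsubring A -> A t -> t != 0 ->
  (forall a, A a -> t * a != 1) ->
  exists P : place X, (forall a, A a -> vge P 0 a) /\ vge P 1 t.
Proof.
move=> hA At t0 tA; have [R [hR AR tR maxR]] := maximal_subring hA tA.
have [P [RP tP]] := maximal_place hR (AR _ At) t0 tR maxR.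
by exists P; split=> // a /AR/RP.
Qed.

End ValuationRing.

(** * Divisors *)

Section Divisors.
Variables (k : fieldType) (kb : closedFieldType) (i : {rmorphism k -> kb}).
Variable X : curve i.
Local Notation K := (gff X).
Local Notation V := (rmod (gcst X)).
Implicit Types (P Q : place X) (z u v t f : K) (s r : seq (place X)).

(** The value at P of a function that is regular there. *)
Definition rv P z : kb := xget 0 [set c | vge P 1 (z - gcst X c)].

Lemma rvP P z : vge P 0 z -> vge P 1 (z - gcst X (rv P z)).
Proof. by move=> /vge_residue[c hc]; rewrite /rv; case: xgetP => [a -> //|/(_ c)]. Qed.

Lemma rv_eq P z c : vge P 1 (z - gcst X c) -> rv P z = c.
Proof.
move=> h; apply: vge_residue_uniq (h); apply: rvP.
rewrite -[z](subrK (gcst X c)); apply: vgeD; last exact: vge_cst.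
exact: vge_leq h.
Qed.

Lemma rv_cst P c : rv P (gcst X c) = c.
Proof. by apply: rv_eq; rewrite subrr vge0. Qed.

Lemma rvD P u v : vge P 0 u -> vge P 0 v -> rv P (u + v) = rv P u + rv P v.
Proof.
move=> /rvP hu /rvP hv; apply: rv_eq; rewrite rmorphD opprD addrACA.
exact: vgeD.
Qed.

Lemma rvM P u v : vge P 0 u -> vge P 0 v -> rv P (u * v) = rv P u * rv P v.
Proof.
move=> hu hv; apply: rv_eq; rewrite rmorphM.
set a := gcst X _; set b := gcst X _.
have -> : u * v - a * b = u * (v - b) + b * (u - a) by ring.
apply: vgeD; apply: vgeMl => //; try exact: rvP; exact: vge_cst.
Qed.

Lemma rv_vge1 P z : vge P 1 z -> rv P z = 0.
Proof. by move=> h; apply: rv_eq; rewrite rmorph0 subr0. Qed.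

Lemma rv_eq0 P z : vge P 0 z -> rv P z = 0 -> vge P 1 z.
Proof. by move=> /rvP h r0; move: h; rewrite r0 rmorph0 subr0. Qed.

Lemma alg_const (q : {poly kb}) z : q != 0 -> pv q z = 0 -> exists c, z = gcst X c.
Proof.
move=> q0; have [rs ->] := closed_field_poly_normal q.
rewrite pvZ pv_prod => /eqP; rewrite mulf_eq0 fmorph_eq0 lead_coef_eq0 (negPf q0) /=.
move=> /eqP h; suff : exists2 c, c \in rs & z = gcst X c by case=> c _; exists c.
elim: rs h => [|c rs IHrs]; first by rewrite big_nil => /eqP; rewrite oner_eq0.
rewrite big_cons => /eqP; rewrite mulf_eq0 pvD pvX pvN pvC subr_eq0 => /orP[/eqP->|/eqP].
  by exists c; rewrite ?inE ?eqxx.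
by move=> /IHrs[d ds ->]; exists d => //; rewrite inE ds orbT.
Qed.

Lemma nonconst_neq0 f : (forall c, f <> gcst X c) -> f != 0.
Proof. by move=> fc; apply/eqP => f0; apply: (fc 0); rewrite rmorph0. Qed.

Lemma nonconst_inv f : (forall c, f <> gcst X c) -> forall c, f^-1 <> gcst X c.
Proof. by move=> fc c fE; apply: (fc c^-1); rewrite fmorphV -fE invrK. Qed.

(** In kb[1/f] the element 1/f is not invertible, since f is transcendental over kb; a place where
    1/f vanishes is a pole of f. *)
Lemma pole_exists f : (forall c, f <> gcst X c) -> exists P, ord P f < 0.
Proof.
move=> fc; have f0 := nonconst_neq0 fc.
have tc := nonconst_inv fc.
pose A : set K := [set x | exists q, x = pv q f^-1].
have [||||P [_ Pt]] := @place_exists _ _ _ X A f^-1.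
- split=> [c|u v [q ->] [r ->]|u v [q ->] [r ->]].
  + by exists c%:P; rewrite pvC.
  + by exists (q - r); rewrite pvD pvN.
  by exists (q * r); rewrite pvM.
- by exists 'X; rewrite pvX.
- by rewrite invr_eq0.
- move=> a [q ->]; apply/eqP => h.
  have q0 : 'X * q - 1 != 0.
    apply/eqP => /(congr1 (horner^~ 0)).
    by rewrite !hornerE /= => /eqP; rewrite ?mul0r ?sub0r oppr_eq0 oner_eq0.
  have [|c /tc//] := @alg_const ('X * q - 1) f^-1 q0.
  by rewrite pvD pvN pv1 pvM pvX h subrr.
exists P; move: Pt; rewrite vgeE ?invr_eq0 // ord_inv; lia.
Qed.

Lemma no_pole_const f : (forall P, vge P 0 f) -> exists c, f = gcst X c.
Proof.
move=> h; apply: contrapT => nc; have [|P] := @pole_exists f.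
  by move=> c fc; apply: nc; exists c.
by rewrite ltNge -vge_reg h.
Qed.

(** Effective divisors are encoded as sequences of places with repetition; the degree is the size of
    the sequence. *)
Definition cnt s P : int := (count_mem P s)%:Z.

Lemma cnt_ge0 s P : 0 <= cnt s P. Proof. by []. Qed.

Lemma cnt_cat s r P : cnt (s ++ r) P = cnt s P + cnt r P.
Proof. by rewrite /cnt count_cat. Qed.

Lemma cnt_cons Q s P : cnt (Q :: s) P = (Q == P)%:R + cnt s P.
Proof. by rewrite /cnt /= PoszD; case: (Q == P). Qed.

Lemma cnt_le_size s P : cnt s P <= (size s)%:Z.
Proof. by rewrite /cnt lez_nat count_size. Qed.

Lemma cnt_gt0 s P : P \in s -> 1 <= cnt s P.
Proof. by rewrite -has_pred1 has_count /cnt lez_nat. Qed.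

Lemma cnt_notin s P : P \notin s -> cnt s P = 0.
Proof. by move=> h; rewrite /cnt (count_memPn h). Qed.

Definition reps m s := flatten (nseq m s).

Lemma cnt_reps m s P : cnt (reps m s) P = m%:Z * cnt s P.
Proof.
elim: m => [|m IHm]; first by rewrite mul0r.
by rewrite /reps /= cnt_cat -/(reps m s) IHm; lia.
Qed.

Lemma size_reps m s : size (reps m s) = (m * size s)%N.
Proof. by elim: m => //= m IHm; rewrite size_cat IHm mulSn. Qed.

Lemma seq_of_fun (n : place X -> nat) r : uniq r -> (forall P, n P != 0%N -> P \in r) ->
  exists s, (forall P, cnt s P = (n P)%:Z) /\ size s = (\sum_(P <- r) n P)%N.
Proof.
move=> ur nr; exists (flatten [seq nseq (n P) P | P <- r]); split; last first.
  rewrite size_flatten /shape -map_comp sumnE big_map.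
  by apply: eq_bigr => P _ /=; rewrite size_nseq.
move=> P; rewrite /cnt count_flatten -map_comp sumnE big_map; congr Posz.
have [Pr|Pr] := boolP (P \in r); last first.
  have -> : n P = 0%N by apply/eqP; apply: contraNT Pr => /nr.
  rewrite big_seq big1 // => Q Qr /=; rewrite count_nseq /=.
  by case: (Q =P P) => [QP|_] //=; rewrite -QP Qr in Pr.
rewrite (bigD1_seq P) //= count_nseq /= eqxx mul1n big1 ?addn0 // => Q QP.
by rewrite count_nseq /= (negPf QP).
Qed.

(* At every zero P of t the approximations z take all the values 0 <= j < ord P t. *)
Lemma zeros_indep t s : uniq s -> t != 0 -> (forall P, P \in s -> 0 < ord P t) ->
  exists (T : finType) (z : T -> K), #|T| = (\sum_(P <- s) `|ord P t|)%N /\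
  forall q : T -> {poly kb}, \sum_j pv (q j) t * z j = 0 -> forall j, (q j)`_0 = 0.
Proof.
move=> us t0 st; pose pl (l : 'I_(size s)) := tnth (in_tuple s) l.
have pls l : pl l \in s by apply: mem_tnth.
have pl_inj : injective pl by apply/tuple_uniqP.
pose T := {l : 'I_(size s) & 'I_`|ord (pl l) t|}.
pose M := (\sum_(P <- s) `|ord P t|).+1%N.
have leM P : P \in s -> (`|ord P t| < M)%N.
  by move=> Ps; rewrite /M ltnS (big_rem P) //= leq_addr.
have /choice[z hz] : forall j : T, exists z, forall P, P \in s ->
    vge P M%:Z (z - (if P == pl (tag j) then unif P ^+ (tagged j) else 0)).
  by move=> j; apply: place_approx.
have card_T : #|{: T}| = (\sum_(P <- s) `|ord P t|)%N.
  rewrite card_tagged sumnE big_map big_enum /= (big_tnth _ _ s).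
  by apply: eq_bigr => l _; rewrite card_ord.
exists T, z; split=> // q hq [l j0]; apply/eqP/negPn/negP => qj0.
pose mk (j : 'I_`|ord (pl l) t|) : T := Tagged (fun l : 'I_(size s) => 'I_`|ord (pl l) t|) j.
(* Among the terms attached to P whose coefficient does not vanish at t = 0, the one of least order
   j dominates: a coefficient that vanishes at t = 0 contributes at least ord P t, which is larger
   than j. *)
case: (@arg_minnP _ j0 (fun j => (q (mk j))`_0 != 0) (fun j => val j) qj0) => j qj jmin.
pose jj := mk j; set P := pl l.
have Ps : P \in s := pls l; have Pt := st P Ps; have PM := leM P Ps.
have jM : (j < `|ord P t|)%N := ltn_ord j.
have u0 : unif P ^+ j != 0 by rewrite expf_neq0 ?unif_neq0.
have ou : ord P (unif P ^+ j) = j%:Z by rewrite ordX ?unif_neq0 // ord_unifE -mulr_natl mulr1 natz.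
have zl (j' : 'I_`|ord (pl l) t|) : vge P M%:Z (z (mk j') - unif P ^+ j').
  by have := hz (mk j') P Ps; rewrite /= eqxx.
have zm (c : T) : tag c != l -> vge P M%:Z (z c).
  move=> cl; have := hz c P Ps; rewrite (inj_eq pl_inj) eq_sym (negPf cl) subr0 //.
have [z0 oz] : z jj != 0 /\ ord P (z jj) = j%:Z.
  rewrite -[z jj](subrK (unif P ^+ j)) addrC -ou; apply: ordD_eq => //.
  by rewrite ou; apply: vge_leq (zl j); lia.
have t1 : vge P 1 t by rewrite vgeE //; lia.
have [q0 oq] := pv_unit t1 qj.
have rest : vge P (j%:Z + 1) (\sum_(c | c != jj) pv (q c) t * z c).
  apply: vge_sum => c cjj; have [ml|ml] := eqVneq (tag c) l; last first.
    apply: vgeMl; first by apply: vge_pv; apply: vge_leq t1.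
    by apply: vge_leq (zm c ml); lia.
  case: c cjj ml => m j' /= cjj ml; subst m; rewrite -/(mk j') in cjj *.
  have zj' : vge P j'%:Z (z (mk j')).
    rewrite -[z _](subrK (unif P ^+ j')); apply: vgeD.
      by apply: vge_leq (zl j'); have := ltn_ord j'; rewrite -/P; lia.
    by rewrite vgeE ?expf_neq0 ?unif_neq0 // ordX ?unif_neq0 // ord_unifE -mulr_natl mulr1 natz.
  have [lt|ge] := ltnP j j'.
    apply: vgeMl; first by apply: vge_pv; apply: vge_leq t1.
    by apply: vge_leq zj'; lia.
  have qj' : (q (mk j'))`_0 = 0.
    apply/eqP/negPn/negP => /jmin /= le; case/eqP: cjj.
    by congr mk; apply: val_inj => /=; apply/eqP; rewrite eqn_leq ge le.
  have [r ->] := pv_split (q (mk j')) t; rewrite qj' rmorph0 add0r.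
  have -> : t * pv r t * z (mk j') = pv r t * (t * z (mk j')) by ring.
  apply: vgeMl; first by apply: vge_pv; apply: vge_leq t1.
  apply: vgeMr; last by apply: vge_leq zj'.
  by rewrite vgeE //; lia.
have [] : pv (q jj) t * z jj + \sum_(c | c != jj) pv (q c) t * z c != 0 /\
    ord P (pv (q jj) t * z jj + \sum_(c | c != jj) pv (q c) t * z c) = ord P (pv (q jj) t * z jj).
  by apply: ordD_eq; rewrite ?mulf_neq0 // ordM // oq oz add0r.
by have := hq; rewrite (bigD1 jj) //= => ->; rewrite eqxx.
Qed.

(** By [zeros_indep], N zeros counted with multiplicity would contradict the relation provided by
    [gff_rank0]. *)
Lemma zeros_bounded t : t != 0 -> exists N, forall s, uniq s ->
  (forall P, P \in s -> 0 < ord P t) -> (\sum_(P <- s) `|ord P t| < N)%N.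
Proof.
move=> t0; have [N hN] := gff_rank0 t0; exists N => s us st.
have [T [z [<- hz]]] := zeros_indep us t0 st; rewrite ltnNge; apply/negP => NT.
pose e (j : 'I_N) : T := enum_val (widen_ord NT j).
have [q [[j qj] hq]] := hN (z \o e).
have e_inj : injective e by move=> a b /enum_val_inj/(congr1 val)/= /val_inj.
pose q' x := \sum_(l | e l == x) q l.
have q'e l : q' (e l) = q l.
  by rewrite /q' (big_pred1 l) // => l'; rewrite inj_eq.
have := hz q' _ (e j); rewrite q'e => h; case/eqP: qj; apply: h.
rewrite -[RHS]hq [RHS](partition_big e predT) //=; apply: eq_bigr => x _.
by rewrite pv_sum mulr_suml; apply: eq_bigr => l /eqP->.
Qed.

Lemma zeros_seq t : t != 0 -> exists s, forall P, cnt s P = Num.max 0 (ord P t).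
Proof.
move=> t0; have [N hN] := zeros_bounded t0.
pose Q n := `[< exists s, [/\ uniq s, forall P, P \in s -> 0 < ord P t & size s = n] >].
have Q0 : exists n, Q n by exists 0%N; apply/asboolP; exists [::].
have QN n : Q n -> (n <= N)%N.
  move=> /asboolP[s [us st <-]]; apply: leq_trans (ltnW (hN s us st)).
  rewrite -sum1_size big_seq [X in (_ <= X)%N]big_seq leq_sum // => P /st; lia.
case: (ex_maxnP Q0 QN) => n /asboolP[r [ur rt sr]] nmax.
have [|s [sE _]] := seq_of_fun (n := fun P => `|(Num.max 0 (ord P t))%R|%N) ur.
  move=> P Pt; apply: contrapT => /negP Pr; have := nmax n.+1; rewrite ltnn => /(_ _)/notF; apply.
  apply/asboolP; exists (P :: r); split=> [|R|]; rewrite /= ?ur ?sr ?andbT //.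
  by rewrite inE => /orP[/eqP->|/rt//]; move: Pt; case: (ltP 0 (ord P t)); lia.
by exists s => P; rewrite sE gez0_abs // le_max lexx.
Qed.

(** The Riemann-Roch space L(E). *)
Definition Lsp (E : place X -> int) : set V := [set z | forall P, vge P (- E P) z].

Lemma Lsp_subspace E : @subspace kb V (Lsp E).
Proof.
split=> [P|a u v hu hv P]; first exact: vge0.
by apply: vgeD => //; apply: vgeMl => //; apply: vge_cst.
Qed.

Lemma unifz_neq0 P (n : int) : unif P ^ n != 0.
Proof. exact/expfz_neq0/unif_neq0. Qed.

Lemma ord_unifz P (n : int) : ord P (unif P ^ n) = n.
Proof.
case: n => n; first by rewrite -exprnP ordX ?unif_neq0 // ord_unifE -mulr_natl mulr1 natz.
rewrite NegzE -exprnN ord_inv ordX ?unif_neq0 // ord_unifE -mulr_natl mulr1 natz //.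
Qed.

Lemma Lsp_step E Q : spans (Lsp E) (Lsp (fun P => (Q == P)%:R + E P)) 1.
Proof.
pose u := unif Q ^ (E Q + 1).
have hu z : Lsp (fun P => (Q == P)%:R + E P) z -> vge Q 0 (z * u).
  move=> /(_ Q); rewrite eqxx => hz; rewrite -(addNr (E Q + 1)).
  by apply: vgeM; [rewrite addrC|rewrite vgeE ?unifz_neq0 // ord_unifz].
apply: (@spans_functional kb V _ _ (fun z : K => rv Q (z * u))).
- exact: Lsp_subspace.
- exact: Lsp_subspace.
- move=> a z w hz hw; rewrite rmod_scaleE mulrDl -mulrA rvD ?hu //.
    by rewrite rvM ?hu ?vge_cst // rv_cst.
  by apply: vgeMl; [exact: vge_cst|exact: hu].
move=> z hz /(rv_eq0 (hu z hz)) zu P; have := hz P; case: (eqVneq Q P) => [<- _|_]; last first.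
  by rewrite add0r.
have -> : z = z * u * unif Q ^ (- (E Q + 1)).
  by rewrite /u -mulrA -expfzDr ?unif_neq0 // subrr expr0z mulr1.
have -> : - E Q = 1 + - (E Q + 1) by ring.
by apply: vgeM => //; rewrite vgeE ?unifz_neq0 // ord_unifz.
Qed.

Lemma Lsp_seq E s : spans (Lsp E) (Lsp (fun P => cnt s P + E P)) (size s).
Proof.
elim: s => [|Q s IHs].
  apply: spans_sub (spans_refl (V := V) _) => [z hz P|]; last by case: (Lsp_subspace E).
  by have := hz P; rewrite add0r.
rewrite /= -addn1; apply: spans_trans IHs _.
apply: spans_sub (Lsp_step _ Q) => z hz P; have := hz P.
by rewrite cnt_cons addrA.
Qed.

Lemma Lsp_cnt s : @spans kb V [set 0] (Lsp (cnt s)) (size s).+1.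
Proof.
rewrite -add1n; apply: (@spans_trans kb V _ (Lsp (fun=> 0))); last first.
  by apply: spans_sub (Lsp_seq (fun=> 0) s) => z hz P; have := hz P; rewrite addr0.
exists (fun=> 1) => z hz; have [P|c ->] := @no_pole_const z; first by have := hz P; rewrite oppr0.
by exists (fun=> c); rewrite big_ord1 rmod_scaleE mulr1 /= subrr.
Qed.

(* Multiplying by a suitable polynomial in f makes u integral over kb[f]. *)
Lemma clear_poles f u : (forall c, f <> gcst X c) ->
  exists q, pv q f != 0 /\ forall P, vge P 0 f -> vge P 0 (pv q f * u).
Proof.
move=> fc; have [N hN] := gff_rank f.
have pvn0 q : q != 0 -> pv q f != 0.
  by move=> q0; apply/eqP => /(alg_const q0)[c /fc].
have [q [[j0 qj0] hq]] := hN (fun j => u ^+ j).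
case: (@arg_maxnP _ j0 (fun j => q j != 0) (fun j => val j) qj0) => M qM Mmax.
exists (q M); split=> [|P Pf]; first exact: pvn0.
have [->|u0] := eqVneq u 0; first by rewrite mulr0 vge0.
set a := pv (q M) f; have a0 : a != 0 by apply: pvn0.
set w := a * u; have w0 : w != 0 by rewrite mulf_neq0.
rewrite vgeE // leNgt; apply/negP => lt.
have qf j : vge P 0 (pv (q j) f) by apply: vge_pv.
case ME: (val M) => [|m].
  move: hq; rewrite (bigD1 M) //= -/a ME expr0 mulr1 big1 ?addr0 => [|j jM].
    by move/eqP; rewrite (negPf a0).
  have -> : q j = 0; last by rewrite pv0 mul0r.
  apply/eqP/negPn/negP => /Mmax; rewrite /= ME leqn0 => /eqP j00; case/eqP: jM.
  by apply: val_inj; rewrite /= j00 ME.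
(* Multiplied by a ^ m, the equation of u becomes monic of degree m + 1 in w = a u, with
   coefficients regular at P; this excludes a pole of w. *)
have wM : vge P (ord P w * m%:Z) (w ^+ m.+1).
  have -> : w ^+ m.+1 = - \sum_(j < N | j != M) pv (q j) f * a ^+ m * u ^+ j.
    have : a ^+ m * \sum_(j < N) pv (q j) f * u ^+ j = 0 by rewrite hq mulr0.
    rewrite (bigD1 M) //= mulrDr => /eqP; rewrite addr_eq0 => /eqP h.
    have -> : w ^+ m.+1 = a ^+ m * (pv (q M) f * u ^+ M).
      have -> : u ^+ M = u ^+ m.+1 by rewrite -ME.
      by rewrite /w exprMn -/a exprSr -mulrA.
    by rewrite h mulr_sumr; congr (- _); apply: eq_bigr => j _; ring.
  rewrite vgeN; apply: vge_sum => j jM; have [->|qj] := eqVneq (q j) 0.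
    by rewrite pv0 !mul0r vge0.
  have jM' : (j <= m)%N.
    rewrite -ltnS -ME ltn_neqAle; move: (Mmax j qj) => /= ->; rewrite andbT.
    by apply: contra jM => /eqP jM; apply/eqP/val_inj.
  have -> : pv (q j) f * a ^+ m * u ^+ j = (pv (q j) f * a ^+ (m - j)) * w ^+ j.
    by rewrite /w exprMn -{1}(subnK jM') exprD; ring.
  apply: vgeMl; first by apply: vgeMl => //; apply: vgeX0; apply: qf.
  rewrite vgeE ?expf_neq0 // ordX // -mulr_natl natz; nia.
by move: wM; rewrite vgeE ?expf_neq0 // ordX // -mulr_natl natz; nia.
Qed.

Lemma pv_rev (q : {poly kb}) n f : f != 0 -> (size q <= n.+1)%N ->
  pv q f = f ^+ n * pv (\poly_(j < n.+1) q`_(n - j)) f^-1.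
Proof.
move=> f0 sq; rewrite (pv_coef _ sq) pv_poly mulr_sumr (reindex_inj rev_ord_inj) /=.
apply: eq_bigr => j _; rewrite subSS.
have -> : f ^+ n = f ^+ (n - j) * f ^+ j by rewrite -exprD subnK // -ltnS.
by rewrite exprVn; field; rewrite expf_neq0.
Qed.

(** There are as many u_l, integral over kb[f] and independent over kb(f), as poles of f. The
    products f ^ j u_l with j <= m have poles bounded by (m + c) times the polar divisor s of f,
    where c does not depend on m. *)
Lemma Lsp_lower f s : (forall c, f <> gcst X c) ->
  (forall P, cnt s P = Num.max 0 (ord P f^-1)) ->
  exists c : nat, forall m, exists (T : finType) (v : T -> V),
    [/\ #|T| = (size s * m.+1)%N, forall j, Lsp (cnt (reps (m + c) s)) (v j) &
        @indep kb V [set 0] T v].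
Proof.
move=> fc hs; have f0 := nonconst_neq0 fc; have t0 : f^-1 != 0 by rewrite invr_eq0.
have ust : forall P, P \in undup s -> 0 < ord P f^-1.
  by move=> P; rewrite mem_undup => /cnt_gt0; rewrite hs; case: (ltP 0 (ord P f^-1)).
have [T [z [cT hz]]] := zeros_indep (undup_uniq s) t0 ust.
have {}cT : #|T| = size s.
  rewrite cT -[RHS]sum1_size -[RHS]big_undup_iterop_count /=.
  rewrite big_seq [RHS]big_seq; apply: eq_bigr => P /ust Pt.
  have := hs P; rewrite Monoid.iteropE iter_addn_0 mul1n /cnt; case: ltP Pt => // _ _.
  by move=> <-.
have /choice[g hg] := fun l => clear_poles (z l) fc.
pose u l := pv (g l) f * z l.
pose c := (\sum_(P <- s) \sum_l `|ord P (u l)|)%N.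
exists c => m; exists (T * 'I_m.+1)%type, (fun lj : T * 'I_m.+1 => f ^+ lj.2 * u lj.1); split.
- by rewrite card_prod card_ord cT.
- move=> [l j] P /=; rewrite cnt_reps.
  have [Ps|Ps] := boolP (P \in s); last first.
    rewrite (cnt_notin Ps) mulr0 oppr0.
    have Pf : vge P 0 f.
      by have := hs P; rewrite (cnt_notin Ps) ord_inv vgeE //; case: (ltP 0 (- ord P f)); lia.
    by apply: vgeMl; [apply: vgeX0|case: (hg l) => _; apply].
  have Pc := cnt_gt0 Ps; have := ust P; rewrite mem_undup => /(_ Ps) Pf.
  have cE : cnt s P = - ord P f by rewrite hs ord_inv in Pf *; case: ltP Pf.
  have -> : - ((m + c)%N%:Z * cnt s P) = - (m%:Z * cnt s P) + - (c%:Z * cnt s P) by lia.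
  apply: vgeM.
    rewrite vgeE ?expf_neq0 // ordX // -mulr_natl natz cE; have := ltn_ord j.
    by rewrite ord_inv in Pf; nia.
  rewrite /vge; case: eqVneq => //= _.
  have : (`|ord P (u l)| <= c)%N.
    by rewrite /c (big_rem P) //= (bigD1 l) //=; lia.
  by move: (ord P (u l)) => a; nia.
move=> a /= ha.
pose A l : {poly kb} := \poly_(j < m.+1) a (l, inord j).
have hA : \sum_l pv (A l * g l) f * z l = 0.
  rewrite -[RHS]ha; transitivity (\sum_l \sum_(j < m.+1) gcst X (a (l, j)) * (f ^+ j * u l)).
    apply: eq_bigr => l _; rewrite pvM pv_poly -mulrA mulr_suml.
    by apply: eq_bigr => j _; rewrite inord_val /u; ring.
  by rewrite pair_bigA; apply: eq_bigr => -[].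
suff B0 n (B : T -> {poly kb}) : (forall l, size (B l) <= n)%N ->
    \sum_l pv (B l) f * z l = 0 -> forall l, B l = 0.
  move=> [l j]; have [gl _] := hg l.
  have /eqP := B0 _ (fun l => A l * g l) (fun l => leq_bigmax l) hA l.
  rewrite mulf_eq0 => /orP[/eqP Al|/eqP g0]; last by rewrite g0 pv0 eqxx in gl.
  have := congr1 (fun q : {poly kb} => q`_j) Al.
  by rewrite coef0 coef_poly ltn_ord inord_val.
(* Read in 1/f by [pv_rev], the relation has the coefficients of degree n of the B_l as constant
   coefficients; these vanish by [zeros_indep], which lowers the degrees. *)
elim: n B => [|n IHn] B sB hB l; first by apply/eqP; rewrite -size_poly_leq0.
apply: IHn l => // l.
have := hz (fun l => \poly_(j < n.+1) (B l)`_(n - j)) _ l; rewrite coef_poly /= subn0 => Bn.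
apply/leq_sizeP => j; rewrite leq_eqVlt => /orP[/eqP<-|]; last first.
  by move=> lt; apply: nth_default; apply: leq_trans (sB l) lt.
apply: Bn; apply: (mulfI (expf_neq0 n f0)); rewrite mulr0 -[RHS]hB mulr_sumr.
by apply: eq_bigr => l' _; rewrite [in RHS](pv_rev f0 (sB l')) mulrA.
Qed.

End Divisors.

(** * Sums with finite support *)

Section FiniteSums.
Variables (T : choiceType) (R : zmodType).
Implicit Types (F G : T -> R) (A : set T).

Definition finsupp F := finite_set [set x | F x != 0].

Lemma finite_set_seq A : finite_set A -> exists2 r : seq T, uniq r & forall x, A x <-> x \in r.
Proof.
move=> /finite_seqP[r ->]; exists (undup r); first exact: undup_uniq.
by move=> x; rewrite mem_undup.
Qed.

Lemma finsupp_seq F : finsupp F ->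
  exists2 r : seq T, uniq r & forall x, F x != 0 -> x \in r.
Proof. by move=> /finite_set_seq[r ur rF]; exists r => // x /rF. Qed.

Lemma seq_finsupp F (r : seq T) : (forall x, F x != 0 -> x \in r) -> finsupp F.
Proof. by move=> h; apply: (@sub_finite_set _ _ [set` r]) => [x /h|]. Qed.

Lemma finsupp2 F G : finsupp F -> finsupp G ->
  exists2 r : seq T, uniq r & forall x, F x != 0 \/ G x != 0 -> x \in r.
Proof.
move=> /finsupp_seq[r ur rF] /finsupp_seq[s us sG].
exists (undup (r ++ s)); first exact: undup_uniq.
by move=> x [/rF|/sG] h; rewrite mem_undup mem_cat h ?orbT.
Qed.

Lemma fsumE F (r : seq T) : uniq r -> (forall x, F x != 0 -> x \in r) ->
  \sum_(x \in [set: T]) F x = \sum_(x <- r) F x.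
Proof.
move=> ur rF; rewrite (fsbig_seq _ F ur).
rewrite (@fsbig_widen _ _ _ _ [set` r] setT) // => x [_] /= nx.
by apply/eqP; apply: contra_notT nx => /rF.
Qed.

Lemma fsumD F G : finsupp F -> finsupp G ->
  \sum_(x \in [set: T]) (F x + G x) =
  \sum_(x \in [set: T]) F x + \sum_(x \in [set: T]) G x.
Proof.
move=> fF fG; have [r ur h] := finsupp2 fF fG.
rewrite (fsumE ur (F := F)); last by move=> x Fx; apply: h; left.
rewrite (fsumE ur (F := G)); last by move=> x Fx; apply: h; right.
rewrite (fsumE ur (F := fun x => F x + G x)) ?big_split // => x.
have [Fx|Fx _] := eqVneq (F x) 0; last by apply: h; left.
by rewrite Fx add0r => Gx; apply: h; right.
Qed.

Lemma finsuppD F G : finsupp F -> finsupp G -> finsupp (fun x => F x + G x).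
Proof.
move=> fF fG; have [r ur h] := finsupp2 fF fG; apply: (seq_finsupp (r := r)) => x.
have [Fx|Fx _] := eqVneq (F x) 0; last by apply: h; left.
by rewrite Fx add0r => Gx; apply: h; right.
Qed.

Lemma finsuppN F : finsupp F -> finsupp (fun x => - F x).
Proof.
move=> /finsupp_seq[r ur h]; apply: (seq_finsupp (r := r)) => x.
by rewrite oppr_eq0; apply: h.
Qed.

Lemma finsuppB F G : finsupp F -> finsupp G -> finsupp (fun x => F x - G x).
Proof. by move=> fF /finsuppN; apply: finsuppD. Qed.

Lemma fsumN F : finsupp F ->
  \sum_(x \in [set: T]) - F x = - \sum_(x \in [set: T]) F x.
Proof.
move=> /finsupp_seq[r ur h]; rewrite (fsumE ur h).
by rewrite (fsumE ur (F := fun x => - F x)) ?sumrN // => x; rewrite oppr_eq0; apply: h.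
Qed.

Lemma fsumB F G : finsupp F -> finsupp G ->
  \sum_(x \in [set: T]) (F x - G x) =
  \sum_(x \in [set: T]) F x - \sum_(x \in [set: T]) G x.
Proof. by move=> fF fG; rewrite fsumD ?fsumN //; apply: finsuppN. Qed.

Lemma fsum0 F : (forall x, F x = 0) -> \sum_(x \in [set: T]) F x = 0.
Proof. by move=> h; apply: fsbig1 => x _. Qed.

Lemma fsum_eq F G : (forall x, F x = G x) ->
  \sum_(x \in [set: T]) F x = \sum_(x \in [set: T]) G x.
Proof. by move=> h; have -> : F = G by apply/funext. Qed.

Lemma finsupp_comp (R' : zmodType) F (G : T -> R') : finsupp F ->
  (forall x, F x = 0 -> G x = 0) -> @finite_set T [set x | G x != 0].
Proof.
move=> fF h; apply: sub_finite_set fF => x /=; apply: contra_neq; exact: h.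
Qed.

Lemma fsum_additive (R' : zmodType) (f : R -> R') F : finsupp F ->
  f 0 = 0 -> {morph f : a b / a + b} ->
  \sum_(x \in [set: T]) f (F x) = f (\sum_(x \in [set: T]) F x).
Proof.
move=> /finsupp_seq[r ur h] f0 fD; rewrite (fsumE ur h).
rewrite (_ : \sum_(x \in [set: T]) f (F x) = \sum_(x <- r) f (F x)).
  by elim: r {ur h} => [|x r IHr]; rewrite ?big_nil // !big_cons fD IHr.
have -> : \sum_(x \in [set: T]) f (F x) = \sum_(x \in [set` r]) f (F x).
  rewrite (@fsbig_widen _ _ _ _ [set` r] setT) // => x [_] /= nx.
  have -> : F x = 0; last by [].
  by apply/eqP; apply: contra_notT nx => /h.
by rewrite (@fsbig_seq _ _ _ _ r _ ur).
Qed.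

End FiniteSums.

(** * Degree of principal divisors and Riemann's inequality *)

Section Degree.
Variables (k : fieldType) (kb : closedFieldType) (i : {rmorphism k -> kb}).
Variable X : curve i.
Local Notation K := (gff X).
Local Notation V := (rmod (gcst X)).
Implicit Types (P Q : place X) (z u v t f : K) (s r : seq (place X)).

(** Multiplication by f ^ -(m + c) embeds L((m + c) s), of dimension at least (m + 1) deg s, in L((m
    + c) r), of dimension at most (m + c) deg r + 1. *)
Lemma poles_le_zeros f s r : (forall c, f <> gcst X c) ->
  (forall P, cnt s P = Num.max 0 (ord P f^-1)) ->
  (forall P, cnt r P = Num.max 0 (ord P f)) -> (size s <= size r)%N.
Proof.
move=> fc hs hr; have f0 := nonconst_neq0 fc; have t0 : f^-1 != 0 by rewrite invr_eq0.
have [c hc] := Lsp_lower fc hs; rewrite leqNgt; apply/negP => lt.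
(* For deg s > deg r the two bounds would force m <= c deg r. *)
pose m := (c * size r).+1%N; have [T [v [cT vL vi]]] := hc m.
have tm : f^-1 ^+ (m + c) != 0 by rewrite expf_neq0.
have := @spans_indep kb V _ _ _ T (fun j => f^-1 ^+ (m + c) * v j)
  (subspace0 _) (Lsp_cnt (reps (m + c) r)).
rewrite size_reps cT => /(_ _ _) h; suff : (size s * m.+1 <= ((m + c) * size r).+1)%N.
  by rewrite /m; nia.
apply: h => [j P|a ha].
  have := vL j P; rewrite !cnt_reps => vP.
  have -> : - ((m + c)%N%:Z * cnt r P) =
      (m + c)%N%:Z * ord P f^-1 + - ((m + c)%N%:Z * cnt s P).
    by rewrite hs hr ord_inv; case: (ltP 0 (ord P f)); case: (ltP 0 (- ord P f)); lia.
  by apply: vgeM => //; rewrite vgeE // ordX // -mulr_natl natz.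
apply: vi; apply: (mulfI tm); rewrite mulr0 -[RHS]ha mulr_sumr.
by apply: eq_bigr => j _; rewrite !rmod_scaleE mulrCA.
Qed.

Lemma div_seqs f : f != 0 -> exists s r, size s = size r /\
  forall P, ord P f = cnt s P - cnt r P.
Proof.
move=> f0; have t0 : f^-1 != 0 by rewrite invr_eq0.
have [[c fc]|fc] := pselect (exists c, f = gcst X c).
  by exists [::], [::]; split=> // P; rewrite fc ord_cst.
have {}fc c : f <> gcst X c by move=> h; apply: fc; exists c.
have [s hs] := zeros_seq f0; have [r hr] := zeros_seq t0.
exists s, r; split; last first.
  by move=> P; rewrite hs hr ord_inv; case: (ltP 0 (ord P f)); case: (ltP 0 (- ord P f)); lia.
apply/eqP; rewrite eqn_leq; apply/andP; split; last exact: poles_le_zeros hr hs.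
apply: (poles_le_zeros (nonconst_inv fc)); first by move=> P; rewrite invrK hs.
exact: hr.
Qed.

Lemma finsupp_cnt s : finsupp (cnt s).
Proof. by apply: (seq_finsupp (r := s)) => P; apply: contraNT => /cnt_notin->. Qed.

Lemma deg_cnt s : \sum_(P \in [set: place X]) cnt s P = (size s)%:Z.
Proof.
rewrite (fsumE (r := undup s)) ?undup_uniq //; last first.
  by move=> P; rewrite mem_undup; apply: contraNT => /cnt_notin->.
rewrite -[in RHS]sum1_size -[in RHS]big_undup_iterop_count /= raddf_sum /=.
by apply: eq_bigr => P _; rewrite Monoid.iteropE iter_addn_0 mul1n.
Qed.

Lemma finsupp_ord f : finsupp (fun P : place X => ord P f).
Proof.
have [->|f0] := eqVneq f 0.
  by apply: (seq_finsupp (r := [::])) => P; rewrite ord_zero eqxx.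
have [s [r [_ h]]] := div_seqs f0.
rewrite (_ : (fun P => ord P f) = fun P => cnt s P - cnt r P); last exact/funext.
exact/finsuppB/finsupp_cnt/finsupp_cnt.
Qed.

Lemma deg_ord f : \sum_(P \in [set: place X]) ord P f = 0.
Proof.
have [->|f0] := eqVneq f 0; first by apply: fsum0 => P; rewrite ord_zero.
have [s [r [sr h]]] := div_seqs f0.
rewrite (fsum_eq h) fsumB ?deg_cnt ?sr ?subrr //; exact: finsupp_cnt.
Qed.

Lemma seq_of_div (D : place X -> int) : finsupp D -> (forall P, 0 <= D P) ->
  exists s, (forall P, cnt s P = D P) /\ (size s)%:Z = \sum_(P \in [set: place X]) D P.
Proof.
move=> fD D0; have [r ur rD] := finsupp_seq fD.
have [|s [sE ss]] := seq_of_fun (n := fun P => `|D P|%N) ur.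
  by move=> P; rewrite absz_eq0; apply: rD.
have {}sE P : cnt s P = D P by rewrite sE gez0_abs.
by exists s; split=> //; rewrite -(fsum_eq sE) deg_cnt.
Qed.

Lemma vge_pv_pole P (q : {poly kb}) n f : (size q <= n.+1)%N -> ord P f <= 0 ->
  vge P (n%:Z * ord P f) (pv q f).
Proof.
have [->|f0] := eqVneq f 0.
  by rewrite ord_zero mulr0 => _ _; apply: vge_pv; rewrite vge0.
move=> sq Pf; rewrite (pv_coef _ sq); apply: vge_sum => j _.
apply: vgeMl; first exact: vge_cst.
by rewrite vgeE ?expf_neq0 // ordX // -mulr_natl natz; have := ltn_ord j; nia.
Qed.

(** Riemann's inequality, for divisors r above any given s. Here r is (m + c) p + div q(f), linearly
    equivalent to a multiple of the polar divisor p of f, where [Lsp_lower] applies; the polynomial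
    q vanishes at the values of f on s. *)
Lemma riemann f : (forall c, f <> gcst X c) ->
  exists c : nat, forall s, exists r, (forall P, cnt s P <= cnt r P) /\
    exists (T : finType) (v : T -> V), [/\ (size r <= #|T| + c)%N,
      forall j, Lsp (cnt r) (v j) & @indep kb V [set 0] T v].
Proof.
move=> fc; have f0 := nonconst_neq0 fc; have t0 : f^-1 != 0 by rewrite invr_eq0.
have [p hp] := zeros_seq t0; have [c hc] := Lsp_lower fc hp.
exists (c * size p)%N => s.
pose fl Q := gcst X (rv Q f).
pose q : {poly kb} := \prod_(Q <- s | 0 <= ord Q f) ('X - (rv Q f)%:P).
have q0 : q != 0 by rewrite monic_neq0 // monic_prod_XsubC.
have qf0 : pv q f != 0 by apply/eqP => /(alg_const q0)[a /fc].
have sq : (size q <= (size s).+1)%N.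
  by rewrite /q -big_filter size_prod_XsubC ltnS size_filter count_size.
(* At a pole of f, q(f) has a pole of order at most size s times that of f. One summand compensates
   it, the other dominates the multiplicity in s. *)
pose m := (size s + size s)%N; have [T [v [cT vL vi]]] := hc m.
pose D P := cnt (reps (m + c) p) P + ord P (pv q f).
have sD P : cnt s P <= D P.
  rewrite /D cnt_reps hp ord_inv.
  have [Pf|Pf] := ltP 0 (- ord P f).
    have := @vge_pv_pole P q (size s) f sq; rewrite vgeE // => /(_ _) h.
    have {}h : (size s)%:Z * ord P f <= ord P (pv q f) by apply: h; lia.
    by have := cnt_le_size s P; rewrite /m; nia.
  suff : vge P (cnt s P) (pv q f) by rewrite vgeE //; lia.
  have Pf' : vge P 0 f by rewrite vge_reg; lia.
  rewrite /q pv_prod; elim: s {m D T v cT vL vi q q0 qf0 sq} => [|Q s IHs].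
    by rewrite big_nil vge_1.
  rewrite big_cons cnt_cons; have [QP|QP] := eqVneq Q P.
    rewrite QP -vge_reg Pf'; apply: vgeM => //.
    by rewrite pvD pvX pvN pvC; apply: rvP.
  rewrite add0r; case: ifP => _ //; apply: vgeMl => //.
  by rewrite pvD pvX pvN pvC; apply: vgeB => //; apply: vge_cst.
have [||r [rD sr]] := @seq_of_div D.
- by apply: finsuppD; [apply: finsupp_cnt|apply: finsupp_ord].
- by move=> P; apply: le_trans (sD P).
exists r; split; first by move=> P; rewrite rD.
exists T, (fun j => (pv q f)^-1 * v j); split.
- have := sr; rewrite fsumD ?deg_ord ?deg_cnt ?size_reps; last 2 first.
  + exact: finsupp_cnt.
  + exact: finsupp_ord.
  by move=> h; rewrite cT; nia.
- move=> j P; rewrite rD /D opprD addrC; apply: vgeM; last exact: vL.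
  exact: vgeV.
move=> a ha; apply: vi; apply: (mulfI (x := (pv q f)^-1)); first by rewrite invr_eq0.
rewrite mulr0 -[RHS]ha mulr_sumr.
by apply: eq_bigr => j _; rewrite !rmod_scaleE mulrCA.
Qed.

Lemma poles_seq (l : seq K) : exists r, forall z P, z \in l -> vge P (- cnt r P) z.
Proof.
elim: l => [|z l [r hr]]; first by exists [::].
have [->|z0] := eqVneq z 0.
  by exists r => w P; rewrite inE => /orP[/eqP->|/hr//]; apply: vge0.
have [s hs] : exists s, forall P, cnt s P = Num.max 0 (ord P z^-1).
  by apply: zeros_seq; rewrite invr_eq0.
exists (s ++ r) => w P; rewrite inE cnt_cat => /orP[/eqP->|/hr h].
  rewrite vgeE // hs ord_inv; have := cnt_ge0 r P; case: (ltP 0 (- ord P z)); lia.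
by apply: vge_leq (h P); have := cnt_ge0 s P; lia.
Qed.

End Degree.

(** * The Cartier operator *)

Section Frobenius.
Variables (p : nat) (K : fieldType).
Hypothesis hp : p \in [pchar K].
Implicit Types x y : K.

Lemma pchar_pr : prime p. Proof. exact: pcharf_prime hp. Qed.
Lemma p_gt0 : (0 < p)%N. Proof. exact/prime_gt0/pchar_pr. Qed.
Lemma p_gt1 : (1 < p)%N. Proof. exact/prime_gt1/pchar_pr. Qed.

Lemma frD x y : (x + y) ^+ p = x ^+ p + y ^+ p.
Proof. by rewrite -!(pFrobenius_autE hp) rmorphD. Qed.
Lemma frN x : (- x) ^+ p = - x ^+ p.
Proof. by rewrite -!(pFrobenius_autE hp) rmorphN. Qed.
Lemma frB x y : (x - y) ^+ p = x ^+ p - y ^+ p.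
Proof. by rewrite frD frN. Qed.
Lemma fr0 : 0 ^+ p = 0 :> K.
Proof. by rewrite -(pFrobenius_autE hp) rmorph0. Qed.
Lemma fr_nat n : n%:R ^+ p = n%:R :> K.
Proof. by rewrite -(pFrobenius_autE hp) rmorph_nat. Qed.
Lemma fr_sum (I : Type) (r : seq I) (P : pred I) (f : I -> K) :
  (\sum_(j <- r | P j) f j) ^+ p = \sum_(j <- r | P j) f j ^+ p.
Proof. by rewrite -(pFrobenius_autE hp) rmorph_sum. Qed.
Lemma fr_inj x y : x ^+ p = y ^+ p -> x = y.
Proof. by rewrite -!(pFrobenius_autE hp); apply: fmorph_inj. Qed.
Lemma fr_eq0 x : (x ^+ p == 0) = (x == 0).
Proof. by rewrite expf_eq0 p_gt0. Qed.

Lemma natr_mod n : (n %% p)%:R = n%:R :> K.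
Proof.
rewrite [in RHS](divn_eq n p) natrD natrM.
by rewrite (pcharf0 hp) mulr0 add0r.
Qed.

Lemma natr_sub_neq0 (j m : nat) : (j < p)%N -> (m < p)%N -> j != m ->
  j%:R - m%:R != 0 :> K.
Proof.
wlog jm : j m / (j < m)%N => [h jp mp|jp mp _].
  rewrite neq_ltn => /orP[lt|lt]; first by apply: h; rewrite // neq_ltn lt.
  by rewrite -opprB oppr_eq0; apply: h; rewrite // neq_ltn lt.
rewrite -opprB oppr_eq0 -natrB ?(ltnW jm) // -(dvdn_pcharf hp).
by rewrite gtnNdvd ?subn_gt0 // (leq_ltn_trans (leq_subr _ _) mp).
Qed.

Lemma natr_neq0 (j : nat) : (0 < j < p)%N -> j%:R != 0 :> K.
Proof.
move=> /andP[j0 jp]; have := @natr_sub_neq0 j 0 jp p_gt0.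
by rewrite mulr0n subr0; apply; rewrite -lt0n.
Qed.

Lemma fermat_natr x : x ^+ p = x -> x != 0 -> x ^+ p.-1 = 1.
Proof.
move=> xp x0; apply: (mulfI x0); rewrite -exprS prednK ?p_gt0 // mulr1 xp //.
Qed.

Lemma fr_fixed x : x ^+ p = x -> exists2 n, (n < p)%N & x = n%:R.
Proof.
move=> xp; apply: contrapT => nx.
pose q : {poly K} := 'X^p - 'X.
have sq : size q = p.+1.
  by rewrite size_polyDl size_polyXn // size_polyN size_polyX ltnS p_gt1.
pose rs := x :: [seq n%:R | n <- iota 0 p].
have := @max_poly_roots _ q rs; rewrite sq /= size_map size_iota ltnn => h.
suff : false by []; apply: h; first by rewrite -size_poly_eq0 sq.
  rewrite /root !hornerE xp subrr eqxx /=; apply/allP => _ /mapP[n _ ->].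
  by rewrite /root !hornerE fr_nat subrr.
rewrite /= map_inj_in_uniq ?iota_uniq ?andbT.
  apply/mapP => -[n]; rewrite mem_iota add0n => /andP[_ np] xn.
  by apply: nx; exists n.
move=> a b; rewrite !mem_iota !add0n /= => ap bp ab; apply/eqP/negPn/negP => nab.
by have := natr_sub_neq0 ap bp nab; rewrite ab subrr eqxx.
Qed.

End Frobenius.

Section PBasis.
Variables (p : nat) (K : fieldType).
Hypothesis hp : p \in [pchar K].
Implicit Types (z w c t g : K).

Definition pbasis t := (forall z, exists a : 'I_p -> K, z = \sum_j a j ^+ p * t ^+ j) /\
  (forall a : 'I_p -> K, \sum_j a j ^+ p * t ^+ j = 0 -> forall j, a j = 0).

Definition pc t z : 'I_p -> K :=
  xget (fun=> 0) [set a : 'I_p -> K | z = \sum_j a j ^+ p * t ^+ j].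

Definition ordp0 : 'I_p := Ordinal (p_gt0 hp).

(* theta t is the derivation with theta t = t; in coordinates A |-> A dt / t,
   phi t is the Cartier operator. *)
Definition theta t z : K := \sum_(j < p) j%:R * (pc t z j ^+ p * t ^+ j).
Definition phi t z : K := pc t z ordp0.

Section Fixed.
Variable t : K.
Hypothesis ht : pbasis t.

Lemma pcE z : z = \sum_j pc t z j ^+ p * t ^+ j.
Proof. by have [a za] := ht.1 z; rewrite /pc; case: xgetP => [b -> //|/(_ a)]. Qed.

Lemma pc_uniq z (a : 'I_p -> K) : z = \sum_j a j ^+ p * t ^+ j -> pc t z = a.
Proof.
move=> za; apply/funext => j; apply/eqP; rewrite -subr_eq0; apply/eqP.
apply: (ht.2 (fun j => pc t z j - a j)); under eq_bigr do rewrite frB // mulrBl.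
by rewrite sumrB -pcE -za subrr.
Qed.

Lemma pcD z w : pc t (z + w) = fun j => pc t z j + pc t w j.
Proof.
apply: pc_uniq; under eq_bigr do rewrite frD // mulrDl.
by rewrite big_split -!pcE.
Qed.

Lemma pcM g z : pc t (g ^+ p * z) = fun j => g * pc t z j.
Proof.
by apply: pc_uniq; rewrite {1}(pcE z) mulr_sumr; apply: eq_bigr => j _; rewrite exprMn mulrA.
Qed.

Lemma pc_monom g n : pc t (g ^+ p * t ^+ n) =
  fun j : 'I_p => if j == (n %% p)%N :> nat then g * t ^+ (n %/ p)%N else 0.
Proof.
apply: pc_uniq; have lt : (n %% p < p)%N by rewrite ltn_mod (p_gt0 hp).
rewrite (bigD1 (Ordinal lt)) //= eqxx big1 ?addr0 => [|j /negPf jn].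
  by rewrite exprMn -exprM -mulrA -exprD -divn_eq.
by rewrite -[j == _ :> nat]/(j == Ordinal lt) jn fr0 // mul0r.
Qed.

Lemma phiD z w : phi t (z + w) = phi t z + phi t w.
Proof. by rewrite /phi pcD. Qed.

Lemma phiM g z : phi t (g ^+ p * z) = g * phi t z.
Proof. by rewrite /phi pcM. Qed.

Lemma phi0 : phi t 0 = 0.
Proof. by have := phiM 0 0; rewrite mulr0 mul0r. Qed.

Lemma phiN z : phi t (- z) = - phi t z.
Proof. by apply/eqP; rewrite -addr_eq0 -phiD addNr phi0. Qed.

Lemma phi_sum (I : Type) (r : seq I) (P : pred I) (f : I -> K) :
  phi t (\sum_(j <- r | P j) f j) = \sum_(j <- r | P j) phi t (f j).
Proof. by apply: (big_morph _ phiD phi0). Qed.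

Lemma phi_monom g n : phi t (g ^+ p * t ^+ n) = if (p %| n)%N then g * t ^+ (n %/ p)%N else 0.
Proof. by rewrite /phi pc_monom /= eq_sym. Qed.

Lemma phi_Kp g : phi t (g ^+ p) = g.
Proof. by have := phi_monom g 0; rewrite dvdn0 div0n expr0 !mulr1. Qed.

Lemma thetaD z w : theta t (z + w) = theta t z + theta t w.
Proof.
rewrite /theta pcD -big_split; apply: eq_bigr => j _ /=.
by rewrite frD // mulrDl mulrDr.
Qed.

Lemma theta_pM g z : theta t (g ^+ p * z) = g ^+ p * theta t z.
Proof.
rewrite /theta pcM mulr_sumr; apply: eq_bigr => j _ /=.
by rewrite exprMn; ring.
Qed.

Lemma theta0 : theta t 0 = 0.
Proof. by have := theta_pM 0 0; rewrite mulr0 fr0 // mul0r. Qed.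

Lemma thetaN z : theta t (- z) = - theta t z.
Proof. by apply/eqP; rewrite -addr_eq0 -thetaD addNr theta0. Qed.

Lemma theta_sum (I : Type) (r : seq I) (P : pred I) (f : I -> K) :
  theta t (\sum_(j <- r | P j) f j) = \sum_(j <- r | P j) theta t (f j).
Proof. by apply: (big_morph _ thetaD theta0). Qed.

Lemma theta_monom g n : theta t (g ^+ p * t ^+ n) = n%:R * (g ^+ p * t ^+ n).
Proof.
rewrite /theta pc_monom; have lt : (n %% p < p)%N by rewrite ltn_mod (p_gt0 hp).
rewrite (bigD1 (Ordinal lt)) //= eqxx big1 ?addr0 => [|j /negPf jn].
  by rewrite natr_mod // exprMn -exprM -mulrA -exprD -divn_eq.
by rewrite -[j == _ :> nat]/(j == Ordinal lt) jn fr0 // mul0r mulr0.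
Qed.

Lemma thetaM z w : theta t (z * w) = theta t z * w + z * theta t w.
Proof.
have mono g j w' : theta t (g ^+ p * t ^+ j * w') =
    j%:R * (g ^+ p * t ^+ j) * w' + g ^+ p * t ^+ j * theta t w'.
  rewrite (pcE w') theta_sum !mulr_sumr theta_sum -big_split; apply: eq_bigr => l _ /=.
  have -> : g ^+ p * t ^+ j * (pc t w' l ^+ p * t ^+ l) =
    (g * pc t w' l) ^+ p * t ^+ (j + l) by rewrite exprMn exprD; ring.
  by rewrite !theta_monom natrD exprMn exprD; ring.
rewrite {1 2 3}(pcE z) mulr_suml !theta_sum !mulr_suml -big_split /=.
by apply: eq_bigr => j _; rewrite mono theta_monom.
Qed.

Lemma theta_Kp g : theta t (g ^+ p) = 0.
Proof. by have := theta_monom g 0; rewrite expr0 !mulr1 mul0r. Qed.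

Lemma theta1 : theta t 1 = 0.
Proof. by rewrite -(expr1n _ p) theta_Kp. Qed.

Lemma theta_t : theta t t = t.
Proof. by have := theta_monom 1 1; rewrite expr1n !mul1r. Qed.

Lemma theta_eq0 z : theta t z = 0 -> exists g, z = g ^+ p.
Proof.
move=> h; exists (phi t z).
have h' : \sum_(j < p) (j%:R * pc t z j) ^+ p * t ^+ j = 0.
  rewrite -[RHS]h; apply: eq_bigr => j _.
  by rewrite exprMn fr_nat // mulrA.
rewrite {1}(pcE z) (bigD1 ordp0) //= expr0 mulr1 big1 ?addr0 // => j j0.
have /eqP := ht.2 _ h' j; rewrite mulf_eq0 => /orP[|/eqP->]; last by rewrite fr0 // mul0r.
rewrite (negPf (natr_neq0 hp _)) // ltn_ord andbT lt0n.
by apply: contra j0 => /eqP j0; apply/eqP/val_inj.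
Qed.

(** The form theta z dt / t is dz, and the Cartier operator kills exact forms. *)
Lemma phi_theta z : phi t (theta t z) = 0.
Proof.
rewrite /phi (pc_uniq (a := fun j => j%:R * pc t z j)) ?mul0r //.
by apply: eq_bigr => j _; rewrite exprMn fr_nat // mulrA.
Qed.

Lemma t_neq0 : t != 0.
Proof.
apply/eqP => t0; have := ht.2 (fun j : 'I_p => (val j == 1%N)%:R) _ (Ordinal (p_gt1 hp)).
move=> /= h; have /negP[] := oner_neq0 K; apply/eqP/h.
apply: big1 => j _; case: eqP => [->|_]; first by rewrite t0 expr1 mulr0.
by rewrite fr0 // mul0r.
Qed.

Lemma thetaV z : z != 0 -> theta t z^-1 = - theta t z / z ^+ 2.
Proof.
move=> z0; have := theta1; rewrite -(mulfV z0) thetaM => /eqP.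
rewrite addrC addr_eq0 => /eqP h; apply: (mulfI z0); rewrite h; field.
exact: z0.
Qed.

(** The coordinate of dz / z on dt / t. *)
Definition dlog z := theta t z / z.

Lemma dlogE z : dlog z = theta t z / z. Proof. by []. Qed.

Lemma dlogM z w : z != 0 -> w != 0 -> dlog (z * w) = dlog z + dlog w.
Proof. by move=> z0 w0; rewrite /dlog thetaM; field; rewrite z0 w0. Qed.

Lemma dlogV z : z != 0 -> dlog z^-1 = - dlog z.
Proof. by move=> z0; rewrite /dlog thetaV // invrK; field. Qed.

Lemma dlog1 : dlog 1 = 0. Proof. by rewrite /dlog theta1 mul0r. Qed.

Lemma dlogX z n : z != 0 -> dlog (z ^+ n) = n%:R * dlog z.
Proof.
move=> z0; elim: n => [|n IHn]; first by rewrite expr0 dlog1 mul0r.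
by rewrite exprS dlogM ?expf_neq0 // IHn -add1n natrD mulrDl mul1r.
Qed.

(* (theta + c)^p - theta^p is multiplication by jacU c. *)
Definition thadd c z := theta t z + c * z.
Definition jacU n c := iter n (thadd c) 1.

(** A binomial formula for (A + c) ^ n, where A does not commute with multiplication by c: [jacU]
    replaces the powers of c and collects its derivatives. *)
Lemma normal_order (A : K -> K) c n z :
  (forall u v, A (u + v) = A u + A v) ->
  (forall g u, A (g * u) = g * A u + theta t g * u) ->
  iter n (fun u => A u + c * u) z =
  \sum_(j < n.+1) 'C(n, j)%:R * (jacU j c * iter (n - j) A z).
Proof.
move=> AD AM; have A0 : A 0 = 0 by apply: (addrI (A 0)); rewrite -AD !addr0.
have Asum m (f : 'I_m -> K) : A (\sum_j f j) = \sum_j A (f j).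
  exact: (big_morph A AD A0).
have An (m : nat) u : A (m%:R * u) = m%:R * A u.
  by rewrite AM -(fr_nat hp m) theta_Kp mul0r addr0.
elim: n => [|n IHn]; first by rewrite big_ord1 bin0 mul1r subnn mul1r.
rewrite iterS IHn Asum mulr_sumr -big_split /=.
transitivity (\sum_(j < n.+1) ('C(n, j)%:R * (jacU j c * iter (n.+1 - j) A z) +
    'C(n, j)%:R * (jacU j.+1 c * iter (n.+1 - j.+1) A z))).
  apply: eq_bigr => j _; rewrite An AM subSS (subSn (ltnSE (ltn_ord j))) iterS /=.
  by rewrite /thadd; ring.
rewrite big_split /= big_ord_recl [in RHS]big_ord_recl !bin0 -addrA; congr (_ + _).
rewrite big_ord_recr /= [in RHS]big_ord_recr /= !binn addrA; congr (_ + _).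
rewrite -big_split /=; apply: eq_bigr => j _; rewrite /bump /= !add1n binS natrD.
by ring.
Qed.

Lemma thadd_additive c u v : thadd c (u + v) = thadd c u + thadd c v.
Proof. by rewrite /thadd thetaD mulrDr addrACA. Qed.

Lemma thadd_leibniz c g u : thadd c (g * u) = g * thadd c u + theta t g * u.
Proof. by rewrite /thadd thetaM; ring. Qed.

Lemma p_order (A : K -> K) c z :
  (forall u v, A (u + v) = A u + A v) ->
  (forall g u, A (g * u) = g * A u + theta t g * u) ->
  iter p (fun u => A u + c * u) z = iter p A z + jacU p c * z.
Proof.
move=> AD AM; have p0 := p_gt0 hp; rewrite normal_order // (bigD1 ord0) //=.
rewrite bin0 mul1r subn0 mul1r; congr (_ + _); rewrite (bigD1 ord_max) //=; last first.
  by rewrite -val_eqE /= -lt0n.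
rewrite binn subnn mul1r big1 ?addr0 // => j /andP[j0 jp].
have /eqP-> : 'C(p, j)%:R == 0 :> K; last by rewrite mul0r.
rewrite -(dvdn_pcharf hp) prime_dvd_bin ?(pchar_pr hp) // lt0n.
rewrite -val_eqE /= in j0; rewrite j0 /= ltn_neqAle -ltnS ltn_ord andbT.
by rewrite -val_eqE /= in jp.
Qed.

(** Apply [p_order] to the operator theta + c and the function c', on the vector 1. *)
Lemma jacU_additive c c' : jacU p (c + c') = jacU p c + jacU p c'.
Proof.
have h : iter p (fun u => thadd c u + c' * u) 1 = iter p (thadd (c + c')) 1.
  by apply: eq_iter => u; rewrite /thadd mulrDl addrA.
rewrite {1}/jacU -h p_order; [|exact: thadd_additive|exact: thadd_leibniz].
by rewrite mulr1.
Qed.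

Lemma iter_theta z : iter p (theta t) z = theta t z.
Proof.
have iter_sum n : iter n (theta t) z = \sum_(j < p) j%:R ^+ n * (pc t z j ^+ p * t ^+ j).
  elim: n => [|n IHn]; first by rewrite {1}[z]pcE; apply: eq_bigr => j _; rewrite mul1r.
  rewrite iterS IHn theta_sum; apply: eq_bigr => j _.
  have -> : j%:R ^+ n * (pc t z j ^+ p * t ^+ j) = (j%:R ^+ n * pc t z j) ^+ p * t ^+ j.
    by rewrite [in RHS]exprMn exprAC (fr_nat hp); ring.
  by rewrite theta_monom exprMn exprAC (fr_nat hp) exprS; ring.
by rewrite iter_sum; apply: eq_bigr => j _; rewrite fr_nat.
Qed.

Lemma iter_thadd c z : iter p (thadd c) z = theta t z + jacU p c * z.
Proof.
have -> : iter p (thadd c) z = iter p (fun u => theta t u + c * u) z by apply: eq_iter.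
rewrite p_order ?iter_theta //; first exact: thetaD.
by move=> g u; rewrite thetaM addrC.
Qed.

(** The operator theta + c commutes with its p-th power theta + [jacU p c]; evaluate both products
    at 1. *)
Lemma theta_jacU c : theta t (jacU p c) = theta t c.
Proof.
have : iter p.+1 (thadd c) 1 = iter p (thadd c) (thadd c 1) by rewrite iterSr.
rewrite iterS -/(jacU p c) iter_thadd /thadd theta1 mulr1 add0r [jacU p c * c]mulrC.
exact: addIr.
Qed.

End Fixed.

(** On an eigenvector c of theta, [jacU p c] is a monic polynomial of degree p in c with natural
    coefficients and no constant term. Applying theta and comparing with [theta_jacU] in the basis
    of the powers of c leaves only c ^ p and c. *)
Lemma jacU_eigen t c : pbasis t -> pbasis c -> forall j : nat, theta t c = j%:R * c ->
  jacU t p c = c ^+ p + c.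
Proof.
move=> ht hc j tc; have c0 := t_neq0 hc.
have tcX m : theta t (c ^+ m) = m%:R * j%:R * c ^+ m.
  elim: m => [|m IHm]; first by rewrite expr0 theta1 // !mul0r.
  by rewrite exprS thetaM // IHm tc -add1n natrD; ring.
have Uform n : exists e : nat -> nat, [/\ e 0%N = 0%N, e n.+1 = 1%N, forall m, (n.+1 < m)%N -> e m = 0%N &
    jacU t n.+1 c = \sum_(m < n.+2) (e m)%:R * c ^+ m].
  elim: n => [|n [e [e0 en elt eU]]].
    exists (fun m => (m == 1%N)%:R%N); split=> // [[|[|m]]//|].
    by rewrite /jacU /thadd /= theta1 // mulr1 add0r big_ord_recl big_ord1 /= mul0r add0r mul1r.
  exists (fun m => (m * j * e m + if m is m'.+1 then e m' else 0)%N); split=> //.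
  - by rewrite elt // en muln0.
  - by case=> // m lt; rewrite !elt ?muln0 //; apply: leq_trans lt.
  have -> : jacU t n.+2 c = thadd t c (jacU t n.+1 c) by [].
  rewrite /thadd eU theta_sum // mulr_sumr [in RHS]big_ord_recl /= e0 muln0 mul0r add0r.
  transitivity (\sum_(m < n.+2) (m * j * e m)%:R * c ^+ m +
      \sum_(m < n.+2) (e m)%:R * c ^+ m.+1).
    congr (_ + _); apply: eq_bigr => m _; last by rewrite exprS; ring.
    rewrite -(fr_nat hp (e m)) theta_pM // tcX fr_nat // !natrM; ring.
  under [in RHS]eq_bigr do rewrite /bump /= add1n natrD mulrDl.
  rewrite [in RHS]big_split /=; congr (_ + _).
  rewrite big_ord_recl /= e0 muln0 mul0r add0r [in RHS]big_ord_recr /= elt // muln0 mul0r addr0.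
  by apply: eq_bigr => m _; rewrite /bump /= add1n.
have [e [e0 ep _]] := Uform p.-1; rewrite prednK ?(p_gt0 hp) // in ep * => eU.
have jc : (j%:R != 0 :> K).
  apply/eqP => j0; move: tc; rewrite j0 mul0r => /(theta_eq0 ht)[g cg].
  have := theta_Kp hc g; rewrite -cg (theta_t hc) => c00.
  by rewrite c00 eqxx in c0.
have : \sum_(m < p) (m%:R * (e m)%:R) ^+ p * c ^+ m = c.
  apply: (mulfI jc); have := theta_jacU ht c; rewrite tc eU theta_sum // => <-.
  rewrite big_ord_recr /= -[X in _ = _ + X]/(theta t _).
  rewrite -(fr_nat hp (e p)) theta_pM // tcX.
  rewrite (pcharf0 hp) !mul0r mulr0 addr0 mulr_sumr.
  apply: eq_bigr => m _; rewrite exprMn !(fr_nat hp) -(fr_nat hp (e m)) theta_pM // tcX.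
  by rewrite fr_nat //; ring.
move=> /esym/(pc_uniq hc) cE.
have em m : (m < p)%N -> m%:R * (e m)%:R = (m == 1%N)%:R :> K.
  move=> mp; have /= := congr1 (fun f => f (Ordinal mp)) cE => <-.
  have := pc_monom hc 1 1; rewrite expr1n mul1r expr1 => -> /=.
  rewrite modn_small ?(p_gt1 hp) // divn_small ?(p_gt1 hp) //.
  by case: eqP => // _; rewrite mul1r.
rewrite eU big_ord_recr /= ep mul1r addrC; congr (_ + _).
rewrite (bigD1 (Ordinal (p_gt1 hp))) //= big1 ?addr0 => [|m m1].
  have := em 1%N (p_gt1 hp); rewrite mul1r => ->.
  by rewrite mul1r.
have [->|m0] := eqVneq (val m) 0%N; first by rewrite e0 mul0r.
have /eqP := em m (ltn_ord m).
have -> : (val m == 1%N) = false by apply: contraNF m1 => /eqP m1; apply/eqP/val_inj.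
rewrite mulf_eq0 (negPf (natr_neq0 hp _)) ?ltn_ord ?lt0n ?m0 //= => /eqP->.
by rewrite mul0r.
Qed.

(* The powers of t are eigenvectors with distinct eigenvalues of a derivation. *)
Lemma pbasis_of_deriv t (D : K -> K) : (forall u v, D (u + v) = D u + D v) ->
  (forall u v, D (u * v) = D u * v + u * D v) -> D t = t -> t != 0 ->
  forall a : 'I_p -> K, \sum_j a j ^+ p * t ^+ j = 0 -> forall j, a j = 0.
Proof.
move=> DD DM Dt t0 a a0 m.
have D0 : D 0 = 0 by apply: (addrI (D 0)); rewrite -DD !addr0.
have Dsum n (f : 'I_n -> K) : D (\sum_j f j) = \sum_j D (f j).
  exact: (big_morph D DD D0).
have DX u n : D (u ^+ n) = n%:R * u ^+ n.-1 * D u.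
  have D1 : D 1 = 0.
    by apply: (addrI (D 1)); rewrite addr0 -{3}(mulr1 1) DM mulr1 mul1r.
  elim: n => [|n IHn]; first by rewrite expr0 D1 !mul0r.
  rewrite exprS DM IHn -add1n natrD; case: n {IHn} => [|n]; first by rewrite expr0; ring.
  by rewrite /= exprS; ring.
have DF u : D (u ^+ p) = 0 by rewrite DX (pcharf0 hp) !mul0r.
have DtX n : D (t ^+ n) = n%:R * t ^+ n.
  by rewrite DX Dt; case: n => [|n]; rewrite ?mul0r // -mulrA -exprSr.
have DE g j : D (g ^+ p * t ^+ j) = j%:R * (g ^+ p * t ^+ j).
  by rewrite DM DF mul0r add0r DtX mulrCA.
have Dn (n : nat) u : D (n%:R * u) = n%:R * D u.
  by rewrite DM -(fr_nat hp n) DF mul0r add0r.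
have En n : \sum_(j < p) (j%:R - m%:R) ^+ n * (a j ^+ p * t ^+ j) = 0.
  elim: n => [|n IHn]; first by rewrite -[RHS]a0; apply: eq_bigr => j _; rewrite mul1r.
  have : D (\sum_(j < p) (j%:R - m%:R) ^+ n * (a j ^+ p * t ^+ j)) -
      m%:R * \sum_(j < p) (j%:R - m%:R) ^+ n * (a j ^+ p * t ^+ j) = 0.
    by rewrite IHn D0 mulr0 subr0.
  rewrite Dsum mulr_sumr -sumrB => h; rewrite -[RHS]h; apply: eq_bigr => j _.
  have -> : (j%:R - m%:R) ^+ n * (a j ^+ p * t ^+ j) =
      ((j%:R - m%:R) ^+ n * a j) ^+ p * t ^+ j.
    by rewrite [in RHS]exprMn exprAC (frB hp) !(fr_nat hp); ring.
  by rewrite DE exprMn exprAC (frB hp) !(fr_nat hp) exprS; ring.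
(* By Fermat, 1 - (j - m) ^ (p - 1) is 1 for j = m and 0 for the other j < p. *)
have : \sum_(j < p) (1 - (j%:R - m%:R) ^+ p.-1) * (a j ^+ p * t ^+ j) = 0.
  under eq_bigr do rewrite mulrBl mul1r.
  by rewrite sumrB a0 En subrr.
rewrite (bigD1 m) //= subrr expr0n -[p.-1 == 0%N]/(p.-1 == 0%N).
have -> : (p.-1 == 0%N) = false by have := p_gt1 hp; case: (p) => [|[|]].
rewrite subr0 mul1r big1 ?addr0 => [/eqP|j jm].
  by rewrite mulf_eq0 fr_eq0 // (negPf (expf_neq0 _ t0)) orbF => /eqP.
rewrite fermat_natr ?subrr ?mul0r //; first by rewrite frB // !fr_nat.
exact: (natr_sub_neq0 hp (ltn_ord j) (ltn_ord m) jm).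
Qed.

End PBasis.

Section PBasisChange.
Variables (p : nat) (K : fieldType).
Hypothesis hp : p \in [pchar K].
Hypothesis Kp_dep : forall z : 'I_p.+1 -> K, exists a : 'I_p.+1 -> K,
  (exists j, a j != 0) /\ \sum_j a j ^+ p * z j = 0.
Implicit Types (z w c t g : K).
Local Notation pbasis := (@pbasis p K).
Local Notation phi := (phi hp).
Local Notation theta := (@theta p K).
Local Notation dlog := (@dlog p K).
Local Notation thadd := (@thadd p K).
Local Notation jacU := (@jacU p K).

(** K has dimension at most p over its p-th powers by [Kp_dep], so p independent elements
    generate. *)
Lemma pbasis_indep t :
  (forall a : 'I_p -> K, \sum_j a j ^+ p * t ^+ j = 0 -> forall j, a j = 0) -> pbasis t.
Proof.
move=> it; split=> // z.
have [a [[j0 aj0] ha]] := Kp_dep (fun j => if unlift ord_max j is Some l then t ^+ l else z).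
move: ha; rewrite big_ord_recr /= unlift_none.
under eq_bigr => j _.
  have -> : widen_ord (leqnSn p) j = lift ord_max j.
    by apply: val_inj; rewrite /= /bump leqNgt ltn_ord.
  rewrite liftK; over.
move=> ha; have am : a ord_max != 0.
  apply: contraNneq aj0 => am; move: ha; rewrite am fr0 // mul0r addr0 => /it h.
  by case: (unliftP ord_max j0) => [l ->|->]; rewrite ?h ?am eqxx.
exists (fun j => - (a (lift ord_max j) / a ord_max)).
apply: (mulfI (x := a ord_max ^+ p)); first by rewrite expf_neq0.
move: ha => /eqP; rewrite addrC addr_eq0 => /eqP->; rewrite mulr_sumr -sumrN.
apply: eq_bigr => j _; rewrite frN // exprMn exprVn; field.
by rewrite expf_neq0.
Qed.

Lemma pbasis_nKp t g : pbasis t -> t <> g ^+ p.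
Proof.
by move=> ht tg; have := theta_Kp hp ht g; rewrite -tg theta_t // => t0;
  have := t_neq0 hp ht; rewrite t0 eqxx.
Qed.

Lemma deriv_theta t (D : K -> K) : pbasis t -> (forall u v, D (u + v) = D u + D v) ->
  (forall u v, D (u * v) = D u * v + u * D v) -> forall z, D z = theta t z / t * D t.
Proof.
move=> ht DD DM z; have D0 : D 0 = 0 by apply: (addrI (D 0)); rewrite -DD !addr0.
have D1 : D 1 = 0 by apply: (addrI (D 1)); rewrite addr0 -{3}(mulr1 1) DM mulr1 mul1r.
have DX u n : D (u ^+ n) = n%:R * u ^+ n.-1 * D u.
  elim: n => [|n IHn]; first by rewrite expr0 D1 !mul0r.
  rewrite exprS DM IHn -add1n natrD; case: n {IHn} => [|n]; first by rewrite expr0; ring.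
  by rewrite /= exprS; ring.
have t0 := t_neq0 hp ht.
rewrite {1}(pcE ht z) (big_morph D DD D0) /theta !mulr_suml; apply: eq_bigr => j _.
rewrite DM !DX (pcharf0 hp) !mul0r add0r.
case: (val j) => [|n]; first by rewrite /= !mul0r mulr0.
by rewrite /= exprS; field.
Qed.

Lemma theta_change s t z : pbasis s -> pbasis t ->
  theta s z = theta t z * (theta s t / t).
Proof.
move=> hs ht; rewrite (deriv_theta ht (thetaD hp hs) (thetaM hp hs)).
by field; apply: t_neq0 ht.
Qed.

(** As t is not a p-th power, theta s t is nonzero, and theta s can be rescaled to a derivation that
    fixes t. *)
Lemma pbasis_notin t : (exists s, pbasis s) -> (forall g, t <> g ^+ p) -> pbasis t.
Proof.
move=> [s hs] nt; have st0 : theta s t != 0.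
  by apply/eqP => /(theta_eq0 hp hs)[g /nt].
have t0 : t != 0 by apply/eqP => t0; apply: (nt 0); rewrite fr0.
apply: pbasis_indep; apply: (pbasis_of_deriv hp (D := fun z => theta s z * (t / theta s t))) => //.
- by move=> u v; rewrite thetaD // mulrDl.
- by move=> u v; rewrite thetaM //; ring.
by field.
Qed.

Section Fixed.
Variable t : K.
Hypothesis ht : pbasis t.

(** Both sides are additive in c, so c may be a monomial b ^ p t ^ j. For j = 0, c is a constant for
    theta and phi c ^ p = c; for j > 0, c is an eigenvector of theta with nonzero eigenvalue and phi
    c = 0. *)
Lemma jacU_formula c : jacU t p c = c ^+ p + c - phi t c ^+ p.
Proof.
have U0 : jacU t p 0 = 0.
  by apply: (addrI (jacU t p 0)); rewrite -(jacU_additive hp ht) !addr0.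
have nKp w g : theta t w != 0 -> w <> g ^+ p.
  by move=> /eqP tw wg; apply: tw; rewrite wg theta_Kp.
have Uconst b : jacU t p (b ^+ p) = (b ^+ p) ^+ p.
  suff h n : jacU t n (b ^+ p) = (b ^+ p) ^+ n by rewrite h.
  elim: n => [|n IHn]; first by rewrite expr0.
  rewrite /jacU iterS -/(jacU _ _ _) IHn /thadd [in theta _ _]exprAC theta_Kp // add0r.
  by rewrite exprS.
have Umono (j : 'I_p) : jacU t p (pc t c j ^+ p * t ^+ j) =
    (pc t c j ^+ p * t ^+ j) ^+ p + (if j == ordp0 hp then 0 else pc t c j ^+ p * t ^+ j).
  case: eqP => [->|/eqP j0]; first by rewrite expr0 mulr1 addr0 Uconst.
  have [->|b0] := eqVneq (pc t c j) 0; first by rewrite fr0 // !mul0r fr0 // U0 addr0.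
  apply: (@jacU_eigen _ _ hp t _ ht _ j); last exact: theta_monom.
  apply: pbasis_notin => [|g]; first by exists t.
  apply: nKp; rewrite theta_monom // mulf_neq0 //.
    apply: (natr_neq0 hp); rewrite ltn_ord andbT lt0n.
    by apply: contra j0 => /eqP j0; apply/eqP/val_inj.
  by rewrite mulf_neq0 ?expf_neq0 ?(t_neq0 hp ht).
rewrite {1}(pcE ht c) (big_morph _ (jacU_additive hp ht) U0).
under eq_bigr do rewrite Umono.
rewrite big_split /= -(fr_sum hp) -(pcE ht) -addrA; congr (_ + _).
rewrite (bigD1 (ordp0 hp)) //= add0r [X in _ = X - _](pcE ht c).
rewrite [X in _ = X - _](bigD1 (ordp0 hp)) //= expr0 mulr1 -/(phi t c) addrAC subrr add0r.
by apply: eq_bigr => j /negPf->.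
Qed.

Lemma jacobson c z : iter p (thadd t c) z = theta t z + (c ^+ p + c - phi t c ^+ p) * z.
Proof. by rewrite (iter_thadd hp ht) jacU_formula. Qed.

(** For c = theta z / z, the operator theta + c is the conjugate of theta by multiplication by z. So
    its p-th power takes 1 to c, and [jacobson] then reads phi c ^ p = c ^ p. *)
Lemma phi_dlog z : z != 0 -> phi t (dlog t z) = dlog t z.
Proof.
move=> z0; set c := dlog t z; have Ec n w : iter n (thadd t c) w = z^-1 * iter n (theta t) (z * w).
  elim: n w => [|n IHn] w; first by rewrite /= mulrA mulVf // mul1r.
  rewrite iterS IHn /thadd (thetaM hp ht) (thetaV hp ht) //= /c /dlog; field.
  exact: z0.
apply: (fr_inj hp); have := Ec p 1.
rewrite jacobson (theta1 hp ht) (iter_theta hp ht) !mulr1 add0r -/(jacU _ _ _).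
have -> : z^-1 * theta t z = c by rewrite mulrC.
by move/eqP; rewrite addrAC -subr_eq0 addrK subr_eq0 => /eqP.
Qed.

(** For F = theta - A the formula [jacobson] gives F ^ p = F, so the product of the F - j over F_p
    is zero. The last nonzero partial product applied to 1 is an eigenvector of F with some
    eigenvalue n, and dividing it by t ^ n yields z. *)
Lemma dlog_of_phi A : phi t A = A -> exists2 z, z != 0 & theta t z = A * z.
Proof.
move=> pA; pose F := thadd t (- A).
have FD u v : F (u + v) = F u + F v by rewrite /F (thadd_additive hp ht).
have F0 : F 0 = 0 by apply: (addrI (F 0)); rewrite -FD !addr0.
have Fp z : iter p F z = F z.
  by rewrite /F jacobson /thadd (phiN hp ht) pA; ring.
have FM g u : theta t g = 0 -> F (g * u) = g * F u.
  by move=> tg; rewrite /F (thadd_leibniz hp ht) tg mul0r addr0.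
pose w n := iteri n (fun j u => F u - j%:R * u) 1.
pose q n : {poly K} := \prod_(j < n) ('X - (j%:R)%:P).
have tnat n : theta t n%:R = 0 by rewrite -(fr_nat hp n) theta_Kp.
have wq n : (forall m, theta t (q n)`_m = 0) /\
    w n = \sum_(m < n.+1) (q n)`_m * iter m F 1.
  elim: n => [|n [IH1 IH2]].
    rewrite /w /q big_ord0 big_ord1 coef1 mul1r; split=> // m.
    by rewrite coef1; apply: tnat.
  have qS : q n.+1 = q n * 'X - n%:R *: q n.
    by rewrite /q big_ord_recr /= mulrBr -mul_polyC [X in _ - X]mulrC.
  have sq : size (q n) = n.+1 by rewrite /q -(big_mkord xpredT (fun j => 'X - (j%:R)%:P)) size_prod_XsubC size_iota subn0.
  split=> [m|].
    rewrite qS coefB coefMX coefZ (thetaD hp ht) (thetaN hp ht) (thetaM hp ht) IH1 tnat.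
    by rewrite mul0r mulr0 addr0 subr0; case: eqP => _; rewrite ?IH1 // (tnat 0).
  have -> : w n.+1 = F (w n) - n%:R * w n by [].
  rewrite IH2 (big_morph F FD F0) [in RHS]qS.
  under [in RHS]eq_bigr do rewrite coefB mulrBl.
  rewrite sumrB; congr (_ - _).
    rewrite [in RHS]big_ord_recl coefMX mul0r add0r; apply: eq_bigr => m _.
    by rewrite FM // coefMX.
  rewrite [in RHS]big_ord_recr /= coefZ [X in _ + X](_ : _ = 0) ?addr0; last first.
    by rewrite (nth_default _ (_ : (size (q n) <= n.+1)%N)) ?sq // mulr0 mul0r.
  by rewrite mulr_sumr; apply: eq_bigr => m _; rewrite coefZ mulrA.
have qp : q p = 'X^p - 'X.
  have sX : size ('X^p - 'X : {poly K}) = p.+1.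
    by rewrite size_polyDl size_polyXn // size_polyN size_polyX ltnS (p_gt1 hp).
  rewrite [RHS](@all_roots_prod_XsubC _ _ [seq (j : nat)%:R | j : 'I_p]).
  - rewrite lead_coefE sX /= coefB coefXn coefX eqxx gtn_eqF ?(p_gt1 hp) // subr0 scale1r.
    by rewrite big_image.
  - by rewrite sX size_image card_ord.
  - by apply/allP => _ /mapP[j _ ->]; rewrite /root !hornerE (fr_nat hp) subrr.
  rewrite uniq_rootsE map_inj_uniq ?enum_uniq // => a b ab; apply/eqP/negPn/negP => nab.
  by have := natr_sub_neq0 hp (ltn_ord a) (ltn_ord b) nab; rewrite ab subrr eqxx.
have wp : w p = 0.
  have [_ ->] := wq p; rewrite qp; have p1 := p_gt1 hp.
  rewrite (bigD1 ord_max) //= (bigD1 (Ordinal (leqW p1))) /=; last first.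
    by rewrite -val_eqE /= neq_ltn p1.
  rewrite !coefB !coefXn !coefX eqxx gtn_eqF // ltn_eqF // subr0 sub0r mul1r mulN1r Fp.
  rewrite big1 ?addr0 ?subrr // => j /andP[jm j1].
  rewrite coefB coefXn coefX; move: jm j1; rewrite -!val_eqE /= => /negPf-> /negPf->.
  by rewrite subrr mul0r.
have [n [wn wSn]] : exists n, w n != 0 /\ w n.+1 = 0.
  apply: contrapT => nn; suff : w p != 0 by rewrite wp eqxx.
  elim: {1}p => [|n IHn]; first by rewrite /w oner_neq0.
  by apply/eqP => h; apply: nn; exists n.
have t0 := t_neq0 hp ht; exists (w n / t ^+ n); first by rewrite mulf_neq0 ?invr_eq0 ?expf_neq0.
have tw : theta t (w n) = A * w n + n%:R * w n.
  have /eqP : F (w n) - n%:R * w n = 0 by [].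
  by rewrite /F /thadd mulNr subr_eq0 subr_eq addrC => /eqP.
have ttn : theta t (t ^+ n) = n%:R * t ^+ n.
  by have := theta_monom hp ht 1 n; rewrite expr1n mul1r.
rewrite (thetaM hp ht) (thetaV hp ht) ?expf_neq0 // ttn tw; field.
by rewrite expf_neq0.
Qed.

End Fixed.

(** The terms of A with j > 0 give exact forms, which are killed in either coordinate; the term j =
    0 is a p-th power times dt / t, a form that the operator fixes. *)
Lemma phi_change s t A : pbasis s -> pbasis t -> phi s (A * (theta s t / t)) = phi t A * (theta s t / t).
Proof.
move=> hs ht; set v := theta s t / t; have t0 := t_neq0 hp ht.
rewrite {1}(pcE ht A) mulr_suml (phi_sum hp hs) (bigD1 (ordp0 hp)) //= big1 ?addr0.
  by rewrite expr0 mulr1 (phiM hp hs) -/(dlog s t) (phi_dlog hs).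
move=> j j0; have jn : j%:R != 0 :> K.
  apply: (natr_neq0 hp); rewrite ltn_ord andbT lt0n.
  by apply: contra j0 => /eqP j0; apply/eqP/val_inj.
have -> : pc t A j ^+ p * t ^+ j * v = theta s ((pc t A j / j%:R) ^+ p * t ^+ j).
  rewrite (theta_pM hp hs); have -> : theta s (t ^+ j) = j%:R * t ^+ j * v.
    have := dlogX hp hs j t0; rewrite /dlog -/v => /(congr1 (fun u => u * t ^+ j)).
    by rewrite divfK ?expf_neq0 // => ->; ring.
  by rewrite exprMn exprVn (fr_nat hp); field.
exact: phi_theta.
Qed.

End PBasisChange.

(** * Operators that are p^-1-linear over an algebraically closed field *)

Section SemilinearOperators.
Variables (p : nat) (kb : closedFieldType) (K : fieldType) (cst : {rmorphism kb -> K}).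
Hypothesis hp : p \in [pchar kb].
Variable f : K -> K.
Hypothesis fD : forall u v, f (u + v) = f u + f v.
Hypothesis fM : forall c u, f (cst (c ^+ p) * u) = cst c * f u.
Implicit Types (h : K) (a x : nat -> kb).

Lemma proot_ex (c : kb) : exists d, d ^+ p = c.
Proof.
have /closed_rootP[d] : size ('X^p - c%:P : {poly kb}) != 1%N.
  by rewrite size_XnsubC ?(p_gt0 hp) // eqSS -lt0n (p_gt0 hp).
by rewrite /root !hornerE subr_eq0 => /eqP; exists d.
Qed.

Definition proot c := sval (cid (proot_ex c)).

Lemma prootK c : proot c ^+ p = c.
Proof. exact: svalP (cid (proot_ex c)). Qed.

Lemma prootX c n : proot c ^+ (p ^ n.+1) = c ^+ (p ^ n).
Proof. by rewrite expnS exprM prootK. Qed.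

Lemma frn_inj n : injective (fun c : kb => c ^+ (p ^ n)).
Proof.
elim: n => [|n IHn] c d /=; first by rewrite !expr1.
by rewrite expnSr !exprM => /(fr_inj hp)/IHn.
Qed.

Lemma frnD n (c d : kb) : (c + d) ^+ (p ^ n) = c ^+ (p ^ n) + d ^+ (p ^ n).
Proof.
elim: n => [|n IHn]; first by rewrite !expr1.
by rewrite expnSr !exprM IHn frD.
Qed.

Lemma frn_sum n (I : Type) (r : seq I) (P : pred I) (F : I -> kb) :
  (\sum_(j <- r | P j) F j) ^+ (p ^ n) = \sum_(j <- r | P j) F j ^+ (p ^ n).
Proof.
apply: (big_morph (fun c => c ^+ (p ^ n))) => [c d|]; first exact: frnD.
by rewrite expr0n expn_eq0 -leqn0 leqNgt (p_gt0 hp).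
Qed.

Let f0 : f 0 = 0. Proof. by apply: (addrI (f 0)); rewrite -fD !addr0. Qed.

Let f_lin n (x : nat -> kb) h :
  f (\sum_(j < n) cst (x j) * iter j f h) = \sum_(j < n) cst (proot (x j)) * iter j.+1 f h.
Proof.
by rewrite (big_morph f fD f0); apply: eq_bigr => j _; rewrite -{1}[x j]prootK fM.
Qed.

(* The coefficients x_j of a solution sum_j x_j f^j(h) of eta - f eta = e h, with
   z = x_n^(1/p). *)
Fixpoint xcoef (e z : kb) a j : kb :=
  if j is j'.+1 then proot (xcoef e z a j') + z * a j else e + z * a 0%N.

Lemma xcoefX e z a j : xcoef e z a j ^+ (p ^ j) =
  e + \sum_(l < j.+1) (z * a l) ^+ (p ^ l).
Proof.
elim: j => [|j IHj]; first by rewrite /= expn0 !expr1 big_ord1 expr1.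
by rewrite /= frnD prootX IHj [in RHS]big_ord_recr /= addrA.
Qed.

Lemma xcoef_sol e z a n h : iter n.+1 f h = \sum_(j < n.+1) cst (a j) * iter j f h ->
  xcoef e z a n = z ^+ p ->
  let eta := \sum_(j < n.+1) cst (xcoef e z a j) * iter j f h in
  eta - f eta = cst e * h.
Proof.
move=> rel xz; rewrite /= f_lin big_ord_recr [X in _ - X]big_ord_recr /=.
have -> : proot (xcoef e z a n) = z by apply: (fr_inj hp); rewrite prootK.
rewrite -[iter n f h]/(iter n f h) -iterS rel.
rewrite -[X in X - _](big_ord_recr n (fun j => cst (xcoef e z a j) * iter j f h)) /=.
rewrite big_ord_recl [X in _ - (_ + X)]mulr_sumr [X in _ - (_ + X)]big_ord_recl /=.
have -> : \sum_(j < n) cst (xcoef e z a (bump 0 j)) * iter (bump 0 j) f h =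
  \sum_(j < n) cst (proot (xcoef e z a j)) * f (iter j f h) +
  \sum_(j < n) cst z * (cst (a (bump 0 j)) * iter (bump 0 j) f h).
  rewrite -big_split /=; apply: eq_bigr => j _.
  by rewrite /bump /= add1n /= rmorphD rmorphM; ring.
by rewrite rmorphD rmorphM; ring.
Qed.

Lemma semilinear_solve n a h : iter n f h = \sum_(j < n) cst (a j) * iter j f h ->
  exists x, let eta := \sum_(j < n) cst (x j) * iter j f h in eta - f eta = h.
Proof.
case: n => [|n] rel.
  by exists a; rewrite /= big_ord0 f0 subr0 -[RHS]/(iter 0 f h) rel big_ord0.
(* This is the condition x_n = z ^ p of [xcoef_sol] for e = 1, raised to the power p ^ n so as to
   remove the p-th roots. *)
pose P : {poly kb} := 'X^(p ^ n.+1) - (1 + \sum_(l < n.+1) (a l *: 'X) ^+ (p ^ l)).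
have /closed_rootP[z] : size P != 1%N.
  have p1 := p_gt1 hp.
  have sP : size P = (p ^ n.+1).+1.
    rewrite size_polyDl size_polyXn // size_polyN ltnS.
    rewrite (leq_trans (size_polyD _ _)) // geq_max size_poly1 expn_gt0 ltnW //=.
    apply: (leq_trans (size_sum _ _ _)); apply/bigmax_leqP => l _.
    rewrite exprZn (leq_trans (size_scale_leq _ _)) // size_polyXn ltn_exp2l //.
  by rewrite sP eqSS -lt0n expn_gt0 ltnW.
rewrite /root /P !hornerE horner_sum subr_eq0 => /eqP hz.
exists (xcoef 1 z a); rewrite xcoef_sol ?rmorph1 ?mul1r //.
apply: (frn_inj (n := n)); rewrite /= xcoefX -exprM -expnS hz; congr (_ + _).
by apply: eq_bigr => l _; rewrite !hornerE mulrC.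
Qed.

(** When a_0 is nonzero, each root z of the separable polynomial P gives a fixed point of f, on
    which S vanishes. This condition, raised to the power p ^ n, reads Q(z) = 0 with deg Q <= p ^ n,
    whereas P has p ^ (n + 1) roots; so Q = 0, and its linear coefficient is S(h) a_0. When a_0 = 0,
    the relation for f h is shorter, and S(f h) ^ p = S h. *)
Lemma semilinear_functional (S : K -> kb) :
  (forall u v, S (u + v) = S u + S v) -> (forall c u, S (cst c * u) = c * S u) ->
  (forall u, S (f u) ^+ p = S u) -> (forall u, f u = u -> S u = 0) ->
  forall n a h, iter n f h = \sum_(j < n) cst (a j) * iter j f h -> S h = 0.
Proof.
move=> SD SM Sf Sfix; have S0 : S 0 = 0 by apply: (addrI (S 0)); rewrite -SD !addr0.
elim=> [|n IHn] a h rel.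
  by rewrite -[h]/(iter 0 f h) rel big_ord0.
have [a0|a0] := eqVneq (a 0%N) 0.
  rewrite -Sf (IHn (fun j => a j.+1) (f h)) ?fr0 //.
  rewrite -iterSr rel big_ord_recl a0 rmorph0 mul0r add0r.
  by apply: eq_bigr => j _; rewrite -iterSr.
pose s := S h; have sX j : S (iter j f h) ^+ (p ^ j) = s.
  by elim: j => [|j IHj]; [rewrite expr1|rewrite expnS exprM /= Sf].
have p1 := p_gt1 hp; have pp0 m : (0 < p ^ m)%N by rewrite expn_gt0 ltnW.
pose P : {poly kb} := 'X^(p ^ n.+1) - \sum_(l < n.+1) (a l *: 'X) ^+ (p ^ l).
pose L j : {poly kb} := \sum_(l < j.+1) (a l *: 'X) ^+ (p ^ l).
have LX j m : L j ^+ (p ^ m) = \sum_(l < j.+1) (a l ^+ (p ^ (l + m))) *: 'X^(p ^ (l + m)).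
  have hpP : p \in [pchar {poly kb}] by rewrite inE /= (pchar_pr hp) -polyC_natr (pcharf0 hp) polyC0 eqxx.
  rewrite /L; have -> : (\sum_(l < j.+1) (a l *: 'X) ^+ (p ^ l)) ^+ (p ^ m) =
    \sum_(l < j.+1) ((a l *: 'X) ^+ (p ^ l)) ^+ (p ^ m) :> {poly kb}.
    elim: m => [|m IHm]; first by rewrite expr1; apply: eq_bigr => l _; rewrite expr1.
    rewrite expnSr exprM IHm -(pFrobenius_autE hpP) rmorph_sum /=.
    by apply: eq_bigr => l _; rewrite pFrobenius_autE [in RHS]exprM.
  by apply: eq_bigr => l _; rewrite -exprM -expnD exprZn.
pose Q : {poly kb} := \sum_(j < n.+1) (s ^+ (p ^ (n - j))) *: L j ^+ (p ^ (n - j)).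
have sP : size P = (p ^ n.+1).+1.
  rewrite size_polyDl size_polyXn // size_polyN ltnS.
  apply: (leq_trans (size_sum _ _ _)); apply/bigmax_leqP => l _.
  by rewrite exprZn (leq_trans (size_scale_leq _ _)) // size_polyXn ltn_exp2l.
have Qroot z : root P z -> root Q z.
  rewrite /root /P !hornerE horner_sum subr_eq0 => /eqP hz.
  have xz : xcoef 0 z a n = z ^+ p.
    apply: (frn_inj (n := n)); rewrite /= xcoefX add0r -exprM -expnS hz.
    by apply: eq_bigr => l _; rewrite !hornerE mulrC.
  have := xcoef_sol rel xz; rewrite /= rmorph0 mul0r => /eqP; rewrite subr_eq0 => /eqP/esym/Sfix.
  rewrite (big_morph S SD S0) => /(congr1 (fun c => c ^+ (p ^ n))).
  rewrite frn_sum expr0n gtn_eqF // => h0; rewrite /Q horner_sum; apply/eqP.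
  rewrite -[RHS]h0; apply: eq_bigr => j _.
  have pn : (p ^ n = p ^ j * p ^ (n - j))%N by rewrite -expnD subnKC // -ltnS.
  rewrite hornerZ horner_exp SM exprMn mulrC; congr (_ * _).
    rewrite pn exprM xcoefX add0r horner_sum; congr (_ ^+ _).
    by apply: eq_bigr => l _; rewrite !hornerE mulrC.
  by rewrite pn exprM sX.
have [rs Prs] := closed_field_poly_normal P.
have lP : lead_coef P != 0 by rewrite lead_coef_eq0 -size_poly_eq0 sP.
have srs : size rs = (p ^ n.+1)%N.
  by have := sP; rewrite Prs size_scale // size_prod_XsubC => -[].
have urs : uniq rs.
  rewrite -separable_prod_XsubC; suff : separable_poly P.
    by rewrite {1}Prs !separable_poly.unlock derivZ coprimepZl // coprimepZr.
  rewrite separable_poly.unlock; have -> : P^`() = (- a 0%N)%:P.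
    have derX m l : ((a l *: 'X) ^+ (p ^ m))^`() = if m is 0%N then (a l)%:P else 0 :> {poly kb}.
      rewrite exprZn derivZ derivXn; case: m => [|m]; first by rewrite expn0 /= expr1 expr0 alg_polyC.
      by rewrite expnS -mulr_natl natrM -polyC_natr (pcharf0 hp) polyC0 !mul0r scaler0.
    rewrite /P derivB derivXn (big_morph deriv (@derivD kb) (@deriv0 kb)) big_ord_recl big1 ?addr0 => [|l _]; last exact: derX.
    rewrite derX polyCN expnS -mulr_natl natrM -polyC_natr (pcharf0 hp) polyC0 !mul0r.
    by rewrite sub0r.
  by rewrite coprimep_sym -alg_polyC coprimepZl ?oppr_eq0 // coprime1p.
have Q0 : Q = 0.
  apply/eqP/negPn/negP => Q0; have := max_poly_roots Q0 (rs := rs) _ urs.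
  rewrite srs ltnNge => /(_ _)/negP; apply.
    by apply/allP => z zrs; apply: Qroot; rewrite Prs rootZ // root_prod_XsubC.
  apply: leq_trans (_ : (p ^ n).+1 <= _)%N; last by rewrite ltn_exp2l.
  apply: (leq_trans (size_sum _ _ _)); apply/bigmax_leqP => j _.
  rewrite LX (leq_trans (size_scale_leq _ _)) //.
  apply: (leq_trans (size_sum _ _ _)); apply/bigmax_leqP => l _.
  rewrite (leq_trans (size_scale_leq _ _)) // size_polyXn ltnS leq_pexp2l ?(ltnW p1) //.
  by have := ltn_ord l; have := ltn_ord j; lia.
have := congr1 (fun q : {poly kb} => q`_1) Q0; rewrite coef0 coef_sum big_ord_recr /= big1 ?add0r.
  rewrite subnn expn0 !expr1 coefZ /L coef_sum big_ord_recl big1 ?addr0 => [/eqP|l _].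
    by rewrite expr1 coefZ coefX eqxx mulr1 mulf_eq0 (negPf a0) orbF => /eqP.
  rewrite exprZn coefZ coefXn ltn_eqF ?mulr0 // -{1}(expn0 p) ltn_exp2l //.
move=> j _; rewrite LX coefZ coef_sum big1 ?mulr0 // => l _.
rewrite coefZ coefXn ltn_eqF ?mulr0 // -{1}(expn0 p) ltn_exp2l //.
by have := ltn_ord j; rewrite /=; lia.
Qed.

End SemilinearOperators.

(** * The Cartier operator of a function field *)

Section CurvePBasis.
Variables (p : nat) (k : fieldType) (kb : closedFieldType) (i : {rmorphism k -> kb}).
Hypothesis hp : p \in [pchar k].
Hypothesis kb_algebraic : forall z : kb, algebraicOver i z.
Variable X : curve i.
Local Notation K := (gff X).
Local Notation V := (rmod (gcst X)).
Implicit Types (P Q : place X) (z u v t f : K) (s r : seq (place X)).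

Lemma hpkb : p \in [pchar kb]. Proof. exact: (rmorph_pchar i) hp. Qed.
Lemma hpK : p \in [pchar K]. Proof. exact: (rmorph_pchar (gcst X)) hpkb. Qed.

Local Notation pbasis := (@pbasis p K).
Local Notation phi := (phi hpK).
Local Notation theta := (@theta p K).
Local Notation proot := (proot hpkb).

Lemma place_ex : exists P : place X, True.
Proof.
by have [f fc] := gff_nonconst X kb_algebraic; have [P _] := pole_exists fc; exists P.
Qed.

(** The products v_l ^ p z_j, for independent v_l in L((m + c) s), lie in a space whose dimension
    grows like p m deg s, while their number grows like (p + 1) m deg s. The constant coefficients
    of a relation are absorbed into the p-th powers. *)
Lemma gff_Kp_dep (z : 'I_p.+1 -> K) : exists a : 'I_p.+1 -> K,
  (exists j, a j != 0) /\ \sum_j a j ^+ p * z j = 0.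
Proof.
have [f fc] := gff_nonconst X kb_algebraic; have f0 := nonconst_neq0 fc.
have [|s hs] := @zeros_seq _ _ _ X f^-1; first by rewrite invr_eq0.
have s0 : (0 < size s)%N.
  have [P Pf] := pole_exists fc; rewrite lt0n size_eq0; apply/eqP => sE.
  by have := hs P; rewrite sE ord_inv /cnt /=; case: (ltP 0 (- ord P f)); lia.
have [c hc] := Lsp_lower fc hs; have [r hr] := poles_seq (codom z).
pose m := (p * (c * size s) + size r).+1%N.
have [T [v [cT vL vi]]] := hc m.
have p0 := p_gt0 hpkb.
have [||a [[[l0 j0] a0] ha]] := @spans_dep kb V [set 0]
    (Lsp (cnt (reps (p * (m + c)) s ++ r))) _ (T * 'I_p.+1)%type
    (fun lj => v lj.1 ^+ p * z lj.2) (subspace0 _) (Lsp_cnt _).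
- move=> [l j] P /=; rewrite cnt_cat opprD; apply: vgeM; last exact/hr/codom_f.
  have -> : - cnt (reps (p * (m + c)) s) P = - cnt (reps (m + c) s) P *+ p.
    by rewrite -mulr_natl natz !cnt_reps; lia.
  by apply: vgeX; apply: vL.
- rewrite size_cat size_reps card_prod card_ord cT /m; nia.
have pa lj : gcst X (a lj) = gcst X (proot (a lj)) ^+ p by rewrite -rmorphXn prootK.
exists (fun j => \sum_l gcst X (proot (a (l, j))) * v l); split.
  exists j0; apply: contra_neq a0 => h.
  by rewrite -[a _](prootK hpkb) (vi (fun l => proot (a (l, j0))) h) fr0 // hpkb.
transitivity (\sum_j \sum_l gcst X (a (l, j)) * (v l ^+ p * z j)).
  apply: eq_bigr => j _; rewrite (fr_sum hpK) mulr_suml; apply: eq_bigr => l _.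
  by rewrite pa exprMn mulrA.
by rewrite exchange_big pair_bigA -[RHS]ha; apply: eq_bigr => -[].
Qed.

(* The terms have pairwise distinct orders modulo p, so they cannot cancel. *)
Lemma vge_pterms P t n (a : 'I_p -> K) : ord P t = 1 ->
  vge P n (\sum_j a j ^+ p * t ^+ j) -> forall j, vge P n (a j ^+ p * t ^+ j).
Proof.
move=> ot hn j1; have t0 := ord1_neq0 ot; apply: contraT => nj1.
have oX m : ord P (t ^+ m) = m%:Z by rewrite ordX // ot -mulr_natl mulr1 natz.
have oF (j : 'I_p) : a j != 0 -> ord P (a j ^+ p * t ^+ j) = ord P (a j) * p%:Z + j%:Z.
  by move=> aj; rewrite ordM ?expf_neq0 // oX ordX // -mulr_natr natz.
have aj1 : a j1 != 0 by apply: contraNneq nj1 => ->; rewrite fr0 ?hpK // mul0r vge0.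
case: (@arg_minP _ _ _ j1 (fun j => a j != 0) (fun j => ord P (a j ^+ p * t ^+ j)) aj1).
move=> j aj jmin.
have [s0 os] : a j ^+ p * t ^+ j + \sum_(l | l != j) a l ^+ p * t ^+ l != 0 /\
    ord P (a j ^+ p * t ^+ j + \sum_(l | l != j) a l ^+ p * t ^+ l) = ord P (a j ^+ p * t ^+ j).
  apply: ordD_eq; first by rewrite mulf_neq0 ?expf_neq0.
  apply: vge_sum => l lj; have [->|al] := eqVneq (a l) 0.
    by rewrite fr0 ?hpK // mul0r vge0.
  rewrite vgeE ?mulf_neq0 ?expf_neq0 //.
  have := jmin l al; rewrite le_eqVlt => /orP[/eqP|]; last by lia.
  rewrite !oF // => e; exfalso.
  have : (nat_of_ord l != nat_of_ord j)%N by rewrite (inj_eq val_inj).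
  have := ltn_ord l; have := ltn_ord j; move: (ord P (a l)) (ord P (a j)) e => A B e.
  move: (nat_of_ord l) (nat_of_ord j) e => l' j' e jp lp /eqP; apply.
  have [AB|[AB|AB]] : A = B \/ A + 1 <= B \/ B + 1 <= A by lia.
  - by move: e; rewrite AB; lia.
  - by nia.
  by nia.
move: hn nj1; rewrite (bigD1 j) //= !vgeE ?mulf_neq0 ?expf_neq0 // os.
by have := jmin j1 aj1; lia.
Qed.

Lemma pbasis_unif P t : ord P t = 1 -> pbasis t.
Proof.
move=> ot; have t0 := ord1_neq0 ot; apply: (pbasis_indep hpK gff_Kp_dep) => a ha j.
apply/eqP/negPn/negP => aj; have z0 : a j ^+ p * t ^+ j != 0 by rewrite mulf_neq0 ?expf_neq0.
have := @vge_pterms P t (ord P (a j ^+ p * t ^+ j) + 1) a ot; rewrite ha vge0 => /(_ isT j).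
by rewrite vgeE //; lia.
Qed.

Lemma gff_pbasis t : (forall g, t <> g ^+ p) -> pbasis t.
Proof.
apply: (pbasis_notin hpK gff_Kp_dep); have [P _] := place_ex.
by exists (unif P); apply: (pbasis_unif (ord_unifE P)).
Qed.

Lemma pbasis_nonconst t : pbasis t -> forall c, t <> gcst X c.
Proof.
move=> ht c tc; apply: (pbasis_nKp hpK (g := gcst X (proot c)) ht).
by rewrite -rmorphXn prootK.
Qed.

Lemma gff_basis t : (forall c, t <> gcst X c) -> exists n (b : 'I_n -> K),
  forall z, exists (d : {poly kb}) (c : 'I_n -> {poly kb}),
    pv d t != 0 /\ pv d t * z = \sum_j pv (c j) t * b j.
Proof.
move=> tc; have [N hN] := gff_rank t.
pose ind n (b : 'I_n -> K) := forall q : 'I_n -> {poly kb},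
  \sum_j pv (q j) t * b j = 0 -> forall j, q j = 0.
pose Q n := `[< exists b : 'I_n -> K, ind n b >].
have Q0 : exists n, Q n by exists 0%N; apply/asboolP; exists (fun=> 0) => q _ [].
have QN n : Q n -> (n <= N)%N.
  move=> /asboolP[b ib]; rewrite leqNgt; apply/negP => Nn.
  have [q [[j qj] hq]] := hN (fun j => b (widen_ord (ltnW Nn) j)).
  pose q' (l : 'I_n) := if insub (val l) is Some j then q j else 0.
  have q'E j' : q' (widen_ord (ltnW Nn) j') = q j' by rewrite /q' /= valK.
  case/eqP: qj; rewrite -q'E; apply: ib.
  rewrite (bigID (fun l : 'I_n => l < N)%N) /= [X in _ + X]big1 ?addr0; last first.
    by move=> l lN; rewrite /q' insubF ?pv0 ?mul0r //; apply/negbTE.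
  rewrite -[RHS]hq (big_ord_narrow (ltnW Nn)).
  by apply: eq_bigr => l _; rewrite q'E.
case: (ex_maxnP Q0 QN) => n /asboolP[b ib] nmax; exists n, b => z.
have : ~ ind n.+1 (fun j => if unlift ord_max j is Some l then b l else z).
  move=> h; have := nmax n.+1; rewrite ltnn => /(_ _)/notF; apply; apply/asboolP.
  by eexists; apply: h.
move=> /existsNP[q /not_implyP[hq /existsNP[j0 /eqP qj0]]].
move: hq; rewrite big_ord_recr /= unlift_none.
under eq_bigr => j _.
  have -> : widen_ord (leqnSn n) j = lift ord_max j.
    by apply: val_inj; rewrite /= /bump leqNgt ltn_ord.
  rewrite liftK; over.
move=> hq; exists (q ord_max), (fun j => - q (lift ord_max j)); split.
  apply/eqP => d0; have qm : q ord_max = 0.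
    by apply/eqP/negPn/negP => /alg_const/(_ d0)[c /tc].
  case/eqP: qj0; move: hq; rewrite d0 mul0r addr0 => /ib h.
  by case: (unliftP ord_max j0) => [l ->|->].
move/eqP: hq; rewrite addrC addr_eq0 => /eqP->; rewrite -sumrN.
by apply: eq_bigr => j _; rewrite pvN mulNr.
Qed.

Lemma phi_cst t c z : pbasis t -> phi t (gcst X (c ^+ p) * z) = gcst X c * phi t z.
Proof. by move=> ht; rewrite rmorphXn (phiM hpK ht). Qed.

(* With b a basis of K over kb(t), the h such that D^2 h is a combination of the b_j
   with coefficients of bounded degree form a finite-dimensional space stable under
   phi: dividing degrees by p leaves room for the denominators D of the phi (t^l b_j). *)
Lemma phi_locally_finite t h : pbasis t -> exists n (a : nat -> kb),
  iter n (phi t) h = \sum_(j < n) gcst X (a j) * iter j (phi t) h.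
Proof.
move=> ht; have [n [b hb]] := gff_basis (pbasis_nonconst ht).
have p1 := p_gt1 hpkb; have p0 := p_gt0 hpkb.
have [D [kp [D0 hD]]] := Msp_common hb
   (h :: codom (fun jl : 'I_n * 'I_p => phi t (t ^+ jl.2 * b jl.1))).
set M := Msp t b in hD; pose dl := size D; pose d := pv D t.
(* Large enough for kp + (s + (p - 2) dl) / p + 1 <= s, the degree bound that makes W stable under
   phi; the factor 2 bounds p / (p - 1). *)
pose s := (2 * kp.+1 + dl)%N.
pose W : set V := [set z | M s (d ^+ 2 * z)].
have sum_mul S (F : nat -> K) : \sum_(j < S * p) F j = \sum_(m < S) \sum_(l < p) F (m * p + l)%N.
  elim: S => [|S IHS]; first by rewrite mul0n !big_ord0.
  rewrite big_ord_recr /= -IHS -!(big_mkord xpredT) mulSnr.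
  rewrite (@big_cat_nat _ _ _ (S * p)%N) ?leq_addr //=; congr (_ + _).
  rewrite -{1}[(S * p)%N]add0n big_addn addKn -(big_mkord xpredT (fun l => F (S * p + l)%N)).
  by apply: eq_bigr => l _; rewrite addnC.
have split_q (q : {poly kb}) S : (size q <= S * p)%N -> exists e : 'I_p -> {poly kb},
    (forall l, size (e l) <= S)%N /\ pv q t = \sum_l pv (e l) t ^+ p * t ^+ l.
  move=> sq; exists (fun l : 'I_p => \poly_(m < S) proot q`_(m * p + l)%N); split=> [l|].
    exact: size_poly.
  rewrite (pv_coef _ sq) (sum_mul S (fun j => gcst X q`_j * t ^+ j)) exchange_big /=.
  apply: eq_bigr => l _; rewrite pv_poly (fr_sum hpK) mulr_suml; apply: eq_bigr => m _.
  by rewrite exprMn -rmorphXn prootK exprD exprM mulrA.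
have Wphi z : W z -> W (phi t z).
  move=> [c [sc hc]]; pose S := ((s + p.-2 * dl) %/ p).+1.
  have hS : (s + p.-2 * dl <= S * p)%N by rewrite ltnW // ltn_ceil.
  have Ss : (kp + S <= s)%N.
    rewrite /S /s; have := leq_trunc_div (s + p.-2 * dl) p; rewrite /s.
    set Q := (_ %/ p)%N; move: p1; case: (p) => [|[|p']] // _ /=; nia.
  have sDc l : (size (D ^+ p.-2 * c l)%R <= S * p)%N.
    apply: leq_trans hS; rewrite (leq_trans (size_polyMleq _ _)) //.
    have := size_poly_exp_leq D p.-2; have := sc l; rewrite -/dl; nia.
  have /choice[e he] := fun l => split_q _ _ (sDc l).
  rewrite /W /=; have -> : d ^+ 2 * phi t z = \sum_l \sum_m pv (e l m) t * (d * phi t (t ^+ m * b l)).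
    have -> : d ^+ 2 * phi t z = d * phi t (d ^+ p * z) by rewrite (phiM hpK ht); ring.
    have -> : d ^+ p * z = \sum_l pv (D ^+ p.-2 * c l) t * b l.
      have -> : d ^+ p = d ^+ p.-2 * d ^+ 2 by rewrite -exprD addn2; case: (p) p1 => [|[|]].
      rewrite -mulrA hc mulr_sumr; apply: eq_bigr => l _.
      by rewrite pvM pvXn mulrA.
    rewrite (phi_sum hpK ht) mulr_sumr; apply: eq_bigr => l _.
    have [_ ->] := he l; rewrite mulr_suml (phi_sum hpK ht) mulr_sumr.
    apply: eq_bigr => m _; rewrite -mulrA (phiM hpK ht); ring.
  apply: Msp_sum => l _; apply: Msp_sum => m _; apply: Msp_leq Ss _.
  apply: Msp_mul; first by have [-> _] := he l.
  by apply: hD; rewrite inE; apply/orP; right; apply/codomP; exists (l, m).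
have Wh : W h.
  rewrite /W /= expr2 -mulrA; apply: (@Msp_leq _ _ _ _ _ _ _ (kp + dl)%N); first by rewrite /s; nia.
  by apply: Msp_mul => //; apply: hD; rewrite inE eqxx.
have Wn m : W (iter m (phi t) h) by elim: m => //= m; apply: Wphi.
have Wspans : @spans kb V [set 0] W (n * s).
  have W0 : @subspace kb V W.
    split=> [|a u v hu hv]; first by rewrite /W /= mulr0; apply: Msp0.
    rewrite /W /= rmod_scaleE; have -> : d ^+ 2 * (gcst X a * u + v) =
      pv a%:P t * (d ^+ 2 * u) + d ^+ 2 * v by rewrite pvC; ring.
    apply: MspD => //; have [c [sc hc]] := hu; exists (fun j => a *: c j); split=> [j|].
      exact: leq_trans (size_scale_leq _ _) (sc j).
    by rewrite hc mulr_sumr; apply: eq_bigr => j _; rewrite pvC pvZ mulrA.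
  apply: (@spans_map kb V V [set 0] W [set 0] (M s) (fun z : K => d ^+ 2 * z)) => //.
  - exact: subspace0.
  - exact: subspace0.
  - by move=> a u v _ _; rewrite !rmod_scaleE; ring.
  - move=> v _ /eqP; rewrite mulf_eq0 expf_eq0 (negPf D0) andbF /= => /eqP //.
  exact: Msp_spans.
have [||c [[j0 cj0] hc]] := @spans_dep kb V [set 0] W _ 'I_(n * s).+1
    (fun j => iter j (phi t) h) (subspace0 _) Wspans.
- by move=> j; apply: Wn.
- by rewrite card_ord.
case: (@arg_maxnP _ j0 (fun j => c j != 0) (fun j => val j) cj0) => m cm mmax.
exists m, (fun j => - (c (inord j) / c m)).
have : \sum_(j < m.+1) gcst X (c (widen_ord (ltn_ord m) j)) * iter j (phi t) h = 0.
  have {}hc : \sum_j gcst X (c j) * iter j (phi t) h = 0 := hc.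
  rewrite -[RHS]hc [RHS](bigID (fun j : 'I__ => (j < m.+1)%N)) /= [X in _ = _ + X]big1 ?addr0.
    by rewrite (big_ord_narrow (ltn_ord m)).
  move=> j; rewrite -leqNgt => mj; have -> : c j = 0; last by rewrite rmorph0 mul0r.
  by apply/eqP/negPn/negP => /mmax /=; rewrite leqNgt mj.
rewrite big_ord_recr /= (_ : widen_ord _ ord_max = m); last exact: val_inj.
have cm0 : gcst X (c m) != 0 by rewrite fmorph_eq0.
move=> /eqP; rewrite addrC addr_eq0 => /eqP h0; apply: (mulfI cm0); rewrite h0 mulr_sumr -sumrN.
apply: eq_bigr => j _; rewrite rmorphN rmorphM fmorphV; have -> : inord j = widen_ord (ltn_ord m) (widen_ord (leqnSn m) j).
  by apply: val_inj; rewrite /= inordK //; apply: ltn_trans (ltn_ord j) (ltn_ord m).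
by field.
Qed.

End CurvePBasis.

(** * Residues *)

Section PolarParts.
Variables (k : fieldType) (kb : closedFieldType) (i : {rmorphism k -> kb}).
Variable X : curve i.
Local Notation K := (gff X).
Implicit Types (P Q : place X) (z u v t f A : K).

(* c0 P t A is the coefficient of t^0 in the expansion of A, that is the residue at P
   of A dt / t; the polynomial a is the polar part of A together with this coefficient. *)
Definition c0 P t A : kb :=
  xget 0 [set c | exists a : {poly kb}, a`_0 = c /\ vge P 1 (A - pv a t^-1)].

Section AtUniformizer.
Variables (P : place X) (t : K).
Hypothesis ot : ord P t = 1.

Let t0 : t != 0. Proof. exact: ord1_neq0 ot. Qed.
Let t1 : vge P 1 t. Proof. by rewrite vgeE // ot. Qed.
Let oX m : ord P (t ^+ m) = m%:Z.
Proof. by rewrite ordX // ot -mulr_natl mulr1 natz. Qed.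

Lemma polar_part A : exists a : {poly kb}, vge P 1 (A - pv a t^-1).
Proof.
have [n hn] : exists n : nat, vge P (1 - n%:Z) A.
  exists (`|ord P A|.+1); apply: vge_leq (vge_ord P A); lia.
elim: n A hn => [|n IHn] A hn; first by exists 0; rewrite pv0 subr0.
have [|c hc] := @vge_residue _ _ _ _ P (A * t ^+ n).
  have -> : 0 = 1 - n.+1%:Z + n%:Z by lia.
  by apply: vgeM => //; rewrite vgeE ?expf_neq0 // oX.
have [|a ha] := IHn (A - gcst X c * t ^- n).
  have -> : A - gcst X c * t ^- n = (A * t ^+ n - gcst X c) * t ^- n.
    by rewrite mulrBl mulfK ?expf_neq0.
  by apply: vgeM => //; rewrite vgeE ?invr_eq0 ?expf_neq0 // ord_inv oX.
exists (a + c *: 'X^n); rewrite pvD pvZ pvXn pvX exprVn.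
by have -> : A - (pv a t^-1 + gcst X c * t ^- n) = A - gcst X c / t ^+ n - pv a t^-1 by ring.
Qed.

Lemma polar_uniq (a : {poly kb}) : vge P 1 (pv a t^-1) -> a = 0.
Proof.
move=> h; apply/eqP/negPn/negP => a0.
have tV0 : t^-1 != 0 by rewrite invr_eq0.
have sa : (size a <= (size a).-1.+1)%N by rewrite prednK // lt0n size_poly_eq0.
move: h; rewrite (pv_rev tV0 sa) invrK.
set q := \poly_(j < _) _; have q0 : q`_0 != 0.
  by rewrite coef_poly /= subn0 -lead_coefE lead_coef_eq0.
have [u0 ou] := pv_unit t1 q0.
rewrite vgeE ?mulf_neq0 ?expf_neq0 // ordM ?expf_neq0 // ou exprVn ord_inv oX; lia.
Qed.

Lemma c0_eq A (a : {poly kb}) : vge P 1 (A - pv a t^-1) -> c0 P t A = a`_0.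
Proof.
move=> ha; rewrite /c0; case: xgetP => [c _ [b [<- hb]]|/(_ a`_0)[]]; last by exists a.
have /polar_uniq/eqP : vge P 1 (pv (a - b) t^-1); last by rewrite subr_eq0 => /eqP->.
have -> : pv (a - b) t^-1 = (A - pv b t^-1) - (A - pv a t^-1) by rewrite pvD pvN; ring.
exact: vgeB.
Qed.

Lemma c0D A B : c0 P t (A + B) = c0 P t A + c0 P t B.
Proof.
have [a ha] := polar_part A; have [b hb] := polar_part B.
rewrite (c0_eq ha) (c0_eq hb) -coefD; apply: c0_eq.
by rewrite pvD opprD addrACA; apply: vgeD.
Qed.

Lemma c0Z c A : c0 P t (gcst X c * A) = c * c0 P t A.
Proof.
have [a ha] := polar_part A; rewrite (c0_eq ha) -coefZ; apply: c0_eq.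
by rewrite pvZ -mulrBr; apply: vgeMl => //; apply: vge_cst.
Qed.

Lemma c0_vge1 A : vge P 1 A -> c0 P t A = 0.
Proof. by move=> h; rewrite (@c0_eq _ 0) ?coef0 // pv0 subr0. Qed.

Lemma c0_0 : c0 P t 0 = 0. Proof. by apply: c0_vge1; rewrite vge0. Qed.

Lemma c0_sum (I : Type) (r : seq I) (B : pred I) (F : I -> K) :
  c0 P t (\sum_(j <- r | B j) F j) = \sum_(j <- r | B j) c0 P t (F j).
Proof. exact: (big_morph (c0 P t) c0D c0_0). Qed.

Lemma c0_vge0 A : vge P 0 A -> c0 P t A = rv P A.
Proof.
move=> /rvP h; rewrite (@c0_eq _ (rv P A)%:P) ?coefC // pvC //.
Qed.

End AtUniformizer.

End PolarParts.

Section Residues.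
Variables (p : nat) (k : fieldType) (kb : closedFieldType) (i : {rmorphism k -> kb}).
Hypothesis hp : p \in [pchar k].
Hypothesis kb_algebraic : forall z : kb, algebraicOver i z.
Variable X : curve i.
Local Notation K := (gff X).
Local Notation hpK := (hpK hp X).
Local Notation phi := (phi hpK).
Local Notation theta := (@theta p K).
Local Notation dlog := (@dlog p K).
Implicit Types (P Q : place X) (z u v t f A : K).

Section AtUniformizer.
Variables (P : place X) (t : K).
Hypothesis ot : ord P t = 1.

Let t0 : t != 0. Proof. exact: ord1_neq0 ot. Qed.
Let ht : @pbasis p K t. Proof. exact: (pbasis_unif hp kb_algebraic ot). Qed.
Let oX m : ord P (t ^+ m) = m%:Z.
Proof. by rewrite ordX // ot -mulr_natl mulr1 natz. Qed.

(** phi takes the p-th root of the part of the expansion with exponents divisible by p, so orders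
    are divided by p and rounded up. *)
Lemma vge_phi n m A : vge P n A -> (m - 1) * p%:Z < n -> vge P m (phi t A).
Proof.
rewrite {1}(pcE ht A) => /(vge_pterms hp ot)/(_ (ordp0 hpK)); rewrite expr0 mulr1.
rewrite -/(phi t A) => h nm; rewrite /vge; case: eqVneq => //= a0.
move: h; rewrite vgeE ?expf_neq0 // ordX // -mulr_natr natz => h.
by have := p_gt0 hpK; nia.
Qed.

Lemma vge_theta0 A : vge P 0 A -> vge P 1 (theta t A).
Proof.
rewrite {1}(pcE ht A) => /(vge_pterms hp ot) h; apply: vge_sum => j _.
have [j0|j0] := posnP j; first by rewrite j0 mul0r vge0.
rewrite -(rmorph_nat (gcst X)); apply: vgeMl; first exact: vge_cst.
have := h j; rewrite /vge; case: eqVneq => //= a0; move: a0; rewrite mulf_eq0 negb_or.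
rewrite fr_eq0 ?hpK // => /andP[a0 _].
rewrite ordM ?expf_neq0 // oX ordX // -mulr_natr natz; have := ltn_ord j.
move: (ord P _) => a; move: (nat_of_ord j) j0 => l l0 lp al.
have [aa|aa] : 0 <= a \/ a + 1 <= 0 by lia.
  by nia.
by nia.
Qed.

Lemma rv_dlog z : z != 0 -> vge P 0 (dlog t z) /\ rv P (dlog t z) = (ord P z)%:~R.
Proof.
move=> z0.
have key n w : w != 0 -> ord P w = 0 -> vge P 1 (dlog t (w * t ^+ n) - gcst X n%:R).
  move=> w0 ow; rewrite (dlogM hpK ht) ?expf_neq0 // (dlogX hpK ht) // !dlogE.
  rewrite (theta_t hpK ht) mulfV // mulr1 rmorph_nat addrK.
  apply: vgeMr; first by apply: vge_theta0; rewrite vgeE // ow.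
  by have := vgeV P w; rewrite ow oppr0.
have main : vge P 1 (dlog t z - gcst X (ord P z)%:~R).
  case oz : (ord P z) => [n|n].
    have := key n (z / t ^+ n); rewrite divfK ?expf_neq0 //; apply.
      by rewrite mulf_neq0 ?invr_eq0 ?expf_neq0.
    by rewrite ordM ?invr_eq0 ?expf_neq0 // ord_inv oX oz subrr.
  have := key n.+1 (z^-1 / t ^+ n.+1); rewrite divfK ?expf_neq0 // (dlogV hpK ht) //.
  have -> : dlog t z - gcst X (Negz n)%:~R = - (- dlog t z - gcst X n.+1%:R).
    by rewrite NegzE mulrNz rmorphN; ring.
  rewrite vgeN; apply.
    by rewrite mulf_neq0 ?invr_eq0 ?expf_neq0.
  by rewrite ordM ?invr_eq0 ?expf_neq0 // !ord_inv oX oz NegzE opprK subrr.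
split; last exact: rv_eq main.
rewrite -[dlog t z](subrK (gcst X (ord P z)%:~R)); apply: vgeD; last exact: vge_cst.
exact: vge_leq main.
Qed.

Lemma c0_phi A : c0 P t (phi t A) ^+ p = c0 P t A.
Proof.
have [a ha] := polar_part ot A; rewrite -[A in LHS](subrK (pv a t^-1)) (phiD hpK ht) (c0D ot).
rewrite (c0_vge1 ot) ?add0r; last by apply: vge_phi ha _; rewrite subrr mul0r.
rewrite (c0_eq ot ha) (pv_coef _ (leqnn (size a))) (phi_sum hpK ht) (c0_sum ot).
have pow j : c0 P t (t^-1 ^+ j) = (j == 0%N)%:R.
  by rewrite (@c0_eq _ _ _ _ _ _ ot _ 'X^j) ?coefXn 1?eq_sym // pvXn pvX subrr vge0.
have term (j : nat) : c0 P t (phi t (gcst X a`_j * t^-1 ^+ j)) =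
    if j == 0%N then proot (hpkb i hp) a`_0 else 0.
  rewrite -{1}(prootK (hpkb i hp) a`_j) (phi_cst hp _ _ ht) (c0Z ot).
  have -> : phi t (t^-1 ^+ j) = if (p %| j)%N then t^-1 ^+ (j %/ p) else 0.
    (* Write t ^ -j as (t ^ -m) ^ p t ^ l with 0 <= l < p, to which [phi_monom] applies. *)
    have p0 := p_gt0 hpK; pose l := ((p - j %% p) %% p)%N; pose m := (j %/ p + (0 < j %% p))%N.
    have jl : (j + l = m * p)%N.
      rewrite /l /m {1}(divn_eq j p); have := ltn_pmod j p0; case: posnP => [->|h0 h1].
        by rewrite subn0 modnn !addn0.
      rewrite (modn_small (m := p - j %% p)); first by rewrite addn1 mulSn; lia.
      by rewrite ltn_subrL h0 p0.
    have -> : t^-1 ^+ j = (t^-1 ^+ m) ^+ p * t ^+ l.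
      by rewrite -exprM -jl exprD -mulrA -exprMn mulVf // expr1n mulr1.
    rewrite (phi_monom hpK ht); have l_lt : (l < p)%N by rewrite ltn_mod.
    have [l0|l0] := posnP l.
      have pj : (p %| j)%N by rewrite /dvdn; apply/eqP; move: jl; rewrite l0 addn0 => ->; rewrite modnMl.
      rewrite l0 dvdn0 div0n expr0 mulr1 pj; congr (_ ^+ _).
      by rewrite /m (eqP pj) addn0.
    rewrite gtnNdvd //; case: ifP => // pj.
    by move: l0; rewrite /l (eqP pj) subn0 modnn.
  case: (posnP j) => [->|j0]; first by rewrite dvdn0 div0n pow mulr1.
  case: ifP => [pj|_]; last by rewrite (c0_0 ot) mulr0.
  by rewrite pow eqn0Ngt divn_gt0 ?(p_gt0 hpK) // dvdn_leq // mulr0.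
under eq_bigr do rewrite term.
case sa : (size a) => [|n].
  by rewrite big_ord0 (fr0 (hpkb i hp)) nth_default ?sa.
rewrite big_ord_recl /= big1 ?addr0 ?prootK // => j _.
Qed.

End AtUniformizer.

(** Applying phi takes the p-th roots of both residues and lowers the order of the pole, until A is
    regular and both sides are its value at P. *)
Lemma c0_indep P s t A : ord P s = 1 -> ord P t = 1 ->
  c0 P s (A * dlog s t) = c0 P t A.
Proof.
move=> os ot; have hs := pbasis_unif hp kb_algebraic os; have ht := pbasis_unif hp kb_algebraic ot.
have [v0 rvv] := rv_dlog os (ord1_neq0 ot).
have [n hn] : exists n : nat, vge P (- n%:Z) A.
  exists `|ord P A|%N; apply: vge_leq (vge_ord P A); lia.
elim: n A hn => [|n IHn] A hn.
  rewrite oppr0 in hn; rewrite (c0_vge0 os) ?(c0_vge0 ot) //; last exact: vgeMl.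
  by rewrite (rvM hn v0) rvv ot mulr1.
rewrite -(c0_phi os) dlogE (phi_change hpK (@gff_Kp_dep _ _ _ _ hp kb_algebraic X) A hs ht) -dlogE.
rewrite IHn ?c0_phi //; apply: (vge_phi ot hn).
by have := p_gt1 hpK; case: n {IHn hn} => [|n]; nia.
Qed.

(** The residue at P of h dz / z. *)
Definition res h z P := c0 P (unif P) (h * dlog (unif P) z).

Lemma pbasis_unifE P : @pbasis p K (unif P).
Proof. exact: (pbasis_unif hp kb_algebraic (ord_unifE P)). Qed.

Lemma res_vge0 h z P : z != 0 -> vge P 0 h -> res h z P = rv P h * (ord P z)%:~R.
Proof.
move=> z0 hh; have [v0 vv] := rv_dlog (ord_unifE P) z0.
by rewrite /res (c0_vge0 (ord_unifE P)) ?(rvM hh v0) ?vv //; apply: vgeMl.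
Qed.

Lemma finsupp_res h z : z != 0 -> finsupp (res h z).
Proof.
move=> z0; have [r ur rh] := finsupp2 (finsupp_ord h) (finsupp_ord z).
apply: (seq_finsupp (r := r)) => P hP; apply: rh; apply: contrapT => /not_orP[].
move=> /negP/negPn/eqP oh /negP/negPn/eqP oz; case/eqP: hP.
by rewrite res_vge0 // ?oz ?mulr0 // vge_reg oh.
Qed.

Theorem residue_theorem h z : z != 0 -> \sum_(P \in [set: place X]) res h z P = 0.
Proof.
move=> z0; have [[g zg]|ng] := pselect (exists g, z = g ^+ p).
  apply: fsum0 => P; rewrite /res dlogE zg (theta_Kp hpK (pbasis_unifE P)) mul0r mulr0.
  exact/c0_0/ord_unifE.
have hz : @pbasis p K z by apply: (gff_pbasis hp kb_algebraic) => g zg; apply: ng; exists g.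
pose S u := \sum_(P \in [set: place X]) res u z P; rewrite -/(S h).
have [n [a rel]] := phi_locally_finite hp h hz.
apply: (@semilinear_functional p kb K (gcst X) (hpkb i hp) (phi z) _ _ S _ _ _ _ n a h rel).
- exact: phiD.
- by move=> c u; apply: phi_cst.
- move=> u v; rewrite -fsumD; [|exact: finsupp_res|exact: finsupp_res].
  by apply: fsum_eq => P; rewrite /res mulrDl (c0D (ord_unifE P)).
- move=> c u; rewrite /S mulr_fsumr; apply: fsum_eq => P.
  by rewrite /res -mulrA (c0Z (ord_unifE P)).
- move=> u; rewrite -(@fsum_additive _ _ _ (fun c => c ^+ p)).
  + apply: fsum_eq => P; rewrite /res dlogE -(phi_change hpK (@gff_Kp_dep _ _ _ _ hp kb_algebraic X)) //.
      by rewrite (c0_phi (ord_unifE P)).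
    exact: pbasis_unifE.
  + exact: finsupp_res.
  + exact: fr0 (hpkb i hp).
  + by move=> x y; apply: frD (hpkb i hp) _ _.
(* For a fixed point u of phi, u dz / z is some dg / g, whose residues are the orders of g, of sum
   zero. *)
move=> u /(dlog_of_phi (@gff_Kp_dep _ _ _ _ hp kb_algebraic X) hz)[g g0 gu].
have gE P : res u z P = (ord P g)%:~R.
  have [v0 <-] := rv_dlog (ord_unifE P) g0.
  rewrite -(c0_vge0 (ord_unifE P)) // /res; congr c0.
  rewrite !dlogE (theta_change hpK g (pbasis_unifE P) hz) gu.
  by field; rewrite z0 g0.
rewrite /S (fsum_eq gE) (@fsum_additive _ _ _ (fun n : int => n%:~R : kb)) ?deg_ord //.
  exact: finsupp_ord.
by move=> x y; rewrite rmorphD.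
Qed.

End Residues.

(** * Weil differentials *)

Section Repartitions.
Variables (k : fieldType) (kb : closedFieldType) (i : {rmorphism k -> kb}).
Variable X : curve i.
Local Notation K := (gff X).
Local Notation V := (rmod (gcst X)).
Definition repart : lmodType kb := place X -> V.
Implicit Types (P Q : place X) (z u v t f : K) (s r : seq (place X)) (x y : repart).
Implicit Types E : place X -> int.

(** In the usual notation [Ad E] is A(E) and [KAd E] is K + A(E); a [repart] alone carries no
    finiteness condition. *)
Definition Ad E : set repart := [set x | forall P, vge P (- E P) (x P)].

Definition cstr f : repart := fun=> f.

Definition KAd E : set repart := [set x | exists f, Ad E (x - cstr f)].

Definition adele : set repart := [set x | exists s, Ad (cnt s) x].

Lemma Ad_subspace E : subspace (Ad E).
Proof.
split=> [P|a u v hu hv P]; first exact: vge0.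
by apply: vgeD => //; apply: vgeMl => //; apply: vge_cst.
Qed.

Lemma Ad_sub E E' : (forall P, E P <= E' P) -> Ad E `<=` Ad E'.
Proof. by move=> h z hz P; apply: vge_leq (hz P); rewrite lerN2. Qed.

Lemma KAd_subspace E : subspace (KAd E).
Proof.
split=> [|a u v [f hf] [g hg]]; first by exists 0 => P; rewrite subrr vge0.
exists (a *: (f : V) + g) => P.
have -> : (a *: u + v - cstr (a *: (f : V) + g)) P = a *: (u P - f : V) + (v P - g).
  by rewrite !fctE /cstr scalerBr opprD addrACA.
by apply: vgeD (hg P); apply: vgeMl (hf P); apply: vge_cst.
Qed.

Lemma Ad_KAd E : Ad E `<=` KAd E.
Proof. by move=> x hx; exists 0; rewrite (_ : cstr 0 = 0) ?subr0. Qed.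

Lemma cstr_KAd E f : KAd E (cstr f).
Proof. by exists f => P; rewrite subrr vge0. Qed.

Lemma adele_subspace : subspace adele.
Proof.
split=> [|a u v [s hs] [r hr]]; first by exists [::]; have [] := Ad_subspace (cnt [::]).
exists (s ++ r); have [_] := Ad_subspace (cnt (s ++ r)); apply.
  by apply: Ad_sub hs => P; rewrite cnt_cat lerDl.
by apply: Ad_sub hr => P; rewrite cnt_cat lerDr.
Qed.

Lemma adele_cstr f : adele (cstr f).
Proof. by have [s hs] := poles_seq [:: f]; exists s => P; apply: hs; rewrite inE. Qed.

Lemma adele_Ad0 : Ad (fun=> 0) `<=` adele.
Proof. by move=> x hx; exists [::]; apply: Ad_sub hx. Qed.

Lemma KAd_adele : KAd (fun=> 0) `<=` adele.
Proof.
move=> x [f hf]; rewrite -[x](subrK (cstr f)).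
by apply: (subspaceD adele_subspace); [apply: adele_Ad0|apply: adele_cstr].
Qed.

Lemma adele_mul f x : adele x -> adele (fun P => f * x P).
Proof.
move=> [s hs]; have [r hr] := adele_cstr f; exists (r ++ s) => P.
by rewrite cnt_cat opprD; apply: vgeM.
Qed.

Lemma Ad_step E Q : spans (Ad E) (Ad (fun P => (Q == P)%:R + E P)) 1.
Proof.
pose u := unif Q ^ (E Q + 1).
have hu x : Ad (fun P => (Q == P)%:R + E P) x -> vge Q 0 (x Q * u).
  move=> /(_ Q); rewrite eqxx => hz; rewrite -(addNr (E Q + 1)).
  by apply: vgeM; [rewrite addrC|rewrite vgeE ?unifz_neq0 // ord_unifz].
apply: (@spans_functional kb repart _ _ (fun x => rv Q (x Q * u))).
- exact: Ad_subspace.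
- exact: Ad_subspace.
- move=> a x y hx hy; have -> : (a *: x + y) Q * u = gcst X a * (x Q * u) + y Q * u.
    by rewrite !fctE rmod_scaleE mulrDl mulrA.
  rewrite rvD; [|by apply: vgeMl; [apply: vge_cst|apply: hu]|exact: hu].
  by rewrite rvM ?rv_cst //; [apply: vge_cst|apply: hu].
move=> x hx /(rv_eq0 (hu x hx)) h P; have [<-|nQ] := eqVneq Q P; last first.
  by have := hx P; rewrite (negPf nQ) add0r.
rewrite -[x Q](mulfK (unifz_neq0 Q (E Q + 1))).
have -> : - E Q = 1 - (E Q + 1) by ring.
by apply: vgeM => //; rewrite vgeE ?invr_eq0 ?unifz_neq0 // ord_inv ord_unifz.
Qed.

Lemma Ad_seq E s : spans (Ad E) (Ad (fun P => cnt s P + E P)) (size s).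
Proof.
elim: s => [|Q s IHs].
  apply: spans_sub (spans_refl (V := repart) _) => [z hz P|]; last by case: (Ad_subspace E).
  by have := hz P; rewrite add0r.
rewrite /= -addn1; apply: spans_trans IHs _; apply: spans_sub (Ad_step _ Q) => z hz P.
by have := hz P; rewrite cnt_cons addrA.
Qed.

Lemma common_adele (T : finType) (v : T -> repart) : (forall j, adele (v j)) ->
  exists s, forall j, Ad (cnt s) (v j).
Proof.
move=> /choice[s hs]; exists (flatten [seq s j | j : T]) => j.
apply: Ad_sub (hs j) => P; rewrite /cnt lez_nat count_flatten -map_comp sumnE big_map.
by rewrite big_enum /= (bigD1 j) //= leq_addr.
Qed.

Definition single P u : repart := fun Q => if Q == P then u else 0.

Lemma adele_single P u : adele (single P u).
Proof.
exists (nseq `|ord P u| P) => Q; rewrite /single; case: eqP => [->|_]; last exact: vge0.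
by rewrite /cnt count_nseq /= eqxx mul1n; apply: vge_leq (vge_ord P u); lia.
Qed.

Hypothesis kb_algebraic : forall z : kb, algebraicOver i z.

(** Vectors independent modulo K + A(0), together with independent vectors of L(r), are independent
    in A(r) modulo A(-Q), of dimension at most deg r + 1; Riemann's inequality then bounds their
    number. *)
Lemma adele_index : exists c : nat,
  spans (KAd (fun=> 0)) adele c /\
  forall s, exists r, (forall P, cnt s P <= cnt r P) /\
    exists (T : finType) (v : T -> V), [/\ (size r <= #|T| + c)%N,
      forall j, Lsp (cnt r) (v j) & @indep kb V [set 0] T v].
Proof.
have [f fc] := gff_nonconst X kb_algebraic; have [c hc] := riemann fc.
exists c.+1; split; last first.
  move=> s; have [r [sr [T [v [cT vL vi]]]]] := hc s; exists r; split=> //.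
  by exists T, v; split=> //; rewrite addnS leqW.
apply: indep_spans => [|v Sv iv]; first exact: KAd_subspace.
have [s hs] := common_adele Sv; have [r [sr [T [w [cT wL wi]]]]] := hc s.
(* Passing from A(0) to A(-Q) excludes the constants, so that K meets the denominator in 0; it costs
   the extra unit in [c.+1]. *)
have [Q _] := pole_exists fc; pose E0 P : int := - (Q == P)%:R.
have sp : spans (Ad E0) (Ad (cnt r)) (size (Q :: r)).
  apply: spans_sub (Ad_seq E0 (Q :: r)) => x hx P; have := hx P.
  by rewrite cnt_cons /E0 addrAC subrr add0r.
have E0le : Ad E0 `<=` KAd (fun=> 0).
  by move=> x hx; apply: Ad_KAd; apply: Ad_sub hx => P; rewrite /E0; case: (_ == _).
have := spans_indep (Ad_subspace E0) sp
  (v := fun j : T + 'I_c.+2 => match j with inl j => cstr (w j) | inr j => v j end).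
rewrite card_sum card_ord /= => h.
suff : (#|T| + c.+2 <= (size r).+1)%N by move: cT; lia.
apply: h => [[j|j]|]; first by move=> P; apply: wL.
  by apply: Ad_sub (hs j) => P; apply: sr.
apply: (indep_cat (KAd_subspace _)) iv => // [j|a ha]; first exact: cstr_KAd.
apply: wi; have h P : vge P (- E0 P) (\sum_j a j *: w j).
  by have := ha P; rewrite fct_sumE.
have [P|d ad] := @no_pole_const _ _ _ X (\sum_j a j *: w j).
  by apply: vge_leq (h P); rewrite /E0 opprK; case: (_ == _).
rewrite /= ad; have := h Q; rewrite /E0 eqxx opprK ad => /vge1_cst ->.
by rewrite rmorph0.
Qed.

Lemma KAd_index : exists c : nat,
  forall s, spans (KAd (fun P => - cnt s P)) adele (size s + c).
Proof.
have [c [hc _]] := adele_index; exists c => s.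
apply: spans_trans hc; have [w hw] := Ad_seq (fun P => - cnt s P) s.
exists w => x [f hf]; have [|a ha] := hw (x - cstr f).
  by apply: Ad_sub hf => P; rewrite subrr.
by exists a, f; rewrite addrAC.
Qed.

End Repartitions.

Section WeilDifferentials.
Variables (p : nat) (k : fieldType) (kb : closedFieldType) (i : {rmorphism k -> kb}).
Hypothesis hp : p \in [pchar k].
Hypothesis kb_algebraic : forall z : kb, algebraicOver i z.
Variable X : curve i.
Local Notation K := (gff X).
Local Notation V := (rmod (gcst X)).
Local Notation hpK := (hpK hp X).
Local Notation phi := (phi hpK).
Local Notation theta := (@theta p K).
Local Notation dlog := (@dlog p K).
Local Notation repart := (repart X).
Local Notation adele := (@adele _ _ _ X).
Implicit Types (P Q : place X) (z u v t f h : K) (s : seq (place X)) (r : repart).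

Variable x : K.
Hypothesis hx : @pbasis p K x.
Let x0 : x != 0. Proof. exact: (t_neq0 hpK hx). Qed.

Definition ldx P : K := dlog (unif P) x.

(* The Weil differential of dx/x. *)
Definition rho r : kb := \sum_(P \in [set: place X]) c0 P (unif P) (r P * ldx P).

Lemma ldx_neq0 P : ldx P != 0.
Proof.
rewrite /ldx dlogE mulf_neq0 ?invr_eq0 //; apply/eqP.
move=> /(theta_eq0 hpK (pbasis_unifE hp kb_algebraic P))[g].
exact: (pbasis_nKp hpK hx).
Qed.

Lemma c0_ldx P u : vge P 0 u -> c0 P (unif P) (u * ldx P) = rv P u * (ord P x)%:~R.
Proof. exact: (res_vge0 hp kb_algebraic x0). Qed.

Lemma finsupp_rho r : adele r -> finsupp (fun P => c0 P (unif P) (r P * ldx P)).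
Proof.
move=> [s hs]; have [l ul hl] := finsupp2 (finsupp_cnt s) (finsupp_ord x).
apply: (seq_finsupp (r := l)) => P hP; apply: hl; apply: contrapT => /not_orP[].
move=> /negP/negPn/eqP sP /negP/negPn/eqP oP; case/eqP: hP.
by rewrite c0_ldx ?oP ?mulr0 //; have := hs P; rewrite sP oppr0.
Qed.

Lemma rho_lin a r r' : adele r -> adele r' -> rho (a *: r + r') = a * rho r + rho r'.
Proof.
move=> hr hr'; rewrite /rho mulr_fsumr -fsumD.
- by apply: fsum_eq => P; rewrite -(c0Z (ord_unifE P)) -(c0D (ord_unifE P)) !fctE
    rmod_scaleE mulrDl mulrA.
- apply: finsupp_comp (finsupp_rho hr) _ => P -> //; exact: mulr0.
- exact: finsupp_rho.
Qed.

Lemma rho_cstr f : rho (cstr f) = 0.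
Proof. exact: (residue_theorem hp kb_algebraic f x0). Qed.

Lemma rho_single P u : rho (single P u) = c0 P (unif P) (u * ldx P).
Proof.
rewrite /rho (fsumE (r := [:: P])) ?big_seq1 /single ?eqxx // => Q.
rewrite inE; case: (Q == P) => //; by rewrite mul0r (c0_0 (ord_unifE Q)) eqxx.
Qed.

Lemma rho_Ad s : (forall P, ord P x != 0 -> P \in s) ->
  forall r, Ad (fun P => - cnt s P) r -> rho r = 0.
Proof.
move=> hs r hr; apply: fsum0 => P; have rP := hr P; rewrite opprK in rP.
rewrite c0_ldx; last exact: vge_leq rP.
have [oP|/hs Ps] := eqVneq (ord P x) 0; first by rewrite oP mulr0.
by rewrite rv_vge1 ?mul0r //; apply: vge_leq rP; apply: cnt_gt0.
Qed.

Lemma rho_mul_eq0 f : (forall r, adele r -> rho (fun P => f * r P) = 0) -> f = 0.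
Proof.
move=> h; apply/eqP/negPn/negP => f0; have [P _] := place_ex kb_algebraic X.
have fl0 : f * ldx P != 0 by rewrite mulf_neq0 ?ldx_neq0.
have := h _ (adele_single P (f * ldx P)^-1).
have -> : (fun Q => f * single P (f * ldx P)^-1 Q) = single P (f * (f * ldx P)^-1).
  by apply/funext => Q; rewrite /single; case: eqP => // _; rewrite mulr0.
rewrite rho_single mulrAC mulfV // (c0_vge0 (ord_unifE P)) ?vge_1 //.
by rewrite -(rmorph1 (gcst X)) rv_cst => /eqP; rewrite oner_eq0.
Qed.

(* The space of Weil differentials is of dimension one over K: by Riemann's
   inequality, 2 l(nD) exceeds the index of the divisors that bound the f la and
   the g rho for f and g in L(nD). *)
Lemma weil_eq s (la : repart -> kb) :
  (forall a r r', adele r -> adele r' -> la (a *: r + r') = a * la r + la r') ->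
  (forall r, KAd (fun P => - cnt s P) r -> adele r -> la r = 0) ->
  exists h, forall r, adele r -> la r = rho (fun P => h * r P).
Proof.
move=> la_lin la_K; have [r0 _ hr0] := finsupp_seq (finsupp_ord x).
have [c [_ riem]] := adele_index X kb_algebraic.
have [c' ind] := KAd_index X kb_algebraic.
have [P0 _] := place_ex kb_algebraic X.
pose e := s ++ r0; pose N := (c.*2 + c' + size e).+1.
have [d [dN [T [w [cT wL wi]]]]] := riem (nseq N P0).
have Nd : (N <= size d)%N.
  have := dN P0; rewrite /cnt count_nseq /= eqxx mul1n lez_nat => h.
  exact: leq_trans h (count_size _ _).
pose F (j : T + T) r := match j with inl j => la (fun P => w j * r P) | inr j => rho (fun P => w j * r P) end.
have mullin u a r r' : (fun P => u * (a *: r + r' : repart) P) =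
    a *: ((fun P => u * r P) : repart) + ((fun P => u * r' P) : repart).
  by apply/funext => P; rewrite !fctE !rmod_scaleE mulrDr mulrCA.
have mulK j r : KAd (fun P => - cnt (e ++ d) P) r -> KAd (fun P => - cnt e P) (fun P => w j * r P).
  move=> [f hf]; exists (w j * f) => P; have := hf P; rewrite !opprK cnt_cat => hP.
  have -> : ((fun P => w j * r P) - cstr (w j * f) : repart) P = w j * (r P - f).
    by rewrite mulrBr.
  have -> : cnt e P = - cnt d P + (cnt e P + cnt d P) by ring.
  by apply: vgeM hP; apply: wL.
have sube (E : seq (place X)) : (forall P, cnt E P <= cnt e P) ->
    forall r, KAd (fun P => - cnt e P) r -> KAd (fun P => - cnt E P) r.
  by move=> h r [f hf]; exists f; apply: Ad_sub hf => P; rewrite lerN2.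
have la_e r : KAd (fun P => - cnt e P) r -> adele r -> la r = 0.
  by move=> hr; apply: la_K; apply: sube hr => P; rewrite cnt_cat lerDl.
have rho_e r : KAd (fun P => - cnt e P) r -> adele r -> rho r = 0.
  move=> [f hf] ar; rewrite -[r](subrK (cstr f)) -[r - _]scale1r rho_lin; last 2 first.
  - exact: (subspaceB (adele_subspace X)) ar (adele_cstr f).
  - exact: adele_cstr.
  rewrite rho_cstr addr0 mul1r; apply: (@rho_Ad e) hf => P oP.
  by rewrite mem_cat (hr0 P oP) orbT.
have [|||||cc [[j0 cj0] hcc]] := @functionals_dep kb repart _ _ _ (T + T)%type F _ _ (ind (e ++ d)).
- exact: KAd_subspace.
- exact: adele_subspace.
- move=> [j|j] a u v hu hv; rewrite /F mullin.
    by rewrite la_lin //; apply: adele_mul.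
  by rewrite rho_lin //; apply: adele_mul.
- move=> [j|j] v hv av; rewrite /F.
    by apply: la_e; [apply: mulK|apply: adele_mul].
  by apply: rho_e; [apply: mulK|apply: adele_mul].
- by rewrite card_sum size_cat; move: Nd cT; rewrite /N; lia.
pose f : V := \sum_j cc (inl j) *: w j; pose g : V := \sum_j cc (inr j) *: w j.
have la_sum r : adele r -> la (fun P => f * r P) = \sum_j cc (inl j) * la (fun P => w j * r P).
  move=> ar; have -> : (fun P => f * r P) = \sum_j cc (inl j) *: ((fun P => w j * r P) : repart).
    apply/funext => P; rewrite fct_sumE /f mulr_suml; apply: eq_bigr => j _.
    by rewrite !fctE !rmod_scaleE mulrA.
  rewrite (@linear_on_sum kb repart kb^o adele la) //; first exact: adele_subspace.
  by move=> j; apply: adele_mul.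
have rho_sum r : adele r -> rho (fun P => g * r P) = \sum_j cc (inr j) * rho (fun P => w j * r P).
  move=> ar; have -> : (fun P => g * r P) = \sum_j cc (inr j) *: ((fun P => w j * r P) : repart).
    apply/funext => P; rewrite fct_sumE /g mulr_suml; apply: eq_bigr => j _.
    by rewrite !fctE !rmod_scaleE mulrA.
  rewrite (@linear_on_sum kb repart kb^o adele rho) //; first exact: adele_subspace.
    by move=> a u v; apply: rho_lin.
  by move=> j; apply: adele_mul.
have rel r : adele r -> la (fun P => f * r P) + rho (fun P => g * r P) = 0.
  by move=> ar; rewrite la_sum // rho_sum // -[RHS](hcc r ar) big_sumType.
have la0 : la 0 = 0.
  have [a0 _] := adele_subspace X.
  by have := la_lin (-1) 0 0 a0 a0; rewrite scaler0 addr0 mulN1r addNr.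
have f0 : f != 0.
  apply/eqP => f0; have g0 : g = 0.
    apply: rho_mul_eq0 => r ar; have := rel r ar.
    have -> : (fun P => f * r P) = (0 : repart) by apply/funext => P; rewrite f0 mul0r.
    by rewrite la0 add0r.
  by case: j0 cj0 => j; rewrite ?(wi _ f0) ?(wi _ g0) eqxx.
exists (- g / f) => r ar; have := rel _ (adele_mul f^-1 ar).
have -> : (fun P => f * (f^-1 * r P)) = r by apply/funext => P; rewrite mulVKf.
move=> /eqP; rewrite addr_eq0 => /eqP->.
have -> : (fun P => - g / f * r P) = - ((fun P => g * (f^-1 * r P)) : repart).
  by apply/funext => P; rewrite !fctE mulNr mulNr mulrA.
have [a0 _] := adele_subspace X.
rewrite -[- (_ : repart)]addr0 -scaleN1r rho_lin //; last exact/adele_mul/adele_mul.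
by rewrite -[X in _ + rho X]/(cstr 0) rho_cstr addr0 mulN1r.
Qed.

(* ldx P is the quotient of dx/x by dt/t, with t = unif P; so h dx/x is regular at P
   if and only if h * ldx P vanishes there. *)
Definition regdiff h := forall P, vge P 1 (h * ldx P).

Lemma ldxE P z : z != 0 -> dlog (unif P) z = theta x z / z * ldx P.
Proof.
move=> z0; rewrite /ldx !dlogE (theta_change hpK z (pbasis_unifE hp kb_algebraic P) hx).
by rewrite mulrAC.
Qed.

Lemma phi_ldx P h : phi x h * ldx P = phi (unif P) (h * ldx P).
Proof.
rewrite /ldx dlogE (phi_change hpK (@gff_Kp_dep _ _ _ _ hp kb_algebraic X)) //.
exact: pbasis_unifE.
Qed.

Lemma regdiff_phi h : regdiff h -> regdiff (phi x h).
Proof.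
move=> rh P; rewrite phi_ldx; apply: (vge_phi hp kb_algebraic (ord_unifE P) (rh P)).
by rewrite subrr mul0r.
Qed.

Lemma regdiffD h h' : regdiff h -> regdiff h' -> regdiff (h + h').
Proof. by move=> rh rh' P; rewrite mulrDl; apply: vgeD. Qed.

Lemma regdiffZ c h : regdiff h -> regdiff (gcst X c * h).
Proof. by move=> rh P; rewrite -mulrA; apply: vgeMl => //; apply: vge_cst. Qed.

(** Regular differentials give functionals on the adeles modulo K + A(0), faithfully by
    [rho_mul_eq0], and this quotient is finite-dimensional. *)
Lemma regdiff_dim : exists n : nat, forall h : 'I_n.+1 -> K, (forall j, regdiff (h j)) ->
  exists c : 'I_n.+1 -> kb, (exists j, c j != 0) /\ \sum_j gcst X (c j) * h j = 0.
Proof.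
have [n [sp _]] := adele_index X kb_algebraic; exists n => h rh.
have mullin u a r r' : (fun P => u * (a *: r + r' : repart) P) =
    a *: ((fun P => u * r P) : repart) + ((fun P => u * r' P) : repart).
  by apply/funext => P; rewrite !fctE !rmod_scaleE mulrDr mulrCA.
have rho0 j r : Ad (fun=> 0) r -> rho (fun P => h j * r P) = 0.
  move=> hr; apply: fsum0 => P; rewrite mulrAC (c0_vge1 (ord_unifE P)) //.
  by apply: vgeMr; [apply: rh|have := hr P; rewrite oppr0].
have [|||||c [cj hc]] := @functionals_dep kb repart _ _ _ 'I_n.+1
    (fun j r => rho (fun P => h j * r P)) _ _ sp.
- exact: KAd_subspace.
- exact: adele_subspace.
- by move=> j a u v hu hv; rewrite mullin rho_lin //; apply: adele_mul.
- move=> j v [f hf] av; rewrite -[v](subrK (cstr f)) -[v - _]scale1r mullin rho_lin.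
  + by rewrite rho0 // -[X in _ + rho X]/(cstr (h j * f)) rho_cstr addr0 mulr0.
  + exact/adele_mul/adele_Ad0.
  + exact/adele_mul/adele_cstr.
- by rewrite card_ord.
exists c; split=> //; apply: rho_mul_eq0 => r ar; rewrite -[RHS](hc r ar).
have -> : (fun P => (\sum_j gcst X (c j) * h j) * r P) =
    \sum_j c j *: ((fun P => h j * r P) : repart).
  apply/funext => P; rewrite fct_sumE mulr_suml; apply: eq_bigr => j _.
  by rewrite !fctE !rmod_scaleE mulrA.
rewrite (@linear_on_sum kb repart kb^o adele rho) //; first exact: adele_subspace.
  by move=> a u v; apply: rho_lin.
by move=> j; apply: adele_mul.
Qed.

End WeilDifferentials.

(** * The Jacobian *)

Lemma functional_extend (F : fieldType) (V : lmodType F) (S1 S : set V) n (mu : V -> F) :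
  subspace S1 -> subspace S -> S1 `<=` S -> spans S1 S n ->
  (forall (a : F) u v, S1 u -> S1 v -> mu (a *: u + v) = a * mu u + mu v) ->
  exists la : V -> F, (forall v, S1 v -> la v = mu v) /\
    forall (a : F) u v, S u -> S v -> la (a *: u + v) = a * la u + la v.
Proof.
move=> hS1 hS S1S /(spans_basis hS1)[m [w [_ Sw iw hw]]] mu_lin.
have /choice[c hc] : forall v, exists c : 'I_m -> F, S v -> S1 (v - \sum_j c j *: w j).
  move=> v; have [/hw[c hc]|nS] := pselect (S v); first by exists c.
  by exists (fun=> 0).
have cuniq v (c1 c2 : 'I_m -> F) : S1 (v - \sum_j c1 j *: w j) -> S1 (v - \sum_j c2 j *: w j) -> c1 =1 c2.
  move=> h1 h2 j; apply/eqP; rewrite -subr_eq0; apply/eqP.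
  apply: (iw (fun j => c1 j - c2 j)); have := subspaceB hS1 h2 h1.
  congr S1; rewrite opprB addrC addrA subrK -sumrB.
  by apply: eq_bigr => l _; rewrite scalerBl.
pose red v := v - \sum_j c v j *: w j; exists (mu \o red).
have redS v : S v -> S1 (red v) by apply: hc.
split=> [v Sv|a u v Su Sv] /=.
  rewrite /red big1 ?subr0 // => j _; rewrite (@cuniq v (c v) (fun=> 0)) ?scale0r //.
    exact/hc/S1S.
  by rewrite big1 ?subr0 // => l _; rewrite scale0r.
rewrite -mu_lin //; try exact: redS; congr mu; rewrite /red scalerBr addrACA -opprD.
congr (_ - _); rewrite scaler_sumr -big_split; apply: eq_bigr => j _ /=.
rewrite scalerA -scalerDl; congr (_ *: _).
apply: (@cuniq (a *: u + v) _ (fun j => a * c u j + c v j)).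
  by apply: hc; have [_] := hS; apply.
have := subspaceD hS1 (subspaceZ a hS1 (redS u Su)) (redS v Sv); congr S1.
rewrite /red scalerBr addrACA -opprD; congr (_ - _).
rewrite scaler_sumr -big_split; apply: eq_bigr => l _ /=.
by rewrite scalerA -scalerDl.
Qed.

(** Normalize a relation so that its last coefficient is 1 and subtract its image under f: the last
    term disappears. Either a shorter nontrivial relation remains, or all coefficients satisfy d ^ p
    = d and lie in F_p. *)
Lemma fixed_dep (p : nat) (kb : closedFieldType) (K : fieldType) (cst : {rmorphism kb -> K})
    (hp : p \in [pchar kb]) (f : K -> K) n (h : 'I_n -> K) (c : 'I_n -> kb) :
  (forall u v, f (u + v) = f u + f v) ->
  (forall c u, f (cst (c ^+ p) * u) = cst c * f u) ->
  (forall j, f (h j) = h j) -> (exists j, c j != 0) ->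
  \sum_j cst (c j) * h j = 0 ->
  exists m : 'I_n -> nat, [/\ forall j, (m j < p)%N, exists j, (0 < m j)%N &
    \sum_j (m j)%:R * h j = 0].
Proof.
move=> fD fM; have f0 : f 0 = 0 by apply: (addrI (f 0)); rewrite -fD !addr0.
elim: n h c => [|n IHn] h c fh [j0 cj0] hc; first by case: j0 cj0.
have short (d : 'I_n -> kb) : (exists j, d j != 0) ->
    \sum_j cst (d j) * h (lift ord_max j) = 0 ->
    exists m : 'I_n.+1 -> nat, [/\ forall j, (m j < p)%N, exists j, (0 < m j)%N &
      \sum_j (m j)%:R * h j = 0].
  move=> dj hd; have [|m [mp [j mj] hm]] := IHn _ _ _ dj hd; first by move=> j; apply: fh.
  exists (fun j => if unlift ord_max j is Some l then m l else 0%N); split.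
  - by move=> l; case: unlift => // ; apply: p_gt0 hp.
  - by exists (lift ord_max j); rewrite liftK.
  rewrite (bigD1 ord_max) //= unlift_none mul0r add0r -[RHS]hm.
  rewrite big_mkcond (bigD1 ord_max) //= eqxx add0r.
  rewrite (reindex_omap (lift ord_max) (unlift ord_max)) /=; last first.
    by move=> l; case: unliftP => [l' ->|->]; rewrite ?eqxx.
  apply: eq_big => [l|l _]; first by rewrite liftK eq_sym neq_lift eqxx.
  by rewrite liftK eq_sym neq_lift.
have recr (d : 'I_n.+1 -> kb) : \sum_j cst (d j) * h j =
    \sum_(j < n) cst (d (lift ord_max j)) * h (lift ord_max j) + cst (d ord_max) * h ord_max.
  rewrite big_ord_recr /=; congr (_ + _); apply: eq_bigr => j _.
  by have -> : widen_ord (leqnSn n) j = lift ord_max j by apply/val_inj; rewrite /= /bump leqNgt ltn_ord.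
have [cn0|cn] := eqVneq (c ord_max) 0.
  apply: (short (fun j => c (lift ord_max j))).
    case: (unliftP ord_max j0) cj0 => [l ->|->]; first by exists l.
    by rewrite cn0 eqxx.
  by have := hc; rewrite recr cn0 rmorph0 mul0r addr0.
pose d j := c j / c ord_max; have dn : d ord_max = 1 by rewrite /d mulfV.
have hd : \sum_j cst (d j) * h j = 0.
  transitivity (cst (c ord_max)^-1 * \sum_j cst (c j) * h j); last by rewrite hc mulr0.
  by rewrite mulr_sumr; apply: eq_bigr => j _; rewrite /d rmorphM -mulrA mulrCA.
have hd' : \sum_j cst (proot hp (d j)) * h j = 0.
  rewrite -[RHS]f0 -[in RHS]hd (big_morph f fD f0).
  by apply: eq_bigr => j _; rewrite -{2}(prootK hp (d j)) fM fh.
have rn : proot hp (d ord_max) = 1.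
  by apply: (fr_inj hp); rewrite prootK dn expr1n.
have [all0|nall] := pselect (forall j : 'I_n, d (lift ord_max j) - proot hp (d (lift ord_max j)) = 0).
  have /choice[m hm] : forall j, exists m, (m < p)%N /\ d j = m%:R.
    move=> j; have [|m mp dm] := @fr_fixed p kb hp (d j); last by exists m.
    rewrite -[in RHS](prootK hp (d j)); congr (_ ^+ p).
    case: (unliftP ord_max j) => [l ->|->]; last by rewrite rn dn.
    by apply/eqP; rewrite -subr_eq0 all0.
  exists m; split=> [j||]; first by have [] := hm j.
    exists ord_max; rewrite lt0n; apply/eqP => m0; have [_] := hm ord_max.
    by rewrite dn m0 => /eqP; rewrite oner_eq0.
  rewrite -[RHS]hd; apply: eq_bigr => j _.
  by have [_ ->] := hm j; rewrite rmorph_nat.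
apply: (short (fun j => d (lift ord_max j) - proot hp (d (lift ord_max j)))).
  apply: contrapT => nex; apply: nall => j; apply/eqP/negPn/negP => hj.
  by apply: nex; exists j.
have := congr2 (fun u v => u - v) hd hd'; rewrite !recr /= rn dn !rmorph1 subr0 => {2}<-.
rewrite opprD addrACA subrr addr0 -sumrB; apply: eq_bigr => j _.
by rewrite rmorphB mulrBl.
Qed.

Section Jacobian.
Variables (k : fieldType) (kb : closedFieldType) (i : {rmorphism k -> kb}).
Variable X : curve i.
Local Notation K := (gff X).
Implicit Types (P Q : place X) (f : K) (D E : div0 X) (x : jac X) (B : place X -> int).

Lemma div0P D : finsupp D /\ \sum_(P \in [set: place X]) D P = 0.
Proof. by have /asboolP := valP D. Qed.

Lemma div0_ex B : finsupp B -> \sum_(P \in [set: place X]) B P = 0 ->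
  exists D : div0 X, forall P, D P = B P.
Proof.
by move=> fB sB; have hB : div_pred B by [apply/asboolP]; exists (Div0 hB).
Qed.

Lemma div0D D E P : (D + E) P = D P + E P. Proof. by []. Qed.
Lemma div0N D P : (- D) P = - D P. Proof. by []. Qed.
Lemma div0Mn D n P : (D *+ n) P = D P *+ n.
Proof. by elim: n => // n IHn; rewrite !mulrS div0D IHn. Qed.

Local Notation cls := (\pi_(jac X)%qT : div0 X -> jac X).

Lemma cls_ex x : exists D, x = cls D.
Proof. by exists (repr x); rewrite reprK. Qed.

Lemma clsD D E : cls (D + E) = cls D + cls E. Proof. exact: Quotient.pi_add. Qed.
Lemma clsN D : cls (- D) = - cls D. Proof. exact: Quotient.pi_opp. Qed.
Lemma cls0 : cls 0 = 0. Proof. by apply: (addrI (cls 0)); rewrite -clsD !addr0. Qed.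
Lemma clsB D E : cls (D - E) = cls D - cls E. Proof. by rewrite clsD clsN. Qed.
Lemma clsMn D n : cls (D *+ n) = cls D *+ n.
Proof. by elim: n => [|n IHn]; rewrite ?cls0 // !mulrS clsD IHn. Qed.

Lemma cls_eq0 D : cls D = 0 <-> exists2 f, f != 0 & forall P, D P = ord P f.
Proof.
split.
  rewrite -cls0 => /eqP; rewrite -Quotient.idealrBE subr0.
  by move=> /asboolP[f [f0 h]]; exists f.
move=> [f f0 h]; rewrite -cls0; apply/eqP; rewrite -Quotient.idealrBE subr0.
by apply/asboolP; exists f.
Qed.

Lemma cls_eq D E : cls D = cls E <-> exists2 f, f != 0 & forall P, D P = E P + ord P f.
Proof.
split=> [h|[f f0 h]].
  have [|f f0 hf] := (cls_eq0 (D - E)).1; first by rewrite clsB h subrr.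
  by exists f => // P; rewrite -hf div0D div0N addrC subrK.
apply/eqP; rewrite -subr_eq0 -clsB; apply/eqP/cls_eq0; exists f => // P.
by rewrite div0D div0N h addrAC subrr add0r.
Qed.

Lemma jtors_cls p D : jtors p (cls D) <-> exists2 f, f != 0 & forall P, D P *+ p = ord P f.
Proof.
rewrite /jtors /= -clsMn; split=> [/cls_eq0|] [f f0 h]; first by exists f => // P; rewrite -div0Mn.
by apply/cls_eq0; exists f => // P; rewrite div0Mn.
Qed.

End Jacobian.

(** * Divisibility of Pic^0 by p and finiteness of the p-torsion *)

Section Divisibility.
Variables (p : nat) (k : fieldType) (kb : closedFieldType) (i : {rmorphism k -> kb}).
Hypothesis hp : p \in [pchar k].
Hypothesis kb_algebraic : forall z : kb, algebraicOver i z.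
Variable X : curve i.
Local Notation K := (gff X).
Local Notation hpK := (hpK hp X).
Local Notation phi := (phi hpK).
Local Notation theta := (@theta p K).
Local Notation dlog := (@dlog p K).
Local Notation repart := (repart X).
Local Notation adele := (@adele _ _ _ X).
Local Notation ldx := (ldx p).
Local Notation rho := (rho p).
Implicit Types (P Q : place X) (B : place X -> int).

Lemma pbasis_ex : exists x : K, @pbasis p K x.
Proof.
by have [P _] := place_ex kb_algebraic X; exists (unif P); apply: pbasis_unifE.
Qed.

(* A differential with simple poles of residue B P at P. *)
Lemma diff_of_residues (x : K) B : @pbasis p K x -> finsupp B ->
  \sum_(P \in [set: place X]) B P = 0 ->
  exists h, forall P, vge P 1 (h * ldx x P - gcst X (B P)%:~R).
Proof.
(* This functional on A(0) prescribes the residues. As B has degree zero it kills the constants, so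
   it extends to K + A(0) by zero on K, and then to all adeles; the extension is h times the Weil
   differential [rho]. *)
move=> hx fB sB; pose mu (r : repart) : kb := \sum_(P \in [set: place X]) (B P)%:~R * rv P (r P).
have fmu r : finsupp (fun P => (B P)%:~R * rv P (r P) : kb).
  by apply: finsupp_comp fB _ => P ->; rewrite mul0r.
have A0 r P : Ad (fun=> 0) r -> vge P 0 (r P) by move=> /(_ P); rewrite oppr0.
have mu_lin (a : kb) (r r' : repart) : Ad (fun=> 0) r -> Ad (fun=> 0) r' ->
    mu (a *: r + r') = a * mu r + mu r'.
  move=> hr hr'; rewrite /mu mulr_fsumr -fsumD //; last first.
    by apply: finsupp_comp (fmu r) _ => P ->; rewrite mulr0.
  apply: fsum_eq => P; rewrite !fctE rmod_scaleE rvD ?rvM ?rv_cst; try exact: A0; try exact: vge_cst.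
    by rewrite mulrDr mulrCA.
  by apply: vgeMl; [apply: vge_cst|apply: A0].
have mu_cst c : mu (cstr (gcst X c)) = 0.
  rewrite /mu; transitivity (\sum_(P \in [set: place X]) (B P)%:~R * c).
    by apply: fsum_eq => P; rewrite /cstr rv_cst.
  rewrite (@fsum_additive _ _ _ (fun n : int => n%:~R * c)) ?sB ?mul0r //.
  by move=> m n; rewrite rmorphD mulrDl.
have /choice[q hq] : forall r : repart, exists f, KAd (fun=> 0) r -> Ad (fun=> 0) (r - cstr f).
  move=> r; have [[f hf]|n] := pselect (KAd (fun=> 0) r); first by exists f.
  by exists 0.
have mu_q r f : Ad (fun=> 0) (r - cstr f) -> mu (r - cstr (q r)) = mu (r - cstr f).
  move=> hf; have hqr : Ad (fun=> 0) (r - cstr (q r)) by apply: hq; exists f.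
  have [|c fc] := @no_pole_const _ _ _ X (f - q r).
    move=> P; have -> : f - q r = (r - cstr (q r)) P - (r - cstr f) P.
      by rewrite !fctE /cstr; ring.
    by apply: vgeB; apply: A0.
  have -> : r - cstr (q r) = 1 *: (r - cstr f) + cstr (gcst X c).
    by rewrite -fc scale1r; apply/funext => P; rewrite !fctE /cstr; ring.
  by rewrite mu_lin ?mu_cst ?mul1r ?addr0 // => P; rewrite oppr0; apply: vge_cst.
have [n0 [sp _]] := adele_index X kb_algebraic.
have [||||la [la_mu la_lin]] := @functional_extend kb repart _ _ _ (fun r => mu (r - cstr (q r))) _ _ _ sp.
- exact: KAd_subspace.
- exact: adele_subspace.
- exact: KAd_adele.
- move=> a u v hu hv; rewrite (@mu_q _ (gcst X a * q u + q v)).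
    rewrite -mu_lin; try exact: hq; congr mu; apply/funext => P.
    by rewrite !fctE /cstr !rmod_scaleE; ring.
  have [_ h] := Ad_subspace (X := X) (fun=> 0); have := h a _ _ (hq _ hu) (hq _ hv); congr Ad.
  by apply/funext => P; rewrite !fctE /cstr !rmod_scaleE; ring.
have la_Ad r : Ad (fun=> 0) r -> la r = mu r.
  move=> hr; rewrite la_mu; last exact: Ad_KAd.
  by have := @mu_q r 0; rewrite -[cstr 0]/(0 : repart) subr0; apply.
have [e _ he] := finsupp_seq fB.
have [|h hh] := @weil_eq _ _ _ _ hp kb_algebraic _ _ hx e la la_lin.
  move=> r [f hf] ar; rewrite la_mu; last first.
    by exists f; apply: Ad_sub hf => P; rewrite oppr_le0.
  rewrite (@mu_q _ f); last by apply: Ad_sub hf => P; rewrite oppr_le0.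
  apply: fsum0 => P; have [->|/he Pe] := eqVneq (B P) 0; first by rewrite mul0r.
  rewrite rv_vge1 ?mulr0 //; apply: vge_leq (hf P); rewrite opprK; exact: cnt_gt0.
exists h => P; set A := h * ldx x P.
have key u : vge P 0 u -> c0 P (unif P) (u * A) = (B P)%:~R * rv P u.
  move=> hu; have := hh _ (adele_single P u); rewrite la_Ad; last first.
    by move=> Q; rewrite oppr0 /single; case: eqP => [->|_] //; apply: vge0.
  have -> : (fun Q => h * single P u Q) = single P (h * u).
    by apply/funext => Q; rewrite /single; case: eqP => // _; rewrite mulr0.
  rewrite rho_single mulrAC mulrC => <-; rewrite /mu (fsumE (r := [:: P])) ?big_seq1 /single ?eqxx // => Q.
  rewrite inE; case: (Q == P) => //.
  by rewrite (_ : rv Q 0 = 0) ?mulr0 ?eqxx // -(rmorph0 (gcst X)) rv_cst.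
have A_reg : vge P 0 A.
  apply: contrapT => nA; have A0' : A != 0 by apply: contra_notN nA => /eqP->; apply: vge0.
  have oA : ord P A < 0 by rewrite ltNge; apply/negP; rewrite -vge_reg.
  pose u := A^-1; have ou : 0 < ord P u by rewrite ord_inv; lia.
  have hu : vge P 1 u by rewrite vgeE ?invr_eq0 //; lia.
  have := key u (vge_leq (ler01) hu); rewrite mulVf // (rv_vge1 hu) mulr0.
  rewrite (c0_vge0 (ord_unifE P)) ?vge_1 // -(rmorph1 (gcst X)) rv_cst => /eqP.
  by rewrite oner_eq0.
have := rvP A_reg; have := key 1 (vge_1 P).
rewrite mul1r (c0_vge0 (ord_unifE P)) // => ->.
by rewrite -(rmorph1 (gcst X)) rv_cst mulr1.
Qed.

(** A differential with simple poles and residues B can be corrected by a regular one into a fixed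
    point of the Cartier operator, that is some df / f; the orders of f then agree with B modulo
    p. *)
Theorem div_p_divisible B : finsupp B -> \sum_(P \in [set: place X]) B P = 0 ->
  exists (f : K) (D : div0 X), f != 0 /\ forall P, B P = ord P f + D P *+ p.
Proof.
move=> fB sB; have [x hx] := pbasis_ex.
have [h hh] := diff_of_residues hx fB sB.
(* Integers are their own p-th roots in kb, so phi h has the same residues as h and the difference
   is regular. *)
have BP (n : int) : proot (hpkb i hp) n%:~R = n%:~R.
  by apply: (fr_inj (hpkb i hp)); rewrite prootK -(pFrobenius_autE (hpkb i hp)) rmorph_int.
have rw : regdiff p x (phi x h - h).
  move=> P; have ou := ord_unifE P; have hu := pbasis_unifE hp kb_algebraic P.
  rewrite mulrBl (phi_ldx hp kb_algebraic hx).
  have -> : h * ldx x P = (h * ldx x P - gcst X (B P)%:~R) + gcst X (B P)%:~R by rewrite subrK.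
  set A := h * ldx x P - _; rewrite (phiD hpK hu).
  have -> : phi (unif P) (gcst X (B P)%:~R) = gcst X (B P)%:~R.
    rewrite -[X in phi _ X]mulr1 -{1}(prootK (hpkb i hp) (B P)%:~R) (phi_cst hp _ _ hu) BP.
    by have := phi_Kp hpK hu 1; rewrite expr1n => ->; rewrite mulr1.
  rewrite opprD addrACA subrr addr0; apply: vgeB (hh P).
  by apply: (vge_phi hp kb_algebraic ou (hh P)); rewrite subrr mul0r.
have [n [a rel]] := phi_locally_finite hp (phi x h - h) hx.
have [b /=] := semilinear_solve (hpkb i hp) (phiD hpK hx) (fun c u => phi_cst hp c u hx) rel.
set eta := \sum_(j < n) _ => heta.
have reta : regdiff p x eta.
  rewrite /eta; elim: (index_enum _) => [|j l IH].
    by rewrite big_nil => P; rewrite mul0r vge0.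
  rewrite big_cons; apply: regdiffD IH.
  apply: regdiffZ; elim: (nat_of_ord j) => //= m.
  exact: (regdiff_phi hp kb_algebraic hx).
have fix_h : phi x (h + eta) = h + eta.
  rewrite (phiD hpK hx); apply/eqP; rewrite -subr_eq0; apply/eqP.
  have -> : phi x eta = eta - (phi x h - h) by rewrite -heta; ring.
  ring.
have [f f0 hf] := dlog_of_phi (@gff_Kp_dep _ _ _ _ hp kb_algebraic X) hx fix_h.
have modp P : exists d : int, B P = ord P f + d *+ p.
  have [_ rvf] := rv_dlog hp kb_algebraic (ord_unifE P) f0.
  have rvB : rv P (dlog (unif P) f) = (B P)%:~R.
    apply: rv_eq; rewrite (ldxE hp kb_algebraic hx _ f0) hf mulfK // mulrDl addrAC.
    exact: vgeD (hh P) (reta P).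
  have : (ord P f - B P)%:~R = 0 :> kb by rewrite rmorphB /= -rvf rvB subrr.
  move=> /eqP; rewrite -(dvdz_pcharf (hpkb i hp)) => /dvdzP[d hd]; exists (- d).
  by rewrite mulNrn -mulr_natr natz -hd; ring.
have /choice[d hd] := modp.
have fd : finsupp d.
  have [l ul hl] := finsupp2 fB (finsupp_ord f); apply: (seq_finsupp (r := l)) => P dP.
  apply: hl; apply: contrapT => /not_orP[/negP/negPn/eqP BP0 /negP/negPn/eqP oP].
  have := hd P; rewrite BP0 oP add0r => /esym/eqP; rewrite mulrn_eq0 (negPf dP) orbF.
  by rewrite eqn0Ngt (p_gt0 hp).
have [|D hD] := div0_ex fd.
  have := fsum_eq hd; rewrite sB fsumD ?deg_ord ?add0r; [|exact: finsupp_ord|]; last first.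
    by apply: finsupp_comp fd _ => P ->; rewrite mul0rn.
  rewrite (@fsum_additive _ _ _ (fun n : int => n *+ p)) ?mul0rn //; last by move=> u v; rewrite mulrnDl.
  by move=> /esym/eqP; rewrite mulrn_eq0 eqn0Ngt (p_gt0 hp) => /eqP.
by exists f, D; split=> // P; rewrite hd hD.
Qed.

(** The class of D, with p D = div f, is sent to df / f, a regular differential fixed by the Cartier
    operator. Such differentials, when dependent over kb, are dependent over F_p, and df / f = 0
    only if f is a p-th power. *)
Theorem jtors_dep : exists n : nat, forall x : 'I_n.+1 -> jac X, (forall j, jtors p (x j)) ->
  exists m : 'I_n.+1 -> nat, [/\ forall j, (m j < p)%N, exists j, (0 < m j)%N &
    \sum_j x j *+ m j = 0].
Proof.
have [x hx] := pbasis_ex; have [n hn] := regdiff_dim hp kb_algebraic hx; exists n => y hy.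
have /choice[D hD] := fun j => cls_ex (y j).
have /choice[f hf] : forall j, exists f : K, f != 0 /\ forall P, D j P *+ p = ord P f.
  by move=> j; have := hy j; rewrite hD => /jtors_cls[f f0 h]; exists f.
have f0 j : f j != 0 by have [] := hf j.
pose h j := dlog x (f j).
have [|c [cj hc]] := hn h.
  move=> j P; rewrite -(ldxE hp kb_algebraic hx _ (f0 j)).
  have [v0 vv] := rv_dlog hp kb_algebraic (ord_unifE P) (f0 j); apply: (rv_eq0 v0).
  by rewrite vv; have [_ <-] := hf j; rewrite -mulr_natr rmorphM /= rmorph_nat (pcharf0 (hpkb i hp)) mulr0.
have [||m [mp mj hm]] := fixed_dep (hpkb i hp) (phiD hpK hx) _ _ cj hc.
- by move=> a u; apply: phi_cst.
- by move=> j; apply: phi_dlog => //; apply: gff_Kp_dep.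
exists m; split=> //; pose F := \prod_j f j ^+ m j.
have [F0 dF] : F != 0 /\ dlog x F = \sum_j (m j)%:R * h j.
  rewrite /F; elim: (index_enum _) => [|j l [l0 IH]].
    by rewrite !big_nil (dlog1 hpK hx) oner_neq0.
  rewrite !big_cons (dlogM hpK hx) ?expf_neq0 // (dlogX hpK hx) // IH; split=> //.
  by rewrite mulf_neq0 ?expf_neq0.
have [|g Fg] := theta_eq0 hpK hx (z := F).
  by move: dF; rewrite hm dlogE => /eqP; rewrite mulf_eq0 invr_eq0 (negPf F0) orbF => /eqP.
have g0 : g != 0 by apply: contra_neq F0 => g0; rewrite Fg g0 (fr0 hpK).
have -> : \sum_j y j *+ m j = \pi_(jac X)%qT (\sum_j D j *+ m j).
  rewrite (big_morph (\pi_(jac X)%qT : div0 X -> jac X) (@clsD _ _ _ X) (@cls0 _ _ _ X)).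
  by apply: eq_bigr => j _; rewrite clsMn -hD.
apply/cls_eq0; exists g => // P.
have : ord P F = (\sum_j D j *+ m j) P *+ p.
  rewrite /F ord_prod; last by move=> j; rewrite expf_neq0.
  elim: (index_enum _) => [|j l IH]; first by rewrite !big_nil mul0rn.
  rewrite !big_cons div0D mulrnDl IH div0Mn ordX //; congr (_ + _).
  by have [_ <-] := hf j; rewrite mulrnAC.
rewrite Fg ordX // => /(pmulrnI (p_gt0 hp)) //.
Qed.

End Divisibility.

(** * Cyclic covers *)

Section Unipotent.
Variables (p : nat) (V : zmodType) (g : V -> V).
Hypothesis pr : prime p.
Hypothesis gD : forall u v, g (u + v) = g u + g v.

Implicit Types (u v z : V).

Definition dif u := g u - u.

(* The action on V of F_p[T], with T acting as g; it is an action on elements whose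
   orbit is killed by p. *)
Definition pact (q : {poly 'F_p}) z := \sum_(j < size q) iter j g z *+ (q`_j)%R.

Lemma mulrn_modp z n : z *+ p = 0 -> z *+ (n %% p) = z *+ n.
Proof.
by move=> zp; rewrite [in RHS](divn_eq n p) mulrnDr mulnC mulrnA zp mul0rn add0r.
Qed.

Lemma mulrn_FpD z (a b : 'F_p) : z *+ p = 0 -> z *+ (a + b)%R = z *+ a + z *+ b.
Proof.
move=> zp; rewrite -mulrnDr -[RHS]mulrn_modp //.
by have -> : (a + b)%R = (a + b)%N%:R :> 'F_p; rewrite ?val_Fp_nat // natrD !natr_Zp.
Qed.

Lemma pact_wide (q : {poly 'F_p}) n z : (size q <= n)%N ->
  pact q z = \sum_(j < n) iter j g z *+ (q`_j)%R.
Proof.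
move=> sq; rewrite /pact (big_ord_widen n (fun j => iter j g z *+ (q`_j)%R) sq) big_mkcond.
by apply: eq_bigr => j _; case: ltnP => // /(nth_default 0) ->.
Qed.

Let g0 : g 0 = 0. Proof. by apply: (addrI (g 0)); rewrite -gD !addr0. Qed.
Let gMn u n : g (u *+ n) = g u *+ n.
Proof. by elim: n => // n IHn; rewrite !mulrS gD IHn. Qed.

Section Orbit.
Variable z : V.
Hypothesis zp : forall j, iter j g z *+ p = 0.

Lemma pactD (q r : {poly 'F_p}) : pact (q + r) z = pact q z + pact r z.
Proof.
rewrite !(@pact_wide _ (maxn (size q) (size r))) ?size_polyD ?leq_maxl ?leq_maxr //.
by rewrite -big_split; apply: eq_bigr => j _; rewrite coefD mulrn_FpD.
Qed.

Lemma pact0 : pact 0 z = 0. Proof. by rewrite /pact size_poly0 big_ord0. Qed.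

Lemma pactN (q : {poly 'F_p}) : pact (- q) z = - pact q z.
Proof. by apply/eqP; rewrite -addr_eq0 -pactD addNr pact0. Qed.

Lemma pactMX (q : {poly 'F_p}) : pact (q * 'X) z = g (pact q z).
Proof.
rewrite (@pact_wide _ (size q).+1); last first.
  by have [->|q0] := eqVneq q 0; rewrite ?mul0r ?size_poly0 // size_mulX.
rewrite big_ord_recl coefMX /= mulr0n add0r /pact (big_morph g gD g0).
by apply: eq_bigr => j _; rewrite coefMX /= gMn.
Qed.

Lemma pact1 : pact 1 z = z.
Proof.
rewrite (@pact_wide _ 1) ?size_poly1 // big_ord1 coef1 /=.
by rewrite modn_small ?mulr1n // Fp_cast ?prime_gt1.
Qed.

Lemma pactXn n : pact 'X^n z = iter n g z.
Proof. by elim: n => [|n IHn]; rewrite ?expr0 ?pact1 // exprSr pactMX IHn. Qed.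

Lemma iter_dif n : iter n dif z = pact (('X - 1) ^+ n) z.
Proof.
elim: n => [|n IHn]; first by rewrite expr0 pact1.
by rewrite /= IHn exprSr mulrBr mulr1 pactD pactN pactMX.
Qed.

Let X1p : ('X - 1) ^+ p = 'X^p - 1 :> {poly 'F_p}.
Proof.
have hq : p \in [pchar {poly 'F_p}] by rewrite (rmorph_pchar polyC) // pchar_Fp.
by rewrite -!(pFrobenius_autE hq) rmorphB rmorph1.
Qed.

Lemma iter_dif_p : iter p dif z = iter p g z - z.
Proof. by rewrite iter_dif X1p pactD pactN pact1 pactXn. Qed.

Lemma iter_dif_p1 : iter p.-1 dif z = \sum_(j < p) iter j g z.
Proof.
rewrite iter_dif (_ : ('X - 1) ^+ p.-1 = \sum_(j < p) 'X^j).
  by rewrite (big_morph (fun q => pact q z) pactD pact0); apply: eq_bigr => j _; rewrite pactXn.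
have X1 : 'X - 1 != 0 :> {poly 'F_p} by rewrite monic_neq0 // -polyC1 monicXsubC.
by apply: (mulfI X1); rewrite -exprS prednK ?prime_gt0 // X1p -subrX1.
Qed.

(** Since (g - 1) ^ p = g ^ p - 1, the operator g - 1 is nilpotent on the orbit of z. The last
    nonzero iterate is fixed by g; additive and multiplicative Hilbert 90 both follow from this. *)
Lemma unipotent : iter p g z = z -> z != 0 ->
  exists n, iter n dif z != 0 /\ iter n.+1 dif z = 0.
Proof.
move=> gz z0; have dp : iter p dif z = 0 by rewrite iter_dif_p gz subrr.
apply: contrapT => h; suff : iter p dif z != 0 by rewrite dp eqxx.
elim: {1}p => // n IHn; apply/eqP => dn; apply: h; by exists n.
Qed.

End Orbit.

End Unipotent.

Lemma interpolation (F : fieldType) (x v : nat -> F) n :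
  (forall j l, (j < n)%N -> (l < n)%N -> j != l -> x j != x l) ->
  exists2 q : {poly F}, (size q <= n)%N & forall j, (j < n)%N -> q.[x j] = v j.
Proof.
elim: n => [|n IHn] xi; first by exists 0; rewrite ?size_poly0.
have [j l jn ln|q sq qv] := IHn; first by apply: xi; apply: ltnW.
pose r : {poly F} := \prod_(l < n) ('X - (x l)%:P).
have rn : r.[x n] != 0.
  rewrite horner_prod; apply/prodf_neq0 => l _.
  by rewrite hornerXsubC subr_eq0 xi ?(ltn_trans (ltn_ord l)) // gtn_eqF.
exists (q + ((v n - q.[x n]) / r.[x n]) *: r).
  rewrite (leq_trans (size_polyD _ _)) // geq_max leqW //=.
  rewrite (leq_trans (size_scale_leq _ _)) // /r.
  by rewrite -(big_mkord xpredT (fun l => 'X - (x l)%:P)) size_prod_XsubC size_iota subn0.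
move=> j; rewrite ltnS leq_eqVlt => /orP[/eqP->|jn]; rewrite hornerD hornerZ.
  by rewrite divfK // addrC subrK.
have -> : r.[x j] = 0; last by rewrite qv // mulr0 addr0.
by rewrite /r horner_prod (bigD1 (Ordinal jn)) //= hornerXsubC subrr mul0r.
Qed.

Lemma interpolation_uniq (F : fieldType) (x : nat -> F) n (q : {poly F}) :
  (forall j l, (j < n)%N -> (l < n)%N -> j != l -> x j != x l) ->
  (size q <= n)%N -> (forall j, (j < n)%N -> q.[x j] = 0) -> q = 0.
Proof.
move=> xi sq qx; apply/eqP/negPn/negP => q0.
have := @max_poly_roots _ q [seq x j | j <- iota 0 n] q0.
rewrite size_map size_iota ltnNge sq => h; suff: false by []; apply: h.
  by apply/allP => _ /mapP[j + ->]; rewrite mem_iota => jn; apply/rootP/qx.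
rewrite map_inj_in_uniq ?iota_uniq // => j l; rewrite !mem_iota /= add0n => jn ln jl.
by apply/eqP/negPn/negP => /(xi _ _ jn ln); rewrite jl eqxx.
Qed.

Section CoverField.
Variables (p : nat) (k : fieldType) (kb : closedFieldType) (i : {rmorphism k -> kb}).
Hypothesis hp : p \in [pchar k].
Variables (X Y : curve i) (pi : zp_cover p X Y).
Local Notation K := (gff X).
Local Notation L := (gff Y).
Local Notation G := (gcov pi).
Local Notation gam := (gdeck pi).
Implicit Types (z u v w : L) (f b c : K) (q : {poly K}).

Let hL : p \in [pchar L]. Proof. exact: hpK hp Y. Qed.
Let pr : prime p. Proof. exact: pchar_pr hp. Qed.

Lemma gamE n (u : 'I_n -> ff Y) (c : 'I_n -> kb) m :
  iter m gam (\sum_j bc Y (u j) * gcst Y (c j)) =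
  \sum_j bc Y (iter m (deck pi) (u j)) * gcst Y (c j).
Proof.
elim: m => // m IHm; rewrite iterS IHm rmorph_sum; apply: eq_bigr => j _.
by rewrite rmorphM gdeck_bc gdeck_cst.
Qed.

Lemma gam_order z : iter p gam z = z.
Proof.
have [n [u [c ->]]] := bc_span z; rewrite gamE.
by apply: eq_bigr => j _; rewrite deck_order.
Qed.

Lemma gam_cov f : gam (G f) = G f.
Proof.
have [n [u [c ->]]] := bc_span f; rewrite !rmorph_sum; apply: eq_bigr => j _.
rewrite !rmorphM gcov_bc gcov_cst gdeck_bc gdeck_cst.
by have -> : deck pi (cov pi (u j)) = cov pi (u j) by apply/deck_fixed; exists (u j).
Qed.

Lemma iter_gam_cov j f : iter j gam (G f) = G f.
Proof. by elim: j => //= j ->; apply: gam_cov. Qed.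

Lemma gam_fixed z : gam z = z -> exists f, z = G f.
Proof.
move=> gz; have [n [u [c zE]]] := bc_span z.
have [m [e [a [efree cE]]]] := kbasis i c.
pose v l := \sum_j u j * kcst Y (a j l).
have {}zE : z = \sum_l bc Y (v l) * gcst Y (e l).
  rewrite zE; under eq_bigr do rewrite cE rmorph_sum mulr_sumr.
  rewrite exchange_big; apply: eq_bigr => l _ /=; rewrite rmorph_sum mulr_suml.
  by apply: eq_bigr => j _; rewrite !rmorphM bc_cst mulrA.
have fixv l : deck pi (v l) = v l.
  apply/eqP; rewrite -subr_eq0; apply/eqP; move: l; apply: (bc_free efree).
  transitivity (gam z - z); last by rewrite gz subrr.
  rewrite {1}zE -[gam _]/(iter 1 gam _) gamE zE -sumrB; apply: eq_bigr => l _ /=.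
  by rewrite rmorphB mulrBl.
have /choice[w wE] : forall l, exists u' : ff X, v l = cov pi u' by move=> l; apply/deck_fixed.
exists (\sum_l bc X (w l) * gcst X (e l)); rewrite zE rmorph_sum.
by apply: eq_bigr => l _; rewrite rmorphM gcov_bc gcov_cst wE.
Qed.

Lemma gam_nontrivial : exists z, gam z != z.
Proof.
have [u hu] := deck_nontrivial pi; exists (bc Y u).
by rewrite gdeck_bc (inj_eq (fmorph_inj _)).
Qed.

Let Lp z : z *+ p = 0. Proof. by rewrite -mulr_natr (pcharf0 hL) mulr0. Qed.

(** Let w = (gam - 1) u be the last nonzero iterate of gam - 1 on a z that is not fixed. As w is
    fixed, y = u / w works. *)
Lemma artin_schreier : exists y, gam y = y + 1.
Proof.
have [z gz] := gam_nontrivial; pose N := dif gam.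
have z0 : z != 0 by apply: contra_neq gz => ->; rewrite rmorph0.
have gD u v : gam (u + v) = gam u + gam v by rewrite rmorphD.
have [[|n] [dn dSn]] := unipotent pr gD (fun=> Lp _) (gam_order z) z0.
  by move: gz dSn => /=; rewrite /dif -subr_eq0 => /negPf + /eqP => ->.
set w := iter n.+1 (dif gam) z in dn dSn; set u := iter n (dif gam) z.
have gw : gam w = w by apply/eqP; rewrite -subr_eq0; apply/eqP.
have gu : gam u = u + w by rewrite addrC subrK.
by exists (u / w); rewrite fmorph_div gw gu mulrDl mulfV.
Qed.

(** The map z |-> u gam(z) has p-th power the identity, by the hypothesis on the norm, so it is
    unipotent and fixes a nonzero vector. *)
Lemma hilbert90 u : \prod_(j < p) iter j gam u = 1 -> exists2 w, w != 0 & u * gam w = w.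
Proof.
move=> Nu; pose F z := u * gam z.
have FD z w : F (z + w) = F z + F w by rewrite /F rmorphD mulrDr.
have Fn n z : iter n F z = \prod_(j < n) iter j gam u * iter n gam z.
  elim: n z => [|n IHn] z; first by rewrite big_ord0 mul1r.
  rewrite iterS IHn /F rmorphM mulrA big_ord_recl; congr (_ * _ * _).
  by rewrite rmorph_prod.
have [|n [dn dSn]] := unipotent pr FD (fun=> Lp _) _ (oner_neq0 L).
  by rewrite Fn Nu mul1r gam_order.
exists (iter n (dif F) 1) => //; apply/eqP; rewrite -subr_eq0; exact/eqP.
Qed.

Lemma norm_cov z : exists f, \prod_(j < p) iter j gam z = G f.
Proof.
apply: gam_fixed; rewrite rmorph_prod; have [->|z0] := eqVneq z 0.
  by apply: eq_bigr => j _; elim: (nat_of_ord j) => [|m IHm]; rewrite /= ?rmorph0 // IHm.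
apply: (mulfI z0); transitivity (\prod_(j < p.+1) iter j gam z); first by rewrite big_ord_recl.
by rewrite big_ord_recr /= gam_order mulrC.
Qed.

Section Generator.
Variable y : L.
Hypothesis gy : gam y = y + 1.

Lemma iter_gam_y j : iter j gam y = y + j%:R.
Proof.
elim: j => [|j IHj]; first by rewrite addr0.
by rewrite iterS IHj rmorphD gy rmorph_nat -addrA -natr1 [j%:R + 1]addrC.
Qed.

Lemma translates_neq j l : (j < p)%N -> (l < p)%N -> j != l -> y + j%:R != y + l%:R.
Proof.
move=> jp lp jl; rewrite (inj_eq (addrI y)) -subr_eq0.
exact: (natr_sub_neq0 hL).
Qed.

Definition cpoly (q : {poly K}) : L := (map_poly G q).[y].

Lemma cpoly_shift q j : (map_poly G q).[y + j%:R] = iter j gam (cpoly q).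
Proof.
elim: j => [|j IHj]; first by rewrite addr0.
rewrite iterS -IHj -horner_map rmorphD gy rmorph_nat -addrA [1 + _]addrC natr1.
congr (_.[_]); rewrite -map_poly_comp; apply: eq_map_poly => f /=.
by rewrite gam_cov.
Qed.

Lemma cpoly_eq0 q : (size q <= p)%N -> cpoly q = 0 -> q = 0.
Proof.
move=> sq q0; have : map_poly G q = 0.
  apply: (interpolation_uniq (x := fun j => y + j%:R) translates_neq).
    by rewrite size_map_poly.
  move=> j _; rewrite cpoly_shift q0; by elim: j => //= j ->; rewrite rmorph0.
by move/eqP; rewrite map_poly_eq0 => /eqP.
Qed.

(** Lagrange interpolation of the conjugates of z at the conjugates y + j of y; by uniqueness the
    coefficients are fixed by gam. *)
Lemma cpoly_ex z : exists2 q : {poly K}, (size q <= p)%N & cpoly q = z.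
Proof.
have [q sq qv] := interpolation (fun j => iter j gam z) translates_neq.
have modp n : (y + n%:R = y + (n %% p)%:R) * (iter n gam z = iter (n %% p) gam z).
  rewrite (natr_mod hL); split=> //; rewrite [in LHS](divn_eq n p) addnC iterD.
  congr (iter _ _ _); elim: (n %/ p)%N => // m IHm; by rewrite mulSn iterD IHm gam_order.
have qv' n : q.[y + n%:R] = iter n gam z.
  by rewrite (modp n).1 (modp n).2 qv // ltn_mod prime_gt0.
have fixq : map_poly gam q = q.
  apply/eqP; rewrite -subr_eq0; apply/eqP.
  apply: (interpolation_uniq (x := fun j => y + j%:R) translates_neq).
    by rewrite (leq_trans (size_polyD _ _)) // size_polyN size_map_poly maxnn.
  move=> j jp; rewrite hornerD hornerN qv'.
  have jE : y + j%:R = gam (y + (j + p.-1)%:R).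
    rewrite rmorphD gy rmorph_nat -addrA [1 + _]addrC natr1 -addnS prednK ?prime_gt0 //.
    by rewrite natrD (pcharf0 hL) addr0.
  rewrite {1}jE horner_map qv' -iterS -addnS prednK ?prime_gt0 // iterD gam_order.
  by rewrite subrr.
have /choice[a aE] : forall j, exists f, q`_j = G f.
  by move=> j; apply: gam_fixed; rewrite -{2}fixq coef_map.
have qE : map_poly G (\poly_(j < p) a j) = q.
  apply/polyP => j; rewrite coef_map coef_poly; case: ltnP => [_|pj]; first by rewrite aE.
  by rewrite /= rmorph0 nth_default // (leq_trans sq).
exists (\poly_(j < p) a j); first exact: size_poly.
by rewrite /cpoly qE -[y]addr0 -[0]/(0%:R) qv'.
Qed.

Lemma cpoly_mod (a : K) q : G a = y ^+ p - y -> cpoly q = 0 -> ('X^p - 'X - a%:P) %| q.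
Proof.
move=> ya q0; set m := 'X^p - 'X - a%:P.
have sm : size m = p.+1.
  rewrite /m -addrA size_polyDl size_polyXn // ltnS.
  rewrite -opprD size_polyN size_XaddC; exact: prime_gt1.
have m0 : m != 0 by rewrite -size_poly_eq0 sm.
have my : cpoly m = 0.
  by rewrite /cpoly /m !rmorphB /= map_polyXn map_polyX map_polyC /= !hornerE ya; ring.
rewrite /dvdp; apply/eqP; apply: cpoly_eq0.
  by rewrite -ltnS -sm ltn_modp.
move: q0; rewrite {1}(divp_eq q m) /cpoly rmorphD rmorphM hornerD hornerM -/(cpoly m) my.
by rewrite mulr0 add0r.
Qed.

End Generator.

End CoverField.

(** * Norms from Y to X *)

Section Norm.
Variables (p : nat) (k : fieldType) (kb : closedFieldType) (i : {rmorphism k -> kb}).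
Hypothesis hp : p \in [pchar k].
Hypothesis kb_algebraic : forall z : kb, algebraicOver i z.
Variables (X Y : curve i) (pi : zp_cover p X Y).
Local Notation K := (gff X).
Local Notation L := (gff Y).
Local Notation G := (gcov pi).
Local Notation gam := (gdeck pi).
Let hL : p \in [pchar L]. Proof. exact: hpK hp Y. Qed.
Local Notation hpK := (hpK hp X).
Local Notation phi := (phi hpK).
Local Notation theta := (@theta p K).
Local Notation cpoly := (cpoly pi).
Implicit Types (f b c w : K) (q r : {poly K}).

Let pr : prime p. Proof. exact: pchar_pr hp. Qed.

Section Operator.
Variables (y : L) (a f c : K).
Hypothesis gy : gam y = y + 1.
Hypothesis ya : G a = y ^+ p - y.
Hypothesis hf : @pbasis p K f.
Hypothesis ca : c - phi f c = a.

(* gff Y acts on gff X, the elements of gff X acting through their p-th powers and y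
   through U.  Multiplication by f carries this action to its conjugate by gdeck,
   so that the element which maps 1 to f is of norm f. *)
Let U := @thadd p K f c.

Let UD u v : U (u + v) = U u + U v. Proof. exact: (thadd_additive hpK hf). Qed.
Let U0 : U 0 = 0. Proof. by apply: (addrI (U 0)); rewrite -UD !addr0. Qed.
Let UM b w : U (b ^+ p * w) = b ^+ p * U w.
Proof. by rewrite /U (thadd_leibniz hpK hf) (theta_Kp hpK hf) mul0r addr0. Qed.
(** The hypothesis on c makes U satisfy the equation of y with a replaced by a ^ p: [jacobson] gives
    U ^ p = U + (c - phi c) ^ p. *)
Let Up w : iter p U w = U w + a ^+ p * w.
Proof.
rewrite /U (jacobson hpK (@gff_Kp_dep _ _ _ _ hp kb_algebraic X) hf) /thadd -ca (frB hpK).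
by ring.
Qed.
Let Uf w : U (f * w) = f * (U w + w).
Proof. by rewrite /U (thadd_leibniz hpK hf) (theta_t hpK hf) -mulrDr. Qed.

(** The action of q on w, coefficients acting through their p-th powers and the indeterminate
    through U. By [cop_kernel] it depends only on the value of q at y. *)
Definition cop q w := \sum_(j < size q) q`_j ^+ p * iter j U w.

Let cop_wide q n w : (size q <= n)%N -> cop q w = \sum_(j < n) q`_j ^+ p * iter j U w.
Proof.
move=> sq; rewrite /cop (big_ord_widen n (fun j => q`_j ^+ p * iter j U w) sq) big_mkcond.
apply: eq_bigr => j _; case: ltnP => // /(nth_default 0) ->.
by rewrite (fr0 hpK) mul0r.
Qed.

Let copD q r w : cop (q + r) w = cop q w + cop r w.
Proof.
rewrite !(@cop_wide _ (maxn (size q) (size r))) ?size_polyD ?leq_maxl ?leq_maxr //.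
by rewrite -big_split; apply: eq_bigr => j _; rewrite coefD (frD hpK) mulrDl.
Qed.

Let cop0l w : cop 0 w = 0. Proof. by rewrite /cop size_poly0 big_ord0. Qed.

Let copN q w : cop (- q) w = - cop q w.
Proof. by apply/eqP; rewrite -addr_eq0 -copD addNr cop0l. Qed.

Let copC b w : cop b%:P w = b ^+ p * w.
Proof. by rewrite (@cop_wide _ 1) ?size_polyC_leq1 // big_ord1 coefC. Qed.

Let copMX q w : cop (q * 'X) w = U (cop q w).
Proof.
rewrite (@cop_wide _ (size q).+1); last first.
  by have [->|q0] := eqVneq q 0; rewrite ?mul0r ?size_poly0 // size_mulX.
rewrite big_ord_recl coefMX /= (fr0 hpK) mul0r add0r /cop (big_morph U UD U0).
by apply: eq_bigr => j _; rewrite coefMX /= UM.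
Qed.

Let copXn n w : cop 'X^n w = iter n U w.
Proof.
by elim: n => [|n IHn]; rewrite ?expr0 ?copC ?expr1n ?mul1r // exprSr copMX IHn.
Qed.

Let cop0r q : cop q 0 = 0.
Proof. by rewrite /cop big1 // => j _; elim: (nat_of_ord j) => [|n]; rewrite ?mulr0 // => /=; rewrite (_ : iter n U 0 = 0) ?U0 ?mulr0 //; elim: n => //= n ->. Qed.

Let copMC q b w : cop (b%:P * q) w = b ^+ p * cop q w.
Proof.
rewrite (@cop_wide (b%:P * q) (size q)); last by rewrite mul_polyC size_scale_leq.
by rewrite /cop mulr_sumr; apply: eq_bigr => j _; rewrite coefCM exprMn mulrA.
Qed.

Let copM q r w : cop (q * r) w = cop q (cop r w).
Proof.
elim/poly_ind: q => [|q b IHq]; first by rewrite mul0r !cop0l.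
by rewrite mulrDl mulrAC !copD !copMX IHq copMC copC.
Qed.

Let cop_kernel q w : cpoly y q = 0 -> cop q w = 0.
Proof.
move=> /(cpoly_mod hp gy ya) mq; rewrite -(divpK mq) copM (_ : cop _ w = 0) ?cop0r //.
by rewrite !copD !copN copXn -['X]expr1 copXn copC Up /=; ring.
Qed.

Let cop_inj q : (size q <= p)%N -> cop q 1 = 0 -> q = 0.
Proof.
move=> sq q1; apply: (cpoly_eq0 hp gy sq); apply/eqP/negPn/negP => z0.
have [r _ rz] := cpoly_ex hp gy (cpoly y q)^-1.
have : cop (r * q - 1) 1 = 0.
  apply: cop_kernel; rewrite /cpoly rmorphB rmorphM rmorph1 hornerD hornerN hornerM hornerC.
  by rewrite -/(cpoly y q) -/(cpoly y r) rz mulVf // subrr.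
rewrite copD copN copM q1 cop0r sub0r copC expr1n mulr1 => /eqP.
by rewrite oppr_eq0 oner_eq0.
Qed.

(** gff Y has dimension p over gff X and acts on the vector 1 without kernel, while gff X has
    dimension at most p over its p-th powers; so 1 generates gff X. *)
Let cop_surj : exists q, cop q 1 = f.
Proof.
have [d [[j0 dj0] hd]] := @gff_Kp_dep _ _ _ _ hp kb_algebraic X
  (fun j => if unlift ord_max j is Some l then iter l U 1 else f).
have hd' : \sum_(j < p) d (lift ord_max j) ^+ p * iter j U 1 = - (d ord_max ^+ p * f).
  apply/eqP; rewrite -addr_eq0 -[X in _ == X]hd [in X in _ == X]big_ord_recr /= unlift_none.
  apply/eqP; congr (_ + _); apply: eq_bigr => j _.
  have -> : widen_ord (leqnSn p) j = lift ord_max j.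
    by apply/val_inj; rewrite /= /bump leqNgt ltn_ord.
  by rewrite liftK.
have copd e : cop (\poly_(j < p) e j) 1 = \sum_(j < p) e j ^+ p * iter j U 1.
  rewrite (cop_wide _ (size_poly _ _)); apply: eq_bigr => j _.
  by rewrite coef_poly ltn_ord.
pose e (j : nat) := if insub j is Some l then d (lift ord_max l) else 0.
have eE (j : 'I_p) : e j = d (lift ord_max j) by rewrite /e valK.
have dm : d ord_max != 0.
  apply/eqP => dm; case/eqP: dj0; case: (unliftP ord_max j0) => [l ->|->] //.
  have : \poly_(j < p) e j = 0.
    apply: cop_inj; first exact: size_poly.
    rewrite copd; under eq_bigr do rewrite eE.
    by rewrite hd' dm (fr0 hpK) mul0r oppr0.
  by move/polyP/(_ l); rewrite coef_poly ltn_ord coef0 eE.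
exists (\poly_(j < p) (- e j / d ord_max)); rewrite copd.
transitivity (- (d ord_max ^+ p)^-1 * \sum_(j < p) d (lift ord_max j) ^+ p * iter j U 1).
  rewrite mulr_sumr; apply: eq_bigr => j _.
  by rewrite eE exprMn exprVn (frN hpK); ring.
by rewrite hd' mulrN mulNr opprK mulKf // expf_neq0.
Qed.

Let cop_f q w : cop q (f * w) = f * cop (q \Po ('X + 1)) w.
Proof.
elim/poly_ind: q => [|q b IHq]; first by rewrite comp_poly0 !cop0l mulr0.
rewrite comp_polyD comp_polyM comp_polyX comp_polyC !copD copMX IHq Uf [_ * ('X + 1)]mulrDr mulr1 copD copMX.
by rewrite !copC [RHS]mulrDr [b ^+ p * (f * w)]mulrCA.
Qed.

Let cop_fn q n w : cop q (f ^+ n * w) = f ^+ n * cop (q \Po ('X + n%:R)) w.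
Proof.
elim: n q w => [|n IHn] q w; first by rewrite addr0 comp_polyXr !mul1r.
rewrite exprSr -mulrA IHn cop_f mulrA -exprSr; congr (_ * cop _ _).
rewrite -comp_polyA comp_polyD comp_polyX -natr1 -(rmorph_nat polyC) comp_polyC.
by rewrite -addrA [1 + _]addrC.
Qed.

(** Let z take 1 to f. As U f = f (U + 1), the conjugates of z, applied in succession, take 1 to f,
    f ^ 2, ..., f ^ p. So the norm of z, which is some b in gff X and acts as b ^ p, takes 1 to f ^
    p. *)
Lemma norm_of_pbasis : exists z, \prod_(j < p) iter j gam z = G f.
Proof.
have [q q1] := cop_surj; exists (cpoly y q).
have [b zb] := norm_cov pi (cpoly y q); rewrite zb; congr (G _).
pose Q n : {poly K} := \prod_(m < n) (q \Po ('X - m%:R)).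
have cQ n : cop (Q n) 1 = f ^+ n.
  elim: n => [|n IHn]; first by rewrite /Q big_ord0 copC expr1n mulr1.
  rewrite /Q big_ord_recr /= -/(Q n) mulrC copM IHn -[f ^+ n]mulr1 cop_fn -comp_polyA.
  rewrite comp_polyB comp_polyX -(rmorph_nat polyC) comp_polyC addrK comp_polyXr q1.
  by rewrite exprSr.
have yQ : cpoly y (Q p) = G b.
  rewrite -[RHS]gam_cov -zb [RHS]rmorph_prod {1}/cpoly rmorph_prod horner_prod.
  rewrite [RHS](reindex_inj rev_ord_inj) /=; apply: eq_bigr => m _.
  rewrite map_comp_poly horner_comp rmorphB /= map_polyX rmorph_nat hornerD hornerX hornerN.
  rewrite -(rmorph_nat polyC) hornerC -iterS subnSK // -cpoly_shift //.
  congr (_.[y + _]); apply/eqP; rewrite -subr_eq0 -opprD oppr_eq0 -natrD subnKC ?(ltnW (ltn_ord m)) //.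
  by rewrite (pcharf0 (hL)).
apply: (fr_inj hpK); rewrite -[RHS]cQ -[LHS]mulr1 -copC; apply/eqP; rewrite -subr_eq0 -copN -copD.
apply/eqP/cop_kernel; rewrite /cpoly rmorphB /= map_polyC hornerD hornerN hornerC.
by rewrite -/(cpoly y (Q p)) yQ subrr.
Qed.

End Operator.

Theorem norm_surj f : f != 0 -> exists z, \prod_(j < p) iter j gam z = G f.
Proof.
move=> f0; have [[b fb]|nb] := pselect (exists b, f = b ^+ p).
  exists (G b); under eq_bigr do rewrite iter_gam_cov.
  by rewrite big_const iter_mulr_1 cardT size_enum_ord fb rmorphXn.
have hf : @pbasis p K f by apply: (gff_pbasis hp kb_algebraic) => b fb; apply: nb; exists b.
have [y gy] := artin_schreier hp pi.
have [|a ya] := @gam_fixed _ _ _ _ X Y pi (y ^+ p - y).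
  rewrite rmorphB rmorphXn gy (frD (hL)) expr1n; ring.
have [n [e rel]] := phi_locally_finite hp a hf.
have [x /= hx] := semilinear_solve (hpkb i hp) (phiD hpK hf) (fun (c : kb) u => phi_cst hp c u hf) rel.
exact: (norm_of_pbasis gy (esym ya) hf hx).
Qed.

End Norm.

(** * Places of Y above the places of X *)

Section CoverPlaces.
Variables (p : nat) (k : fieldType) (kb : closedFieldType) (i : {rmorphism k -> kb}).
Variables (X Y : curve i) (pi : zp_cover p X Y).
Local Notation K := (gff X).
Local Notation L := (gff Y).
Local Notation G := (gcov pi).
Local Notation gam := (gdeck pi).
Local Notation below := (below pi).
Implicit Types (z u v w : L) (f b c : K) (P : place X) (Q R : place Y).

Definition tau : place Y -> place Y := twist gam.

Lemma ord_tau Q z : ord (tau Q) z = ord Q (gam z). Proof. by []. Qed.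

Lemma ord_iter_tau j Q z : ord (iter j tau Q) z = ord Q (iter j gam z).
Proof. by elim: j z => // j IHj z; rewrite iterS ord_tau IHj -iterSr. Qed.

Lemma iter_gamD j u v : iter j gam (u + v) = iter j gam u + iter j gam v.
Proof. by elim: j => // j IHj; rewrite !iterS IHj rmorphD. Qed.

Lemma iter_gamN j u : iter j gam (- u) = - iter j gam u.
Proof. by elim: j => // j IHj; rewrite !iterS IHj rmorphN. Qed.

Lemma iter_gamM j u v : iter j gam (u * v) = iter j gam u * iter j gam v.
Proof. by elim: j => // j IHj; rewrite !iterS IHj rmorphM. Qed.

Lemma iter_gam_eq0 j u : (iter j gam u == 0) = (u == 0).
Proof. by elim: j => // j IHj; rewrite iterS fmorph_eq0. Qed.

Lemma iter_gam_cst j (c : kb) : iter j gam (gcst Y c) = gcst Y c.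
Proof. by elim: j => //= j ->; rewrite gdeck_cst. Qed.

Lemma vge_iter_tau j Q n z : vge (iter j tau Q) n z = vge Q n (iter j gam z).
Proof. by rewrite /vge ord_iter_tau iter_gam_eq0. Qed.

Lemma tau_order Q : iter p tau Q = Q.
Proof. by apply: place_eq => z; rewrite ord_iter_tau gam_order. Qed.

Lemma tau_orderM m Q : iter (m * p) tau Q = Q.
Proof. by elim: m => // m IHm; rewrite mulSn iterD IHm tau_order. Qed.

Lemma iter_tau_mod n Q : iter n tau Q = iter (n %% p) tau Q.
Proof. by rewrite {1}(divn_eq n p) addnC iterD tau_orderM. Qed.

Lemma tau_bij : bijective tau. Proof. exact: twist_bij. Qed.

Lemma ord_below Q f : ord (below Q) f = ord Q (G f). Proof. by []. Qed.

Lemma vge_below Q n f : vge (below Q) n f = vge Q n (G f).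
Proof. by rewrite /vge ord_below fmorph_eq0. Qed.

Lemma below_tau Q : below (tau Q) = below Q.
Proof. by apply: place_eq => f; rewrite !ord_below ord_tau gam_cov. Qed.

Lemma below_iter_tau j Q : below (iter j tau Q) = below Q.
Proof. by elim: j => //= j <-; apply: below_tau. Qed.

Lemma pv_cov (q : {poly kb}) f : pv q (G f) = G (pv q f).
Proof.
rewrite /pv -horner_map -map_poly_comp; congr (_.[_]).
by apply: eq_map_poly => c /=; rewrite gcov_cst.
Qed.

Hypothesis hp : p \in [pchar k].
Let pr : prime p. Proof. exact: pchar_pr hp. Qed.

(* If gdeck ^ j fixes Q, it preserves the expansion of y at Q in a uniformizer that
   comes from X, which is not compatible with y |-> y + j. *)
Lemma tau_free Q j : (0 < j < p)%N -> iter j tau Q <> Q.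
Proof.
move=> jp Qj; have [t ot] := unramified pi Q; have [y gy] := artin_schreier hp pi.
have [a ha] := polar_part ot y; rewrite -fmorphV pv_cov in ha.
have := ha; rewrite -{1}Qj vge_iter_tau iter_gamD iter_gamN iter_gam_cov (iter_gam_y gy) => ha'.
have : vge Q 1 (gcst Y j%:R).
  rewrite rmorph_nat; have := vgeB ha' ha; congr vge; ring.
move=> /vge1_cst /eqP; apply/negP; exact: (natr_neq0 (hpkb i hp) jp).
Qed.

Lemma iter_tau_inj Q j l : (j < p)%N -> (l < p)%N -> iter j tau Q = iter l tau Q -> j = l.
Proof.
wlog jl : j l / (j <= l)%N => [h|] jp lp e.
  by have [|/ltnW] := leqP j l => [jl|lj]; [apply: h|apply/esym/h].
apply/eqP; rewrite eqn_leq jl /= leqNgt; apply/negP => lj.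
apply: (@tau_free (iter j tau Q) (l - j)); first by rewrite subn_gt0 lj (leq_ltn_trans (leq_subr _ _)).
by rewrite -iterD subnK // e.
Qed.

(** If the orbits were disjoint, approximation would give z with value 1 on the first and 0 on the
    second; its norm would have both values at the common image. *)
Lemma tau_trans Q Q' : below Q = below Q' -> exists2 j, (j < p)%N & Q' = iter j tau Q.
Proof.
move=> bQ; apply: contrapT => nQ'; have p0 := prime_gt0 pr.
pose orb R := [seq iter j tau R | j <- iota 0 p].
have orbP R j : iter j tau R \in orb R.
  by rewrite iter_tau_mod; apply: map_f; rewrite mem_iota ltn_mod p0.
have disj R : R \in orb Q -> R \in orb Q' -> False.
  move=> /mapP[j _ ->] /mapP[l]; rewrite mem_iota /= => lp e; apply: nQ'.
  exists ((p - l + j) %% p)%N; first by rewrite ltn_mod.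
  by rewrite -iter_tau_mod iterD e -iterD subnK ?tau_order // ltnW.
have [z hz] := place_approx (fun R => if R \in orb Q then 1 else 0) 1 (undup_uniq (orb Q ++ orb Q')).
have zQ j : vge Q 1 (iter j gam z - 1).
  have := hz (iter j tau Q); rewrite mem_undup mem_cat orbP => /(_ isT).
  by rewrite vge_iter_tau iter_gamD iter_gamN -(rmorph1 (gcst Y)) iter_gam_cst.
have zQ' j : vge Q' 1 (iter j gam z).
  have := hz (iter j tau Q'); rewrite mem_undup mem_cat orbP orbT => /(_ isT).
  case: ifP => [h|_]; last by rewrite subr0 vge_iter_tau.
  by case: (disj _ h (orbP _ _)).
have [b hb] := norm_cov pi z.
have b0 : vge (below Q') 1 b.
  rewrite vge_below -hb (bigD1 (Ordinal p0)) //=; apply: vgeMr; first exact: (zQ' 0%N).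
  elim/big_ind: _ => [|u v hu hv|j _]; [exact: vge_1|exact: vgeMl|].
  exact: vge_leq (zQ' j).
have b1 : vge (below Q) 1 (b - 1).
  rewrite vge_below rmorphB rmorph1 -hb.
  elim/big_ind: _ => [|u v hu hv|j _]; [by rewrite subrr vge0| |exact: zQ].
  have -> : u * v - 1 = (u - 1) * (v - 1) + (u - 1) + (v - 1) by ring.
  have h0 : vge Q 0 (u - 1) := vge_leq ler01 hu.
  exact: vgeD (vgeD (vgeMl h0 hv) hu) hv.
apply: (@vge1_1 _ _ _ _ (below Q)).
have -> : 1 = b - (b - 1) by ring.
by apply: vgeB b1; rewrite bQ.
Qed.

(** The valuation ring of P, seen in gff Y, does not invert a uniformizer of P, so it is contained
    in the ring of some place of Y; by [place_sub] that place lies above P. *)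
Lemma below_surj P : exists Q, below Q = P.
Proof.
pose A z := exists2 f, vge P 0 f & z = G f.
have [||||Q [QA _]] := @place_exists _ _ _ Y A (G (unif P)).
- split=> [c|_ _ [f hf ->] [g hg ->]|_ _ [f hf ->] [g hg ->]].
  + by exists (gcst X c); [apply: vge_cst|rewrite gcov_cst].
  + by exists (f - g); [apply: vgeB|rewrite rmorphB].
  + by exists (f * g); [apply: vgeMl|rewrite rmorphM].
- by exists (unif P) => //; rewrite vgeE ?unif_neq0 // ord_unifE.
- by rewrite fmorph_eq0 unif_neq0.
- move=> _ [f hf ->]; rewrite -rmorphM -(rmorph1 G) (inj_eq (fmorph_inj _)).
  apply/eqP => e; apply: (@vge1_1 _ _ _ _ P); rewrite -e; apply: vgeMr => //.
  by rewrite vgeE ?unif_neq0 // ord_unifE.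
by exists Q; apply/esym/place_sub => f hf; rewrite vge_below; apply: QA; exists f.
Qed.

Definition sec P : place Y := sval (cid (below_surj P)).

Lemma secK P : below (sec P) = P. Proof. exact: svalP (cid (below_surj P)). Qed.

Lemma sec_orbit Q : exists2 j, (j < p)%N & Q = iter j tau (sec (below Q)).
Proof. by apply: tau_trans; rewrite secK. Qed.

Lemma fsum_fibres (W : zmodType) (E : place Y -> W) : finsupp E ->
  finsupp (fun P => \sum_(j < p) E (iter j tau (sec P))) /\
  \sum_(Q \in [set: place Y]) E Q =
  \sum_(P \in [set: place X]) \sum_(j < p) E (iter j tau (sec P)).
Proof.
move=> /finsupp_seq[r ur hr]; pose r' := undup [seq below Q | Q <- r].
have hr' P : \sum_(j < p) E (iter j tau (sec P)) != 0 -> P \in r'.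
  apply: contraNT => Pr; apply/eqP/big1 => j _; apply/eqP; apply: contraNT Pr => /hr Qr.
  by rewrite mem_undup -(secK P) -(below_iter_tau j); apply: map_f.
split; first exact: seq_finsupp hr'.
rewrite (fsumE (undup_uniq _) hr'); pose l := [seq iter j tau (sec P) | P <- r', j <- iota 0 p].
have ul : uniq l.
  apply: allpairs_uniq; rewrite ?undup_uniq ?iota_uniq //.
  move=> [P j] [P' j'] /allpairsP[[a1 a2] /= [_ + [-> ->]]] /allpairsP[[b1 b2] /= [_ + [-> ->]]].
  rewrite !mem_iota /= => jp j'p e; have := congr1 below e; rewrite !below_iter_tau !secK => ab.
  by move: e; rewrite ab => /iter_tau_inj->.
rewrite (fsumE (r := l) ul) => [|Q EQ]; last first.
  have [j jp QE] := sec_orbit Q; apply/allpairsP; exists (below Q, j); split=> //=.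
    by rewrite mem_undup; apply/map_f/hr.
  by rewrite mem_iota.
rewrite /l big_allpairs_dep; apply: eq_bigr => P _.
by rewrite -(big_mkord xpredT (fun j => E (iter j tau (sec P)))) /index_iota subn0.
Qed.

Lemma fsum_tau (W : zmodType) (E : place Y -> W) :
  \sum_(Q \in [set: place Y]) E (tau Q) = \sum_(Q \in [set: place Y]) E Q.
Proof. by rewrite [RHS](reindex_fsbigT tau _ tau_bij). Qed.

Lemma finsupp_tau (W : zmodType) (E : place Y -> W) : finsupp E -> finsupp (E \o tau).
Proof.
move=> fE; apply: (finite_preimage (f := tau) _ fE).
by move=> Q R _ _; apply: (bij_inj tau_bij).
Qed.

Lemma finsupp_below (W : zmodType) (D : place X -> W) : finsupp D -> finsupp (D \o below).
Proof.
move=> /finsupp_seq[r ur hr]; pose l := [seq iter j tau (sec P) | P <- r, j <- iota 0 p].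
apply: (seq_finsupp (r := l)) => Q DQ; have [j jp QE] := sec_orbit Q; apply/allpairsP; exists (below Q, j); split=> //=.
  exact: hr.
by rewrite mem_iota.
Qed.

End CoverPlaces.

Section Action.
Variables (k : fieldType) (kb : closedFieldType) (i : {rmorphism k -> kb}).
Variables (X : curve i) (s : semiaut X).
Implicit Types (D E : div0 X) (x y : jac X).

Local Notation cls := (\pi_(jac X)%qT : div0 X -> jac X).

Lemma act_cls D : act s (cls D) = cls (div_act s D).
Proof.
have [|f f0 h] := (cls_eq (repr (cls D)) D).1; first by rewrite reprK.
apply/cls_eq; exists (s f); first by rewrite fmorph_eq0.
by move=> P; rewrite /= h.
Qed.

Lemma actD x y : act s (x + y) = act s x + act s y.
Proof.
have [D ->] := cls_ex x; have [E ->] := cls_ex y; rewrite -clsD !act_cls -clsD.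
by apply/cls_eq; exists 1 => [|P]; rewrite ?oner_neq0 // -(rmorph1 (gcst X)) ord_cst addr0.
Qed.

Lemma act0 : act s 0 = 0.
Proof. by apply: (addrI (act s 0)); rewrite -actD !addr0. Qed.

Lemma actN x : act s (- x) = - act s x.
Proof. by apply/eqP; rewrite -addr_eq0 -actD addNr act0. Qed.

Lemma actB x y : act s (x - y) = act s x - act s y.
Proof. by rewrite actD actN. Qed.

Lemma actMn x n : act s (x *+ n) = act s x *+ n.
Proof. by elim: n => [|n IHn]; rewrite ?act0 // !mulrS actD IHn. Qed.

End Action.

Lemma div0_eq (k : fieldType) (kb : closedFieldType) (i : {rmorphism k -> kb}) (X : curve i)
  (D E : div0 X) : (forall P, D P = E P) -> D = E.
Proof. by move=> h; apply/val_inj/funext. Qed.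

(** * Pullback of divisor classes *)

Section Pullback.
Variables (p : nat) (k : fieldType) (kb : closedFieldType) (i : {rmorphism k -> kb}).
Hypothesis hp : p \in [pchar k].
Variables (X Y : curve i) (pi : zp_cover p X Y).
Local Notation K := (gff X).
Local Notation L := (gff Y).
Local Notation G := (gcov pi).
Local Notation gam := (gdeck pi).
Local Notation below := (below pi).
Local Notation tau := (tau pi).
Local Notation clX := (\pi_(jac X)%qT : div0 X -> jac X).
Local Notation clY := (\pi_(jac Y)%qT : div0 Y -> jac Y).
Implicit Types (P : place X) (Q : place Y) (D : div0 X) (E : div0 Y) (x : jac X) (y : jac Y).

Let pr : prime p. Proof. exact: pchar_pr hp. Qed.

Lemma iter_act_cls j E : iter j (act gam) (clY E) = clY (iter j (div_act gam) E).
Proof. by elim: j => // j IHj; rewrite !iterS IHj act_cls. Qed.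

Lemma iter_div_actE j E Q : iter j (div_act gam) E Q = E (iter j tau Q).
Proof. by elim: j Q => // j IHj Q; rewrite iterS /= IHj -iterSr. Qed.

Lemma act_order y : iter p (act gam) y = y.
Proof.
have [E ->] := cls_ex y; rewrite iter_act_cls; congr (\pi_(jac Y)%qT _).
by apply: div0_eq => Q; rewrite iter_div_actE tau_order.
Qed.

Lemma delta_dif : delta pi = dif (act gam). Proof. by []. Qed.

Lemma deltaD y y' : delta pi (y + y') = delta pi y + delta pi y'.
Proof. by rewrite /delta actD opprD addrACA. Qed.

Lemma iter_act_jtors j y : jtors p y -> iter j (act gam) y *+ p = 0.
Proof. by move=> hy; elim: j => //= j IHj; rewrite -actMn IHj act0. Qed.

Lemma iter_delta_p y : jtors p y -> iter p (delta pi) y = 0.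
Proof.
move=> hy; rewrite delta_dif (iter_dif_p pr (actD gam)) ?act_order ?subrr //.
by move=> j; apply: iter_act_jtors.
Qed.

Lemma iter_delta_p1 y : jtors p y -> iter p.-1 (delta pi) y = \sum_(j < p) iter j (act gam) y.
Proof.
by move=> hy; rewrite delta_dif (iter_dif_p1 pr (actD gam)) // => j; apply: iter_act_jtors.
Qed.

Lemma pull_ex D : exists E, forall Q, E Q = D (below Q).
Proof.
have [fD sD] := div0P D; have fE := finsupp_below pi hp fD.
apply: (div0_ex fE); have [_ ->] := fsum_fibres pi hp fE.
transitivity (\sum_(P \in [set: place X]) D P *+ p).
  apply: fsum_eq => P; rewrite -[p in RHS]card_ord -sumr_const.
  by apply: eq_bigr => j _; rewrite /= below_iter_tau secK.
rewrite (@fsum_additive _ _ _ (fun n : int => n *+ p)) ?sD ?mul0rn //.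
by move=> u v; rewrite mulrnDl.
Qed.

Definition pull D : div0 Y := sval (cid (pull_ex D)).

Lemma pullE D Q : pull D Q = D (below Q). Proof. exact: (svalP (cid (pull_ex D))). Qed.

Lemma pullback_cls D : pullback pi (clX D) = clY (pull D).
Proof.
rewrite /pullback; case: xgetP => [y -> [D' [E [xD -> hE]]]|/(_ (clY (pull D)))[]].
  have /cls_eq[f f0 hf] := xD; apply/cls_eq; exists (G f)^-1.
    by rewrite invr_eq0 fmorph_eq0.
  by move=> Q; rewrite hE pullE hf ord_inv -ord_below addrK.
by exists D, (pull D); split=> // Q; rewrite pullE.
Qed.

Lemma pullbackD x x' : pullback pi (x + x') = pullback pi x + pullback pi x'.
Proof.
have [D ->] := cls_ex x; have [D' ->] := cls_ex x'; rewrite -clsD !pullback_cls -clsD.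
by congr (\pi_(jac Y)%qT _); apply: div0_eq => Q; rewrite div0D !pullE div0D.
Qed.

Lemma pullback0 : pullback pi 0 = 0.
Proof. by apply: (addrI (pullback pi 0)); rewrite -pullbackD !addr0. Qed.

Lemma pullbackN x : pullback pi (- x) = - pullback pi x.
Proof. by apply/eqP; rewrite -addr_eq0 -pullbackD addNr pullback0. Qed.

Lemma pullbackMn x n : pullback pi (x *+ n) = pullback pi x *+ n.
Proof. by elim: n => [|n IHn]; rewrite ?pullback0 // !mulrS pullbackD IHn. Qed.

(** If pi^* D = div g, then gam g / g is a constant c with c ^ p = 1, hence c = 1 in characteristic
    p, and g comes from X. *)
Lemma pullback_eq0 x : pullback pi x = 0 -> x = 0.
Proof.
have [D ->] := cls_ex x; rewrite pullback_cls => /cls_eq0[g g0 hg].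
have [|c hc] := @no_pole_const _ _ _ Y (gam g / g).
  move=> Q; rewrite vge_reg ord_mul ?invr_eq0 ?fmorph_eq0 // ord_inv -ord_tau.
  by rewrite -!hg !pullE below_tau subrr.
have gg : gam g = gcst Y c * g by rewrite -hc divfK.
have gj j : iter j gam g = gcst Y (c ^+ j) * g.
  elim: j => [|j IHj]; first by rewrite rmorph1 mul1r.
  by rewrite iterS IHj rmorphM gdeck_cst gg mulrA -rmorphM -exprSr.
have c1 : c = 1.
  apply: (fr_inj (hpkb i hp)); rewrite expr1n; apply: (fmorph_inj (gcst Y)); apply: (mulIf g0).
  by rewrite -gj gam_order rmorph1 mul1r.
have [|f gf] := @gam_fixed _ _ _ _ X Y pi g; first by rewrite gg c1 rmorph1 mul1r.
apply/cls_eq0; exists f => [|P]; first by rewrite -(fmorph_eq0 G) -gf.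
by rewrite -(secK pi P) ord_below -gf -hg pullE.
Qed.

Lemma pullback_inj x x' : pullback pi x = pullback pi x' -> x = x'.
Proof.
move=> e; apply/eqP; rewrite -subr_eq0; apply/eqP/pullback_eq0.
by rewrite pullbackD pullbackN e subrr.
Qed.

Lemma jtors_pullback x : jtors p (pullback pi x) <-> jtors p x.
Proof.
rewrite /jtors /= -pullbackMn; split=> [|->]; last exact: pullback0.
exact: pullback_eq0.
Qed.

Lemma act_pullback x : act gam (pullback pi x) = pullback pi x.
Proof.
have [D ->] := cls_ex x; rewrite pullback_cls act_cls; congr (\pi_(jac Y)%qT _).
by apply: div0_eq => Q; rewrite /= !pullE below_tau.
Qed.

Lemma delta_pullback x : delta pi (pullback pi x) = 0.
Proof. by rewrite /delta act_pullback subrr. Qed.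

(* A Galois invariant divisor class is the class of an invariant divisor, by
   Hilbert 90 and since constants are norms of constants. *)
Lemma pullback_surj y : delta pi y = 0 -> exists x, y = pullback pi x.
Proof.
have [E ->] := cls_ex y; rewrite /delta => /eqP; rewrite subr_eq0 => /eqP.
rewrite act_cls => /cls_eq[h h0 hh].
have {}hh Q : E (tau Q) = E Q + ord Q h by rewrite -hh.
have hj j Q : ord Q (iter j gam h) = E (iter j.+1 tau Q) - E (iter j tau Q).
  by rewrite -ord_iter_tau iterS hh addrC addKr.
have [b hb] := norm_cov pi h.
have N0 : \prod_(j < p) iter j gam h != 0.
  by apply/prodf_neq0 => j _; rewrite iter_gam_eq0.
have ordb Q : ord Q (G b) = 0.
  rewrite -hb ord_prod; last by move=> j; rewrite iter_gam_eq0.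
  under eq_bigr do rewrite hj.
  by rewrite -(big_mkord xpredT (fun j => E (iter j.+1 tau Q) - E (iter j tau Q))) telescope_sumr // tau_order subrr.
have [|c bc] := @no_pole_const _ _ _ X b.
  by move=> P; rewrite -(secK pi P) vge_below vge_reg ordb.
have c0 : c != 0.
  by move: N0; rewrite hb bc; apply: contra_neq => ->; rewrite !rmorph0.
pose d := proot (hpkb i hp) c; have dc : d ^+ p = c := prootK _ c.
have d0 : d != 0 by apply: contra_neq c0 => d0; rewrite -dc d0 (fr0 (hpkb i hp)).
have [|w w0 hw] := @hilbert90 _ _ _ _ hp X Y pi (h / gcst Y d).
  transitivity (\prod_(j < p) iter j gam h / gcst Y d ^+ p).
    rewrite -[p in _ ^+ p]card_ord -prodr_const -prodf_div; apply: eq_bigr => j _.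
    by rewrite -fmorphV iter_gamM iter_gam_cst fmorphV.
  by rewrite hb bc gcov_cst -rmorphXn dc mulfV // fmorph_eq0.
have inv Q : E (tau Q) + ord (tau Q) w = E Q + ord Q w.
  have ow : ord Q w = ord Q h + ord (tau Q) w.
    rewrite ord_tau -{1}hw !ord_mul ?mulf_neq0 ?invr_eq0 ?fmorph_eq0 //.
    by rewrite ord_inv ord_cst subr0.
  by rewrite hh ow addrA.
have inv' j Q : E (iter j tau Q) + ord (iter j tau Q) w = E Q + ord Q w.
  by elim: j => // j IHj; rewrite iterS inv.
pose F Q := E Q + ord Q w; pose D P := F (sec pi P).
have [fE sE] := div0P E.
have fF : finsupp F by apply: finsuppD => //; apply: finsupp_ord.
have sF : \sum_(Q \in [set: place Y]) F Q = 0.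
  by rewrite fsumD ?sE ?deg_ord ?addr0 //; apply: finsupp_ord.
have [fD' sD'] := fsum_fibres pi hp fF.
have FD P : \sum_(j < p) F (iter j tau (sec pi P)) = D P *+ p.
  by rewrite -[p in RHS]card_ord -sumr_const; apply: eq_bigr => j _; apply: inv'.
have fD : finsupp D.
  apply: finsupp_comp fD' _ => P /eqP; rewrite FD mulrn_eq0 eqn0Ngt prime_gt0 //= => /eqP //.
have [|D' hD'] := div0_ex fD.
  move: sD'; rewrite sF (fsum_eq FD) (@fsum_additive _ _ _ (fun n : int => n *+ p)) ?mul0rn //.
    by move=> /esym/eqP; rewrite mulrn_eq0 eqn0Ngt prime_gt0 //= => /eqP.
  by move=> u v; rewrite mulrnDl.
exists (clX D'); rewrite pullback_cls; apply/cls_eq; exists w^-1; first by rewrite invr_eq0.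
move=> Q; rewrite pullE hD' /D ord_inv; have [j _ QE] := sec_orbit pi hp Q.
by rewrite {3}QE /F -(inv' j) -QE addrK.
Qed.

Lemma pullback_iso y : jtors_delta pi y -> exists2 x, jtors p x & y = pullback pi x.
Proof.
by move=> [hy /pullback_surj[x yx]]; exists x => //; apply/jtors_pullback; rewrite -yx.
Qed.

End Pullback.

(** * The cup product with the class of the cover *)

Lemma dlog_prod (p : nat) (K : fieldType) (t : K) (I : Type) (r : seq I) (F : I -> K) :
  p \in [pchar K] -> @pbasis p K t -> (forall j, F j != 0) ->
  dlog p t (\prod_(j <- r) F j) = \sum_(j <- r) dlog p t (F j).
Proof.
move=> hp ht F0; elim: r => [|j r IHr]; first by rewrite !big_nil (dlog1 hp ht).
rewrite !big_cons (dlogM hp ht) ?IHr //.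
by elim/big_ind: _ => [|u v|l _]; [apply: oner_neq0|apply: mulf_neq0|].
Qed.

Section Morphism.
Variables (p : nat) (K K' : fieldType) (h : {rmorphism K -> K'}).
Hypothesis hp : p \in [pchar K].
Variable t : K.
Hypotheses (ht : @pbasis p K t) (ht' : @pbasis p K' (h t)).

Let hp' : p \in [pchar K']. Proof. exact: rmorph_pchar hp. Qed.

Lemma theta_morph z : theta p (h t) (h z) = h (theta p t z).
Proof.
rewrite {1}(pcE ht z) [in RHS](pcE ht z) rmorph_sum (theta_sum hp' ht') (theta_sum hp ht) rmorph_sum.
apply: eq_bigr => j _; rewrite (theta_monom hp ht) [in RHS]rmorphM rmorph_nat.
by rewrite rmorphM !rmorphXn (theta_monom hp' ht').
Qed.

Lemma dlog_morph z : dlog p (h t) (h z) = h (dlog p t z).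
Proof. by rewrite !dlogE theta_morph fmorph_div. Qed.

End Morphism.

Section ResidueForms.
Variables (p : nat) (k : fieldType) (kb : closedFieldType) (i : {rmorphism k -> kb}).
Hypothesis hp : p \in [pchar k].
Hypothesis kb_algebraic : forall z : kb, algebraicOver i z.
Variable X : curve i.
Local Notation K := (gff X).
Local Notation hpK := (hpK hp X).
Local Notation theta := (@theta p K).
Local Notation dlog := (@dlog p K).
Local Notation res := (res p).
Implicit Types (P : place X) (t f h r : K).

Lemma res_unif P t h f : ord P t = 1 -> f != 0 -> res h f P = c0 P t (h * dlog t f).
Proof.
move=> ot f0; have ht := pbasis_unif hp kb_algebraic ot.
rewrite -(c0_indep hp kb_algebraic _ (ord_unifE P) ot) /res; congr c0; rewrite -mulrA; congr (_ * _).
rewrite !dlogE (theta_change hpK f (pbasis_unifE hp kb_algebraic P) ht).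
by rewrite mulrAC.
Qed.

Lemma resD h h' f P : res (h + h') f P = res h f P + res h' f P.
Proof. by rewrite /res mulrDl (c0D (ord_unifE P)). Qed.

Section LocalDerivation.
Variable P : place X.
Let t := unif P.
Let ht : @pbasis p K t. Proof. exact: pbasis_unifE. Qed.

Let dD : {morph (fun z => theta t z / t) : f g / f + g}.
Proof. by move=> f g; rewrite (thetaD hpK ht) mulrDl. Qed.

Let dM f g : theta t (f * g) / t = theta t f / t * g + f * (theta t g / t).
Proof. by rewrite (thetaM hpK ht) mulrDl [theta t f * g / t]mulrAC mulrA. Qed.

Let dC c : theta t (gcst X c) / t = 0.
Proof. by rewrite -(prootK (hpkb i hp) c) rmorphXn (theta_Kp hpK ht) mul0r. Qed.

Definition unif_der : der X := Der dD dM dC.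

Lemma local_unif_der : local_der P t unif_der.
Proof. by split; [exact: ord_unifE|rewrite /= (theta_t hpK ht) mulfV // unif_neq0]. Qed.

End LocalDerivation.

Lemma local_derE P t (D : der X) z : local_der P t D -> D z = theta t z / t.
Proof.
move=> [ot Dt]; have ht := pbasis_unif hp kb_algebraic ot.
by rewrite (deriv_theta hpK ht (derD D) (derM D)) Dt mulr1.
Qed.

Lemma der_pth (D : der X) z : D (z ^+ p) = 0.
Proof.
have DX n : D (z ^+ n.+1) = n.+1%:R * z ^+ n * D z.
  elim: n => [|n IHn]; first by rewrite expr1 mulr1 mul1r.
  rewrite exprS derM IHn -[n.+2]addn1 natrD exprS; ring.
by rewrite -(prednK (p_gt0 hp)) DX prednK ?(p_gt0 hp) // (pcharf0 hpK) !mul0r.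
Qed.

(** The definition of [residue] expands a form in terms of dt, whereas [c0] does so in terms of dt /
    t: the exponents differ by one, and the coefficient of index 0 is the residue in both. *)
Lemma residueE P r f c : f != 0 ->
  residue P (fun D => r * (D f / f)) c <-> c = res r f P.
Proof.
move=> f0; split=> [[t [D [hD [m [a [reg ->]]]]]]|->].
  have [ot _] := hD; have t0 := ord1_neq0 ot; rewrite (res_unif _ ot f0).
  pose q : {poly kb} := \poly_(j < m.+1) a (inord j).
  have -> : a ord0 = q`_0 by rewrite coef_poly /=; congr a; apply/val_inj; rewrite /= inordK.
  symmetry; apply: (c0_eq ot); move: reg; rewrite -vge_reg (local_derE f hD) => reg.
  have t1 : vge P 1 t by rewrite vgeE // ot.
  have := vgeM reg t1; rewrite add0r; congr vge; rewrite mulrBl dlogE; congr (_ - _).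
    by field; rewrite t0 f0.
  rewrite pv_poly mulr_suml; apply: eq_bigr => j _; rewrite inord_val -mulrA exprVn; congr (_ * _).
  by rewrite exprS; field; rewrite t0 expf_neq0.
exists (unif P), (unif_der P); split; first exact: local_unif_der.
have ot := ord_unifE P; have t0 := unif_neq0 P.
have [q hq] := polar_part ot (r * dlog (unif P) f).
exists (size q), (fun j => q`_j); split; last by rewrite /res (c0_eq ot hq).
rewrite -vge_reg; have tV : vge P (-1) (unif P)^-1 by have := vgeV P (unif P); rewrite ot.
have := vgeM hq tV; rewrite subrr; congr vge; rewrite mulrBl dlogE /=; congr (_ - _).
  by field; rewrite t0 f0.
rewrite (@pv_coef _ _ _ X q (size q).+1) // mulr_suml; apply: eq_bigr => j _.
by rewrite -mulrA exprVn exprS invfM mulrC [in RHS]mulrC; congr (_ * _); rewrite mulrC.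
Qed.

End ResidueForms.

Section Trace.
Variables (p : nat) (k : fieldType) (kb : closedFieldType) (i : {rmorphism k -> kb}).
Hypothesis hp : p \in [pchar k].
Hypothesis kb_algebraic : forall z : kb, algebraicOver i z.
Variables (X Y : curve i) (pi : zp_cover p X Y).
Local Notation K := (gff X).
Local Notation L := (gff Y).
Local Notation G := (gcov pi).
Local Notation gam := (gdeck pi).
Local Notation below := (below pi).
Local Notation tau := (tau pi).
Local Notation sec := (sec pi).
Local Notation res := (res p).
Local Notation clX := (\pi_(jac X)%qT : div0 X -> jac X).
Implicit Types (P : place X) (Q : place Y) (D : div0 X) (B : place Y -> int).

Let pr : prime p. Proof. exact: pchar_pr hp. Qed.

Lemma c0_below P Q t A : below Q = P -> ord P t = 1 -> c0 P t A = c0 Q (G t) (G A).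
Proof.
move=> <- ot; have [a ha] := polar_part ot A; rewrite (c0_eq ot ha).
symmetry; apply: c0_eq => //; move: ha.
by rewrite vge_below rmorphB -pv_cov fmorphV.
Qed.

Lemma c0_tau j Q t z : ord (below Q) t = 1 ->
  c0 (iter j tau Q) (G t) z = c0 Q (G t) (iter j gam z).
Proof.
move=> ot; have ot' : ord (iter j tau Q) (G t) = 1 by rewrite ord_iter_tau iter_gam_cov.
have [a ha] := polar_part ot' z; rewrite (c0_eq ot' ha); symmetry; apply: c0_eq => //.
move: ha; rewrite vge_iter_tau iter_gamD iter_gamN.
by rewrite -fmorphV pv_cov iter_gam_cov.
Qed.

Lemma dlog_gam t z j : @pbasis p L (G t) ->
  dlog p (G t) (iter j gam z) = iter j gam (dlog p (G t) z).
Proof.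
move=> ht; elim: j => // j IHj; rewrite !iterS -IHj -{1}(gam_cov pi t).
by rewrite (dlog_morph (hpK hp Y)) // gam_cov.
Qed.

(** The logarithmic differential of the norm is the sum of the conjugates of that of g, and
    conjugation moves the residue along the fibre. *)
Lemma res_norm r f g P : f != 0 -> G f = \prod_(j < p) iter j gam g ->
  res r f P = \sum_(j < p) res (G r) g (iter j tau (sec P)).
Proof.
move=> f0 fg; have ot := ord_unifE P; set t := unif P in ot *.
have g0 : g != 0.
  apply: contra_neq f0 => g0; apply: (fmorph_inj G); rewrite fg rmorph0.
  by rewrite (bigD1 (Ordinal (prime_gt0 pr))) //= g0 mul0r.
have oT Q : below Q = P -> ord Q (G t) = 1 by move=> QP; rewrite -ord_below QP.
have bP : below (sec P) = P := secK pi P.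
have hT : @pbasis p L (G t) := pbasis_unif hp kb_algebraic (oT _ bP).
have ht : @pbasis p K t := pbasis_unif hp kb_algebraic ot.
rewrite {1}/res (c0_below _ bP ot) rmorphM -(dlog_morph (hpK hp X) ht hT) fg.
rewrite (dlog_prod _ (hpK hp Y) hT) => [|j]; last by rewrite iter_gam_eq0.
rewrite mulr_sumr (c0_sum (oT _ bP)); apply: eq_bigr => j _.
rewrite (res_unif hp kb_algebraic _ (t := G t)) //; last by apply: oT; rewrite below_iter_tau.
by rewrite c0_tau ?bP // iter_gamM iter_gam_cov (dlog_gam _ _ hT).
Qed.

Section Formula.
Variables (y : L) (r : place X -> K).
Hypothesis gy : gam y = y + 1.
Hypothesis ry : forall Q, vge Q 0 (y + G (r (below Q))).

Let S Q := rv Q (y + G (r (below Q))).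

Let S_tau Q : S (tau Q) = S Q + 1.
Proof.
apply: rv_eq; rewrite below_tau -[tau Q]/(iter 1 tau Q) vge_iter_tau /=.
rewrite rmorphB !rmorphD gy gdeck_cst gam_cov; have := rvP (ry Q); rewrite -/(S Q).
by congr vge; rewrite rmorph1; ring.
Qed.

(** On Y, replacing r by y + r changes the total by the sum of the residues of y dg / g, which is
    zero; and y + r is regular, with value S Q at Q. *)
Lemma cup_formula f g : f != 0 -> G f = \prod_(j < p) iter j gam g -> g != 0 ->
  \sum_(P \in [set: place X]) res (r P) f P = \sum_(Q \in [set: place Y]) S Q * (ord Q g)%:~R.
Proof.
move=> f0 fg g0; pose E Q := res (G (r (below Q))) g Q.
have E2 Q : E Q = S Q * (ord Q g)%:~R - res y g Q.
  by rewrite -(res_vge0 hp kb_algebraic g0 (ry Q)) resD addrAC subrr add0r.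
have fS : finsupp (fun Q => S Q * (ord Q g)%:~R).
  by apply: finsupp_comp (finsupp_ord g) _ => Q ->; rewrite mulr0.
have fE : finsupp E.
  rewrite (_ : E = fun Q => S Q * (ord Q g)%:~R - res y g Q); last exact/funext.
  by apply: finsuppB => //; apply: finsupp_res.
transitivity (\sum_(Q \in [set: place Y]) E Q).
  have [_ ->] := fsum_fibres pi hp fE; apply: fsum_eq => P.
  rewrite (res_norm _ _ f0 fg); apply: eq_bigr => j _.
  by rewrite /E below_iter_tau secK.
rewrite (fsum_eq E2) fsumB //; last exact: finsupp_res.
by rewrite (residue_theorem hp kb_algebraic _ g0) subr0.
Qed.

(** Summation by parts, with S increasing by 1 along tau. *)
Lemma shift_formula B : finsupp B ->
  \sum_(Q \in [set: place Y]) S Q * (B (tau Q) - B Q)%:~R =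
  (- \sum_(Q \in [set: place Y]) B Q)%:~R.
Proof.
move=> fB; have fBt := finsupp_tau pi fB.
have f1 : finsupp (fun Q => S Q * (B (tau Q))%:~R).
  by apply: finsupp_comp fBt _ => Q /= ->; rewrite mulr0.
have f2 : finsupp (fun Q => S (tau Q) * (B (tau Q))%:~R).
  by apply: finsupp_comp fBt _ => Q /= ->; rewrite mulr0.
have f3 : finsupp (fun Q => S Q * (B Q)%:~R).
  by apply: finsupp_comp fB _ => Q /= ->; rewrite mulr0.
transitivity (\sum_(Q \in [set: place Y]) (S Q * (B (tau Q))%:~R - S Q * (B Q)%:~R)).
  by apply: fsum_eq => Q; rewrite rmorphB mulrBr.
rewrite fsumB // -(fsum_tau pi (fun Q => S Q * (B Q)%:~R)) -fsumB //.
transitivity (\sum_(Q \in [set: place Y]) (- (B (tau Q))%:~R : kb)).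
  by apply: fsum_eq => Q; rewrite S_tau; ring.
rewrite (@fsum_additive _ _ _ (fun n : int => - n%:~R : kb) (B \o tau)) //.
- by rewrite (fsum_tau pi B) rmorphN.
- by rewrite oppr0.
- by move=> u v; rewrite rmorphD opprD.
Qed.

End Formula.

(* A divisor D with p D principal is described through a function g on Y such that
   p D is the divisor of its norm: div g is p D1 + (B o tau - B), where D1 is of norm D. *)
Definition sdat D B := exists (g : L) (D1 : place Y -> int),
  [/\ g != 0, forall Q, ord Q g = D1 Q *+ p + (B (tau Q) - B Q) &
      forall Q, \sum_(j < p) D1 (iter j tau Q) = D (below Q)].

Lemma Fp_kb (c : 'F_p) (n : int) : (c : nat)%:R = n%:~R :> kb <-> c = n%:~R.
Proof.
have h (R : fieldType) : p \in [pchar R] -> (c : nat)%:R = n%:~R :> R <-> (p %| (c : nat)%:Z - n)%Z.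
  move=> hR; rewrite (dvdz_pcharf hR) rmorphB /= subr_eq0.
  by split=> [e|/eqP //]; apply/eqP.
rewrite (h kb (hpkb i hp)) -(h 'F_p (pchar_Fp pr)).
by rewrite natr_Zp.
Qed.

Lemma finite_poles_sec y : finite_set [set P | ~~ (0 <= ord (sec P) y)].
Proof.
have [l _ hl] := finsupp_seq (finsupp_ord y).
apply: (@sub_finite_set _ _ [set` [seq below Q | Q <- l]]) => [P /= h|//].
rewrite -(secK pi P); apply/map_f/hl; apply: contraNN h => /eqP -> //.
Qed.

(** Where an Artin-Schreier generator y has a pole at the chosen point above P, r P is minus its
    polar part; the other points of the fibre see y + j, with the same poles. With a = y ^ p - y,
    the class (r, -da) is fixed by F through h = -a, as r ^ p - r + a is regular. *)
Lemma eta_ex : exists r w, eta pi r w.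
Proof.
have [y gy] := artin_schreier hp pi.
have [|a ya] := @gam_fixed _ _ _ _ X Y pi (y ^+ p - y).
  rewrite rmorphB rmorphXn gy (frD (hpK hp Y)) expr1n; ring.
have /choice[r hr] : forall P, exists r, (0 <= ord (sec P) y -> r = 0) /\ vge (sec P) 0 (y + G r).
  move=> P; have [h|h] := boolP (0 <= ord (sec P) y).
    by exists 0; split=> //; rewrite rmorph0 addr0 vge_reg.
  have [t ot] := unramified pi (sec P); have [q hq] := polar_part ot y.
  exists (- pv q t^-1); split=> //; rewrite rmorphN -pv_cov fmorphV; exact: vge_leq hq.
have ry Q : vge Q 0 (y + G (r (below Q))).
  have [j _ QE] := sec_orbit pi hp Q; rewrite {1}QE vge_iter_tau iter_gamD iter_gam_cov.
  rewrite (iter_gam_y gy) addrAC; apply: vgeD; first by have [] := hr (below Q).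
  by rewrite -(rmorph_nat (gcst Y)); apply: vge_cst.
pose b P := r P ^+ p - r P + a.
have hb P : vge P 0 (b P).
  rewrite -(secK pi P) vge_below secK /b rmorphD rmorphB rmorphXn -ya.
  have := ry (sec P); rewrite secK; set s := y + _ => hs.
  have -> : G (r P) ^+ p - G (r P) + (y ^+ p - y) = s ^+ p - s.
    by rewrite /s (frD (hpK hp Y)); ring.
  by apply: vgeB => //; apply: vgeX0.
exists r, (fun D : der X => - D a); split.
- split.
  + apply: sub_finite_set (finite_poles_sec y) => P /=; apply: contraNN => h.
    by have [/(_ h) ->] := hr P; rewrite ord_zero.
  + exists (-1), a => D; by rewrite mulN1r.
  + move=> P t D hD; have [ot _] := hD; have ht := pbasis_unif hp kb_algebraic ot.
    have -> : - D a + diff (r P) D = - D (b P).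
      have D0 : D 0 = 0 by rewrite -(rmorph0 (gcst X)) der_cst rmorph0.
      have DN u : D (- u) = - D u by apply/eqP; rewrite -addr_eq0 -derD addNr D0.
      by rewrite /b !derD DN (der_pth hp) /diff; ring.
    rewrite -vge_reg vgeN (local_derE hp kb_algebraic _ hD).
    rewrite -[0](subrr 1); apply: vgeM; first exact: (vge_theta0 hp kb_algebraic ot).
    by have := vgeV P t; rewrite ot.
- by exists y; split=> // Q; rewrite -vge_reg.
- exists (- a); split=> [P|D]; first by rewrite opprK -vge_reg.
  have D0 : D 0 = 0 by rewrite -(rmorph0 (gcst X)) der_cst rmorph0.
  have DN u : D (- u) = - D u by apply/eqP; rewrite -addr_eq0 -derD addNr D0.
  by rewrite sub0r opprK /diff DN opprK.
Qed.

Lemma is_dlog_indep D f u : f != 0 -> (forall P, D P *+ p = ord P f) -> is_dlog p (clX D) u ->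
  forall E, u E = E f / f.
Proof.
move=> f0 hf [D' [f' [/cls_eq[h h0 DD'] f0' hf' uE]]] E.
have [|c hc] := @no_pole_const _ _ _ X (f / (f' * h ^+ p)).
  move=> P; rewrite vge_reg ord_mul ?invr_eq0 ?mulf_neq0 ?expf_neq0 // ord_inv.
  rewrite ord_mul ?expf_neq0 // ordX // -hf -hf' DD' mulrnDl subrr //.
have fE : f = gcst X c * (f' * h ^+ p).
  by rewrite -hc divfK // mulf_neq0 ?expf_neq0.
have c0 : gcst X c != 0 by apply: contra_neq f0; rewrite fE => ->; rewrite mul0r.
rewrite uE fE !derM der_cst (der_pth hp) mul0r add0r mulr0 addr0.
by field; rewrite c0 f0' expf_neq0.
Qed.

(** The cup product is the sum of the S Q times ord Q g. The part p D1 of div g vanishes in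
    characteristic p, and [shift_formula] evaluates the rest, for every choice of eta and of the
    representatives of x. *)
Theorem surj_eq D B : finsupp B -> sdat D B ->
  jtors p (clX D) /\ Defs.surj pi (clX D) = (- \sum_(Q \in [set: place Y]) B Q)%:~R.
Proof.
move=> fB [g [D1 [g0 hg hD1]]]; have [f fg] := norm_cov pi g.
have f0 : f != 0.
  by rewrite -(fmorph_eq0 G) -fg; apply/prodf_neq0 => j _; rewrite iter_gam_eq0.
have hf P : D P *+ p = ord P f.
  rewrite -{2}(secK pi P) ord_below -fg ord_prod; last by move=> j; rewrite iter_gam_eq0.
  under eq_bigr do rewrite -ord_iter_tau hg.
  rewrite big_split /= sumrMnl hD1 secK.
  rewrite -(big_mkord xpredT (fun j => B (iter j.+1 tau (sec P)) - B (iter j tau (sec P)))).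
  by rewrite telescope_sumr // tau_order subrr addr0.
split; first by apply/jtors_cls; exists f.
set c : 'F_p := _%:~R; pose n := - \sum_(Q \in [set: place Y]) B Q.
have val r y : gam y = y + 1 -> (forall Q, vge Q 0 (y + G (r (below Q)))) ->
    \sum_(P \in [set: place X]) res (r P) f P = n%:~R.
  move=> gy ry; rewrite (cup_formula ry f0 (esym fg) g0) -(shift_formula gy ry fB).
  apply: fsum_eq => Q; rewrite hg rmorphD mulrDr -mulr_natr rmorphM /= rmorph_nat.
  by rewrite (pcharf0 (hpkb i hp)) mulr0 mulr0 add0r.
rewrite /Defs.surj; case: xgetP => [d -> [r [w [u [hrw hu [rho [hrho hd]]]]]]|/(_ c)[]].
  have [_ [y [gy ry]] _] := hrw; have uE := is_dlog_indep f0 hf hu.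
  apply/Fp_kb; rewrite hd -/n -(val r y gy) => [|Q]; last by rewrite vge_reg.
  apply: fsum_eq => P; apply/(residueE hp kb_algebraic _ _ _ f0).
  have := hrho P; congr residue; apply/funext => E; by rewrite uE.
have [r [w hrw]] := eta_ex; have [_ [y [gy ry]] _] := hrw.
exists r, w, (fun E => E f / f); split=> //; first by exists D, f.
exists (fun P => res (r P) f P); split=> [P|]; first exact/(residueE hp kb_algebraic _ _ _ f0).
rewrite (val r y gy) => [|Q]; last by rewrite vge_reg.
exact/Fp_kb.
Qed.

End Trace.

(** * Divisors along the orbits of tau *)

Section OrbitSums.
Variables (p : nat) (k : fieldType) (kb : closedFieldType) (i : {rmorphism k -> kb}).
Variables (X Y : curve i) (pi : zp_cover p X Y).
Hypothesis hp : p \in [pchar k].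
Local Notation below := (below pi).
Local Notation tau := (tau pi).
Local Notation sec := (sec pi).
Implicit Types (P : place X) (Q : place Y) (F B : place Y -> int) (d : place X -> int).

Let p0 : (0 < p)%N. Proof. exact: prime_gt0 (pchar_pr hp). Qed.

Definition idx Q : nat := s2val (cid2 (sec_orbit pi hp Q)).

Lemma idx_lt Q : (idx Q < p)%N. Proof. exact: s2valP (cid2 (sec_orbit pi hp Q)). Qed.

Lemma idxE Q : Q = iter (idx Q) tau (sec (below Q)).
Proof. exact: s2valP' (cid2 (sec_orbit pi hp Q)). Qed.

Lemma idx_sec j P : (j < p)%N -> idx (iter j tau (sec P)) = j.
Proof.
move=> jp; have e := idxE (iter j tau (sec P)); rewrite below_iter_tau secK in e.
by apply/esym; apply: iter_tau_inj e => //; apply: idx_lt.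
Qed.

Lemma orbit_sum F Q : \sum_(j < p) F (iter j tau Q) = \sum_(j < p) F (iter j tau (sec (below Q))).
Proof.
have inv R : \sum_(j < p) F (iter j tau (tau R)) = \sum_(j < p) F (iter j tau R).
  apply: (addrI (F R)); transitivity (\sum_(j < p.+1) F (iter j tau R)).
    by rewrite big_ord_recl; congr (_ + _); apply: eq_bigr => j _; rewrite -iterSr.
  by rewrite big_ord_recr /= tau_order addrC.
rewrite {1}(idxE Q); elim: (idx Q) => // n IHn.
by rewrite -IHn; apply: inv.
Qed.

(* Partial sums of F along the orbits of tau, each numbered from its section point. *)
Definition psum F Q := \sum_(l < idx Q) F (iter l tau (sec (below Q))).

(** All of d is put on the last point of each orbit, where the partial sums drop back to zero. *)
Definition lst d Q := if idx Q == p.-1 then d (below Q) else 0.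

Lemma psum_tau F d Q : (forall P, \sum_(l < p) F (iter l tau (sec P)) = d P *+ p) ->
  F Q = lst d Q *+ p + (psum F (tau Q) - psum F Q).
Proof.
move=> hd; rewrite /psum /lst below_tau; set P := below Q; set j := idx Q.
have jp : (j < p)%N := idx_lt Q; have QE : Q = iter j tau (sec P) := idxE Q.
have tQ : tau Q = iter j.+1 tau (sec P) by rewrite iterS -QE.
have FQ : F Q = F (iter j tau (sec P)) by rewrite -QE.
rewrite FQ tQ; case: eqP => [jE|/eqP jE].
  have pj : p = j.+1 by rewrite jE prednK.
  have recr n : n = j.+1 -> \sum_(l < n) F (iter l tau (sec P)) =
      \sum_(l < j) F (iter l tau (sec P)) + F (iter j tau (sec P)).
    by move=> ->; rewrite big_ord_recr.
  have i0 : idx (iter p tau (sec P)) = 0%N by rewrite tau_order; apply: (@idx_sec 0 P p0).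
  rewrite -pj i0 big_ord0 sub0r /= -hd.
  by rewrite (recr p pj) addrC addKr.
have j1p : (j.+1 < p)%N by rewrite -(prednK p0) ltnS ltn_neqAle jE -ltnS prednK.
by rewrite idx_sec // big_ord_recr /= mul0rn add0r addrAC subrr add0r.
Qed.

Lemma lst_norm d Q : \sum_(j < p) lst d (iter j tau Q) = d (below Q).
Proof.
have lt : (p.-1 < p)%N by rewrite prednK.
rewrite orbit_sum (bigD1 (Ordinal lt)) //= big1 ?addr0 => [|j /negPf].
  by rewrite /lst idx_sec // eqxx below_iter_tau secK.
by rewrite -val_eqE /= /lst idx_sec // => ->.
Qed.

Lemma finsupp_psum F : finsupp F -> finsupp (psum F).
Proof.
(* Absolute values are needed because the sum of F over an orbit can vanish although F does not. *)
move=> fF; have fA : finsupp (fun Q => `|F Q|) by apply: finsupp_comp fF _ => Q ->; rewrite normr0.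
have [fA' _] := fsum_fibres pi hp fA.
apply: finsupp_comp (finsupp_below pi hp fA') _ => Q /= h0.
rewrite /psum big1 // => l _; have lp : (l < p)%N := ltn_trans (ltn_ord l) (idx_lt Q).
apply/eqP; rewrite -normr_eq0; apply/eqP.
move/eqP: h0; rewrite psumr_eq0 // => /allP/(_ (Ordinal lp) (mem_index_enum _)) /eqP //.
Qed.

End OrbitSums.

(** * Kernel and image of the surjection onto Z/p *)

Section Surjection.
Variables (p : nat) (k : fieldType) (kb : closedFieldType) (i : {rmorphism k -> kb}).
Hypothesis hp : p \in [pchar k].
Hypothesis kb_algebraic : forall z : kb, algebraicOver i z.
Variables (X Y : curve i) (pi : zp_cover p X Y).
Local Notation K := (gff X).
Local Notation L := (gff Y).
Local Notation G := (gcov pi).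
Local Notation gam := (gdeck pi).
Local Notation below := (below pi).
Local Notation tau := (tau pi).
Local Notation sec := (sec pi).
Local Notation srj := (Defs.surj pi).
Local Notation clX := (\pi_(jac X)%qT : div0 X -> jac X).
Local Notation clY := (\pi_(jac Y)%qT : div0 Y -> jac Y).
Local Notation psum := (psum pi hp).
Local Notation lst := (lst pi hp).
Implicit Types (P : place X) (Q : place Y) (D : div0 X) (E : div0 Y) (B : place Y -> int).
Implicit Types (x : jac X) (m : jac Y).

Let pr : prime p. Proof. exact: pchar_pr hp. Qed.

Lemma sdat_ex D : jtors p (clX D) -> exists2 B, finsupp B & sdat pi D B.
Proof.
move=> /jtors_cls[f f0 hf]; have [g gf] := norm_surj hp kb_algebraic pi f0.
have g0 : g != 0.
  apply: contra_neq f0 => g0; apply: (fmorph_inj G); rewrite -gf rmorph0.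
  by rewrite (bigD1 (Ordinal (prime_gt0 pr))) //= g0 mul0r.
exists (psum (fun Q => ord Q g)); first exact/finsupp_psum/finsupp_ord.
exists g, (lst D); split=> // [Q|Q]; last exact: lst_norm.
apply: (@psum_tau _ _ _ _ _ _ pi hp (fun Q => ord Q g)) => P.
under eq_bigr do rewrite ord_iter_tau.
rewrite -ord_prod; last by move=> j; rewrite iter_gam_eq0.
by rewrite gf -ord_below secK hf.
Qed.

Lemma surj_spec x : jtors p x -> exists D B, [/\ x = clX D, finsupp B, sdat pi D B &
  srj x = (- \sum_(Q \in [set: place Y]) B Q)%:~R].
Proof.
have [D ->] := cls_ex x; move=> hx; have [B fB hB] := sdat_ex hx.
by exists D, B; split=> //; have [_ ->] := surj_eq hp kb_algebraic fB hB.
Qed.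

Lemma surjD x x' : jtors p x -> jtors p x' -> srj (x + x') = srj x + srj x'.
Proof.
move=> /surj_spec[D [B [-> fB [g [D1 [g0 hg hD1]]] ->]]].
move=> /surj_spec[D' [B' [-> fB' [g' [D1' [g0' hg' hD1']]] ->]]].
have fBB := finsuppD fB fB'; rewrite -clsD.
have [|_ ->] := @surj_eq _ _ _ _ hp kb_algebraic _ _ pi (D + D') _ fBB.
  exists (g * g'), (fun Q => D1 Q + D1' Q); split=> [|Q|Q]; first exact: mulf_neq0.
    by rewrite ord_mul // hg hg' mulrnDl; ring.
  by rewrite big_split /= hD1 hD1'.
by rewrite fsumD // opprD rmorphD.
Qed.

Lemma jtors0 (Z : curve i) : jtors p (0 : jac Z).
Proof. by rewrite /jtors /= mul0rn. Qed.

Lemma jtorsD (Z : curve i) (u v : jac Z) : jtors p u -> jtors p v -> jtors p (u + v).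
Proof. by rewrite /jtors /= mulrnDl => -> ->; rewrite addr0. Qed.

Lemma jtorsN (Z : curve i) (u : jac Z) : jtors p u -> jtors p (- u).
Proof. by rewrite /jtors /= mulNrn => ->; rewrite oppr0. Qed.

Lemma jtorsMn (Z : curve i) (u : jac Z) n : jtors p u -> jtors p (u *+ n).
Proof. by move=> hu; rewrite /jtors /= mulrnAC hu mul0rn. Qed.

Lemma surj0 : srj 0 = 0.
Proof. by apply: (addrI (srj 0)); rewrite -surjD ?addr0 //; apply: jtors0. Qed.

Lemma surjMn x n : jtors p x -> srj (x *+ n) = srj x *+ n.
Proof.
move=> hx; elim: n => [|n IHn]; first by rewrite surj0.
by rewrite !mulrS surjD ?IHn //; apply: jtorsMn.
Qed.

Lemma surjN x : jtors p x -> srj (- x) = - srj x.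
Proof.
move=> hx; apply/eqP; rewrite -addr_eq0 -surjD ?addNr ?surj0 //; exact: jtorsN.
Qed.

Lemma fsum_pt (Z : curve i) (Q0 : place Z) : finsupp (fun Q : place Z => (Q == Q0)%:R : int) /\
  \sum_(Q \in [set: place Z]) ((Q == Q0)%:R : int) = 1.
Proof.
have h (Q : place Z) : (Q == Q0)%:R != 0 :> int -> Q \in [:: Q0] by rewrite inE; case: (Q == Q0).
split; first exact: seq_finsupp h.
by rewrite (fsumE (r := [:: Q0])) // big_seq1 eqxx.
Qed.

(** Start from B of degree -1: B o tau - B has degree zero, and divisibility of Pic^0 by p provides
    g and D1. *)
Lemma surj_onto : exists2 x, jtors p x & srj x = 1.
Proof.
have [Q0 _] := place_ex kb_algebraic Y; have [f1 s1] := fsum_pt Q0.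
pose B Q : int := - (Q == Q0)%:R; have fB : finsupp B := finsuppN f1.
have sB : \sum_(Q \in [set: place Y]) B Q = -1 by rewrite fsumN // s1.
have fBt := finsupp_tau pi fB.
have [|g [D' [g0 hg]]] := @div_p_divisible _ _ _ _ hp kb_algebraic Y (fun Q => B (tau Q) - B Q) (finsuppB fBt fB).
  by rewrite fsumB // (fsum_tau pi B) subrr.
have [fD' sD'] := div0P D'.
have [fN sN] := fsum_fibres pi hp fD'.
have [|D hD] := div0_ex (finsuppN fN); first by rewrite fsumN // -sN sD' oppr0.
have [|hx hs] := @surj_eq _ _ _ _ hp kb_algebraic _ _ pi D B fB.
  exists g, (fun Q => - D' Q); split=> // Q; first by rewrite hg mulNrn; ring.
  by rewrite hD -(orbit_sum pi hp) sumrN.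
by exists (clX D) => //; rewrite hs sB.
Qed.

(** If m is the class of E and E o tau - E = pi^* D + div h, then B can be the partial sums of pi^*
    D minus E. Its degree is 0 + 1 + ... + (p - 1) times deg D, that is zero. *)
Lemma surj_delta m x : delta pi m = pullback pi x -> srj x = 0.
Proof.
have [D ->] := cls_ex x; have [E ->] := cls_ex m.
rewrite (pullback_cls hp) /delta act_cls -clsB => /cls_eq[h h0 hh].
have {}hh Q : E (tau Q) - E Q = D (below Q) + ord Q h by rewrite -(pullE hp pi) -hh.
have [fE sE] := div0P E; have [fD sD] := div0P D.
have fF := finsupp_psum pi hp (finsupp_below pi hp fD).
pose B Q := psum (D \o below) Q - E Q.
have fB : finsupp B by apply: finsuppB.
have DP P : \sum_(l < p) (D \o below) (iter l tau (sec P)) = D P *+ p.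
  rewrite -[p in RHS]card_ord -sumr_const.
  by apply: eq_bigr => j _; rewrite /= below_iter_tau secK.
have [|_ ->] := @surj_eq _ _ _ _ hp kb_algebraic _ _ pi D B fB.
  exists h^-1, (lst D); split=> [|Q|Q]; first by rewrite invr_eq0.
    have /(_ Q) h1 := @psum_tau _ _ _ _ _ _ pi hp (D \o below) D _ DP.
    rewrite ord_inv; have := hh Q; rewrite -[D (below Q)]/((D \o below) Q) h1 /B; lia.
  exact: lst_norm.
rewrite /B fsumB // sE subr0; have [_ ->] := fsum_fibres pi hp fF.
transitivity ((- \sum_(P \in [set: place X]) D P *+ (\sum_(j < p) j))%:~R : 'F_p).
  congr (- _)%:~R; apply: fsum_eq => P; rewrite -sumrMnr; apply: eq_bigr => j _.
  rewrite /psum idx_sec // below_iter_tau secK -[nat_of_ord j in RHS]card_ord -sumr_const.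
  by apply: eq_bigr => l _; rewrite /= below_iter_tau secK.
rewrite (@fsum_additive _ _ _ (fun n : int => n *+ (\sum_(j < p) j)) D) ?sD ?mul0rn ?oppr0 //.
by move=> u v; rewrite mulrnDl.
Qed.

(** The degree of B is now a multiple of p. Subtracting a multiple of a fibre, which tau preserves,
    gives B' of degree zero, so B' = div e + p E1. Then g e / gam e has divisor p M with M = D1 + E1
    o tau - E1, and M has the same sums over orbits as D1, namely those that give pi^* D. *)
Lemma surj_norm x : jtors p x -> srj x = 0 ->
  exists2 m, jtors p m & pullback pi x = iter p.-1 (delta pi) m.
Proof.
move=> hx sx; have [D [B [xD fB [g [D1 [g0 hg hD1]]] hs]]] := surj_spec hx.
have [n hn] : exists n : int, \sum_(Q \in [set: place Y]) B Q = n *+ p.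
  move: hs; rewrite sx => /esym/eqP; rewrite -(dvdz_pcharf (pchar_Fp pr)) => /dvdzP[d hd].
  by exists (- d); rewrite -[LHS]opprK hd mulNrn -mulr_natr natz.
have [P0 _] := place_ex kb_algebraic X; have [f1 s1] := fsum_pt P0.
pose I Q : int := (below Q == P0)%:R.
have It Q : I (tau Q) = I Q by rewrite /I below_tau.
have fI : finsupp I := finsupp_below pi hp f1.
have sI : \sum_(Q \in [set: place Y]) I Q = 1 *+ p.
  have [_ ->] := fsum_fibres pi hp fI; rewrite -s1 -(@fsum_additive _ _ _ (fun n : int => n *+ p)) ?mul0rn //.
    apply: fsum_eq => P; rewrite -[p in RHS]card_ord -sumr_const.
    by apply: eq_bigr => j _; rewrite /I below_iter_tau secK.
  by move=> u v; rewrite mulrnDl.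
pose B' Q := B Q - n * I Q.
have fnI : finsupp (fun Q => n * I Q) by apply: finsupp_comp fI _ => Q ->; rewrite mulr0.
have fB' : finsupp B' by apply: finsuppB.
have [|e [E1 [e0 he]]] := @div_p_divisible _ _ _ _ hp kb_algebraic Y B' fB'.
  rewrite fsumB // hn (@fsum_additive _ _ _ (fun m : int => n * m)) ?mulr0 //.
    by rewrite sI mulrnAr mulr1 subrr.
  by move=> u v; rewrite mulrDr.
have hB' Q : B (tau Q) - B Q = B' (tau Q) - B' Q by rewrite /B' It; ring.
pose M Q := D1 Q + (E1 (tau Q) - E1 Q).
have hM Q : M Q *+ p = ord Q (g * e / gam e).
  rewrite !ord_mul ?invr_eq0 ?mulf_neq0 ?fmorph_eq0 // ord_inv -ord_tau hg hB' !he.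
  by rewrite /M !mulrnDl mulNrn; ring.
have fM : finsupp M.
  apply: finsupp_comp (finsupp_ord (g * e / gam e)) _ => Q /eqP.
  by rewrite -hM mulrn_eq0 eqn0Ngt prime_gt0 //= => /eqP.
have [|m hm] := div0_ex fM.
  have := deg_ord (g * e / gam e); rewrite -(fsum_eq hM).
  rewrite (@fsum_additive _ _ _ (fun n : int => n *+ p)) ?mul0rn //; last by move=> u v; rewrite mulrnDl.
  by move=> /eqP; rewrite mulrn_eq0 eqn0Ngt prime_gt0 //= => /eqP.
have tm : jtors p (clY m).
  apply/jtors_cls; exists (g * e / gam e); first by rewrite !mulf_neq0 ?invr_eq0 ?fmorph_eq0.
  by move=> Q; rewrite hm hM.
exists (clY m) => //; rewrite iter_delta_p1 // xD (pullback_cls hp).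
under eq_bigr do rewrite iter_act_cls.
rewrite -(big_morph clY (@clsD _ _ _ Y) (@cls0 _ _ _ Y)); congr (\pi_(jac Y)%qT _).
apply: div0_eq => Q; rewrite pullE -hD1.
have -> : (\sum_(j < p) iter j (div_act gam) m) Q = \sum_(j < p) M (iter j tau Q).
  elim: (index_enum _) => [|j l IH]; first by rewrite !big_nil.
  by rewrite !big_cons div0D IH iter_div_actE hm.
rewrite big_split /= -(big_mkord xpredT (fun j => E1 (iter j.+1 tau Q) - E1 (iter j tau Q))).
by rewrite telescope_sumr // tau_order subrr addr0.
Qed.

End Surjection.

(** * Galois action *)

(** Elements of Gal(kbar/k), kept apart from their action on a function field so that the same one
    can act on X and on Y. *)
Record kaut (k : fieldType) (kb : closedFieldType) (i : {rmorphism k -> kb}) := KAut {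
  kf :> kb -> kb;
  kg : kb -> kb;
  kfB : zmod_morphism kf;
  kfM : monoid_morphism kf;
  kf_base : forall a, kf (i a) = i a;
  kfK : cancel kf kg;
  kgK : cancel kg kf }.

HB.instance Definition _ k kb i (a : @kaut k kb i) :=
  GRing.isZmodMorphism.Build kb kb (kf a) (kfB a).
HB.instance Definition _ k kb i (a : @kaut k kb i) :=
  GRing.isMonoidMorphism.Build kb kb (kf a) (kfM a).

Section InverseAut.
Variables (k : fieldType) (kb : closedFieldType) (i : {rmorphism k -> kb}) (a : kaut i).

Let gB : zmod_morphism (kg a).
Proof. by move=> c d; apply: (can_inj (kfK a)); rewrite rmorphB /= !kgK. Qed.

Let gM : monoid_morphism (kg a).
Proof.
split; first by apply: (can_inj (kfK a)); rewrite rmorph1 /= kgK.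
by move=> c d; apply: (can_inj (kfK a)); rewrite rmorphM /= !kgK.
Qed.

Let g_base c : kg a (i c) = i c.
Proof. by apply: (can_inj (kfK a)); rewrite kgK kf_base. Qed.

Definition kinv : kaut i := KAut gB gM g_base (kgK a) (kfK a).

End InverseAut.

Section Lift.
Variables (k : fieldType) (kb : closedFieldType) (i : {rmorphism k -> kb}).
Variable Z : curve i.
Local Notation K := (gff Z).
Implicit Types (l : seq (ff Z * kb)) (f : kb -> kb) (a : kaut i).

(** A list stands for a formal sum of tensors of k(Z) and kbar, with f acting on the second
    factors. *)
Definition bcsum f l : K := \sum_(x <- l) bc Z x.1 * gcst Z (f x.2).

Lemma bcsum_ex z : exists l, z = bcsum id l.
Proof.
have [n [u [c ->]]] := bc_span z; exists [seq (u j, c j) | j : 'I_n].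
by rewrite /bcsum big_map big_enum.
Qed.

Lemma bcsum_cat f l l' : bcsum f (l ++ l') = bcsum f l + bcsum f l'.
Proof. by rewrite /bcsum big_cat. Qed.

Lemma bcsum_opp f l : bcsum f [seq (- x.1, x.2) | x <- l] = - bcsum f l.
Proof. by rewrite /bcsum big_map -sumrN; apply: eq_bigr => x _; rewrite rmorphN mulNr. Qed.

Lemma bcsum_mul f l l' : {morph f : c d / c * d} ->
  bcsum f [seq (x.1 * y.1, x.2 * y.2) | x <- l, y <- l'] = bcsum f l * bcsum f l'.
Proof.
move=> fM; rewrite /bcsum big_allpairs_dep mulr_suml; apply: eq_bigr => x _.
rewrite mulr_sumr; apply: eq_bigr => y _ /=.
by rewrite fM !rmorphM mulrACA.
Qed.

Lemma bcsum_map f g l : bcsum f [seq (x.1, g x.2) | x <- l] = bcsum (f \o g) l.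
Proof. by rewrite /bcsum big_map. Qed.

(** Rewritten with constants independent over k, a vanishing sum has zero coefficients, and a does
    not act on these; so the action on tensors is well defined. *)
Lemma bcsum_eq0 a l : bcsum id l = 0 -> bcsum a l = 0.
Proof.
rewrite /bcsum big_tnth [in X in _ -> X]big_tnth.
set u := fun j => (tnth (in_tuple l) j).1; set c := fun j => (tnth (in_tuple l) j).2 => h.
have [m [e [b [efree cE]]]] := kbasis i c.
pose v j := \sum_l u l * kcst Z (b l j).
have conv (f : {rmorphism kb -> kb}) : (forall d, f (i d) = i d) ->
    \sum_j bc Z (u j) * gcst Z (f (c j)) = \sum_j bc Z (v j) * gcst Z (f (e j)).
  move=> fi; under eq_bigr do rewrite cE !rmorph_sum mulr_sumr.
  rewrite exchange_big; apply: eq_bigr => j _; rewrite rmorph_sum mulr_suml.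
  by apply: eq_bigr => d _; rewrite !rmorphM fi bc_cst mulrA.
have v0 j : v j = 0.
  move: j; apply: (bc_free efree); rewrite -[RHS]h; symmetry.
  exact: (conv idfun).
rewrite [LHS](conv a (kf_base a)) big1 // => j _.
by rewrite v0 rmorph0 mul0r.
Qed.

Section LiftAut.
Variable a : kaut i.

Definition lift_fun z : K := bcsum a (sval (cid (bcsum_ex z))).

Lemma lift_bcsum l : lift_fun (bcsum id l) = bcsum a l.
Proof.
rewrite /lift_fun; set l' := sval _; have e : bcsum id l = bcsum id l' := svalP (cid (bcsum_ex _)).
apply/eqP; rewrite -subr_eq0 -bcsum_opp -bcsum_cat; apply/eqP/bcsum_eq0.
by rewrite bcsum_cat bcsum_opp e subrr.
Qed.

Let lift_zmod : zmod_morphism lift_fun.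
Proof.
move=> z w; have [l ->] := bcsum_ex z; have [l' ->] := bcsum_ex w.
by rewrite -bcsum_opp -bcsum_cat !lift_bcsum bcsum_cat bcsum_opp.
Qed.

Let bcsum1 f u c : bcsum f [:: (u, c)] = bc Z u * gcst Z (f c).
Proof. by rewrite /bcsum big_seq1. Qed.

Let lift_monoid : monoid_morphism lift_fun.
Proof.
split; last first.
  move=> z w; have [l ->] := bcsum_ex z; have [l' ->] := bcsum_ex w.
  by rewrite -bcsum_mul // !lift_bcsum bcsum_mul // => c d; rewrite rmorphM.
have -> : 1 = bcsum id [:: (1, 1)] :> K by rewrite bcsum1 !rmorph1 mulr1.
by rewrite lift_bcsum !bcsum1 !rmorph1.
Qed.

HB.instance Definition _ := GRing.isZmodMorphism.Build K K lift_fun lift_zmod.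
HB.instance Definition _ := GRing.isMonoidMorphism.Build K K lift_fun lift_monoid.

Lemma lift_bc u : lift_fun (bc Z u) = bc Z u.
Proof.
have -> : bc Z u = bcsum id [:: (u, 1)] by rewrite bcsum1 rmorph1 mulr1.
by rewrite lift_bcsum !bcsum1 !rmorph1.
Qed.

Lemma lift_gcst c : lift_fun (gcst Z c) = gcst Z (a c).
Proof.
have -> : gcst Z c = bcsum id [:: (1, c)] by rewrite bcsum1 rmorph1 mul1r.
by rewrite lift_bcsum bcsum1 rmorph1 mul1r.
Qed.

End LiftAut.

Lemma lift_funK (a b : kaut i) : cancel a b -> cancel (lift_fun a) (lift_fun b).
Proof.
move=> ab z; have [l ->] := bcsum_ex z; rewrite lift_bcsum.
rewrite -[bcsum a l]/(bcsum (id \o a) l) -bcsum_map lift_bcsum bcsum_map.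
by rewrite /bcsum; apply: eq_bigr => x _ /=; rewrite ab.
Qed.

Section LiftSemiaut.
Variable a : kaut i.

Let lift_cst z : (exists c, z = gcst Z c) <-> (exists c, lift_fun a z = gcst Z c).
Proof.
split=> [[c ->]|[c zc]]; first by exists (a c); apply: lift_gcst.
exists (kinv a c); rewrite -(lift_gcst (kinv a)) -zc.
by rewrite (lift_funK (b := kinv a)) //; exact: kfK.
Qed.

Definition glift : semiaut Z :=
  @Semiaut _ _ _ Z (lift_fun a) (lift_fun (kinv a))
    (lift_funK (b := kinv a) (kfK a)) (@lift_funK (kinv a) a (kgK a)) lift_cst.

Definition over (s : semiaut Z) := galois s /\ forall c, s (gcst Z c) = gcst Z (a c).

Lemma over_lift : over glift.
Proof. by split=> [u|c]; [apply: lift_bc|apply: lift_gcst]. Qed.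

Lemma over_bcsum s l : over s -> s (bcsum id l) = bcsum a l.
Proof.
move=> [sb sc]; rewrite /bcsum rmorph_sum; apply: eq_bigr => x _.
by rewrite rmorphM sb sc.
Qed.

End LiftSemiaut.

Lemma galois_over (s : semiaut Z) : galois s -> exists a, over a s.
Proof.
move=> gs; have /choice[f hf] : forall c, exists d, s (gcst Z c) = gcst Z d.
  by move=> c; have [h _] := sfun_cst s (gcst Z c); apply: h; exists c.
have /choice[g hg] : forall c, exists d, sinv s (gcst Z c) = gcst Z d.
  by move=> c; have [_ h] := sfun_cst s (sinv s (gcst Z c)); apply: h; exists c; rewrite sinvK.
have inj := fmorph_inj (gcst Z).
have fB : zmod_morphism f by move=> c d; apply: inj; rewrite -hf !rmorphB !hf.
have fM : monoid_morphism f.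
  split; first by apply: inj; rewrite -hf !rmorph1.
  by move=> c d; apply: inj; rewrite -hf !rmorphM !hf.
have fb c : f (i c) = i c by apply: inj; rewrite -hf -bc_cst gs.
have fK : cancel f g by move=> c; apply: inj; rewrite -hg -hf sfunK.
have gK : cancel g f by move=> c; apply: inj; rewrite -hf -hg sinvK.
by exists (KAut fB fM fb fK gK); split.
Qed.

End Lift.

Section Equivariance.
Variables (p : nat) (k : fieldType) (kb : closedFieldType) (i : {rmorphism k -> kb}).
Hypothesis hp : p \in [pchar k].
Hypothesis kb_algebraic : forall z : kb, algebraicOver i z.
Variables (X Y : curve i) (pi : zp_cover p X Y).
Local Notation G := (gcov pi).
Local Notation gam := (gdeck pi).
Local Notation below := (below pi).
Local Notation tau := (tau pi).
Implicit Types (a : kaut i).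

Let pr : prime p. Proof. exact: pchar_pr hp. Qed.

Section Over.
Variables (a : kaut i) (sX : semiaut X) (sY : semiaut Y).
Hypotheses (hX : over a sX) (hY : over a sY).

Lemma over_cov f : G (sX f) = sY (G f).
Proof.
have [l ->] := bcsum_ex f; rewrite (over_bcsum l hX) /bcsum !rmorph_sum.
apply: eq_bigr => x _; rewrite !rmorphM !gcov_bc !gcov_cst.
by have [-> ->] := hY.
Qed.

Lemma over_gam z : sY (gam z) = gam (sY z).
Proof.
have [l ->] := bcsum_ex z; rewrite (over_bcsum l hY) /bcsum !rmorph_sum.
have gamE' u c : gam (bc Y u * gcst Y c) = bc Y (deck pi u) * gcst Y c.
  by rewrite rmorphM gdeck_bc gdeck_cst.
have [sb sc] := hY; apply: eq_bigr => x _; rewrite !gamE' rmorphM sb sc //.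
Qed.

Lemma below_twist Q : below (twist sY Q) = twist sX (below Q).
Proof. by apply: place_eq => f; apply: (congr1 (ord Q) (esym (over_cov f))). Qed.

Lemma tau_twist Q : twist sY (tau Q) = tau (twist sY Q).
Proof. by apply: place_eq => z /=; rewrite over_gam. Qed.

Lemma act_pullback_over x : pullback pi (act sX x) = act sY (pullback pi x).
Proof.
have [D ->] := cls_ex x; rewrite act_cls !(pullback_cls hp) act_cls; congr (\pi_(jac Y)%qT _).
by apply: div0_eq => Q; rewrite /= !pullE /= below_twist.
Qed.

Lemma act_gam_over y : act sY (act gam y) = act gam (act sY y).
Proof.
have [D ->] := cls_ex y; rewrite !act_cls; congr (\pi_(jac Y)%qT _).
by apply: div0_eq => Q; rewrite /= -[twist gam]/tau tau_twist.
Qed.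

Lemma act_delta_over y : act sY (delta pi y) = delta pi (act sY y).
Proof. by rewrite /delta actB act_gam_over. Qed.

(** The data of [sdat] are carried along by the action, and the degree of B does not change. *)
Lemma surj_over x : jtors p x -> Defs.surj pi (act sX x) = Defs.surj pi x.
Proof.
move=> /(surj_spec hp kb_algebraic pi)[D [B [-> fB [g [D1 [g0 hg hD1]]] ->]]].
have bY := twist_bij sY.
have fB' : finsupp (B \o twist sY).
  apply: (finite_preimage (f := twist sY) _ fB).
  by move=> P Q _ _; apply: (bij_inj bY).
have iter_twist j Q : twist sY (iter j tau Q) = iter j tau (twist sY Q).
  by elim: j => // j IHj; rewrite !iterS tau_twist IHj.
rewrite act_cls; have [|_ ->] := @surj_eq _ _ _ _ hp kb_algebraic _ _ pi (div_act sX D) _ fB'.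
  exists (sY g), (D1 \o twist sY); split=> [|Q|Q]; first by rewrite fmorph_eq0.
    by have := hg (twist sY Q); rewrite /= tau_twist.
  under eq_bigr do rewrite /= iter_twist.
  by rewrite hD1 /= below_twist.
by rewrite [in RHS](reindex_fsbigT (twist sY) _ bY).
Qed.

End Over.

Lemma galois_down (s : semiaut Y) : galois s -> exists s' : semiaut X, galois s' /\
  forall x, pullback pi (act s' x) = act s (pullback pi x).
Proof.
move=> /galois_over[a sa]; exists (glift X a); have la := over_lift X a; split.
  by case: la.
by move=> x; apply: act_pullback_over la sa x.
Qed.

Lemma galois_up (s : semiaut X) : galois s -> exists s' : semiaut Y, galois s' /\
  forall x, pullback pi (act s x) = act s' (pullback pi x).
Proof.
move=> /galois_over[a sa]; exists (glift Y a); have la := over_lift Y a; split.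
  by case: la.
by move=> x; apply: act_pullback_over sa la x.
Qed.

Lemma galois_surj (s : semiaut X) x : galois s -> jtors p x ->
  Defs.surj pi (act s x) = Defs.surj pi x.
Proof. by move=> /galois_over[a sa]; apply: (surj_over sa (over_lift Y a)). Qed.

Lemma galois_delta (s : semiaut Y) y : galois s -> act s (delta pi y) = delta pi (act s y).
Proof. by move=> /galois_over[a sa]; apply: act_delta_over sa y. Qed.

End Equivariance.

(** * Continuity of the Galois action *)

Section FieldOfDefinition.
Variables (k : fieldType) (kb : closedFieldType) (i : {rmorphism k -> kb}).
Variable Z : curve i.
Local Notation K := (gff Z).
Implicit Types (P Q : place Z) (s : semiaut Z).

(** [unif P] has finitely many zeros, and z vanishes at P but at none of the others. So a place is
    recognized on finitely many functions, which involve finitely many constants. *)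
Lemma place_char P : exists W : seq K, forall Q, (forall z, z \in W -> vge Q 1 z) <-> Q = P.
Proof.
have [l hl] := zeros_seq (unif_neq0 P).
have lP Q : vge Q 1 (unif P) -> Q \in l.
  rewrite vgeE ?unif_neq0 // => h; apply/negPn/negP => /cnt_notin.
  by rewrite hl; case: ltP; lia.
have P1 : vge P 1 (unif P) by rewrite vgeE ?unif_neq0 // ord_unifE.
have [z hz] := place_approx (fun Q => if Q == P then 0 else 1) 1 (undup_uniq l).
exists [:: unif P; z] => Q; split=> [h|-> w].
  have Ql := lP Q (h _ (mem_head _ _)); apply/eqP/negPn/negP => QP.
  have := hz Q; rewrite mem_undup (negPf QP) => /(_ Ql) z1.
  have zQ : vge Q 1 z by apply: h; rewrite !inE eqxx orbT.
  apply: (@vge1_1 _ _ _ _ Q); have -> : 1 = z - (z - 1) by ring.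
  exact: vgeB.
rewrite !inE => /orP[/eqP->|/eqP->] //.
by have := hz P; rewrite mem_undup eqxx subr0 => /(_ (lP _ P1)).
Qed.

Lemma consts_of (W : seq K) : exists C : seq kb, forall s s', galois s -> galois s' ->
  (forall c, c \in C -> s (gcst Z c) = s' (gcst Z c)) -> forall z, z \in W -> s z = s' z.
Proof.
elim: W => [|w W [C hC]]; first by exists [::].
have [l wl] := bcsum_ex w; exists ([seq x.2 | x <- l] ++ C) => s s' gs gs' h z.
rewrite inE => /orP[/eqP->|]; last by apply: hC => // c cC; apply: h; rewrite mem_cat cC orbT.
rewrite wl /bcsum !rmorph_sum !big_seq; apply: eq_bigr => x xl.
by rewrite !rmorphM gs gs' h // mem_cat map_f.
Qed.

(** Only the places in the support of a divisor matter; [place_char] recognizes each of them by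
    functions that involve finitely many constants. *)
Lemma act_consts (x : jac Z) : exists C : seq kb, forall s s', galois s -> galois s' ->
  (forall c, c \in C -> s (gcst Z c) = s' (gcst Z c)) -> act s x = act s' x.
Proof.
have [D ->] := cls_ex x; have [fD _] := div0P D; have [r _ hr] := finsupp_seq fD.
have /choice[W hW] := place_char.
have [C hC] := consts_of (flatten [seq W P | P <- r]); exists C => s s' gs gs' h.
rewrite !act_cls; congr (\pi_(jac Z)%qT _); apply: div0_eq => Q /=.
have key t t' : galois t -> galois t' ->
    (forall c, c \in C -> t (gcst Z c) = t' (gcst Z c)) ->
    D (twist t Q) != 0 -> twist t' Q = twist t Q.
  move=> gt gt' tt DQ; apply/hW => z zW.
  have zf : z \in flatten [seq W P | P <- r].
    by apply/flattenP; exists (W (twist t Q)) => //; apply/map_f/hr.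
  have : vge (twist t Q) 1 z by move: z zW {zf}; apply/hW.
  by rewrite /vge /= (hC t t' gt gt' tt).
have [D0|/(key s s' gs gs' h)-> //] := eqVneq (D (twist s Q)) 0.
have [D0'|] := eqVneq (D (twist s' Q)) 0; first by rewrite D0 D0'.
by move=> /(key s' s gs' gs (fun c cC => esym (h c cC))) ->.
Qed.

End FieldOfDefinition.

Lemma finite_field_card (k : fieldType) p : p \in [pchar k] -> finite_set [set: k] ->
  exists (r : seq k) e, [/\ uniq r, forall x, x \in r, size r = (p ^ e)%N &
    forall a : k, a ^+ (p ^ e) = a].
Proof.
move=> hp /finite_set_seq[r ur rP]; have rk x : x \in r by apply/rP.
have pK : pcancel (index^~ r) (fun n => nth None (map some r) n).
  by move=> x /=; rewrite (nth_map x) ?index_mem ?nth_index.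
have fA : Finite.axiom r by move=> x; rewrite count_uniq_mem ?rk.
pose kF : finFieldType := HB.pack k (Choice_isCountable.Build k pK) (isFinite.Build k fA).
have sr : #|kF| = size r.
  rewrite cardT enumT unlock //.
have hF : p \in [pchar kF] := hp.
have e1 : #|kF| = (p ^ logn p #|kF|)%N := card_pprimeChar hF.
exists r, (logn p #|kF|); split=> //; first by rewrite -sr.
by move=> a; rewrite -e1; apply: (@expf_card kF).
Qed.

(** * Frobenius over a finite base field *)

Section FiniteBase.
Variables (p : nat) (k : fieldType) (kb : closedFieldType) (i : {rmorphism k -> kb}).
Hypothesis hp : p \in [pchar k].
Hypothesis kb_algebraic : forall z : kb, algebraicOver i z.
Variables (r : seq k) (e : nat).
Hypotheses (ur : uniq r) (rk : forall x, x \in r) (sr : size r = (p ^ e)%N).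
Hypothesis ke : forall a : k, a ^+ (p ^ e) = a.
Local Notation q := (p ^ e)%N.

Let hpkb : p \in [pchar kb]. Proof. exact: hpkb i hp. Qed.

Lemma card_gt1 : (1 < q)%N.
Proof.
rewrite -sr ltnNge; apply/negP => h; have := rk 0; have := rk 1.
case: r h => [//|x [|//]] _; rewrite !inE => /eqP<- /eqP/esym.
exact/eqP/oner_neq0.
Qed.

Lemma frob_base (c : kb) : c ^+ q = c -> exists a, c = i a.
Proof.
move=> cq; apply: contrapT => nc; pose P : {poly kb} := 'X^q - 'X.
have sP : size P = q.+1.
  by rewrite /P size_polyDl size_polyXn // size_polyN size_polyX ltnS card_gt1.
have P0 : P != 0 by rewrite -size_poly_eq0 sP.
have := @max_poly_roots _ P (c :: map i r) P0; rewrite sP /= size_map sr ltnn => h.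
suff: false by []; apply: h.
  apply/andP; split; first by rewrite /root !hornerE cq subrr.
  by apply/allP => _ /mapP[a _ ->]; rewrite /root !hornerE -rmorphXn ke subrr.
rewrite (map_inj_uniq (fmorph_inj i)) ur andbT; apply/mapP => -[a _ ca].
by apply: nc; exists a.
Qed.

Let fB : zmod_morphism (fun c : kb => c ^+ q).
Proof.
move=> c d; have := frnD hpkb e (c - d) d; rewrite subrK => ->.
by rewrite addrK.
Qed.

Let fM : monoid_morphism (fun c : kb => c ^+ q).
Proof. by split=> [|c d]; rewrite ?expr1n ?exprMn. Qed.

Let f_base a : i a ^+ q = i a. Proof. by rewrite -rmorphXn ke. Qed.

Let f_surj (c : kb) : exists d, d ^+ q = c.
Proof.
elim: e c => [|n IHn] c; first by exists c; rewrite expr1.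
by have [d dc] := IHn c; exists (proot hpkb d); rewrite prootX.
Qed.

Let fg c := sval (cid (f_surj c)).
Let fgK : cancel fg (fun c : kb => c ^+ q). Proof. by move=> c; apply: svalP (cid (f_surj c)). Qed.
Let ffK : cancel (fun c : kb => c ^+ q) fg.
Proof. by move=> c; apply: (frn_inj hpkb (n := e)); rewrite fgK. Qed.

Definition frob : kaut i := KAut fB fM f_base ffK fgK.

Lemma iter_frob n c : iter n frob c = c ^+ (q ^ n).
Proof. by elim: n => [|n IHn]; rewrite ?expr1 // iterS IHn /= -exprM -expnSr. Qed.

(** The iterates of c are roots of one polynomial over k, so two of them coincide, and Frobenius is
    injective. *)
Lemma frob_period (c : kb) : exists2 m, (0 < m)%N & iter m frob c = c.
Proof.
have [P P0 Pc] := kb_algebraic c; pose P' := map_poly i P.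
have fP : map_poly frob P' = P'.
  by rewrite -map_poly_comp; apply: eq_map_poly => a /=; rewrite f_base.
have rt j : root P' (iter j frob c).
  elim: j => // j; rewrite iterS /root -{2}fP => /eqP h.
  by rewrite (horner_map frob) /= h expr0n expn_eq0 eqn0Ngt (p_gt0 hp).
pose s := [seq iter j frob c | j <- iota 0 (size P')].
have P'0 : P' != 0 by rewrite map_poly_eq0.
have ns : ~~ uniq s.
  apply/negP => us; have := max_poly_roots P'0 _ us.
  rewrite size_map size_iota ltnn => h; suff: false by []; apply: h.
  by apply/allP => _ /mapP[j _ ->].
have [j [l [jl jlE]]] : exists j l, (j < l)%N /\ iter j frob c = iter l frob c.
  apply: contrapT => h; case/negP: ns; rewrite map_inj_in_uniq ?iota_uniq // => j l _ _ jl.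
  by have [jl'|jl'|//] := ltngtP j l; case: h; [exists j, l|exists l, j].
exists (l - j)%N; first by rewrite subn_gt0.
have inj n : injective (iter n frob).
  by elim: n => // n IHn x y; rewrite !iterS => /(can_inj (kfK frob))/IHn.
by apply: (inj j); rewrite -iterD addnC subnK // ltnW.
Qed.

Lemma frob_periods (C : seq kb) : exists2 m, (0 < m)%N & forall c, c \in C -> iter m frob c = c.
Proof.
elim: C => [|c C [m m0 hm]]; first by exists 1%N.
have [n n0 hn] := frob_period c; exists (m * n)%N; first by rewrite muln_gt0 m0.
have per u v x : iter u frob x = x -> iter (v * u) frob x = x.
  by move=> h; elim: v => // v IHv; rewrite mulSn iterD IHv.
move=> x; rewrite inE => /orP[/eqP->|/hm h]; first exact: per.
by rewrite mulnC; apply: per.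
Qed.

(* C lies in a finite field, which is generated by a root of unity z; the image of z
   is a conjugate z ^ q ^ j. *)
Lemma kaut_frob (a : kaut i) (C : seq kb) : exists n, forall c, c \in C -> a c = iter n frob c.
Proof.
have [m m0 hm] := frob_periods C; pose N := (q ^ m).-1.
have qm : (1 < q ^ m)%N.
  by rewrite -(expn0 q) ltn_exp2l // card_gt1.
have N0 : (0 < N)%N by rewrite /N; case: (q ^ m)%N qm => [|[]].
have NS : N.+1 = (q ^ m)%N by rewrite prednK // ltnW.
have Nn : N%:R != 0 :> kb.
  have : (N.+1)%:R = 0 :> kb.
    rewrite NS -expnM; apply/eqP; rewrite -(dvdn_pcharf hpkb); apply: dvdn_exp => //.
    rewrite muln_gt0 m0 andbT lt0n; apply/eqP => e0.
    by have := card_gt1; rewrite e0 expn0.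
  rewrite -natr1 => /eqP; rewrite addr_eq0 => /eqP->; rewrite oppr_eq0; exact: oner_neq0.
have [rs rsE] := closed_field_poly_normal ('X^N - 1 : {poly kb}).
rewrite (monicP _) ?scale1r in rsE; last by rewrite -polyC1 monicXnsubC.
have urs : uniq rs by rewrite -separable_prod_XsubC -rsE separable_Xn_sub_1.
have srs : (N <= size rs)%N.
  by rewrite -ltnS -(size_prod_XsubC rs id) -rsE -polyC1 size_XnsubC.
have ars : all N.-unity_root rs.
  apply/allP => x xr; apply/unity_rootP; have : root ('X^N - 1) x by rewrite rsE root_prod_XsubC.
  by rewrite /root !hornerE subr_eq0 => /eqP.
have /hasP[z zr zp] := has_prim_root N0 ars urs srs.
have zm : iter m frob z = z by rewrite iter_frob -NS exprS (prim_expr_order zp) mulr1.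
pose P : {poly kb} := \prod_(j < m) ('X - (iter j frob z)%:P).
have fP : map_poly frob P = P.
  pose F j : {poly kb} := 'X - (iter j frob z)%:P.
  have FS j : map_poly frob (F j) = F j.+1 by rewrite /F map_polyXsubC.
  have F0 : F 0%N != 0 by rewrite polyXsubC_eq0.
  rewrite /P rmorph_prod; transitivity (\prod_(j < m) F j.+1); first by apply: eq_bigr => j _; apply: FS.
  apply: (mulfI F0); transitivity (\prod_(j < m.+1) F j); first by rewrite big_ord_recl.
  by rewrite big_ord_recr mulrC /F /= zm.
have aP : map_poly a P = P.
  apply/polyP => j; rewrite coef_map; have : frob P`_j = P`_j by rewrite -{2}fP coef_map.
  by move=> /frob_base[c ->]; apply: kf_base.
have : root P (a z).
  rewrite /root -aP horner_map; apply/eqP; rewrite (_ : P.[z] = 0) ?rmorph0 //.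
  by rewrite horner_prod (bigD1 (Ordinal m0)) //= hornerXsubC subrr mul0r.
rewrite /root horner_prod => /prodf_eq0[n _]; rewrite hornerXsubC subr_eq0 => /eqP an.
exists n => c /hm cm; have [->|c0] := eqVneq c 0.
  by rewrite rmorph0; elim: (nat_of_ord n) => //= l <-; rewrite expr0n expn_eq0 eqn0Ngt (p_gt0 hp).
have [l ->] : exists l, c = z ^+ l.
  have cN : c ^+ N = 1.
    by apply: (mulfI c0); rewrite -exprS NS -iter_frob cm mulr1.
  by have [l ->] := prim_rootP zp cN; exists l.
by rewrite rmorphXn [LHS]/= an !iter_frob exprAC.
Qed.

End FiniteBase.

(** * Dimension counts *)

Section Dimension.
Variables (F : fieldType) (V : lmodType F).
Implicit Types (S : set V).

Definition dimS S n := exists w : 'I_n -> V, [/\ forall j, S (w j), indep [set 0] w &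
  forall v, S v -> exists c : 'I_n -> F, v = \sum_j c j *: w j].

Lemma dimS_spans S n : dimS S n -> spans [set 0] S n.
Proof. by move=> [w [_ _ h]]; exists w => v /h[c ->]; exists c; rewrite /= subrr. Qed.

Lemma dimS_ex S n : spans [set 0] S n -> exists m, dimS S m.
Proof.
move=> /(spans_basis (subspace0 V))[m [w [_ Sw iw h]]]; exists m, w; split=> // v /h[c hc].
by exists c; apply/eqP; rewrite -subr_eq0; apply/eqP.
Qed.

Lemma dimS_le S n m (w : 'I_m -> V) : (forall j, S (w j)) -> indep [set 0] w ->
  spans [set 0] S n -> (m <= n)%N.
Proof. by move=> Sw iw hn; rewrite -(card_ord m); apply: spans_indep (subspace0 V) hn Sw iw. Qed.

Lemma dimS_uniq S n m : dimS S n -> dimS S m -> n = m.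
Proof.
move=> hn hm; have [w [Sw iw _]] := hn; have [w' [Sw' iw' _]] := hm.
by apply/eqP; rewrite eqn_leq (dimS_le Sw iw (dimS_spans hm)) (dimS_le Sw' iw' (dimS_spans hn)).
Qed.

Section Filtration.
Variables (d : V -> V) (S0 S : set V).
Hypothesis d_lin : forall (a : F) u v, d (a *: u + v) = a *: d u + d v.
Hypotheses (hS0 : subspace S0) (hS : subspace S) (dS : forall v, S v -> S (d v)).

Lemma iter_lin j (a : F) u v : iter j d (a *: u + v) = a *: iter j d u + iter j d v.
Proof. by elim: j => // j IHj; rewrite !iterS IHj d_lin. Qed.

Lemma iter_stable j v : S v -> S (iter j d v).
Proof. by move=> Sv; elim: j => // j; apply: dS. Qed.

(* Each step of the filtration { v | d^j v in S0 } embeds in the first one by d^j. *)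
Lemma filtration_spans n N : spans S0 [set v | S v /\ S0 (d v)] n ->
  (forall v, S v -> S0 (iter N d v)) -> spans S0 S (N * n).
Proof.
move=> h1 hN; pose M j := [set v | S v /\ S0 (iter j d v)].
have hM j : subspace (M j).
  have [S00 S0l] := hS0; have [S_0 Sl] := hS; split.
    by split=> //; have := iter_lin j (-1) 0 0; rewrite scaler0 addr0 scaleN1r addNr => ->.
  by move=> a u v [Su u0] [Sv v0]; split; [apply: Sl|rewrite iter_lin; apply: S0l].
suff h j : spans S0 (M j) (j * n) by apply: spans_sub (h N) => v Sv; split=> //; apply: hN.
elim: j => [|j IHj].
  by exists (fun=> 0) => v [_ v0]; exists (fun=> 0); rewrite big_ord0 subr0.
rewrite mulSn addnC; apply: spans_trans IHj _.
apply: (@spans_map _ _ _ _ _ S0 [set v | S v /\ S0 (d v)] (iter j d)) => //.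
- by move=> a u v _ _; apply: iter_lin.
- by move=> v [Sv hv]; split=> //; apply: iter_stable.
- by move=> v [Sv _].
Qed.

Lemma inj_surj n : spans [set 0] S n -> (forall v, S v -> d v = 0 -> v = 0) ->
  forall v, S v -> exists2 u, S u & d u = v.
Proof.
move=> /dimS_ex[m hm] inj v Sv; have [w [Sw iw hw]] := hm.
have d_sum (c : 'I_m -> F) : d (\sum_j c j *: w j) = \sum_j c j *: d (w j).
  apply: (@linear_on_sum F V V setT d) => // a u u' _ _; exact: d_lin.
have idw : indep [set 0] (d \o w).
  move=> c /= hc; apply: iw => /=; apply: inj; first exact: subspace_lin.
  by rewrite d_sum.
have [[c hc]|nc] := pselect (exists c : 'I_m -> F, [set 0] (v - \sum_j c j *: (d \o w) j)).
  exists (\sum_j c j *: w j); first exact: subspace_lin.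
  by rewrite d_sum; apply/esym/eqP; rewrite -subr_eq0; apply/eqP.
have := dimS_le _ (indep_extend (subspace0 V) idw nc) (dimS_spans hm).
rewrite ltnn => h; suff: false by []; apply: h => j.
by case: unliftP => [l _|_] //; apply: dS.
Qed.

End Filtration.

End Dimension.

(** * The p-torsion as a vector space over F_p *)

Definition tors_pred p (k : fieldType) (kb : closedFieldType) (i : {rmorphism k -> kb})
  (Z : curve i) : {pred jac Z} := fun x => x *+ p == 0.

Record tors p (k : fieldType) (kb : closedFieldType) (i : {rmorphism k -> kb}) (Z : curve i) :=
  Tors { tval :> jac Z; _ : tors_pred p tval }.

Section TorsionModule.
Variables (p : nat) (k : fieldType) (kb : closedFieldType) (i : {rmorphism k -> kb}).
Variable Z : curve i.

Lemma tors_pred_closed : zmod_closed (@tors_pred p k kb i Z).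
Proof.
split=> [|x y]; rewrite unfold_in ?mul0rn // => /eqP hx; rewrite unfold_in => /eqP hy.
by rewrite unfold_in mulrnBl hx hy subrr.
Qed.

HB.instance Definition _ := GRing.isZmodClosed.Build _ (@tors_pred p k kb i Z) tors_pred_closed.
HB.instance Definition _ := [isSub for @tval p k kb i Z].
HB.instance Definition _ := [Choice of tors p Z by <:].
HB.instance Definition _ := [SubChoice_isSubZmodule of tors p Z by <:].

Lemma jtors_tval (x : tors p Z) : jtors p (tval x).
Proof. exact/eqP/(valP x). Qed.

Definition mkT x (hx : jtors p x) : tors p Z := Tors (introT eqP hx).

Lemma tval_inj (x y : tors p Z) : tval x = tval y -> x = y.
Proof. exact: val_inj. Qed.

Lemma tvalD (x y : tors p Z) : tval (x + y) = tval x + tval y. Proof. by []. Qed.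
Lemma tval0 : tval (0 : tors p Z) = 0. Proof. by []. Qed.
Lemma tvalN (x : tors p Z) : tval (- x) = - tval x. Proof. by []. Qed.
Lemma tvalMn (x : tors p Z) n : tval (x *+ n) = tval x *+ n.
Proof. by elim: n => // n IHn; rewrite !mulrS tvalD IHn. Qed.

Lemma torsMp (x : tors p Z) : x *+ p = 0.
Proof. by apply: tval_inj; rewrite tvalMn; apply: jtors_tval. Qed.

End TorsionModule.

(** ['F_p] is the ring of integers modulo p only when p is prime, so primality is a parameter of the
    type that carries the scaling. *)
Definition tmod p (pr : prime p) (k : fieldType) (kb : closedFieldType)
  (i : {rmorphism k -> kb}) (Z : curve i) : Type := tors p Z.

Section TorsionLmodule.
Variables (p : nat) (pr : prime p) (k : fieldType) (kb : closedFieldType) (i : {rmorphism k -> kb}).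
Variable Z : curve i.
Local Notation T := (tmod pr Z).

HB.instance Definition _ := GRing.Zmodule.on T.

Let scale (a : 'F_p) (x : T) : T := x *+ a.

Let scaleA a b x : scale a (scale b x) = scale (a * b) x.
Proof.
rewrite /scale -mulrnA -[LHS](mulrn_modp _ (torsMp x)).
by have -> : a * b = (b * a)%N%:R :> 'F_p; rewrite ?val_Fp_nat // natrM !natr_Zp mulrC.
Qed.

Let scale1 : left_id 1 scale.
Proof. by move=> x; rewrite /scale -[1]/(1%:R) val_Fp_nat // mulrn_modp ?mulr1n //; apply: torsMp. Qed.

Let scaleDr : right_distributive scale +%R.
Proof. by move=> a x y; rewrite /scale mulrnDl. Qed.

Let scaleDl x : {morph scale^~ x : a b / a + b}.
Proof. by move=> a b; rewrite /scale (mulrn_FpD pr) //; apply: torsMp. Qed.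

HB.instance Definition _ := GRing.Zmodule_isLmodule.Build 'F_p T scaleA scale1 scaleDr scaleDl.

End TorsionLmodule.

Lemma additive_Fp p (pr : prime p) (V W : lmodType 'F_p) (f : V -> W) :
  (forall u v, f (u + v) = f u + f v) -> forall (a : 'F_p) u v, f (a *: u + v) = a *: f u + f v.
Proof.
move=> fD a u v; rewrite fD; congr (_ + _).
have f0 : f 0 = 0 by apply: (addrI (f 0)); rewrite -fD !addr0.
have fMn n : f (u *+ n) = f u *+ n by elim: n => // n IHn; rewrite !mulrS fD IHn.
by rewrite -[a]natr_Zp !scaler_nat fMn.
Qed.

Section RationalTorsion.
Variables (p : nat) (pr : prime p) (k : fieldType) (kb : closedFieldType) (i : {rmorphism k -> kb}).
Variable Z : curve i.
Local Notation T := (tmod pr Z).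

Definition Vk : set T := [set x : T | forall s : semiaut Z, galois s -> act s (tval x) = tval x].

Lemma Vk_subspace : subspace Vk.
Proof.
split=> [s _|a u v hu hv s gs]; first by rewrite act0.
by rewrite tvalD actD tvalMn actMn hu // hv.
Qed.

Lemma has_dimE n : has_dim p (@jtors_k p _ _ _ Z) n <-> dimS Vk n.
Proof.
split=> [[b [hb hx]]|[w [Vw iw hw]]].
  have /choice[w wb] : forall j, exists x : T, tval x = b j.
    by move=> j; have [tb _] := hb j; exists (mkT tb).
  have sumE (c : 'I_n -> 'F_p) : tval (\sum_j c j *: w j) = \sum_j b j *+ c j.
    elim: (index_enum _) => [|j r IH]; first by rewrite !big_nil.
    by rewrite !big_cons tvalD IH tvalMn wb.
  exists w; split=> [j s gs|c hc j|v hv].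
  - by rewrite wb; have [_ h] := hb j; apply: h.
  - have [|c0 [_ uniq0]] := hx 0; first by split=> [|s _]; [apply: jtors0|apply: act0].
    have h (d : {ffun 'I_n -> 'F_p}) : 0 = \sum_j b j *+ d j -> d = c0 by move/uniq0.
    have e1 : [ffun j => c j] = c0.
      apply: h; transitivity (tval (\sum_j c j *: w j)); first by rewrite hc.
      by rewrite sumE; apply: eq_bigr => l _; rewrite ffunE.
    have e2 : [ffun=> 0] = c0 by apply: h; rewrite big1 // => l _; rewrite ffunE.
    by have := congr1 (fun d : {ffun 'I_n -> 'F_p} => d j) (etrans e1 (esym e2)); rewrite !ffunE.
  have [|c [xc _]] := hx (tval v); first by split=> //; apply: jtors_tval.
  by exists c; apply: tval_inj; rewrite sumE.
exists (fun j => tval (w j)); split=> [j|x [tx gx]]; first by split; [apply: jtors_tval|apply: Vw].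
have sumE (c : 'I_n -> 'F_p) : tval (\sum_j c j *: w j) = \sum_j tval (w j) *+ c j.
  elim: (index_enum _) => [|j r IH]; first by rewrite !big_nil.
  by rewrite !big_cons tvalD IH tvalMn.
have [c hc] := hw (mkT tx) gx; exists [ffun j => c j]; split.
  transitivity (tval (\sum_j c j *: w j)); first by rewrite -hc.
  by rewrite sumE; apply: eq_bigr => l _; rewrite ffunE.
move=> d xd; apply/ffunP => j; rewrite ffunE; apply/eqP; rewrite -subr_eq0; apply/eqP; move: j.
apply: iw; rewrite /=; under eq_bigr do rewrite scalerBl.
rewrite sumrB -hc; apply/eqP; rewrite subr_eq0; apply/eqP/tval_inj.
by rewrite sumE -xd.
Qed.

Lemma nuE n : dimS Vk n -> nu p Z = n.
Proof.
move=> hn; rewrite /nu; case: xgetP => [m _ /has_dimE hm|/(_ n)[]]; last exact/has_dimE.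
exact: dimS_uniq hm hn.
Qed.

Hypothesis hp : p \in [pchar k].
Hypothesis kb_algebraic : forall z : kb, algebraicOver i z.

Lemma tors_spans : exists n, spans [set 0 : T] setT n.
Proof.
have [n hn] := jtors_dep hp kb_algebraic Z; exists n; apply: indep_spans; first exact: subspace0.
move=> v _ iv; have [|m [mp [j mj] hm]] := hn (fun j => tval (v j)).
  by move=> j; apply: jtors_tval.
have val j' : ((m j')%:R : 'F_p) = m j' :> nat by rewrite val_Fp_nat // modn_small.
have /(_ j) : forall j, (m j)%:R = 0 :> 'F_p.
  apply: iv; apply: tval_inj; rewrite -[RHS]hm.
  elim: (index_enum _) => [|l r IH]; first by rewrite !big_nil.
  by rewrite !big_cons tvalD IH tvalMn val.
by move=> e; have := val j; rewrite e => m0; move: mj; rewrite -m0.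
Qed.

Lemma dim_ex (S : set T) : exists n, dimS S n.
Proof. by have [n hn] := tors_spans; apply: dimS_ex (spans_sub _ hn). Qed.

End RationalTorsion.

Section KernelOfNorm.
Variables (p : nat) (k : fieldType) (kb : closedFieldType) (i : {rmorphism k -> kb}).
Hypothesis hp : p \in [pchar k].
Hypothesis kb_algebraic : forall z : kb, algebraicOver i z.
Variables (X Y : curve i) (pi : zp_cover p X Y).
Let pr : prime p := pchar_pr hp.
Local Notation TX := (tmod pr X).
Local Notation TY := (tmod pr Y).
Local Notation srj := (Defs.surj pi).

Lemma jtors_delta y : jtors p y -> jtors p (delta pi y).
Proof. by move=> hy; apply: jtorsD (jtorsN _); [rewrite /jtors /= -actMn hy act0|]. Qed.

Definition pbT (x : TX) : TY := mkT ((jtors_pullback hp pi (tval x)).2 (jtors_tval x)).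
Definition dlT (y : TY) : TY := mkT (jtors_delta (jtors_tval y)).

Lemma pbT_lin (a : 'F_p) u v : pbT (a *: u + v) = a *: pbT u + pbT v.
Proof.
apply: additive_Fp => // {}u {}v; apply: tval_inj.
by rewrite tvalD /= (pullbackD hp).
Qed.

Lemma dlT_lin (a : 'F_p) u v : dlT (a *: u + v) = a *: dlT u + dlT v.
Proof.
apply: additive_Fp => // {}u {}v; apply: tval_inj.
by rewrite tvalD /= deltaD.
Qed.

Lemma pbT_inj u v : pbT u = pbT v -> u = v.
Proof. by move=> /(congr1 (@tval _ _ _ _ _)) /= /(pullback_inj hp)/tval_inj. Qed.

Lemma pbT0 : pbT 0 = 0. Proof. by apply: tval_inj; rewrite /= (pullback0 hp). Qed.
Lemma dlT0 : dlT 0 = 0. Proof. by apply: tval_inj; rewrite /= /delta act0 subrr. Qed.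

Lemma iter_dlT j y : tval (iter j dlT y) = iter j (delta pi) (tval y).
Proof. by elim: j => //= j ->. Qed.

Lemma iter_dlT_p y : iter p dlT y = 0.
Proof. by apply: tval_inj; rewrite iter_dlT (iter_delta_p hp) //; apply: jtors_tval. Qed.

Lemma dlT_pbT x : dlT (pbT x) = 0.
Proof. by apply: tval_inj; rewrite /= (delta_pullback hp). Qed.

Lemma dlT_ker y : dlT y = 0 -> exists x, y = pbT x.
Proof.
move=> /(congr1 (@tval _ _ _ _ _)) /= dy.
have [|x tx yx] := @pullback_iso _ _ _ _ hp _ _ pi (tval y).
  by split=> //; apply: jtors_tval.
by exists (mkT tx); apply: tval_inj.
Qed.

Lemma sum_lin (V W : lmodType 'F_p) (f : V -> W) (I : finType) (c : I -> 'F_p) (v : I -> V) :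
  (forall (a : 'F_p) u v, f (a *: u + v) = a *: f u + f v) ->
  f (\sum_j c j *: v j) = \sum_j c j *: f (v j).
Proof.
move=> f_lin; apply: (@linear_on_sum 'F_p V W setT f) => // a u u' _ _; exact: f_lin.
Qed.

Lemma srj_lin (a : 'F_p) (u v : TX) : srj (tval (a *: u + v)) = a * srj (tval u) + srj (tval v).
Proof.
have tu := jtors_tval u; have tv := jtors_tval v.
rewrite tvalD tvalMn (surjD hp kb_algebraic) //; last exact: jtorsMn.
rewrite (surjMn hp kb_algebraic) // -mulr_natl; congr (_ * _ + _).
by rewrite natr_Zp.
Qed.

Definition GX : set TX := [set x : TX | srj (tval x) = 0].

Lemma GX_subspace : subspace GX.
Proof.
split=> [|a u v hu hv]; rewrite /GX /=; first exact: surj0.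
by rewrite srj_lin hu hv mulr0 addr0.
Qed.

Variable x0 : TX.
Hypothesis sx0 : srj (tval x0) = 1.

(** By [surj_delta], a class whose pullback lies in the image of delta is killed by [surj], which
    takes the value c on c x0. *)
Lemma dlT_image c y : dlT y = c *: pbT x0 -> c = 0.
Proof.
move=> e; have cE : srj (tval (c *: x0)) = c.
  by rewrite -[c *: x0]addr0 srj_lin sx0 mulr1 (surj0 hp kb_algebraic) addr0.
rewrite -{}cE; apply: (@surj_delta _ _ _ _ hp kb_algebraic _ _ pi (tval y)).
have := congr1 (@tval _ _ _ _ _) e; rewrite /= => ->.
by rewrite !tvalMn (pullbackMn hp).
Qed.

Let N := iter p.-1 dlT.

Let N_lin (a : 'F_p) u v : N (a *: u + v) = a *: N u + N v.
Proof. exact: (iter_lin dlT_lin). Qed.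

Let N0 : N 0 = 0.
Proof. by rewrite /N; elim: p.-1 => //= n ->; apply: dlT0. Qed.

Let ND u v : N (u + v) = N u + N v.
Proof. by have := N_lin 1 u v; rewrite !scale1r. Qed.

Let NZ a u : N (a *: u) = a *: N u.
Proof. by have := N_lin a u 0; rewrite N0 !addr0. Qed.

Let N_dlT y : N (dlT y) = 0.
Proof. by rewrite /N -iterSr prednK ?prime_gt0 //; apply: iter_dlT_p. Qed.

Let N_pbT x : N (pbT x) = 0.
Proof.
have -> : N (pbT x) = iter p.-2 dlT (dlT (pbT x)).
  by rewrite -iterSr prednK // -subn1 subn_gt0 prime_gt1.
by rewrite dlT_pbT; elim: p.-2 => //= n ->; apply: dlT0.
Qed.

(* Both sides have the same dimension: the image of N is the image of GX, of dimension
   one less than the kernel of dlT. *)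
Lemma norm_kernel n : N n = 0 -> exists a c, n = dlT a + c *: pbT x0.
Proof.
move=> Nn; apply: contrapT => nn.
have [g [u [uG iu uS]]] := dim_ex hp kb_algebraic GX.
have spG : spans [set 0] GX g by apply: dimS_spans; exists u.
have spX : spans [set 0 : TX] setT (g + 1).
  apply: spans_trans spG _; apply: (@spans_functional 'F_p TX GX setT (fun x => srj (tval x))) => //.
  - exact: GX_subspace.
  - by move=> a v w _ _; apply: srj_lin.
pose ker : set TY := [set y | dlT y = 0]; pose img : set TY := [set y | exists a, y = dlT a].
have hker : subspace ker.
  by split=> [|a v w hv hw]; rewrite /ker /= ?dlT0 // dlT_lin hv hw scaler0 addr0.
have himg : subspace img.
  split=> [|a v w [b ->] [c ->]]; first by exists 0; rewrite dlT0.
  by exists (a *: b + c); rewrite dlT_lin.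
have spK : spans [set 0] ker (g + 1).
  have [w hw] := spX; exists (pbT \o w) => y /dlT_ker[x ->]; have [c hc] := hw x I.
  exists c; rewrite /= -(sum_lin _ _ pbT_lin) -scaleN1r addrC -pbT_lin scaleN1r addrC.
  by rewrite [x - _]hc pbT0.
have [e0 spT] := tors_spans pr Y hp kb_algebraic.
have spKT : spans ker setT e0.
  by have [w hw] := spT; exists w => v /hw[c hc]; exists c; rewrite hc; case: hker.
have [e [w [_ _ iw hw]]] := spans_basis hker spKT.
have spT' : spans [set 0 : TY] setT (g + 1 + e).
  by apply: spans_trans spK _; exists w.
have /choice[m hm] : forall j, exists y : TY, N y = pbT (u j).
  move=> j; have [y ty hy] := @surj_norm _ _ _ _ hp kb_algebraic _ _ pi _ (jtors_tval (u j)) (uG j).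
  by exists (mkT ty); apply: tval_inj; rewrite iter_dlT /= -hy.
(* If n were outside the span, these g + 2 vectors would be independent modulo the image of delta: N
   maps the m_j to a basis of the image of [GX] and kills the other two vectors, and [dlT_image]
   separates x0 from the image. With the e vectors [dlT (w j)] this exceeds the dimension bound g +
   1 + e by one. *)
pose v (j : 'I_g + bool) := match j with
  | inl j => m j | inr true => pbT x0 | inr false => n end.
have iv : indep img v.
  move=> c; rewrite big_sumType /= big_bool /= => -[t ht].
  have c1 j : c (inl j) = 0.
    move: j; apply: iu; apply: pbT_inj; rewrite pbT0 (sum_lin _ _ pbT_lin).
    transitivity (N (\sum_j c (inl j) *: m j + (c (inr true) *: pbT x0 + c (inr false) *: n))).
      rewrite ND (sum_lin _ _ N_lin) N_lin N_pbT NZ Nn !scaler0 !addr0.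
    by apply: eq_bigr => j _; rewrite hm.
    by rewrite ht N_dlT.
  rewrite big1 ?add0r in ht; last by move=> j _; rewrite c1 scale0r.
  have c2 : c (inr false) = 0.
    apply/eqP/negPn/negP => c0; apply: nn.
    exists ((c (inr false))^-1 *: t + 0), (- (c (inr false))^-1 * c (inr true)).
    rewrite dlT_lin dlT0 addr0 -ht scalerDr !scalerA mulVf // scale1r mulNr scaleNr.
    by rewrite addrAC subrr add0r.
  have c3 : c (inr true) = 0.
    by apply: (@dlT_image _ t); rewrite -ht c2 scale0r addr0.
  by case=> [j|[]].
have idw : indep [set 0] (fun j : 'I_e + ('I_g + bool) => match j with
    | inl j => dlT (w j) | inr j => v j end).
  apply: (indep_cat himg) iv => // [_ -> |j|c hc]; first by case: himg.
    by exists (w j).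
  by apply: iw; rewrite /ker /= (sum_lin _ _ dlT_lin).
have := spans_indep (subspace0 TY) spT' (fun=> I) idw.
by rewrite !card_sum !card_ord card_bool; lia.
Qed.

End KernelOfNorm.

(** * Inequalities between nu_X and nu_Y *)

Section Bounds.
Variables (p : nat) (k : fieldType) (kb : closedFieldType) (i : {rmorphism k -> kb}).
Hypothesis hp : p \in [pchar k].
Hypothesis kb_algebraic : forall z : kb, algebraicOver i z.
Variables (X Y : curve i) (pi : zp_cover p X Y).
Let pr : prime p := pchar_pr hp.
Local Notation TX := (tmod pr X).
Local Notation TY := (tmod pr Y).
Local Notation VX := (@Vk p pr k kb i X).
Local Notation VY := (@Vk p pr k kb i Y).
Local Notation srj := (Defs.surj pi).
Local Notation pbT := (@pbT p k kb i hp X Y pi).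
Local Notation dlT := (@dlT p k kb i hp X Y pi).

Lemma Vk_pbT x : VX x -> VY (pbT x).
Proof. by move=> Vx s /(galois_down hp pi)[s' [gs /(_ (tval x)) e]]; rewrite /= -e Vx. Qed.

Lemma Vk_pbT_inv x : VY (pbT x) -> VX x.
Proof.
move=> Vx s /(galois_up hp pi)[s' [gs e]]; apply: (pullback_inj hp (pi := pi)).
by rewrite e; apply: Vx.
Qed.

Lemma Vk_dlT y : VY y -> VY (dlT y).
Proof. by move=> Vy s gs; rewrite /= galois_delta // Vy. Qed.

Lemma Vk_ker y : VY y -> dlT y = 0 -> exists2 x, VX x & y = pbT x.
Proof. by move=> Vy /dlT_ker[x yx]; exists x => //; apply: Vk_pbT_inv; rewrite -yx. Qed.

Lemma spans_pbT (S0 S : set TX) (S0' : set TY) n : subspace S0 -> (forall x, S0 x -> S0' (pbT x)) ->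
  spans S0 S n -> spans S0' [set y | exists2 x, S x & y = pbT x] n.
Proof.
move=> hS0 h [w hw]; exists (pbT \o w) => y [x /hw[c hc] ->]; exists c.
rewrite /= -(sum_lin _ _ (pbT_lin pi)) -scaleN1r addrC -pbT_lin scaleN1r addrC.
exact: h.
Qed.

Lemma nu_le : (nu p X <= nu p Y)%N.
Proof.
have [m hm] := dim_ex hp kb_algebraic VX; have [n hn] := dim_ex hp kb_algebraic VY.
rewrite (nuE hm) (nuE hn); have [w [Vw iw _]] := hm.
apply: (@dimS_le _ _ VY n m (fun j => pbT (w j)) _ _ (dimS_spans hn)) => [j|c hc].
  exact: Vk_pbT.
by apply: iw; apply: (pbT_inj (pi := pi)); rewrite pbT0 (sum_lin _ _ (pbT_lin pi)).
Qed.

Lemma nu_le_mul : (nu p Y <= p * nu p X)%N.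
Proof.
have [m hm] := dim_ex hp kb_algebraic VX; have [n hn] := dim_ex hp kb_algebraic VY.
rewrite (nuE hm) (nuE hn); have [w [Vw iw _]] := hn.
apply: (dimS_le Vw iw); apply: (filtration_spans (dlT_lin pi) (subspace0 TY) (Vk_subspace pr Y)).
- exact: Vk_dlT.
- apply: spans_sub (spans_pbT (subspace0 TX) _ (dimS_spans hm)) => [y [Vy /= y0]|x ->].
    exact: Vk_ker.
  exact: pbT0.
by move=> v _; apply: iter_dlT_p.
Qed.

Lemma split_X_a : split_X pi <-> split_a pi.
Proof.
split=> [[s [s1 sD sg]]|[s [s1 sD sg]]].
  exists (pullback pi \o s); split=> [a|a b|g /(galois_down hp pi)[g' [gg e]] a] /=.
  - have [ts as_] := s1 a; split; last by exists (s a).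
    by split; [apply/jtors_pullback|apply: (delta_pullback hp)].
  - by rewrite sD (pullbackD hp).
  - by rewrite -e sg.
have /choice[t ht] : forall a, exists x, [/\ jtors p x, pullback pi x = s a & srj x = a].
  by move=> a; have [_] := s1 a.
have inj := pullback_inj hp (pi := pi).
exists t; split=> [a|a b|g /(galois_up hp pi)[g' [gg e]] a]; first by have [] := ht a.
  apply: inj; rewrite (pullbackD hp).
  by have [_ -> _] := ht a; have [_ -> _] := ht b; have [_ -> _] := ht (a + b).
by apply: inj; rewrite e; have [_ -> _] := ht a; apply: sg.
Qed.

Lemma split_X_unit : split_X pi -> exists2 x0 : TX, VX x0 & srj (tval x0) = 1.
Proof.
by move=> [s [s1 _ sg]]; have [ts s1E] := s1 1; exists (mkT ts) => // g gg; apply: sg.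
Qed.

(* Filtering by powers of delta modulo the line of x0 saves one dimension in each
   step, since x0 is not in the image of delta. *)
Lemma nu_split : split_X pi -> (nu p Y)%:Z - 1 <= p%:Z * ((nu p X)%:Z - 1).
Proof.
move=> /split_X_unit[x0 Vx0 sx0].
have [m hm] := dim_ex hp kb_algebraic VX; have [n hn] := dim_ex hp kb_algebraic VY.
rewrite (nuE hm) (nuE hn); have [w [Vw iw _]] := hn.
pose LX : set TX := [set x | exists c : 'F_p, x = c *: x0].
pose LY : set TY := [set y | exists c : 'F_p, y = c *: pbT x0].
have hLX : subspace LX.
  split=> [|a u v [c ->] [d ->]]; first by exists 0; rewrite scale0r.
  by exists (a * c + d); rewrite scalerDl scalerA.
have hLY : subspace LY.
  split=> [|a u v [c ->] [d ->]]; first by exists 0; rewrite scale0r.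
  by exists (a * c + d); rewrite scalerDl scalerA.
have [e [u [_ Vu iu hu]]] : exists e (u : 'I_e -> TX), [/\ (e <= m)%N, forall j, VX (u j),
    indep LX u & forall v, VX v -> exists c : 'I_e -> 'F_p, LX (v - \sum_j c j *: u j)].
  apply: (spans_basis hLX); have [w' hw'] := dimS_spans hm.
  by exists w' => v /hw'[c hc]; exists c; rewrite hc; case: hLX.
(* x0 is rational and spans [LX], so it can be added to the u_j in an independent family of rational
   points. *)
have em : (e < m)%N.
  have ix0 : indep [set 0] (fun _ : 'I_1 => x0).
    move=> c; rewrite big_ord1 /= => h j; have := @srj_lin _ _ _ _ hp kb_algebraic _ _ pi (c ord0) x0 0.
    have -> : j = ord0 by apply/val_inj; case: j => [[]].
    by rewrite addr0 h tval0 (surj0 hp kb_algebraic) sx0 mulr1 addr0 => <-.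
  have := spans_indep (subspace0 TX) (dimS_spans hm) _ (indep_cat hLX _ _ ix0 iu).
  rewrite card_sum !card_ord add1n; apply=> [[j|j] //|_ ->|_]; first by case: hLX.
  by exists 1; rewrite scale1r.
have sp1 : spans LY [set v | VY v /\ LY (dlT v)] e.
  apply: spans_sub (spans_pbT (S0 := LX) hLX (S0' := LY) _ (_ : spans LX VX e)) => [y|x [c ->]|].
  - move=> [Vy [c yc]]; apply: Vk_ker => //.
    by have c0 := dlT_image kb_algebraic sx0 yc; rewrite yc c0 scale0r.
  - by exists c; rewrite -[c *: x0]addr0 pbT_lin pbT0 addr0.
  - by exists u.
have spY : spans LY VY (p * e).
  apply: (filtration_spans (dlT_lin pi) hLY (Vk_subspace pr Y) _ sp1).
    exact: Vk_dlT.
  by move=> v _; rewrite iter_dlT_p; case: hLY.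
have spL : spans [set 0] LY 1.
  exists (fun=> pbT x0) => _ [c ->]; exists (fun=> c).
  by rewrite big_ord1 subrr.
have := dimS_le Vw iw (spans_trans spL spY).
case: m em {hm} => // m em; have := leq_mul (leqnn p) (em : (e <= m)%N).
by rewrite intS [1 + _]addrC addrK -PoszM; lia.
Qed.

End Bounds.

Lemma nu_gt0 p (pr : prime p) (k : fieldType) (kb : closedFieldType) (i : {rmorphism k -> kb})
  (hp : p \in [pchar k]) (kb_algebraic : forall z : kb, algebraicOver i z) (Z : curve i)
  (x : tmod pr Z) : Vk x -> x != 0 -> (0 < nu p Z)%N.
Proof.
move=> Vx x0; have [n hn] := dim_ex hp kb_algebraic (@Vk p pr k kb i Z); rewrite (nuE hn).
case: n hn => // -[w [_ _ hw]]; have [c xc] := hw x Vx.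
by rewrite xc big_ord0 eqxx in x0.
Qed.

(** * Algebraically closed base field *)

Section ClosedBase.
Variables (k : fieldType) (kb : closedFieldType) (i : {rmorphism k -> kb}).
Hypothesis kb_algebraic : forall z : kb, algebraicOver i z.
Hypothesis k_closed : GRing.closed_field_axiom k.

Lemma closed_root (P : {poly k}) : (1 < size P)%N -> exists a, root P a.
Proof.
move=> sP; have lP : lead_coef P != 0.
  by rewrite lead_coef_eq0 -size_poly_gt0 ltnW.
have [|a ha] := @k_closed (size P).-1 (fun j => - P`_j / lead_coef P); first by case: size sP => [|[]].
exists a; rewrite /root horner_coef -(prednK (ltnW sP)) big_ord_recr /= ha -lead_coefE.
rewrite mulr_sumr -big_split big1 //= => j _.
by rewrite mulrA mulrCA mulfV // mulr1 mulNr subrr.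
Qed.

Lemma closed_base (c : kb) : exists a, c = i a.
Proof.
have [P P0 Pc] := kb_algebraic c; have [n le_n] := ubnP (size P).
elim: n P P0 Pc le_n => // n IHn P P0 Pc le_n.
have [|a /factor_theorem[Q PQ]] := closed_root (P := P).
  rewrite ltnNge; apply/negP => /size1_polyC e; move: Pc P0; rewrite e map_polyC /root hornerC.
  by rewrite fmorph_eq0 polyC_eq0 => ->.
move: Pc; rewrite PQ rmorphM rootM /= map_polyXsubC root_XsubC => /orP[Qc|/eqP->]; last by exists a.
have Q0 : Q != 0 by apply: contra_neq P0 => Q0; rewrite PQ Q0 mul0r.
have sPQ : size P = (size Q).+1.
  by rewrite PQ (size_Mmonic Q0 (monicXsubC a)) size_XsubC addn2.
by apply: IHn Q0 Qc _; rewrite -ltnS -sPQ.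
Qed.

Lemma galois_closed (Z : curve i) (s : semiaut Z) x : galois s -> act s x = x.
Proof.
move=> gs; have sE z : s z = z.
  have [l ->] := bcsum_ex z; rewrite /bcsum rmorph_sum; apply: eq_bigr => -[u c] _ /=.
  by rewrite rmorphM gs; have [a ->] := closed_base c; rewrite -bc_cst gs.
have [D ->] := cls_ex x; rewrite act_cls; congr (\pi_(jac Z)%qT _); apply: div0_eq => P /=.
by congr (D _); apply: place_eq => z /=; rewrite sE.
Qed.

End ClosedBase.

Section Composition.
Variables (k : fieldType) (kb : closedFieldType) (i : {rmorphism k -> kb}).

Lemma act_comp (Z : curve i) (s t u : semiaut Z) x :
  (forall f, u f = s (t f)) -> act u x = act s (act t x).
Proof.
move=> h; have [D ->] := cls_ex x; rewrite !act_cls; congr (\pi_(jac Z)%qT _).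
by apply: div0_eq => P /=; congr (D _); apply: place_eq => f /=; rewrite h.
Qed.

Lemma kaut_id : exists b : kaut i, forall c, b c = c.
Proof.
have fB : zmod_morphism (@id kb) by [].
have fM : monoid_morphism (@id kb) by [].
by exists (KAut fB fM (fun=> erefl) (fun=> erefl) (fun=> erefl)).
Qed.

Lemma kaut_comp (a b : kaut i) : exists d : kaut i, forall c, d c = a (b c).
Proof.
have fB : zmod_morphism (a \o b) by move=> c d; rewrite /= !rmorphB.
have fM : monoid_morphism (a \o b) by split=> [|c d]; rewrite /= ?rmorph1 ?rmorphM.
have fb c : (a \o b) (i c) = i c by rewrite /= !kf_base.
have fK : cancel (a \o b) (kg b \o kg a) by move=> c; rewrite /= !kfK.
have gK : cancel (kg b \o kg a) (a \o b) by move=> c; rewrite /= !kgK.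
by exists (KAut fB fM fb fK gK).
Qed.

Lemma glift_comp (Z : curve i) (a b d : kaut i) : (forall c, d c = a (b c)) ->
  forall f, glift Z d f = glift Z a (glift Z b f).
Proof.
move=> h f; have [l ->] := bcsum_ex f.
rewrite !(over_bcsum _ (over_lift Z _)) -[bcsum b l]/(bcsum (id \o b) l) -bcsum_map.
rewrite (over_bcsum _ (over_lift Z _)) bcsum_map.
by apply: eq_bigr => x _ /=; rewrite h.
Qed.

Lemma iter_glift (Z : curve i) (a : kaut i) n : exists2 b : kaut i,
  (forall c, b c = iter n a c) & forall x, act (glift Z b) x = iter n (act (glift Z a)) x.
Proof.
elim: n => [|n [b hb IHn]].
  have [b hb] := kaut_id; exists b => // x.
  have [D ->] := cls_ex x; rewrite act_cls; congr (\pi_(jac Z)%qT _).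
  apply: div0_eq => P /=; congr (D _); apply: place_eq => f /=.
  have [l ->] := bcsum_ex f; rewrite [lift_fun _ _](over_bcsum _ (over_lift Z b)).
  by congr (ord P _); apply: eq_bigr => y _; rewrite hb.
have [d hd] := kaut_comp a b; exists d => [c|x]; first by rewrite hd hb.
by rewrite iterS -IHn; apply: act_comp; apply: glift_comp.
Qed.

Lemma act_consts_seq (Z : curve i) (xs : seq (jac Z)) : exists C : seq kb,
  forall s s' : semiaut Z, galois s -> galois s' ->
  (forall c, c \in C -> s (gcst Z c) = s' (gcst Z c)) -> forall x, x \in xs -> act s x = act s' x.
Proof.
elim: xs => [|y xs [C hC]]; first by exists [::].
have [C' hC'] := act_consts y; exists (C' ++ C) => s s' gs gs' h x.
rewrite inE => /orP[/eqP->|]; [apply: hC'|apply: hC] => // c cC; apply: h; rewrite mem_cat cC //.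
by rewrite orbT.
Qed.

End Composition.

Section Frobenius.
Variables (p : nat) (k : fieldType) (kb : closedFieldType) (i : {rmorphism k -> kb}).
Hypothesis hp : p \in [pchar k].
Hypothesis kb_algebraic : forall z : kb, algebraicOver i z.

(** Density of the powers of a in Gal(kbar/k) for the Krull topology. *)
Definition topological_generator (a : kaut i) := forall (b : kaut i) (C : seq kb),
  exists n, forall c, c \in C -> b c = iter n a c.

Lemma finite_generator : finite_set [set: k] -> exists a, topological_generator a.
Proof.
move=> /(finite_field_card hp)[r [e [ur rk sr ke]]].
by exists (frob i hp ke) => b C; apply: (kaut_frob hp kb_algebraic ur rk sr ke).
Qed.

Lemma galois_frob (a : kaut i) (Z : curve i) (s : semiaut Z) (xs : seq (jac Z)) :
  topological_generator a -> galois s ->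
  exists n, forall x, x \in xs -> act s x = iter n (act (glift Z a)) x.
Proof.
move=> ha gs; have [b [_ sb]] := galois_over gs.
have [C hC] := act_consts_seq xs; have [n hn] := ha b C; exists n => x xxs.
have [d hd <-] := iter_glift Z a n; have [gd dd] := over_lift Z d.
by apply: hC => // c cC; rewrite sb dd hn // hd.
Qed.

End Frobenius.

Section TorsionAction.
Variables (p : nat) (pr : prime p) (k : fieldType) (kb : closedFieldType) (i : {rmorphism k -> kb}).
Variables (Z : curve i) (s : semiaut Z).
Local Notation T := (tmod pr Z).

Lemma jtors_act x : jtors p x -> jtors p (act s x).
Proof. by move=> hx; rewrite /jtors /= -actMn hx act0. Qed.

Definition difT (x : T) : T := mkT (jtors_act (jtors_tval x)) - x.

Lemma tval_difT x : tval (difT x) = act s (tval x) - tval x.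
Proof. by []. Qed.

Lemma difT_lin (a : 'F_p) u v : difT (a *: u + v) = a *: difT u + difT v.
Proof.
apply: additive_Fp => // {}u {}v; apply: tval_inj.
by rewrite [LHS]tval_difT [RHS]tvalD !tval_difT tvalD actD opprD addrACA.
Qed.

Lemma difTD u v : difT (u + v) = difT u + difT v.
Proof. by have := difT_lin 1 u v; rewrite !scale1r. Qed.

Lemma difTB u v : difT (u - v) = difT u - difT v.
Proof. by rewrite addrC -scaleN1r difT_lin scaleN1r addrC. Qed.

End TorsionAction.

(** * Fixed points of Frobenius and the splitting of (b) *)

Section FiniteBaseField.
Variables (p : nat) (k : fieldType) (kb : closedFieldType) (i : {rmorphism k -> kb}).
Hypothesis hp : p \in [pchar k].
Hypothesis kb_algebraic : forall z : kb, algebraicOver i z.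
Variables (X Y : curve i) (pi : zp_cover p X Y).
Let pr : prime p := pchar_pr hp.
Local Notation TX := (tmod pr X).
Local Notation TY := (tmod pr Y).
Local Notation VX := (@Vk p pr k kb i X).
Local Notation srj := (Defs.surj pi).
Local Notation pbT := (@pbT p k kb i hp X Y pi).
Local Notation dlT := (@dlT p k kb i hp X Y pi).
Local Notation GX := (@GX p k kb i hp X Y pi).

Variable a : kaut i.
Hypothesis gen_a : topological_generator a.
Local Notation phX := (glift X a).
Local Notation phY := (glift Y a).
Local Notation dX := (difT (pr := pr) phX).
Local Notation dY := (difT (pr := pr) phY).

Lemma Vk_fixed (x : TX) : dX x = 0 -> VX x.
Proof.
move=> dx; have fx : act phX (tval x) = tval x.
  by apply/eqP; rewrite -subr_eq0 -tval_difT dx.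
move=> s gs; have [n ->] := galois_frob [:: tval x] gen_a gs; last exact: mem_head.
by elim: n => // n IHn; rewrite iterS IHn.
Qed.

Lemma srj_difT x : srj (tval (dX x)) = 0.
Proof.
have [ga _] := over_lift X a; have tx := jtors_tval x.
rewrite tval_difT (surjD hp kb_algebraic) ?(surjN hp kb_algebraic) ?(galois_surj hp kb_algebraic pi ga) //.
- exact: subrr.
- exact: jtors_act.
- exact: jtorsN.
Qed.

(* As surj is Galois invariant, F - 1 is not surjective on J_X[p], hence not injective. *)
Lemma finite_fixed : exists2 x, VX x & x != 0.
Proof.
apply: contrapT => nx; have [n hn] := tors_spans pr X hp kb_algebraic.
have [x1 tx1 sx1] := surj_onto hp kb_algebraic pi.
have [||x _ dx] := @inj_surj _ _ dX setT (difT_lin phX) _ (fun _ _ => I) n hn _ (mkT tx1) I.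
- by [].
- move=> x _ dx; apply: contrapT => /eqP x0; apply: nx; exists x => //.
  exact: Vk_fixed.
have := srj_difT x; rewrite dx /= sx1 => /eqP; exact/negP/oner_neq0.
Qed.

Section Split.
Variable x0 : TX.
Hypotheses (Vx0 : VX x0) (sx0 : srj (tval x0) = 1).
(** This is the form in which nu_X < 2 is used: the rational point x0 leaves no room for a nonzero
    one in [GX]. *)
Hypothesis GV0 : forall x, GX x -> VX x -> x = 0.
Let N := iter p.-1 dlT.

Let dX_inj x : GX x -> dX x = 0 -> x = 0.
Proof. by move=> Gx /Vk_fixed; apply: GV0. Qed.

Let N_lin (c : 'F_p) u v : N (c *: u + v) = c *: N u + N v.
Proof. exact: (iter_lin (dlT_lin pi)). Qed.

Let NB u v : N (u - v) = N u - N v.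
Proof. by rewrite addrC -scaleN1r N_lin scaleN1r addrC. Qed.

Let pbTB u v : pbT (u - v) = pbT u - pbT v.
Proof. by rewrite addrC -scaleN1r pbT_lin scaleN1r addrC. Qed.

Let phiX (x : TX) : TX := dX x + x.
Let phiY (y : TY) : TY := dY y + y.

Let tval_phiX x : tval (phiX x) = act phX (tval x). Proof. by rewrite /phiX tvalD tval_difT subrK. Qed.
Let tval_phiY y : tval (phiY y) = act phY (tval y). Proof. by rewrite /phiY tvalD tval_difT subrK. Qed.

Let tval_pbT x : tval (pbT x) = pullback pi (tval x). Proof. by []. Qed.
Let tval_dlT y : tval (dlT y) = delta pi (tval y). Proof. by []. Qed.

Let phiY_pbT x : phiY (pbT x) = pbT (phiX x).
Proof.
apply: tval_inj; rewrite tval_phiY !tval_pbT tval_phiX.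
by rewrite (act_pullback_over hp pi (over_lift X a) (over_lift Y a)).
Qed.

Let phiY_dlT y : phiY (dlT y) = dlT (phiY y).
Proof.
apply: tval_inj; rewrite tval_phiY !tval_dlT tval_phiY.
by rewrite (act_delta_over pi (over_lift Y a)).
Qed.

Let phiY_N y : phiY (N y) = N (phiY y).
Proof. by rewrite /N; elim: p.-1 => // n IHn; rewrite !iterS phiY_dlT IHn. Qed.

Let dYE y : dY y = phiY y - y. Proof. by rewrite /phiY addrK. Qed.
Let dXE x : dX x = phiX x - x. Proof. by rewrite /phiX addrK. Qed.

(* The lift of x to J_Y[p] is to be (F - 1) m. *)
Let good (x : jac Y) (m : TY) := exists z, [/\ GX z, N m = pbT z & pullback pi (tval (dX z)) = x].

Let good_ex x : GetY pi x -> exists m, good x m.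
Proof.
move=> [z [tz sz] zx]; have [n hn] := dim_ex hp kb_algebraic GX.
have [|u Gu du] := @inj_surj _ _ dX GX (difT_lin phX) (GX_subspace hp kb_algebraic pi)
  (fun v _ => srj_difT v) n (dimS_spans hn) dX_inj (mkT tz).
  exact: sz.
have [m tm mE] := @surj_norm _ _ _ _ hp kb_algebraic _ _ pi _ (jtors_tval u) Gu.
exists (mkT tm), u; split=> //; last by rewrite du.
by apply: tval_inj; rewrite iter_dlT /= -mE.
Qed.

Let good_phi x m : good x m -> good (act phY x) (phiY m).
Proof.
move=> [z [Gz Nm zx]]; exists (phiX z); split.
- have [ga _] := over_lift X a.
  rewrite -[_ (phiX z)]/(srj (tval (phiX z)) = 0) tval_phiX.
  by rewrite (galois_surj hp kb_algebraic pi ga) //; apply: jtors_tval.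
- by rewrite -phiY_N Nm phiY_pbT.
rewrite -zx -(act_pullback_over hp pi (over_lift X a) (over_lift Y a)) !tval_difT tval_phiX.
by rewrite actB.
Qed.

Let good_add x y m n : good x m -> good y n -> good (x + y) (m + n).
Proof.
move=> [z [Gz Nm zx]] [w [Gw Nn wy]]; exists (z + w); split.
- exact: (subspaceD (GX_subspace hp kb_algebraic pi)).
- by rewrite -[m]scale1r N_lin scale1r Nm Nn -[pbT z]scale1r -pbT_lin scale1r.
rewrite -zx -wy -(pullbackD hp) -tvalD; congr (pullback _ (tval _)).
exact: difTD.
Qed.

(** z is unique because F - 1 is injective on [GX]. Two choices of m then differ by delta b + c x0,
    and F - 1 kills x0, so (F - 1) m is well defined modulo the image of delta. *)
Let good_uniq x m n : good x m -> good x n -> exists b, dY m - dY n = dlT b.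
Proof.
move=> [z [Gz Nm zx]] [w [Gw Nn wx]]; have zw : z = w.
  apply/eqP; rewrite -subr_eq0; apply/eqP/dX_inj.
    exact: (subspaceB (GX_subspace hp kb_algebraic pi)).
  rewrite difTB; apply/eqP; rewrite subr_eq0; apply/eqP/tval_inj.
  by apply: (pullback_inj hp (pi := pi)); rewrite zx wx.
have [|b [c mn]] := norm_kernel kb_algebraic sx0 (n := m - n).
  by rewrite -/N NB Nm Nn zw subrr.
have dx0 : dY (pbT x0) = 0.
  rewrite dYE phiY_pbT -pbTB -dXE (_ : dX x0 = 0) ?pbT0 //.
  apply: tval_inj; rewrite tval_difT Vx0 ?subrr //.
  by have [] := over_lift X a.
exists (dY b); rewrite -difTB mn addrC difT_lin dx0 scaler0 add0r.
rewrite !dYE phiY_dlT; apply/esym.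
by rewrite addrC -scaleN1r dlT_lin scaleN1r addrC.
Qed.

Let sec_b (x : jac Y) : jac Y := if pselect (GetY pi x) is left h
  then tval (dY (sval (cid (good_ex h)))) else 0.

Let sec_bE x : GetY pi x -> exists2 m, good x m & sec_b x = tval (dY m).
Proof.
rewrite /sec_b; case: pselect => // h _; exists (sval (cid (good_ex h))) => //.
exact: svalP (cid _).
Qed.

Let delta_jtorsE (u v : TY) b : u - v = dlT b -> delta_jtors pi (tval u - tval v).
Proof.
move=> e; exists (tval b); first exact: jtors_tval.
by rewrite -tvalN -tvalD e.
Qed.

Lemma split_b_finite : split_b pi.
Proof.
have GD x y : GetY pi x -> GetY pi y -> GetY pi (x + y).
  move=> [z [tz sz] <-] [w [tw sw] <-]; exists (z + w); last exact: (pullbackD hp).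
  by split; [apply: jtorsD|rewrite (surjD hp kb_algebraic) // sz sw addr0].
exists sec_b; split=> [x /sec_bE[m [z [Gz Nm zx]] ->]|x y Gx Gy|g gg x Gx].
- split; first exact: jtors_tval.
  rewrite -iter_dlT -/N -zx dYE NB -phiY_N Nm phiY_pbT -pbTB -dXE //.
- have [m gm ->] := sec_bE Gx; have [n gn ->] := sec_bE Gy.
  have [l gl ->] := sec_bE (GD _ _ Gx Gy); have [b bE] := good_uniq gl (good_add gm gn).
  have -> : tval (dY m) + tval (dY n) = tval (dY (m + n)).
    by rewrite difTD.
  exact: delta_jtorsE bE.
have Ggx : GetY pi (act g x).
  have [z [tz sz] <-] := Gx; have [h [gh <-]] := galois_down hp pi gg.
  by exists (act h z) => //; split; [apply: jtors_act|rewrite (galois_surj hp kb_algebraic pi gh)].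
(* g is replaced by a power of Frobenius that has the same effect on both x and its lift; the
   construction commutes with Frobenius by [good_phi]. *)
have [n hn] := galois_frob [:: x; sec_b x] gen_a gg.
have [l gl ->] := sec_bE Ggx; have [m gm mE] := sec_bE Gx.
rewrite (hn x (mem_head _ _)) in gl; rewrite hn ?inE ?eqxx ?orbT // mE.
have gi : good (iter n (act phY) x) (iter n phiY m).
  by elim: n {hn gl} => // n IHn; rewrite !iterS; apply: good_phi.
have -> : iter n (act phY) (tval (dY m)) = tval (dY (iter n phiY m)).
  elim: n {hn gl gi} => // n IHn; rewrite !iterS IHn -tval_phiY; congr tval.
  by rewrite /phiY difTD.
have [b bE] := good_uniq gl gi; exact: delta_jtorsE bE.
Qed.

End Split.

End FiniteBaseField.

Lemma nu_ge2 p (k : fieldType) (kb : closedFieldType) (i : {rmorphism k -> kb})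
  (hp : p \in [pchar k]) (kb_algebraic : forall z : kb, algebraicOver i z)
  (X Y : curve i) (pi : zp_cover p X Y) (x0 x : tmod (pchar_pr hp) X) :
  Vk x0 -> Defs.surj pi (tval x0) = 1 -> GX pi x -> Vk x -> x <> 0 -> (2 <= nu p X)%N.
Proof.
move=> Vx0 sx0 Gx Vx x_neq0; have [n hn] := dim_ex hp kb_algebraic (@Vk p (pchar_pr hp) k kb i X).
rewrite (nuE hn) -card_bool.
apply: (spans_indep (subspace0 _) (dimS_spans hn) (v := fun b : bool => if b then x0 else x)).
  by case.
move=> c; rewrite big_bool /= => h.
have ct : c true = 0.
  have := srj_lin (hp := hp) kb_algebraic pi (c true) x0 (c false *: x).
  rewrite h tval0 (surj0 hp kb_algebraic) sx0 mulr1.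
  rewrite -[c false *: x]addr0 (srj_lin kb_algebraic) tval0 (surj0 hp kb_algebraic).
  by have -> : Defs.surj pi (tval x) = 0 := Gx; rewrite mulr0 !addr0 => <-.
case=> //; move: h; rewrite ct scale0r add0r => /eqP.
by rewrite scaler_eq0 => /orP[/eqP //|/eqP].
Qed.

Theorem theorem1p7 (p : nat) (k : fieldType) (kb : closedFieldType)
  (i : {rmorphism k -> kb})
  (hp : p \in [pchar k])
  (k_perfect : forall a : k, exists b, b ^+ p = a)
  (kb_algebraic : forall z : kb, algebraicOver i z)
  (X Y : curve i) (pi : zp_cover p X Y) :
  [/\ (nu p X <= nu p Y)%N /\ (nu p Y <= p * nu p X)%N,
      (split_X pi <-> split_a pi) /\
        (split_X pi ->
         (nu p Y)%:Z - 1 <= p%:Z * ((nu p X)%:Z - 1)),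
      finite_set [set: k] \/ GRing.closed_field_axiom k -> (1 <= nu p X)%N &
      finite_set [set: k] -> split_a pi -> ~ split_b pi -> (2 <= nu p X)%N].
Proof.
split; first by split; [apply: nu_le|apply: nu_le_mul].
- by split; [apply: split_X_a|apply: nu_split].
- move=> [kfin|kclosed].
    have [a gen_a] := finite_generator hp kb_algebraic kfin.
    have [x Vx x0] := finite_fixed hp kb_algebraic pi gen_a.
    exact: (nu_gt0 hp kb_algebraic Vx x0).
  (* All of J_X[p] is rational here, and a class on which [surj] is 1 is nonzero. *)
  have [x tx sx] := surj_onto hp kb_algebraic pi.
  apply: (@nu_gt0 _ (pchar_pr hp) _ _ _ hp kb_algebraic X (mkT tx)) => [s gs|].
    exact: galois_closed.
  apply/eqP => /(congr1 (@tval _ _ _ _ _)) /= x0; move: sx.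
  by rewrite x0 (surj0 hp kb_algebraic) => /esym/eqP; rewrite oner_eq0.
move=> kfin /(split_X_a hp)/(split_X_unit hp)[x0 Vx0 sx0] nb.
have [a gen_a] := finite_generator hp kb_algebraic kfin.
rewrite leqNgt; apply/negP => nu2; apply: nb.
apply: (split_b_finite kb_algebraic gen_a Vx0 sx0) => x Gx Vx; apply: contrapT => x_neq0.
by have := nu_ge2 kb_algebraic Vx0 sx0 Gx Vx x_neq0; rewrite leqNgt nu2.
Qed.
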